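(* Let $\mathcal{L}=\sum_{|I|=\nu}c_IX_I$ be a generalized Rockland operator on $\mathbb{R}^n$ (in the sense defined in the context), assume that $\nu<q$, where $\nu$ is the homogeneity degree of $\mathcal{L}$ and $q=\sum_{i=1}^n\sigma_i$ is the homogeneous dimension of $\mathbb{R}^n$, and assume that $\mathcal{L}^*$ is also a generalized Rockland operator. Then there exists a global fundamental solution $\Gamma(x,y)$ of $\mathcal{L}$, that is: (a) for every fixed $x,y\in\mathbb{R}^n$, $\Gamma(\cdot,y)\in L^1_{\mathrm{loc}}(\mathbb{R}^n)$ and $\Gamma(x,\cdot)\in L^1_{\mathrm{loc}}(\mathbb{R}^n)$; also $\Gamma\in L^1_{\mathrm{loc}}(\mathbb{R}^{2n})$ in the joint variables; (b) for every $\varphi\in C_0^\infty(\mathbb{R}^n)$, $\int_{\mathbb{R}^n}\Gamma(x,y)\,\mathcal{L}^*\varphi(x)\,dx=-\varphi(y)$ for all $y\in\mathbb{R}^n$; (c) for every $\varphi\in C_0^\infty(\mathbb{R}^n)$, the function $u(x)=\int_{\mathbb{R}^n}\Gamma(x,y)\varphi(y)\,dy$ is in $L^1_{\mathrm{loc}}(\mathbb{R}^n)$ and satisfies $\mathcal{L}u=-\varphi$ in the distributional sense (therefore $u$ is a.e. equal to a smooth function $u^*$ satisfying $\mathcal{L}u^*=-\varphi$ pointwise). Moreover, $\Gamma$ satisfies the following properties: (I) setting $\mathbb{D}=\{(x,y)\in\mathbb{R}^{2n}:x=y\}$, $\Gamma\in C^\infty(\mathbb{R}^{2n}\setminus\mathbb{D})$;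 (II) $\Gamma$ is jointly $\delta_\lambda$-homogeneous of degree $\nu-q$: $\Gamma(\delta_\lambda(x),\delta_\lambda(y))=\lambda^{\nu-q}\Gamma(x,y)$ for all $(x,y)\in\mathbb{R}^{2n}\setminus\mathbb{D}$ and $\lambda>0$; (III) for every fixed $y\in\mathbb{R}^n$, $\Gamma(x,y)\to0$ as $|x|\to+\infty$; (IV) $\Gamma$ is unique within the class of functions $\gamma(x,y)$ satisfying the properties in (b) and (III); (V) for this uniquely defined $\Gamma$, one has $\Gamma^*(x,y)=\Gamma(y,x)$ for every $x\ne y\in\mathbb{R}^n$, where $\Gamma^*$ is the global fundamental solution of $\mathcal{L}^*$. In particular, if $\mathcal{L}$ is formally self-adjoint (that is, $\mathcal{L}^*=\mathcal{L}$), then $\Gamma(x,y)=\Gamma(y,x)$ for every $x\neq y\in\mathbb{R}^n$.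
   Context: **Assumption on the vector fields.** $X=\{X_1,\dots,X_m\}$ is a family of real smooth vector fields on $\mathbb{R}^n$, linearly independent in the (infinite-dimensional) real vector space of smooth vector fields on $\mathbb{R}^n$, satisfying Hörmander's condition at the origin (the vector fields in the Lie algebra $\mathrm{Lie}(X)$ generated by $X$, evaluated at $0$, span $\mathbb{R}^n$). $\mathbb{R}^n$ carries dilations $\delta_\lambda(x)=(\lambda^{\sigma_1}x_1,\dots,\lambda^{\sigma_n}x_n)$, $\lambda>0$, with integers $1=\sigma_1\le\sigma_2\le\dots\le\sigma_n$, and each $X_i$ is $\delta_\lambda$-homogeneous of positive integer degree $\nu_i$: $X_i(u\circ\delta_\lambda)=\lambda^{\nu_i}(X_iu)\circ\delta_\lambda$ for all $\lambda>0$, $u\in C^\infty(\mathbb{R}^n)$; moreover $1\le\nu_1\le\dots\le\nu_m$. It follows that $N:=\dim\mathrm{Lie}(X)$ is finite and $N\ge n$; put $p=N-n$. **Operators.** For a multi-index $I=(i_1,\dots,i_k)$ with $i_j\in\{1,\dots,m\}$, put $X_I=X_{i_1}\cdots X_{i_k}$ and $|I|=\nu_{i_1}+\dots+\nu_{i_k}$. $\mathcal{L}=\sum_{|I|=\nu}c_IX_I$, with $\nu$ a positive integer and given real constants $c_I$. The formal transpose $\mathcal{L}^*$ is defined by $\int(\mathcal{L}u)v=\int u(\mathcal{L}^*v)$ for $u,v\in C_0^\infty$. One has $X_i^*=-X_i$, so $\mathcal{L}^*=\sum_{|I|=\nu}(-1)^kc_IX_{i_k}\cdots X_{i_1}$,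 which is of the same form. **Homogeneous group.** A homogeneous group $\mathbb{G}=(\mathbb{R}^N,\star,D_\lambda)$ is a Lie group structure on $\mathbb{R}^N$ (with neutral element $0$) together with diagonal dilations $D_\lambda$ (positive exponents) that are group automorphisms; $\mathrm{Lie}(\mathbb{G})$ is the Lie algebra of its left-invariant vector fields; its homogeneous dimension is the sum of the exponents of $D_\lambda$. **Lifting.** Assume $p\ge1$ and write points of $\mathbb{R}^N=\mathbb{R}^n\times\mathbb{R}^p$ as $(x,\xi)$. By a lifting theorem of Biagi and Bonfiglioli there exist a homogeneous group $\mathbb{G}=(\mathbb{R}^N,\star,D_\lambda)$, of homogeneous dimension $Q>q$, with $D_\lambda(x,\xi)=(\delta_\lambda(x),E_\lambda(\xi))$, $E_\lambda(\xi)=(\lambda^{\tau_1}\xi_1,\dots,\lambda^{\tau_p}\xi_p)$ for integers $1\le\tau_1\le\dots\le\tau_p$, and vector fields $\widetilde X_1,\dots,\widetilde X_m\in\mathrm{Lie}(\mathbb{G})$ generating $\mathrm{Lie}(\mathbb{G})$ as a Lie algebra, such that $\widetilde X_j$ is $D_\lambda$-homogeneous of degree $\nu_j$ and $\widetilde X_j=X_j+R_j$, where $R_j$ is a non-vanishing smooth vector field operating only in the $\xi$ variables (with coefficients possibly depending on $(x,\xi)$). This group and these vector fields are fixed. The lifted operator is $\widetilde{\mathcal{L}}=\sum_{|I|=\nu}c_I\widetilde X_I$, with $\widetilde X_I=\widetilde X_{i_1}\cdots\widetilde X_{i_k}$; the lifted operator of $\mathcal{L}^*$ is $(\widetilde{\mathcal{L}})^*$.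 **Generalized Rockland operator.** $\mathcal{L}=\sum_{|I|=\nu}c_IX_I$ is a generalized Rockland operator if $X_1,\dots,X_m$ satisfy the assumption above, $p\ge1$, and the lifted operator $\widetilde{\mathcal{L}}$ is hypoelliptic on $\mathbb{R}^N$ (for every open $\Omega'\subseteq\Omega\subseteq\mathbb{R}^N$ and $u\in\mathcal{D}'(\Omega)$, $\widetilde{\mathcal{L}}u\in C^\infty(\Omega')$ implies $u\in C^\infty(\Omega')$). *)

(* Defs.v *)
From HB Require Import structures.
From mathcomp Require Import all_boot all_order all_algebra.
From mathcomp Require Import all_classical all_reals all_analysis.

Set Implicit Arguments.
Unset Strict Implicit.
Unset Printing Implicit Defensive.

Import Order.TTheory GRing.Theory Num.Theory.
Import numFieldNormedType.Exports.

Local Open Scope classical_set_scope.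
Local Open Scope ring_scope.

Fact rV_display : measure_display.
Proof. exact: default_measure_display. Qed.

(* the product (= Borel) sigma-algebra on R^n *)
Section measurable_rV.
Context {R : realType} (n : nat).

Let coord (i : 'I_n) (x : 'rV[R]_n) : measurableTypeR R := x 0 i.

Let rV_set0 : g_sigma_preimage coord set0.
Proof. exact: sigma_algebra0. Qed.

Let rV_setC A : g_sigma_preimage coord A -> g_sigma_preimage coord (~` A).
Proof. exact: sigma_algebraC. Qed.

Let rV_bigcup (F : _^nat) : (forall i, g_sigma_preimage coord (F i)) ->
  g_sigma_preimage coord (\bigcup_i (F i)).
Proof. exact: sigma_algebra_bigcup. Qed.

HB.instance Definition _ := @isMeasurable.Build rV_display
  'rV[R]_n (g_sigma_preimage coord) rV_set0 rV_setC rV_bigcup.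

End measurable_rV.

Section measurable_fun_rV.
Context {R : realType}.

Lemma measurable_rV_coord n (i : 'I_n) :
  measurable_fun [set: 'rV[R]_n] (fun x => x 0 i : measurableTypeR R).
Proof.
move=> _ Y mY; rewrite setTI; apply: sub_sigma_algebra => /=.
rewrite -bigcup_seq/=; exists i => /=; first by rewrite mem_index_enum.
by exists Y => //; rewrite setTI.
Qed.

Lemma measurable_fun_rV d (T : measurableType d) n (f : T -> 'rV[R]_n) :
  (forall i, measurable_fun [set: T] (fun t => f t 0 i : measurableTypeR R)) ->
  measurable_fun [set: T] f.
Proof.
move=> mf _ A mA; rewrite setTI.
pose F := [set B | measurable (f @^-1` B)].
suff: F A by [].
apply: mA; split.
  split.
  - by rewrite /F /= preimage_set0.
  - by move=> B mB; rewrite /F /= setTD -preimage_setC; exact: measurableC.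
  - move=> G mG; rewrite /F /= preimage_bigcup.
    by apply: bigcup_measurable => k _; exact: mG.
move=> B; rewrite -bigcup_seq => -[i _ [C mC <-]].
by rewrite /F/= setTI; have := mf i measurableT C mC; rewrite setTI.
Qed.

Definition rV_cons n (z : measurableTypeR R * 'rV[R]_n) : 'rV[R]_n.+1 :=
  row_mx (const_mx z.1 : 'rV[R]_1) z.2.

Definition rV_uncons n (x : 'rV[R]_n.+1) : measurableTypeR R * 'rV[R]_n :=
  (x 0 0, @rsubmx _ 1 1 n x).

Lemma rV_consK n : cancel (@rV_cons n) (@rV_uncons n).
Proof.
move=> [a v]; rewrite /rV_uncons row_mxKr; congr pair => /=.
transitivity (rV_cons (a, v) 0 (@lshift 1 n 0)).
  by rewrite /=; congr (rV_cons _ _ _); exact/val_inj.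
by rewrite /rV_cons (@row_mxEl _ 1 1 n) mxE.
Qed.

Lemma rV_unconsK n : cancel (@rV_uncons n) (@rV_cons n).
Proof.
move=> x; rewrite /rV_cons/= (_ : const_mx _ = @lsubmx _ 1 1 n x).
  exact: (@hsubmxK _ 1 1 n).
by apply/rowP => i; rewrite !mxE ord1; congr (x _ _); exact/val_inj.
Qed.

Lemma measurable_rV_cons n : measurable_fun setT (@rV_cons n).
Proof.
apply: measurable_fun_rV => i.
case: (@split_ordP 1 n i) => j ->.
  rewrite [X in measurable_fun _ X](_ : _ = fst); first exact: measurable_fst.
  by apply/funext => z; rewrite /rV_cons (@row_mxEl _ 1 1 n) mxE.
rewrite [X in measurable_fun _ X](_ : _ =
    (fun x : 'rV[R]_n => x 0 j : measurableTypeR R) \o snd).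
  by apply: measurableT_comp; [exact: measurable_rV_coord|exact: measurable_snd].
by apply/funext => z; rewrite /rV_cons (@row_mxEr _ 1 1 n).
Qed.

Lemma measurable_rV_uncons n : measurable_fun setT (@rV_uncons n).
Proof.
apply: measurable_fun_pair; first exact: measurable_rV_coord.
apply: measurable_fun_rV => i.
rewrite [X in measurable_fun _ X](_ : _ =
    fun x : 'rV[R]_n.+1 => x 0 (rshift 1 i)); first exact: measurable_rV_coord.
by apply/funext => x; rewrite mxE.
Qed.

End measurable_fun_rV.

Section lebesgue_rV.
Context {R : realType}.
Local Open Scope ereal_scope.

Definition cons_measure n (m : {sigma_finite_measure set 'rV[R]_n -> \bar R}) :=
  pushforward (lebesgue_measure \x m) (@rV_cons R n).

Section cons_measure_sigma_finite.
Variables (n : nat) (m : {sigma_finite_measure set 'rV[R]_n -> \bar R}).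

Let cons_measure0 : cons_measure m set0 = 0.
Proof. by rewrite /cons_measure /pushforward preimage_set0 measure0. Qed.

Let cons_measure_ge0 A : 0 <= cons_measure m A.
Proof. by rewrite /cons_measure /pushforward; exact: measure_ge0. Qed.

Let cons_measure_sigma_additive : semi_sigma_additive (cons_measure m).
Proof.
exact: (@measure_semi_sigma_additive _ _ _
  (measure_function_pushforward__canonical__measure_function_Measure
     (lebesgue_measure \x m) (@measurable_rV_cons R n))).
Qed.

HB.instance Definition _ := isMeasure.Build _ _ _ (cons_measure m)
  cons_measure0 cons_measure_ge0 cons_measure_sigma_additive.

Let cons_measure_sigma_finite : sigma_finite setT (cons_measure m).
Proof.
have /sigma_finiteP[F [FT ndF Foo]] := sigma_finiteT (@lebesgue_measure R).
have /sigma_finiteP[G [GT ndG Goo]] := sigma_finiteT m.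
exists (fun k => @rV_uncons R n @^-1` (F k `*` G k)).
  rewrite -preimage_bigcup -[LHS](@preimage_setT _ _ (@rV_uncons R n)).
  congr (_ @^-1` _); rewrite -setXTT FT GT predeqE => -[x y]; split.
    move=> [/= [i _ Fix] [k _ Gky]]; exists (maxn i k) => //; split.
    - by move: x Fix; exact/subsetPset/ndF/leq_maxl.
    - by move: y Gky; exact/subsetPset/ndG/leq_maxr.
  by move=> [k _ []/= ? ?]; split; exists k.
move=> k; have [mF Fk] := Foo k; have [mG Gk] := Goo k; split.
  rewrite -[X in measurable X]setTI.
  by apply: measurable_rV_uncons => //; exact: measurableX.
rewrite /cons_measure /pushforward -comp_preimage.
rewrite (_ : _ \o _ = id); last by apply/funext => z /=; rewrite rV_consK.
by rewrite preimage_id product_measure1E// lte_mul_pinfty// ge0_fin_numE.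
Qed.

HB.instance Definition _ := Measure_isSigmaFinite.Build _ _ _ (cons_measure m)
  cons_measure_sigma_finite.

End cons_measure_sigma_finite.

Fixpoint lebesgue_rV n : {sigma_finite_measure set 'rV[R]_n -> \bar R} :=
  match n with
  | 0%N => \d_(0%R : 'rV[R]_0)
  | n'.+1 => cons_measure (lebesgue_rV n')
  end.

Lemma measurable_rV_box n (A : 'I_n -> set (measurableTypeR R)) :
  (forall i, measurable (A i)) ->
  measurable [set x : 'rV[R]_n | forall i, A i (x 0%R i)].
Proof.
move=> mA; rewrite [X in measurable X](_ : _ =
    \bigcap_(i in [set: 'I_n]) ((fun x : 'rV[R]_n => x 0%R i) @^-1` A i)); last first.
  by apply/seteqP; split=> x /= h i; [move=> _; exact: h|exact: h].
apply: fin_bigcap_measurable => // i _.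
by rewrite -[X in measurable X]setTI; exact: measurable_rV_coord.
Qed.

Lemma lebesgue_rV_box n (A : 'I_n -> set (measurableTypeR R)) :
  (forall i, measurable (A i)) ->
  lebesgue_rV n [set x : 'rV[R]_n | forall i, A i (x 0%R i)] =
  \prod_(i < n) lebesgue_measure (A i).
Proof.
elim: n A => [|n IH] A mA.
  by rewrite big_ord0 /= diracE mem_set// => -[].
rewrite big_ord_recl -IH// /= /cons_measure /pushforward.
have mB : measurable [set x : 'rV[R]_n | forall i, A (lift ord0 i) (x 0%R i)].
  exact: (@measurable_rV_box n (fun i => A (lift ord0 i))).
rewrite -(product_measure1E lebesgue_measure (lebesgue_rV n) (mA ord0) mB).
congr (_ _); apply/seteqP; split=> -[a v] /=.
- move=> h; split => [|i].
    have := h ord0.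
    by rewrite -[_ 0%R ord0]/((rV_uncons (rV_cons (a, v))).1) rV_consK.
  have := h (lift ord0 i); rewrite (_ : lift ord0 i = rshift 1 i).
    by rewrite /rV_cons (@row_mxEr _ 1 1 n).
  exact/val_inj.
move=> [Aa Av] i; case: (unliftP ord0 i) => [j|] ->.
  rewrite (_ : rV_cons _ _ _ = v 0%R j)// (_ : lift ord0 j = rshift 1 j).
    by rewrite /rV_cons (@row_mxEr _ 1 1 n).
  exact/val_inj.
by rewrite -[X in A _ X]/((rV_uncons (rV_cons (a, v))).1) rV_consK.
Qed.
End lebesgue_rV.

Section smooth.
Context {R : realType}.

Definition partial n (i : 'I_n) (f : 'rV[R]_n -> R) : 'rV[R]_n -> R :=
  fun x => 'D_(delta_mx 0 i) f x.

Definition partials n (s : seq 'I_n) (f : 'rV[R]_n -> R) : 'rV[R]_n -> R :=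
  foldr (@partial n) f s.

(* f \in C^oo(W), for W open; the values of f outside W are irrelevant. *)
Definition smooth_on n (W : set 'rV[R]_n) (f : 'rV[R]_n -> R) : Prop :=
  forall (s : seq 'I_n) (x : 'rV[R]_n), W x ->
    {for x, continuous (partials s f)} /\
    forall i : 'I_n, derivable (partials s f) x (delta_mx 0 i).

Definition smooth n (f : 'rV[R]_n -> R) : Prop := smooth_on setT f.

Definition smooth_map n k (F : 'rV[R]_n -> 'rV[R]_k) : Prop :=
  forall j : 'I_k, smooth (fun x => F x 0 j).

Definition supported_in n (K : set 'rV[R]_n) (f : 'rV[R]_n -> R) : Prop :=
  forall x, ~ K x -> f x = 0.

(* f \in C_0^oo(W) *)
Definition test_fun n (W : set 'rV[R]_n) (f : 'rV[R]_n -> R) : Prop :=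
  smooth f /\
  exists K : set 'rV[R]_n, [/\ compact K, K `<=` W & supported_in K f].

Definition L1loc n (f : 'rV[R]_n -> R) : Prop :=
  measurable_fun [set: 'rV[R]_n] f /\
  forall K : set 'rV[R]_n, compact K ->
    (\int[lebesgue_rV n]_(x in K) `|f x|%:E < +oo)%E.

(* u \in D'(W); only the values of u on C_0^oo(W) are relevant. Any bound M on
   the derivatives of order at most k stands for the corresponding seminorm. *)
Definition distribution_on n (W : set 'rV[R]_n) (u : ('rV[R]_n -> R) -> R) :
    Prop :=
  (forall (a : R) (f g : 'rV[R]_n -> R), test_fun W f -> test_fun W g ->
     u (fun x => a * f x + g x) = a * u f + u g) /\
  (forall K : set 'rV[R]_n, compact K -> K `<=` W ->
     exists (C : R) (k : nat), forall f, smooth f -> supported_in K f ->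
       forall M : R,
         (forall (s : seq 'I_n) x, (size s <= k)%N -> `|partials s f x| <= M) ->
         `|u f| <= C * M).

(* the restriction of u to W is the distribution defined by some f in C^oo(W) *)
Definition dist_smooth_on n (W : set 'rV[R]_n) (u : ('rV[R]_n -> R) -> R) :
    Prop :=
  exists2 f : 'rV[R]_n -> R, smooth_on W f &
    forall phi, test_fun W phi -> u phi = \int[lebesgue_rV n]_x (f x * phi x).

End smooth.

Section vector_fields.
Context {R : realType}.

Definition vfield n := 'rV[R]_n -> 'rV[R]_n.

(* X = \sum_i X_i(x) \partial_i acting on functions *)
Definition vfapp n (X : vfield n) (f : 'rV[R]_n -> R) : 'rV[R]_n -> R :=
  fun x => \sum_(i < n) X x 0 i * partial i f x.

Definition lie_bracket n (X Y : vfield n) : vfield n := fun x =>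
  \row_j (vfapp X (fun y => Y y 0 j) x - vfapp Y (fun y => X y 0 j) x).

Inductive lie_generated n m (X : 'I_m -> vfield n) : vfield n -> Prop :=
| lie_gen i : lie_generated X (X i)
| lie_zero : lie_generated X (fun=> 0)
| lie_add Y Z : lie_generated X Y -> lie_generated X Z ->
    lie_generated X (fun x => Y x + Z x)
| lie_scale a Y : lie_generated X Y -> lie_generated X (fun x => a *: Y x)
| lie_brack Y Z : lie_generated X Y -> lie_generated X Z ->
    lie_generated X (lie_bracket Y Z).

Definition vf_independent n k (B : 'I_k -> vfield n) : Prop :=
  forall a : 'I_k -> R, (forall x, \sum_i a i *: B i x = 0) ->
    forall i, a i = 0.

Definition vf_dimension n (A : set (vfield n)) (N : nat) : Prop :=
  exists B : 'I_N -> vfield n,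
    [/\ forall i, A (B i), vf_independent B &
        forall Z, A Z ->
          exists a : 'I_N -> R, forall x, Z x = \sum_i a i *: B i x].

Definition hormander_at n m (X : 'I_m -> vfield n) (x : 'rV[R]_n) : Prop :=
  forall v : 'rV[R]_n, exists (k : nat) (Z : 'I_k -> vfield n) (a : 'I_k -> R),
    (forall i, lie_generated X (Z i)) /\ v = \sum_i a i *: Z i x.

Definition dilation n (e : 'I_n -> nat) (lambda : R) (x : 'rV[R]_n) :
    'rV[R]_n :=
  \row_i (lambda ^+ e i * x 0 i).

Definition vf_homogeneous n (e : 'I_n -> nat) (X : vfield n) (d : nat) : Prop :=
  forall (lambda : R) (u : 'rV[R]_n -> R), 0 < lambda -> smooth u ->
    forall x, vfapp X (u \o dilation e lambda) x =
              lambda ^+ d * vfapp X u (dilation e lambda x).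

Record vf_assumption n m (sigma : 'I_n -> nat) (w : 'I_m -> nat)
    (X : 'I_m -> vfield n) : Prop := VfAssumption {
  vfa_dim : (0 < n)%N ;
  vfa_sigma1 : forall i : 'I_n, i = 0%N :> nat -> sigma i = 1%N ;
  vfa_sigma_le : forall i j : 'I_n, (i <= j)%N -> (sigma i <= sigma j)%N ;
  vfa_w_gt0 : forall i, (0 < w i)%N ;
  vfa_w_le : forall i j : 'I_m, (i <= j)%N -> (w i <= w j)%N ;
  vfa_smooth : forall i, smooth_map (X i) ;
  vfa_indep : vf_independent X ;
  vfa_hormander : hormander_at X 0 ;
  vfa_hom : forall i, vf_homogeneous sigma (X i) (w i) }.

(* X_I = X_(i_1) ... X_(i_k) for I = [:: i_1; ...; i_k] *)
Definition vf_word n m (X : 'I_m -> vfield n) (I : seq 'I_m)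
    (f : 'rV[R]_n -> R) : 'rV[R]_n -> R :=
  foldr (fun i g => vfapp (X i) g) f I.

(* \sum_(|I| = nu) c_I X_I with |I| = \sum_(i in I) w i; multi-indices longer
   than nu need not be considered, as the weights w i are positive *)
Definition hom_op n m (X : 'I_m -> vfield n) (w : 'I_m -> nat) (nu : nat)
    (c : seq 'I_m -> R) (f : 'rV[R]_n -> R) : 'rV[R]_n -> R :=
  fun x => \sum_(k < nu.+1) \sum_(I : k.-tuple 'I_m | \sum_(i <- I) w i == nu)
    c I * vf_word X I f x.

(* \sum_(|I| = nu) (-1)^k c_I X_(i_k) ... X_(i_1) = \sum_(|J| = nu) c'_J X_J
   with c'_J = (-1)^|J| c_(rev J); as X_i^* = - X_i, these are the coefficients
   of the formal transpose. *)
Definition transpose_coef m (c : seq 'I_m -> R) : seq 'I_m -> R :=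
  fun I => (-1) ^+ size I * c (rev I).

(* (L u)(phi) = u (L^* phi) *)
Definition dist_hom_op n m (X : 'I_m -> vfield n) (w : 'I_m -> nat) (nu : nat)
    (c : seq 'I_m -> R) (u : ('rV[R]_n -> R) -> R) : ('rV[R]_n -> R) -> R :=
  fun phi => u (hom_op X w nu (transpose_coef c) phi).

Definition hypoelliptic n m (X : 'I_m -> vfield n) (w : 'I_m -> nat) (nu : nat)
    (c : seq 'I_m -> R) : Prop :=
  forall (W W' : set 'rV[R]_n) (u : ('rV[R]_n -> R) -> R),
    open W -> open W' -> W' `<=` W -> distribution_on W u ->
    dist_smooth_on W' (dist_hom_op X w nu c u) -> dist_smooth_on W' u.

End vector_fields.

Section lifting.
Context {R : realType}.

Record homogeneous_group N (e : 'I_N -> nat)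
    (mul : 'rV[R]_N -> 'rV[R]_N -> 'rV[R]_N) (inv : 'rV[R]_N -> 'rV[R]_N) :
    Prop := HomogeneousGroup {
  hg_mulA : associative mul ;
  hg_mul0x : left_id 0 mul ;
  hg_mulx0 : right_id 0 mul ;
  hg_mulVx : left_inverse 0 inv mul ;
  hg_mulxV : right_inverse 0 inv mul ;
  hg_mul_smooth :
    smooth_map (fun z : 'rV[R]_(N + N) => mul (lsubmx z) (rsubmx z)) ;
  hg_inv_smooth : smooth_map inv ;
  hg_exp_gt0 : forall i, (0 < e i)%N ;
  hg_dilation : forall lambda : R, 0 < lambda ->
    {morph dilation e lambda : x y / mul x y} }.

Definition left_invariant N (mul : 'rV[R]_N -> 'rV[R]_N -> 'rV[R]_N)
    (Z : vfield N) : Prop :=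
  smooth_map Z /\
  forall (a : 'rV[R]_N) (u : 'rV[R]_N -> R), smooth u ->
    forall x, vfapp Z (u \o mul a) x = vfapp Z u (mul a x).

(* the exponents of D_lambda(x, xi) = (delta_lambda(x), E_lambda(xi)) *)
Definition cat_exp n p (sigma : 'I_n -> nat) (tau : 'I_p -> nat) :
    'I_(n + p) -> nat :=
  fun k => match fintype.split k with inl i => sigma i | inr j => tau j end.

Record is_lifting n m p (sigma : 'I_n -> nat) (w : 'I_m -> nat)
    (X : 'I_m -> vfield n) (tau : 'I_p -> nat)
    (mul : 'rV[R]_(n + p) -> 'rV[R]_(n + p) -> 'rV[R]_(n + p))
    (inv : 'rV[R]_(n + p) -> 'rV[R]_(n + p))
    (Xt : 'I_m -> vfield (n + p)) : Prop := IsLifting {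
  lift_dim : vf_dimension (lie_generated X) (n + p) ;
  lift_tau_gt0 : forall j, (0 < tau j)%N ;
  lift_tau_le : forall i j : 'I_p, (i <= j)%N -> (tau i <= tau j)%N ;
  lift_group : homogeneous_group (cat_exp sigma tau) mul inv ;
  lift_inv : forall j, left_invariant mul (Xt j) ;
  lift_gen : forall Z, left_invariant mul Z -> lie_generated Xt Z ;
  lift_hom : forall j, vf_homogeneous (cat_exp sigma tau) (Xt j) (w j) ;
  (* R_j is non-vanishing in the sense that it is not identically zero *)
  lift_proj : forall j, exists Rj : 'rV[R]_(n + p) -> 'rV[R]_p,
    [/\ smooth_map Rj, exists z, Rj z != 0 &
        forall z, Xt j z = row_mx (X j (lsubmx z)) (Rj z)] }.

(* \sum_(|I| = nu) c_I X_I is a generalized Rockland operator, with respect to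
   the fixed lifting (mul, inv, Xt) *)
Definition generalized_rockland n m p (sigma : 'I_n -> nat) (w : 'I_m -> nat)
    (X : 'I_m -> vfield n) (tau : 'I_p -> nat)
    (mul : 'rV[R]_(n + p) -> 'rV[R]_(n + p) -> 'rV[R]_(n + p))
    (inv : 'rV[R]_(n + p) -> 'rV[R]_(n + p))
    (Xt : 'I_m -> vfield (n + p)) (nu : nat) (c : seq 'I_m -> R) : Prop :=
  [/\ vf_assumption sigma w X, (0 < p)%N,
      is_lifting sigma w X tau mul inv Xt & hypoelliptic Xt w nu c].

End lifting.

Section fundamental_solution.
Context {R : realType} (n : nat).
Implicit Types (L Ls : ('rV[R]_n -> R) -> 'rV[R]_n -> R)
  (G : 'rV[R]_n -> 'rV[R]_n -> R).

Definition joint G : 'rV[R]_(n + n) -> R := fun z => G (lsubmx z) (rsubmx z).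

Definition fs_integrable G : Prop :=
  [/\ forall y, L1loc (fun x => G x y), forall x, L1loc (fun y => G x y) &
      L1loc (joint G)].

Definition fs_reproducing Ls G : Prop :=
  forall phi, test_fun setT phi ->
    forall y, \int[lebesgue_rV n]_x (G x y * Ls phi x) = - phi y.

Definition fs_solving L Ls G : Prop :=
  forall phi, test_fun setT phi ->
    let u := fun x => \int[lebesgue_rV n]_y (G x y * phi y) in
    [/\ L1loc u,
        (forall psi, test_fun setT psi ->
          \int[lebesgue_rV n]_x (u x * Ls psi x) =
          \int[lebesgue_rV n]_x (- phi x * psi x)) &
        exists us, [/\ smooth us, {ae lebesgue_rV n, forall x, u x = us x} &
                       forall x, L us x = - phi x]].

Definition global_fundamental_solution L Ls G : Prop :=
  [/\ fs_integrable G, fs_reproducing Ls G & fs_solving L Ls G].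

Definition smooth_off_diagonal G : Prop :=
  smooth_on [set z : 'rV[R]_(n + n) | lsubmx z != rsubmx z] (joint G).

Definition jointly_homogeneous (sigma : 'I_n -> nat) (d : int) G : Prop :=
  forall (x y : 'rV[R]_n) (lambda : R), x != y -> 0 < lambda ->
    G (dilation sigma lambda x) (dilation sigma lambda y) =
    lambda ^ d * G x y.

Definition vanishing_at_infinity G : Prop :=
  forall y (eps : R), 0 < eps ->
    exists M : R, forall x, M < `|x| -> `|G x y| < eps.

End fundamental_solution.

(* Main.v *)
(* Let [L~] be the lifted operator on the homogeneous group R^N = R^n x R^p, with dilations
   [D], and let Q be its homogeneous dimension.

   Estimates. If the difference quotients of smooth [u] were not controlled near 0 by the
   sup norms of [u] and of finitely many derivatives of [L~ u], a gliding hump series would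
   give a bounded function with smooth image which is not smooth, against hypoellipticity.
   Rescaling this estimate by [D] yields a Liouville theorem (bounded solutions of [L~ u = 0]
   are constant) and, for the transposed operator, a bound of [phi (0)] by finitely many
   derivatives of [L~* phi], for [phi] supported in the unit ball.

   Kernel on the group. By Hahn-Banach the latter bound gives a local fundamental solution
   [T] at 0. The rescalings [2^(j nu) T (phi o D_(2^j))] differ by smooth functions and converge
   because nu < Q; the limit is homogeneous, smooth off 0 by hypoellipticity, and equals a
   locally integrable function [K] because a homogeneous distribution of this degree which
   is supported at 0 vanishes. Only homogeneity under [D_2] is needed.

   Projection. Put [G (x, y) = \int K ((y, 0)^-1 * (x, xi)) dxi]. Left invariant fields project
   to R^n, so left translation by [(0, eta)] preserves the base coordinates; all the group maps
   involved are triangular by homogeneity, hence preserve Lebesgue measure. This and nu < q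
   give convergence, integrability and decay of [G], and the reproducing property follows
   from that of [K].

   The base. A weak solution on R^n lifts to a weak solution on R^N which is constant along
   the fibers, so regularity and the Liouville theorem descend. Hence two kernels which
   reproduce test functions and vanish at infinity agree; homogeneity and the symmetry
   [G* (x, y) = G (y, x)] are instances of this uniqueness. *)
Require Import Defs.
From mathcomp Require Import all_boot all_order all_algebra.
From mathcomp Require Import all_classical all_reals all_analysis.
From mathcomp Require Import measurable_realfun ring lra.

Set Implicit Arguments.
Unset Strict Implicit.
Unset Printing Implicit Defensive.

Import Order.TTheory GRing.Theory Num.Theory.
Import numFieldNormedType.Exports.

Local Open Scope classical_set_scope.
Local Open Scope ring_scope.

(** * Calculus of smooth functions on row vectors *)

Section normed_modules.
Context {R : realType}.
Implicit Types U V : normedModType R.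

Lemma cvg_at_normP U V (f : U -> V) (x : U) (l : V) :
  (f @ x --> l) <-> (forall e : R, 0 < e ->
    exists2 d : R, 0 < d & forall y, `|y - x| < d -> `|f y - l| <= e).
Proof.
split=> [/cvgrPdist_le fl e /fl /nbhs_ballP[d d0 near_l]|fl].
  exists d => // y yx; rewrite distrC; apply: near_l.
  by rewrite -ball_normE /= distrC.
apply/cvgrPdist_le => e /fl[d d0 near_l]; apply/nbhs_ballP; exists d => //= y.
by rewrite -ball_normE /= distrC => /near_l; rewrite distrC.
Qed.

Lemma continuous_normP U V (f : U -> V) (x : U) :
  {for x, continuous f} <-> (forall e : R, 0 < e ->
    exists2 d : R, 0 < d & forall y, `|y - x| < d -> `|f y - f x| <= e).
Proof. exact: cvg_at_normP. Qed.

Lemma nbhs_norm_lt V (x : V) (A : set V) :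
  nbhs x A -> exists2 r : R, 0 < r & forall y, `|y - x| < r -> A y.
Proof.
move=> /nbhs_ballP[r r0 rA]; exists r => // y yx; apply: rA.
by rewrite -ball_normE /= distrC.
Qed.

Lemma norm_lt_nbhs V (x : V) (A : set V) (r : R) :
  0 < r -> (forall y, `|y - x| < r -> A y) -> nbhs x A.
Proof.
move=> r0 rA; apply/nbhs_ballP; exists r => //= y.
by rewrite -ball_normE /= distrC; exact: rA.
Qed.

Lemma open_norm_lt V (x : V) (r : R) : open [set y | `|y - x| < r].
Proof.
rewrite (_ : [set y | _] = ball x r); first exact: ball_open.
by apply/seteqP; split => y; rewrite -ball_normE /= distrC.
Qed.

Lemma open_norm_lt0 V (r : R) : open [set y : V | `|y| < r].
Proof. by have := @open_norm_lt V 0 r; under eq_fun do rewrite subr0. Qed.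

Lemma closed_norm_le V (x : V) (r : R) : closed [set y | `|y - x| <= r].
Proof.
apply: (@preimage_closed _ _ (fun y : V => `|y - x|) [set t : R | t <= r]); last exact: closed_le.
by move=> y _; apply: cvg_norm; apply: cvgB => //; exact: cvg_cst.
Qed.

Lemma closed_norm_le0 V (r : R) : closed [set y : V | `|y| <= r].
Proof. by have := @closed_norm_le V 0 r; under eq_fun do rewrite subr0. Qed.

Lemma compact_norm_bound V (K : set V) :
  compact K -> exists2 M : R, 0 < M & forall x, K x -> `|x| <= M.
Proof.
move=> /compact_bounded[M [_ bounded_M]].
exists (`|M| + 1); first by rewrite ltr_wpDl.
by move=> x; apply: bounded_M; rewrite (le_lt_trans (ler_norm M)) // ltrDl.
Qed.

Lemma compact_closed_normed V (K : set V) : compact K -> closed K.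
Proof. by apply: compact_closed; exact: norm_hausdorff. Qed.

Lemma open_setC_compact V (K : set V) : compact K -> open (~` K).
Proof. by move=> cK; apply: closed_openC; exact: compact_closed_normed. Qed.

Lemma open_neq_normed V (x : V) : open [set y | y != x].
Proof.
rewrite (_ : [set y | _] = ~` [set x]); last by apply/seteqP; split => y /= /eqP.
by apply: open_setC_compact; exact: compact_set1.
Qed.

Lemma compact_continuous_bound (T : topologicalType) (K : set T) (f : T -> R) :
  compact K -> (forall x, K x -> {for x, continuous f}) ->
  exists2 M : R, 0 < M & forall x, K x -> `|f x| <= M.
Proof.
move=> cK cf.
have cfK : {within K, continuous f}.
  by apply: continuous_in_subspaceT => x /set_mem; exact: cf.
have [M M0 fM] := compact_norm_bound (continuous_compact cfK cK).
by exists M => // x Kx; apply: fM; exists x.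
Qed.

Lemma continuous_at_ext (T S : topologicalType) (f g : T -> S) (x : T) :
  f =1 g -> {for x, continuous g} -> {for x, continuous f}.
Proof. by move=> /funext ->. Qed.

Lemma continuous_at_near (T S : topologicalType) (f g : T -> S) (x : T) :
  (\forall y \near x, f y = g y) -> {for x, continuous f} -> {for x, continuous g}.
Proof.
move=> fg cf; have fgx : f x = g x by exact: nbhs_singleton fg.
rewrite /prop_for /continuous_at -fgx; apply: cvg_trans cf.
by apply: near_eq_cvg.
Qed.

Lemma continuous_at_cst (T : topologicalType) (x : T) (c : R) : {for x, continuous (fun=> c)}.
Proof. exact: cvg_cst. Qed.

Lemma continuous_atD (T : topologicalType) (f g : T -> R) (x : T) :
  {for x, continuous f} -> {for x, continuous g} -> {for x, continuous (fun y => f y + g y)}.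
Proof. exact: cvgD. Qed.

Lemma continuous_atM (T : topologicalType) (f g : T -> R) (x : T) :
  {for x, continuous f} -> {for x, continuous g} -> {for x, continuous (fun y => f y * g y)}.
Proof. exact: cvgM. Qed.

Lemma continuous_atV (T : topologicalType) (f : T -> R) (x : T) :
  f x != 0 -> {for x, continuous f} -> {for x, continuous (fun y => (f y)^-1)}.
Proof. by move=> f0 cf; exact: cvgV. Qed.

Lemma near_forall (T : topologicalType) (x : T) (I : finType) (P : I -> T -> Prop) :
  (forall i, \forall y \near x, P i y) -> \forall y \near x, forall i, P i y.
Proof. by move=> Px; apply: filter_forall. Qed.

Lemma cvg_line0 V (x v : V) : h *: v + x @[h --> (0 : R)^'] --> x.
Proof.
rewrite -[X in _ --> X]add0r -[X in X + x](scale0r v).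
by apply: cvgD; [apply: cvgZr_tmp; exact: cvg_within|exact: cvg_cst].
Qed.

Lemma near_line V (P : V -> Prop) (x v : V) :
  (\forall y \near x, P y) -> \forall h \near (0 : R)^', P (h *: v + x).
Proof. by move=> xP; apply: cvg_line0. Qed.

Lemma cvg_seq_unique (u v : nat -> R) (l l' : R) : u =1 v ->
  u @ \oo --> l -> v @ \oo --> l' -> l = l'.
Proof. by move=> /funext -> ul vl; rewrite -(cvg_lim _ ul) // -(cvg_lim _ vl). Qed.

Lemma cvg_norm_le (u : nat -> R) (l M : R) :
  u @ \oo --> l -> (forall k, `|u k| <= M) -> `|l| <= M.
Proof.
move=> /cvg_norm ul uM; rewrite -(cvg_lim _ ul) //.
apply: limr_le; first by apply/cvg_ex; eexists; exact: ul.
exact: nearW.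
Qed.

Lemma expr2_ge_nat k : k%:R <= 2 ^+ k :> R.
Proof. by rewrite -natrX ler_nat; exact: (ltnW (ltn_expl k (ltnSn 1))). Qed.

Lemma exists_expr2_ge (a : R) : exists k, a <= 2 ^+ k.
Proof.
exists (Num.bound `|a|); apply: le_trans (ler_norm _) _.
by apply: le_trans (expr2_ge_nat _); apply: ltW; exact: archi_boundP.
Qed.

End normed_modules.

Section row_vectors.
Context {R : realType}.

Lemma coord_le_norm n (x : 'rV[R]_n) i : `|x 0 i| <= `|x|.
Proof.
rewrite /Num.norm /= mx_normrE; apply/bigmax_geP; right => /=.
by exists (0, i).
Qed.

Lemma norm_rV_le n (x : 'rV[R]_n) (M : R) :
  0 <= M -> (forall i, `|x 0 i| <= M) -> `|x| <= M.
Proof.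
move=> M0 xM; rewrite /Num.norm /= mx_normrE; apply/bigmax_leP; split => //= -[i j] _ /=.
by rewrite ord1.
Qed.

Lemma norm_rV_lt n (x : 'rV[R]_n) (M : R) :
  0 < M -> (forall i, `|x 0 i| < M) -> `|x| < M.
Proof.
move=> M0 xM; rewrite /Num.norm /= mx_normrE; apply/bigmax_ltP; split => //= -[i j] _ /=.
by rewrite ord1.
Qed.

Lemma norm_delta_le n (i : 'I_n) : `|delta_mx 0 i : 'rV[R]_n| <= 1.
Proof.
apply: norm_rV_le => // j; rewrite mxE eqxx /=.
by case: eqP => _; rewrite ?normr1 ?normr0.
Qed.

Lemma norm_scale_delta_le n (t : R) (i : 'I_n) : `|t *: delta_mx 0 i : 'rV[R]_n| <= `|t|.
Proof. by rewrite normrZ ler_piMr // norm_delta_le. Qed.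

Lemma norm_row_mx_le n k (r : R) (x : 'rV[R]_n) (y : 'rV[R]_k) : 0 <= r ->
  (`|row_mx x y| <= r) = (`|x| <= r) && (`|y| <= r).
Proof.
move=> r0; apply/idP/andP => [xyr|[xr yr]].
  split; apply: norm_rV_le => // i.
    by have := le_trans (coord_le_norm _ (lshift k i)) xyr; rewrite row_mxEl.
  by have := le_trans (coord_le_norm _ (rshift n i)) xyr; rewrite row_mxEr.
apply: norm_rV_le => // i; case: (split_ordP i) => j ->.
  by rewrite row_mxEl (le_trans (coord_le_norm _ _)).
by rewrite row_mxEr (le_trans (coord_le_norm _ _)).
Qed.

Lemma cvg_rV T (F : set_system T) {FF : Filter F} n (f : T -> 'rV[R]_n) (l : 'rV[R]_n) :
  (forall i, f x 0 i @[x --> F] --> l 0 i) -> f @ F --> l.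
Proof.
move=> cf; apply/cvgrPdist_lt => e e0.
have near_l : \forall x \near F, forall i, `|l 0 i - f x 0 i| < e.
  by apply: filter_forall => i; have /cvgrPdist_lt := cf i; apply.
apply: filterS near_l => x lx; apply: norm_rV_lt => // i.
by have := lx i; rewrite !mxE.
Qed.

Lemma continuous_rV (T : topologicalType) n (f : T -> 'rV[R]_n) x :
  (forall i, {for x, continuous (fun y => f y 0 i)}) -> {for x, continuous f}.
Proof. by move=> cf; apply: cvg_rV => i; exact: cf. Qed.

Lemma continuous_lsubmx n k : continuous (@lsubmx R 1 n k).
Proof.
move=> x; apply: continuous_rV => i.
apply: (continuous_at_ext (fun y => mxE _ _ _ _)); exact: coord_continuous.
Qed.

Lemma continuous_rsubmx n k : continuous (@rsubmx R 1 n k).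
Proof.
move=> x; apply: continuous_rV => i.
apply: (continuous_at_ext (fun y => mxE _ _ _ _)); exact: coord_continuous.
Qed.

Lemma continuous_row_mx (T : topologicalType) n k (f : T -> 'rV[R]_n) (g : T -> 'rV[R]_k) x :
  {for x, continuous f} -> {for x, continuous g} ->
  {for x, continuous (fun t => row_mx (f t) (g t))}.
Proof.
move=> cf cg; apply: continuous_rV => i; case: (split_ordP i) => j ->.
  apply: (continuous_at_ext (fun y => row_mxEl _ _ _ _)).
  by apply: (@continuous_comp _ _ _ f (fun y : 'rV[R]_n => y 0 j)) => //; exact: coord_continuous.
apply: (continuous_at_ext (fun y => row_mxEr _ _ _ _)).
by apply: (@continuous_comp _ _ _ g (fun y : 'rV[R]_k => y 0 j)) => //; exact: coord_continuous.
Qed.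

Lemma compact_closed_ball_rV n (r : R) : compact [set x : 'rV[R]_n | `|x| <= r].
Proof.
apply: bounded_closed_compact; last exact: closed_norm_le0.
by exists r; split; [exact: num_real|move=> M rM x /=; move/le_trans; apply; exact: ltW].
Qed.

Lemma compact_ball_at n (x : 'rV[R]_n) (r : R) : compact [set y : 'rV[R]_n | `|y - x| <= r].
Proof.
apply: (subclosed_compact (@closed_norm_le _ _ x r) (@compact_closed_ball_rV n (r + `|x|))).
move=> y /= yr; rewrite -[y](subrK x) (le_trans (ler_normD _ _)) //.
by rewrite lerD2r.
Qed.

Lemma compact_row_mx n k (A : set 'rV[R]_n) (B : set 'rV[R]_k) : compact A -> compact B ->
  compact [set z : 'rV[R]_(n + k) | A (lsubmx z) /\ B (rsubmx z)].
Proof.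
move=> cA cB; have [a a0 Aa] := compact_norm_bound cA; have [b b0 Bb] := compact_norm_bound cB.
apply: (subclosed_compact _ (@compact_closed_ball_rV (n + k) (a + b))).
  apply: (@closedI _ [set z : 'rV[R]_(n + k) | A (lsubmx z)] [set z | B (rsubmx z)]).
    by apply: preimage_closed (compact_closed_normed cA) => z _; exact: continuous_lsubmx.
  by apply: preimage_closed (compact_closed_normed cB) => z _; exact: continuous_rsubmx.
move=> z [/Aa za /Bb zb] /=; rewrite -[z]hsubmxK norm_row_mx_le ?addr_ge0 ?(ltW a0) ?(ltW b0) //.
by apply/andP; split; [apply: le_trans za _; rewrite lerDl|apply: le_trans zb _; rewrite lerDr]; exact: ltW.
Qed.

End row_vectors.

Section directional_derivative.
Context {R : realType}.

Lemma is_derive_line (V : normedModType R) (f : V -> R) (x v : V) (t : R) :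
  derivable f (x + t *: v) v ->
  is_derive t 1 (fun s : R => f (x + s *: v)) ('D_v f (x + t *: v)).
Proof.
move=> df.
have quotientE : (fun h : R => h^-1 *: ((f \o shift (x + t *: v)) (h *: v) - f (x + t *: v))) =
  (fun h : R => h^-1 *: (((fun s : R => f (x + s *: v)) \o shift t) (h *: 1) - f (x + t *: v))).
  apply/funext => h /=; congr (_ *: (f _ - _)).
  by rewrite [h%:A]mulr1 scalerDl addrCA addrA.
split; first by rewrite /derivable -quotientE.
by rewrite /derive -quotientE.
Qed.

Lemma is_derive_of_line (V : normedModType R) (f : V -> R) (x v : V) (d : R) :
  is_derive (0 : R) (1 : R) (fun h : R => f (h *: v + x)) d -> is_derive x v f d.
Proof.
have quotientE : (fun h : R => h^-1 *: ((f \o shift x) (h *: v) - f x)) =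
  (fun h : R => h^-1 *: (((fun h : R => f (h *: v + x)) \o shift 0) (h *: 1) - f (0 *: v + x))).
  apply/funext => h /=; congr (_ *: (f _ - _)).
    by rewrite [h%:A]mulr1 addr0.
  by rewrite scale0r add0r.
by move=> [df fd]; split; [rewrite /derivable quotientE|rewrite /derive quotientE].
Qed.

Lemma is_derive_cvg (V : normedModType R) (f : V -> R) (x v : V) (d : R) :
  h^-1 *: ((f \o shift x) (h *: v) - f x) @[h --> 0^'] --> d -> is_derive x v f d.
Proof. by move=> fd; split; [apply/cvg_ex; exists d|exact/cvg_lim]. Qed.

Lemma is_derive_near (V : normedModType R) (f g : V -> R) (x v : V) :
  (\forall y \near x, f y = g y) -> derivable f x v ->
  is_derive x v g ('D_v f x).
Proof.
move=> fg df; apply: is_derive_cvg; apply: cvg_trans df; apply: near_eq_cvg.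
apply: filterS (near_line v fg) => h /= ->.
by rewrite (nbhs_singleton fg).
Qed.

Lemma MVT_line (V : normedModType R) (f : V -> R) (x v : V) (t : R) :
  (forall s : R, `|s| <= `|t| -> derivable f (x + s *: v) v) ->
  exists2 s : R, `|s| <= `|t| & f (x + t *: v) - f x = t * 'D_v f (x + s *: v).
Proof.
move=> df.
have MVT_segment_line (a b : R) : a <= b -> (forall s : R, s \in `[a, b] -> `|s| <= `|t|) ->
    exists2 s : R, `|s| <= `|t| &
      f (x + b *: v) - f (x + a *: v) = 'D_v f (x + s *: v) * (b - a).
  move=> ab ab_t; have dl (s : R) : s \in `[a, b] ->
      is_derive s 1 (fun s : R => f (x + s *: v)) ('D_v f (x + s *: v)).
    by move=> /ab_t st; apply: is_derive_line; exact: df.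
  have dl_oo (s : R) : s \in `]a, b[ ->
      is_derive s 1 (fun s : R => f (x + s *: v)) ('D_v f (x + s *: v)).
    by move=> sab; apply: dl; apply: subset_itv_oo_cc.
  have cl : {within `[a, b], continuous (fun s : R => f (x + s *: v))}.
    by apply: derivable_within_continuous => s /dl[].
  have [s sab fE] := MVT_segment ab dl_oo cl.
  by exists s => //; exact: ab_t.
have [t0|t0] := leP t 0.
  have [|s|s st] := MVT_segment_line t 0 => //.
    by rewrite in_itv /= => /andP[ts s0]; rewrite !ler0_norm // lerN2.
  by rewrite scale0r addr0 sub0r => fE; exists s => //; rewrite -opprB fE; ring.
have [|s|s st] := MVT_segment_line 0 t; first exact: ltW.
  by rewrite in_itv /= => /andP[s0 st]; rewrite ger0_norm // gtr0_norm.
by rewrite scale0r addr0 subr0 => fE; exists s => //; rewrite fE mulrC.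
Qed.

Definition C1_at n (f : 'rV[R]_n -> R) (x : 'rV[R]_n) : Prop :=
  (\forall y \near x, forall i : 'I_n, derivable f y (delta_mx 0 i)) /\
  (forall i : 'I_n, {for x, continuous (partial i f)}).

Let trunc n (h : 'rV[R]_n) (k : nat) : 'rV[R]_n :=
  \row_i (if (i < k)%N then h 0 i else 0).

Let truncS n (h : 'rV[R]_n) (k : 'I_n) :
  trunc h k.+1 = trunc h k + h 0 k *: delta_mx 0 k.
Proof.
apply/rowP => i; rewrite !mxE eqxx /= ltnS leq_eqVlt.
have [<-|ik] := eqVneq k i; first by rewrite eqxx /= ltnn mulr1 add0r.
by rewrite mulr0 addr0 -[_ == _ :> nat]/(i == k) eq_sym (negbTE ik).
Qed.

Let trunc_telescope n (f : 'rV[R]_n -> R) (x h : 'rV[R]_n) :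
  f (x + h) - f x = \sum_(i < n) (f (x + trunc h i.+1) - f (x + trunc h i)).
Proof.
rewrite -(big_mkord xpredT (fun i => f (x + trunc h i.+1) - f (x + trunc h i))).
rewrite telescope_sumr //; congr (f _ - f _).
  by congr (x + _); apply/rowP => i; rewrite mxE ltn_ord.
by rewrite (_ : trunc h 0 = 0) ?addr0 //; apply/rowP => i; rewrite !mxE ltn0.
Qed.

Let norm_trunc_line_le n (h : 'rV[R]_n) (i : 'I_n) (s : R) :
  `|s| <= `|h 0 i| -> `|trunc h i + s *: delta_mx 0 i| <= `|h|.
Proof.
move=> sh; apply: norm_rV_le => // j; rewrite !mxE eqxx /=.
have [->|ij] := eqVneq j i.
  by rewrite ltnn add0r mulr1; apply: le_trans sh _; exact: coord_le_norm.
rewrite mulr0 addr0; case: ifP => _; last by rewrite normr0.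
exact: coord_le_norm.
Qed.

Lemma C1_expansion n (f : 'rV[R]_n -> R) (x : 'rV[R]_n) : C1_at f x ->
  forall e : R, 0 < e -> exists2 d : R, 0 < d & forall h : 'rV[R]_n, `|h| < d ->
    `|f (x + h) - f x - \sum_i h 0 i * partial i f x| <= e * `|h|.
Proof.
move=> [df cf] e e0.
pose e' : R := e / n.+1%:R.
have e'0 : 0 < e' by rewrite divr_gt0.
have near_x : \forall y \near x, (forall i : 'I_n, derivable f y (delta_mx 0 i)) /\
    (forall i : 'I_n, `|partial i f x - partial i f y| < e').
  have near_partial : \forall y \near x, forall i : 'I_n, `|partial i f x - partial i f y| < e'.
    by apply: near_forall => i; have /cvgrPdist_lt := cf i; apply.
  by apply: filterI.
have [d d0 ball_d] := nbhs_norm_lt near_x; exists d => // h hd.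
rewrite trunc_telescope -sumrB.
apply: (@le_trans _ _ (\sum_(i < n) e' * `|h|)); last first.
  rewrite sumr_const card_ord -mulr_natr mulrAC ler_wpM2r // /e' -mulrA.
  by rewrite ler_piMr ?(ltW e0) // mulrC ler_pdivrMr // mul1r ler_nat.
apply: le_trans (ler_norm_sum _ _ _) _; apply: ler_sum => i _.
have in_ball (s : R) : `|s| <= `|h 0 i| -> `|(x + trunc h i + s *: delta_mx 0 i) - x| < d.
  by move=> sh; rewrite -[x + _ + _]addrA [x + (_ + _)]addrC addrK (le_lt_trans (norm_trunc_line_le sh)).
rewrite truncS addrA; have [s sh ->] := @MVT_line _ f (x + trunc h i) (delta_mx 0 i) (h 0 i)
  (fun s sh => (ball_d _ (in_ball s sh)).1 i).
rewrite -mulrBr normrM mulrC ler_pM ?coord_le_norm // distrC ltW //.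
exact: (ball_d _ (in_ball s sh)).2.
Qed.

Let remainder n (f : 'rV[R]_n -> R) (x u : 'rV[R]_n) : R :=
  (f (x + u) - f x - \sum_i u 0 i * partial i f x) / `|u|.

Let cvg_remainder n (f : 'rV[R]_n -> R) (x : 'rV[R]_n) : C1_at f x ->
  remainder f x @ (0 : 'rV[R]_n) --> (0 : R).
Proof.
move=> C1f; apply/cvg_at_normP => e e0; have [d d0 expansion] := C1_expansion C1f e0.
exists d => // u; rewrite !subr0 => ud; rewrite /remainder normrM normfV normr_id.
have [->|u0] := eqVneq u 0; first by rewrite normr0 invr0 mulr0 ltW.
by rewrite ler_pdivrMr ?normr_gt0 // expansion.
Qed.

Section increments.
Variables (V : normedModType R) (n : nat) (F : V -> 'rV[R]_n) (x v : V).
Hypothesis dF : forall j, derivable (fun y => F y 0 j) x v.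

Let increment (h : R) : 'rV[R]_n := F (h *: v + x) - F x.

Let velocity : 'rV[R]_n := \row_j 'D_v (fun y => F y 0 j) x.

Let cvg_quotient : h^-1 *: increment h @[h --> 0^'] --> velocity.
Proof.
apply: cvg_rV => j; rewrite mxE; have := @dF j; rewrite /derivable; apply: cvg_trans.
by apply: near_eq_cvg; near=> h; rewrite !mxE.
Unshelve. all: by end_near. Qed.

Let cvg_increment : increment @ 0^' --> (0 : 'rV[R]_n).
Proof.
rewrite -[X in _ --> X](scale0r velocity).
have : h *: (h^-1 *: increment h) @[h --> 0^'] --> (0 : R) *: velocity.
  by apply: cvgZ cvg_quotient; exact: cvg_within.
apply: cvg_trans; apply: near_eq_cvg; near=> h.
by rewrite scalerA divff ?scale1r //; near: h; exact: nbhs_dnbhs_neq.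
Unshelve. all: by end_near. Qed.

Lemma chain_rule (f : 'rV[R]_n -> R) : C1_at f (F x) ->
  is_derive x v (f \o F) (\sum_j partial j f (F x) * 'D_v (fun y => F y 0 j) x).
Proof.
move=> C1f; have scaleE (a b : R) : a *: b = a * b by [].
apply: is_derive_cvg; rewrite -[X in _ --> X]addr0.
have linear_part : \sum_j partial j f (F x) * (h^-1 * increment h 0 j) @[h --> 0^'] -->
    \sum_j partial j f (F x) * 'D_v (fun y => F y 0 j) x.
  apply: (@cvg_big _ _ +%R) => [|j _]; first exact: add_continuous.
  apply: cvgMl_tmp; have := @dF j; rewrite /derivable; apply: cvg_trans.
  by apply: near_eq_cvg; near=> h; rewrite !mxE.
have norm_remainder_part : `|h^-1 *: increment h| * `|remainder f (F x) (increment h)|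
  @[h --> 0^'] --> (0 : R).
  rewrite -[X in _ --> X](mulr0 `|velocity|); apply: cvgM; first exact: cvg_norm.
  have := cvg_norm (cvg_comp _ _ cvg_increment (cvg_remainder C1f)); rewrite normr0; exact.
have remainder_part : h^-1 * `|increment h| * remainder f (F x) (increment h) @[h --> 0^'] --> (0 : R).
  apply/norm_cvg0P; rewrite (_ : (fun h => _) =
      (fun h => `|h^-1 *: increment h| * `|remainder f (F x) (increment h)|)) //.
  by apply/funext => h; rewrite !normrM normr_id [in RHS]normrZ.
have : \sum_j partial j f (F x) * (h^-1 * increment h 0 j) +
    h^-1 * `|increment h| * remainder f (F x) (increment h) @[h --> 0^'] -->
    \sum_j partial j f (F x) * 'D_v (fun y => F y 0 j) x + 0 by exact: cvgD.
apply: cvg_trans; apply: near_eq_cvg; near=> h.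
have -> : (f \o F \o shift x) (h *: v) = f (F x + increment h).
  by rewrite /= /increment [F x + _]addrC subrK.
rewrite scaleE /remainder; under eq_bigr do rewrite mulrCA.
rewrite -mulr_sumr -mulrA -mulrDr; congr (_ * _).
have [->|u0] := eqVneq (increment h) 0.
  rewrite normr0 mul0r !addr0 subrr big1 // => j _.
  by rewrite mxE mulr0.
rewrite mulrCA divff ?normr_eq0 // mulr1.
by under eq_bigr do rewrite mulrC; rewrite addrC subrK.
Unshelve. all: by end_near. Qed.

End increments.

End directional_derivative.

Section smooth_functions.
Context {R : realType}.

Lemma is_derive_coord n (j : 'I_n) (x v : 'rV[R]_n) :
  is_derive x v (fun y : 'rV[R]_n => y 0 j) (v 0 j).
Proof.
apply: is_derive_cvg.
apply: (@cvg_trans _ ((fun=> v 0 j) @ (0 : R)^')); last exact: cvg_cst.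
apply: near_eq_cvg; near=> h.
rewrite /= !mxE addrK [_ *: _]mulrA mulVf ?mul1r //; near: h; exact: nbhs_dnbhs_neq.
Unshelve. all: by end_near. Qed.

Implicit Types n : nat.

Lemma partial_coord n (i j : 'I_n) (x : 'rV[R]_n) :
  partial i (fun y : 'rV[R]_n => y 0 j) x = (i == j)%:R.
Proof. by rewrite /partial (@derive_val _ _ _ _ _ _ _ (is_derive_coord j x _)) mxE eqxx eq_sym. Qed.

Lemma near_open n (W : set 'rV[R]_n) (P : 'rV[R]_n -> Prop) x :
  open W -> W x -> (forall y, W y -> P y) -> \forall y \near x, P y.
Proof. by move=> oW Wx WP; apply: filterS WP _; exact: open_nbhs_nbhs. Qed.

Lemma partial_eq_on n (W : set 'rV[R]_n) (f g : 'rV[R]_n -> R) (i : 'I_n) : open W ->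
  (forall x, W x -> f x = g x) -> forall x, W x -> partial i f x = partial i g x.
Proof.
move=> oW fg x Wx; rewrite /partial /derive (fg x Wx).
have quotientE : \forall h \near 0^', h^-1 *: ((f \o shift x) (h *: delta_mx 0 i) - g x) =
    h^-1 *: ((g \o shift x) (h *: delta_mx 0 i) - g x).
  by apply: filterS (near_line (delta_mx 0 i) (near_open oW Wx fg)) => h /= ->.
by congr lim; rewrite eqEsubset; split; apply: near_eq_cvg => //; apply: filterS quotientE.
Qed.

Lemma partials_rcons n s (i : 'I_n) (f : 'rV[R]_n -> R) :
  partials (rcons s i) f = partials s (partial i f).
Proof. by rewrite /partials foldr_rcons. Qed.

Lemma partials_cat n s t (f : 'rV[R]_n -> R) :
  partials (s ++ t) f = partials s (partials t f).
Proof. by rewrite /partials foldr_cat. Qed.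

Lemma partials_eq_on n (W : set 'rV[R]_n) (f g : 'rV[R]_n -> R) (s : seq 'I_n) : open W ->
  (forall x, W x -> f x = g x) -> forall x, W x -> partials s f x = partials s g x.
Proof. by move=> oW fg; elim: s => //= i s; exact: partial_eq_on. Qed.

Lemma smooth_on_coind n (W : set 'rV[R]_n) (P : ('rV[R]_n -> R) -> Prop) : open W ->
  (forall f, P f -> forall x, W x -> {for x, continuous f} /\
    forall i : 'I_n, derivable f x (delta_mx 0 i)) ->
  (forall f (i : 'I_n), P f ->
    exists2 g, P g & forall x, W x -> partial i f x = g x) ->
  forall f, P f -> smooth_on W f.
Proof.
move=> oW P_derivable P_partial f Pf.
have P_partials s : exists2 g, P g & forall x, W x -> partials s f x = g x.
  elim: s => [|i s [g Pg fg]] /=; first by exists f.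
  have [g' Pg' gg'] := P_partial g i Pg; exists g' => // x Wx.
  by rewrite -gg' //; exact: (partial_eq_on i oW fg).
move=> s x Wx; have [g Pg fg] := P_partials s.
have [cg dg] := P_derivable g Pg x Wx.
have gf : \forall y \near x, g y = partials s f y.
  by apply: (near_open oW Wx) => y Wy; rewrite fg.
split; first exact: continuous_at_near cg.
by move=> i; have [] := is_derive_near gf (dg i).
Qed.

Lemma smooth_on_partials n (W : set 'rV[R]_n) s (f : 'rV[R]_n -> R) :
  smooth_on W f -> smooth_on W (partials s f).
Proof. by move=> sf t x Wx; rewrite -partials_cat; exact: sf. Qed.

Lemma smooth_on_partial n (W : set 'rV[R]_n) i (f : 'rV[R]_n -> R) :
  smooth_on W f -> smooth_on W (partial i f).
Proof. exact: (@smooth_on_partials _ _ [:: i]). Qed.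

Lemma smooth_on_continuous n (W : set 'rV[R]_n) (f : 'rV[R]_n -> R) x :
  smooth_on W f -> W x -> {for x, continuous f}.
Proof. by move=> sf Wx; have [] := sf [::] x Wx. Qed.

Lemma smooth_on_derivable n (W : set 'rV[R]_n) (f : 'rV[R]_n -> R) x (i : 'I_n) :
  smooth_on W f -> W x -> derivable f x (delta_mx 0 i).
Proof. by move=> sf Wx; have [_] := sf [::] x Wx; apply. Qed.

Lemma smooth_on_C1 n (W : set 'rV[R]_n) (f : 'rV[R]_n -> R) x :
  open W -> smooth_on W f -> W x -> C1_at f x.
Proof.
move=> oW sf Wx; split.
  by apply: (near_open oW Wx) => y Wy i; exact: smooth_on_derivable sf Wy.
by move=> i; apply: smooth_on_continuous Wx; exact: smooth_on_partial.
Qed.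

Lemma smooth_on_sub n (W W' : set 'rV[R]_n) (f : 'rV[R]_n -> R) :
  W' `<=` W -> smooth_on W f -> smooth_on W' f.
Proof. by move=> W'W sf s x /W'W; exact: sf. Qed.

Lemma smooth_smooth_on n (W : set 'rV[R]_n) (f : 'rV[R]_n -> R) :
  smooth f -> smooth_on W f.
Proof. exact: smooth_on_sub. Qed.

Lemma smooth_on_ext n (W : set 'rV[R]_n) (f g : 'rV[R]_n -> R) : open W ->
  (forall x, W x -> f x = g x) -> smooth_on W f -> smooth_on W g.
Proof.
move=> oW fg sf s x Wx; have [cf df] := sf s x Wx.
have near_fg : \forall y \near x, partials s f y = partials s g y.
  by apply: (near_open oW Wx) => y Wy; exact: (partials_eq_on s oW fg).
split; first exact: continuous_at_near cf.
by move=> i; have [] := is_derive_near near_fg (df i).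
Qed.

Lemma partial_cst n i (c : R) : partial i (fun=> c : R) = (fun _ : 'rV[R]_n => 0).
Proof. by apply/funext => x; rewrite /partial derive_cst. Qed.

Lemma smooth_on_cst n (W : set 'rV[R]_n) (c : R) : open W -> smooth_on W (fun=> c).
Proof.
move=> oW; apply: (@smooth_on_coind _ _ (fun f => exists c, f = (fun=> c))) => //.
- move=> _ [{}c ->] x Wx; split; first exact: continuous_at_cst.
  by move=> i; exact: derivable_cst.
- by move=> _ i [{}c ->]; rewrite partial_cst; exists (fun=> 0) => //; exists 0.
- by exists c.
Qed.

Lemma smooth_on_coord n (W : set 'rV[R]_n) j : open W ->
  smooth_on W (fun x : 'rV[R]_n => x 0 j).
Proof.
move=> oW; apply: (@smooth_on_coind _ _
   (fun f => f = (fun x : 'rV[R]_n => x 0 j) \/ exists c, f = (fun=> c))) => //.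
- move=> _ [->|[c ->]] x Wx; split.
  + exact: coord_continuous.
  + by move=> i; have [] := is_derive_coord j x (delta_mx 0 i).
  + exact: continuous_at_cst.
  + by move=> i; exact: derivable_cst.
- move=> _ i [->|[c ->]].
    by exists (fun=> (i == j)%:R) => [|x _]; [right; eexists|rewrite partial_coord].
  by rewrite partial_cst; exists (fun=> 0) => //; right; exists 0.
- by left.
Qed.

Lemma partialD n i (f g : 'rV[R]_n -> R) x :
  derivable f x (delta_mx 0 i) -> derivable g x (delta_mx 0 i) ->
  partial i (fun y => f y + g y) x = partial i f x + partial i g x.
Proof. by move=> df dg; rewrite /partial (deriveD df dg). Qed.

Lemma partialM n i (f g : 'rV[R]_n -> R) x :
  derivable f x (delta_mx 0 i) -> derivable g x (delta_mx 0 i) ->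
  partial i (fun y => f y * g y) x = f x * partial i g x + g x * partial i f x.
Proof. by move=> df dg; rewrite /partial (deriveM df dg). Qed.

Lemma partialZ n i (c : R) (f : 'rV[R]_n -> R) x :
  derivable f x (delta_mx 0 i) ->
  partial i (fun y => c * f y) x = c * partial i f x.
Proof. by move=> df; exact: (deriveZ c df). Qed.

Lemma partialV n i (f : 'rV[R]_n -> R) x : f x != 0 ->
  derivable f x (delta_mx 0 i) ->
  partial i (fun y => (f y)^-1) x = - 1 * (f x)^-1 * (f x)^-1 * partial i f x.
Proof.
move=> f0 df; rewrite /partial (deriveV f0 df).
by rewrite [_ *: _]mulNr mulN1r !mulNr expr2 invfM.
Qed.

Lemma is_derive_comp n k (W : set 'rV[R]_n) (V : set 'rV[R]_k)
    (F : 'rV[R]_n -> 'rV[R]_k) f x i : open V -> smooth_on V f ->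
  (forall j, smooth_on W (fun y => F y 0 j)) -> W x -> V (F x) ->
  is_derive x (delta_mx 0 i) (fun y => f (F y))
    (\sum_j partial j f (F x) * partial i (fun y => F y 0 j) x).
Proof.
move=> oV sf sF Wx VFx; apply: (@chain_rule R _ k F x (delta_mx 0 i) _ f).
  by move=> j; exact: smooth_on_derivable (sF j) Wx.
exact: smooth_on_C1 VFx.
Qed.

Lemma partial_comp n k (W : set 'rV[R]_n) (V : set 'rV[R]_k)
    (F : 'rV[R]_n -> 'rV[R]_k) f x i : open V -> smooth_on V f ->
  (forall j, smooth_on W (fun y => F y 0 j)) -> W x -> V (F x) ->
  partial i (fun y => f (F y)) x = \sum_j partial j f (F x) * partial i (fun y => F y 0 j) x.
Proof.
move=> oV sf sF Wx VFx.
exact: (@derive_val _ _ _ _ _ _ _ (is_derive_comp i oV sf sF Wx VFx)).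
Qed.

(* Closing up under all operations at once makes the class stable under partial
   derivatives, so that the coinduction principle applies. *)
Inductive smooth_closure n (W : set 'rV[R]_n) : ('rV[R]_n -> R) -> Prop :=
| smooth_closure_on f : smooth_on W f -> smooth_closure W f
| smooth_closureD f g : smooth_closure W f -> smooth_closure W g ->
    smooth_closure W (fun x => f x + g x)
| smooth_closureM f g : smooth_closure W f -> smooth_closure W g ->
    smooth_closure W (fun x => f x * g x)
| smooth_closureV f : smooth_closure W f -> (forall x, W x -> f x != 0) ->
    smooth_closure W (fun x => (f x)^-1)
| smooth_closure_comp k (V : set 'rV[R]_k) (F : 'rV[R]_n -> 'rV[R]_k) f :
    open V -> smooth_on V f -> (forall x, W x -> V (F x)) ->
    (forall j, smooth_on W (fun x => F x 0 j)) ->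
    smooth_closure W (fun x => f (F x)).

Lemma smooth_closure_sum n (W : set 'rV[R]_n) (I : Type) (s : seq I)
    (f : I -> 'rV[R]_n -> R) : open W -> (forall i, smooth_closure W (f i)) ->
  smooth_closure W (fun x => \sum_(i <- s) f i x).
Proof.
move=> oW sf; elim: s => [|i s IHs].
  under eq_fun do rewrite big_nil.
  by apply: smooth_closure_on; exact: smooth_on_cst.
by under eq_fun do rewrite big_cons; exact: smooth_closureD.
Qed.

Lemma smooth_closure_derivable n (W : set 'rV[R]_n) f : smooth_closure W f ->
  forall x, W x -> {for x, continuous f} /\ forall i : 'I_n, derivable f x (delta_mx 0 i).
Proof.
elim=> {f} [f sf|f g _ IHf _ IHg|f g _ IHf _ IHg|f _ IHf f0|k V F f oV sf WV sF] x Wx.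
- by split => [|i]; [exact: smooth_on_continuous Wx|exact: smooth_on_derivable sf Wx].
- have [cf df] := IHf x Wx; have [cg dg] := IHg x Wx; split; first exact: continuous_atD.
  by move=> i; exact: derivableD.
- have [cf df] := IHf x Wx; have [cg dg] := IHg x Wx; split; first exact: continuous_atM.
  by move=> i; exact: derivableM.
- have [cf df] := IHf x Wx; split; first exact: continuous_atV (f0 x Wx) cf.
  by move=> i; apply: derivableV => //; exact: f0.
- split; last by move=> i; have [] := is_derive_comp i oV sf sF Wx (WV _ Wx).
  apply: (@continuous_comp _ _ _ F f).
    by apply: continuous_rV => j; exact: smooth_on_continuous Wx.
  exact: smooth_on_continuous (WV _ Wx).
Qed.

Lemma smooth_closure_partial n (W : set 'rV[R]_n) f (i : 'I_n) : open W -> smooth_closure W f ->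
  exists2 g, smooth_closure W g & forall x, W x -> partial i f x = g x.
Proof.
move=> oW; elim=> {f} [f sf|f g scf [f' sf' ff'] scg [g' sg' gg']|
    f g scf [f' sf' ff'] scg [g' sg' gg']|f scf [f' sf' ff'] f0|k V F f oV sf WV sF].
- by exists (partial i f) => //; apply: smooth_closure_on; exact: smooth_on_partial.
- exists (fun x => f' x + g' x) => [|x Wx]; first exact: smooth_closureD.
  have [_ df] := smooth_closure_derivable scf Wx; have [_ dg] := smooth_closure_derivable scg Wx.
  by rewrite partialD ?ff' ?gg'.
- exists (fun x => f x * g' x + g x * f' x) => [|x Wx].
    by apply: smooth_closureD; exact: smooth_closureM.
  have [_ df] := smooth_closure_derivable scf Wx; have [_ dg] := smooth_closure_derivable scg Wx.
  by rewrite partialM ?ff' ?gg'.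
- have scV := smooth_closureV scf f0.
  exists (fun x => -1 * (f x)^-1 * (f x)^-1 * f' x) => [|x Wx].
    apply: smooth_closureM => //; apply: smooth_closureM => //.
    by apply: smooth_closureM => //; apply: smooth_closure_on; exact: smooth_on_cst.
  by have [_ df] := smooth_closure_derivable scf Wx; rewrite partialV ?ff' ?f0.
- exists (fun x => \sum_j partial j f (F x) * partial i (fun y => F y 0 j) x) => [|x Wx].
    apply: smooth_closure_sum => // j; apply: smooth_closureM.
      by apply: (@smooth_closure_comp _ _ _ V) => //; exact: smooth_on_partial.
    by apply: smooth_closure_on; exact: smooth_on_partial.
  exact: (partial_comp i oV sf sF Wx (WV _ Wx)).
Qed.

Lemma smooth_closure_smooth n (W : set 'rV[R]_n) f : open W ->
  smooth_closure W f -> smooth_on W f.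
Proof.
move=> oW; apply: smooth_on_coind => // {}f; first exact: smooth_closure_derivable.
by move=> i; exact: smooth_closure_partial.
Qed.

Lemma smooth_onD n (W : set 'rV[R]_n) (f g : 'rV[R]_n -> R) : open W ->
  smooth_on W f -> smooth_on W g -> smooth_on W (fun x => f x + g x).
Proof. by move=> oW sf sg; apply: smooth_closure_smooth => //; apply: smooth_closureD;
  exact: smooth_closure_on. Qed.

Lemma smooth_onM n (W : set 'rV[R]_n) (f g : 'rV[R]_n -> R) : open W ->
  smooth_on W f -> smooth_on W g -> smooth_on W (fun x => f x * g x).
Proof. by move=> oW sf sg; apply: smooth_closure_smooth => //; apply: smooth_closureM;
  exact: smooth_closure_on. Qed.

Lemma smooth_onZ n (W : set 'rV[R]_n) c (f : 'rV[R]_n -> R) : open W ->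
  smooth_on W f -> smooth_on W (fun x => c * f x).
Proof. by move=> oW sf; apply: smooth_onM => //; exact: smooth_on_cst. Qed.

Lemma smooth_onN n (W : set 'rV[R]_n) (f : 'rV[R]_n -> R) : open W ->
  smooth_on W f -> smooth_on W (fun x => - f x).
Proof. by move=> oW sf; under eq_fun do rewrite -mulN1r; exact: smooth_onZ. Qed.

Lemma smooth_onB n (W : set 'rV[R]_n) (f g : 'rV[R]_n -> R) : open W ->
  smooth_on W f -> smooth_on W g -> smooth_on W (fun x => f x - g x).
Proof. by move=> oW sf sg; exact: (smooth_onD oW sf (smooth_onN oW sg)). Qed.

Lemma smooth_onV n (W : set 'rV[R]_n) (f : 'rV[R]_n -> R) : open W ->
  smooth_on W f -> (forall x, W x -> f x != 0) -> smooth_on W (fun x => (f x)^-1).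
Proof. by move=> oW sf f0; apply: smooth_closure_smooth => //; apply: smooth_closureV => //;
  exact: smooth_closure_on. Qed.

Lemma smooth_on_comp n k (W : set 'rV[R]_n) (V : set 'rV[R]_k)
    (F : 'rV[R]_n -> 'rV[R]_k) (f : 'rV[R]_k -> R) : open W -> open V ->
  smooth_on V f -> (forall x, W x -> V (F x)) ->
  (forall j, smooth_on W (fun x => F x 0 j)) ->
  smooth_on W (fun x => f (F x)).
Proof. by move=> oW oV sf WV sF; apply: smooth_closure_smooth => //;
  exact: (@smooth_closure_comp _ _ _ V). Qed.

Lemma smooth_on_sum n (W : set 'rV[R]_n) (I : Type) (s : seq I) (P : pred I)
    (f : I -> 'rV[R]_n -> R) : open W -> (forall i, P i -> smooth_on W (f i)) ->
  smooth_on W (fun x => \sum_(i <- s | P i) f i x).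
Proof.
move=> oW sf; elim: s => [|i s IHs].
  by under eq_fun do rewrite big_nil; exact: smooth_on_cst.
have [Pi|Pi] := boolP (P i); last by under eq_fun do rewrite big_cons (negbTE Pi).
by under eq_fun do rewrite big_cons Pi; apply: smooth_onD => //; exact: sf.
Qed.

Lemma smooth_on_prod n (W : set 'rV[R]_n) (I : Type) (s : seq I)
    (f : I -> 'rV[R]_n -> R) : open W -> (forall i, smooth_on W (f i)) ->
  smooth_on W (fun x => \prod_(i <- s) f i x).
Proof.
move=> oW sf; elim: s => [|i s IHs].
  by under eq_fun do rewrite big_nil; exact: smooth_on_cst.
by under eq_fun do rewrite big_cons; exact: smooth_onM.
Qed.

Lemma smooth_comp n k (F : 'rV[R]_n -> 'rV[R]_k) (f : 'rV[R]_k -> R) :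
  smooth f -> smooth_map F -> smooth (fun x => f (F x)).
Proof. by move=> sf sF; apply: (@smooth_on_comp _ _ _ setT) => //; exact: openT. Qed.

Lemma smooth_map_comp n k l (F : 'rV[R]_n -> 'rV[R]_k) (G : 'rV[R]_k -> 'rV[R]_l) :
  smooth_map G -> smooth_map F -> smooth_map (fun x => G (F x)).
Proof. by move=> sG sF j; exact: (smooth_comp (sG j)). Qed.

Lemma smooth_continuous n (f : 'rV[R]_n -> R) : smooth f -> continuous f.
Proof. by move=> sf x; exact: smooth_on_continuous sf _. Qed.

Lemma smooth_derivable n (f : 'rV[R]_n -> R) x (i : 'I_n) :
  smooth f -> derivable f x (delta_mx 0 i).
Proof. by move=> sf; exact: smooth_on_derivable sf _. Qed.

Lemma smooth_map_continuous n k (F : 'rV[R]_n -> 'rV[R]_k) :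
  smooth_map F -> continuous F.
Proof. by move=> sF x; apply: continuous_rV => i; exact: smooth_continuous. Qed.

Lemma partial_smooth_comp n k (F : 'rV[R]_n -> 'rV[R]_k) (f : 'rV[R]_k -> R) i x :
  smooth f -> smooth_map F -> partial i (fun y => f (F y)) x =
  \sum_j partial j f (F x) * partial i (fun y => F y 0 j) x.
Proof. by move=> sf sF; exact: (@partial_comp n k setT setT F f x i openT). Qed.

Lemma smooth_map_row_mx l n k (F : 'rV[R]_l -> 'rV[R]_n) (G : 'rV[R]_l -> 'rV[R]_k) :
  smooth_map F -> smooth_map G -> smooth_map (fun x => row_mx (F x) (G x)).
Proof.
move=> sF sG j; case: (split_ordP j) => i ->.
  by under eq_fun do rewrite row_mxEl; exact: sF.
by under eq_fun do rewrite row_mxEr; exact: sG.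
Qed.

Lemma smooth_map_lsubmx n k : smooth_map (@lsubmx R 1 n k).
Proof. by move=> j; under eq_fun do rewrite mxE; exact: (smooth_on_coord _ openT). Qed.

Lemma smooth_map_rsubmx n k : smooth_map (@rsubmx R 1 n k).
Proof. by move=> j; under eq_fun do rewrite mxE; exact: (smooth_on_coord _ openT). Qed.

Lemma smooth_map_cst n k (c : 'rV[R]_k) : smooth_map (fun _ : 'rV[R]_n => c).
Proof. by move=> j; exact: (smooth_on_cst _ openT). Qed.

Lemma smooth_map_id n : smooth_map (fun x : 'rV[R]_n => x).
Proof. by move=> j; exact: (smooth_on_coord _ openT). Qed.

Lemma smooth_map_translation n (b : 'rV[R]_n) : smooth_map (fun x => x + b).
Proof.
move=> j; under eq_fun do rewrite mxE.
exact: (smooth_onD openT (smooth_on_coord j openT) (smooth_on_cst (b 0 j) openT)).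
Qed.

End smooth_functions.

Section partial_along_lines.
Context {R : realType}.

Lemma partial_line_eq n k (f : 'rV[R]_n -> R) (g : 'rV[R]_k -> R) i j x y :
  (forall t : R, f (t *: delta_mx 0 i + x) = g (t *: delta_mx 0 j + y)) ->
  partial i f x = partial j g y.
Proof.
move=> fg; have fxgy : f x = g y by have := fg 0; rewrite !scale0r !add0r.
rewrite /partial /derive.
suff -> : (fun h : R => h^-1 *: ((f \o shift x) (h *: delta_mx 0 i) - f x)) =
  (fun h : R => h^-1 *: ((g \o shift y) (h *: delta_mx 0 j) - g y)) by [].
by apply/funext => h; rewrite /= fg fxgy.
Qed.

Lemma lsubmx_add n k (x y : 'rV[R]_(n + k)) : lsubmx (x + y) = lsubmx x + lsubmx y.
Proof. by apply/rowP => i; rewrite !mxE. Qed.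

Lemma row_mx_line_l n k (t : R) i (x : 'rV[R]_n) (y : 'rV[R]_k) :
  row_mx (t *: delta_mx 0 i + x) y = t *: delta_mx 0 (lshift k i) + row_mx x y.
Proof.
apply/rowP => j; case: (split_ordP j) => l ->.
  by rewrite row_mxEl [RHS]mxE row_mxEl !mxE (inj_eq (@lshift_inj _ _)).
by rewrite row_mxEr [RHS]mxE row_mxEr !mxE eq_rlshift mulr0 add0r.
Qed.

Lemma row_mx_line_r n k (t : R) i (x : 'rV[R]_n) (y : 'rV[R]_k) :
  row_mx x (t *: delta_mx 0 i + y) = t *: delta_mx 0 (rshift n i) + row_mx x y.
Proof.
apply/rowP => j; case: (split_ordP j) => l ->.
  by rewrite row_mxEl [RHS]mxE row_mxEl !mxE eq_lrshift mulr0 add0r.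
by rewrite row_mxEr [RHS]mxE row_mxEr !mxE (inj_eq (@rshift_inj _ _)).
Qed.

Lemma lsubmx_line_l n k (t : R) i (z : 'rV[R]_(n + k)) :
  lsubmx (t *: delta_mx 0 (lshift k i) + z) = t *: delta_mx 0 i + lsubmx z.
Proof. by rewrite -{1}[z]hsubmxK -row_mx_line_l row_mxKl. Qed.

Lemma lsubmx_line_r n k (t : R) i (z : 'rV[R]_(n + k)) :
  lsubmx (t *: delta_mx 0 (rshift n i) + z) = lsubmx z.
Proof. by rewrite -{1}[z]hsubmxK -row_mx_line_r row_mxKl. Qed.

Lemma partial_lsubmx_l n k (g : 'rV[R]_n -> R) i (z : 'rV[R]_(n + k)) :
  partial (lshift k i) (fun z => g (lsubmx z)) z = partial i g (lsubmx z).
Proof. by apply: partial_line_eq => t; rewrite lsubmx_line_l. Qed.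

Lemma partial_lsubmx_r n k (g : 'rV[R]_n -> R) i (z : 'rV[R]_(n + k)) :
  partial (rshift n i) (fun z => g (lsubmx z)) z = 0.
Proof.
have -> : partial (rshift n i) (fun z => g (lsubmx z)) z = partial i (fun _ : 'rV[R]_k => g (lsubmx z)) 0.
  by apply: partial_line_eq => t; rewrite lsubmx_line_r.
by rewrite partial_cst.
Qed.

Lemma partials_row_mx n k (f : 'rV[R]_(n + k) -> R) (y : 'rV[R]_k) s x :
  partials s (fun x => f (row_mx x y)) x = partials [seq lshift k i | i <- s] f (row_mx x y).
Proof.
elim: s x => //= i s IHs x; rewrite (funext IHs).
by apply: partial_line_eq => t; rewrite row_mx_line_l.
Qed.

End partial_along_lines.

Section cutoff_functions.
Context {R : realType}.

(* The functions [t^-k exp(-1/t)], extended by [0] to [t <= 0], are closed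
   under differentiation up to linear combinations. *)
Definition flat_exp (k : nat) (t : R) : R :=
  if 0 < t then t^-1 ^+ k * expR (- t^-1) else 0.

Lemma flat_exp_le0 k t : t <= 0 -> flat_exp k t = 0.
Proof. by rewrite /flat_exp ltNge => ->. Qed.

Lemma flat_exp_ge0 k t : 0 <= flat_exp k t.
Proof.
rewrite /flat_exp; case: ifP => // t0.
by rewrite mulr_ge0 ?expR_ge0 // exprn_ge0 // invr_ge0 ltW.
Qed.

Lemma flat_exp0_gt0 t : 0 < t -> 0 < flat_exp 0 t.
Proof. by move=> t0; rewrite /flat_exp t0 expr0 mul1r expR_gt0. Qed.

(* [exp(s) >= (s / m)^m] for [s = 1 / t] and [m = k + 2]. *)
Lemma flat_exp_le_sqr k t : flat_exp k t <= k.+2%:R ^+ k.+2 * t ^+ 2.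
Proof.
rewrite /flat_exp; case: ifPn => [t0|_]; last by rewrite mulr_ge0 ?sqr_ge0 ?exprn_ge0.
set m := k.+2.
have m0 : 0 < m%:R :> R by rewrite ltr0n.
have expr_le_expR : (t^-1 / m%:R) ^+ m <= expR t^-1.
  have {2}-> : t^-1 = m%:R * (t^-1 / m%:R).
    by rewrite mulrC divfK // lt0r_neq0.
  rewrite expRM_natl.
  apply: lerXn2r; rewrite ?nnegrE ?expR_ge0 ?divr_ge0 ?invr_ge0 ?(ltW t0) //.
  by apply: le_trans (expR_ge1Dx _); rewrite lerDr.
rewrite expRN ler_pdivrMr ?expR_gt0 //.
apply: le_trans (_ : _ <= m%:R ^+ m * t ^+ 2 * (t^-1 / m%:R) ^+ m) _; last first.
  by rewrite ler_wpM2l // mulr_ge0 ?sqr_ge0 ?exprn_ge0.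
rewrite -mulrA [t ^+ 2 * _]mulrC mulrA -exprMn [m%:R * _]mulrC divfK ?lt0r_neq0 //.
by rewrite /m -addn2 exprD -mulrA -exprMn mulVf ?lt0r_neq0 // expr1n mulr1.
Qed.

Let scaleE (a b : R) : a *: b = a * b. Proof. by []. Qed.

Lemma is_derive_invX k (t : R) : t != 0 ->
  is_derive t (1 : R) (fun s : R => s^-1 ^+ k) (- k%:R * t^-1 ^+ k.+1).
Proof.
move=> t0; have d_inv : is_derive t (1 : R) (fun s : R => s^-1) (- t ^- 2).
  apply: (is_derive_eq (@is_deriveV R id t 1 1 t0 (is_derive_id _ _))); exact: mulr1.
elim: k => [|k IHk].
  under eq_fun do rewrite expr0; rewrite oppr0 mul0r; exact: is_derive_cst.
under eq_fun do rewrite exprS.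
apply: (is_derive_eq (is_deriveM d_inv IHk)) => /=.
by rewrite !scaleE -exprVn -natr1 !exprS expr0; ring.
Qed.

Lemma is_derive_flat_exp_gt0 k (t : R) : 0 < t ->
  is_derive t (1 : R) (flat_exp k) (flat_exp k.+2 t - k%:R * flat_exp k.+1 t).
Proof.
move=> t0; have tn0 := lt0r_neq0 t0.
have d_inv : is_derive t (1 : R) (fun s : R => - s^-1) (t ^- 2).
  by have := is_deriveN (@is_deriveV R id t 1 1 tn0 (is_derive_id _ _)); rewrite scaleE mulr1 opprK.
have d_exp := @is_derive1_comp _ expR (fun s => - s^-1) t _ _ (is_derive_expR _) d_inv.
have d_formula : is_derive t (1 : R) (fun s : R => s^-1 ^+ k * expR (- s^-1))
    (flat_exp k.+2 t - k%:R * flat_exp k.+1 t).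
  apply: (is_derive_eq (is_deriveM (is_derive_invX k tn0) d_exp)) => /=.
  by rewrite /flat_exp t0 !scaleE -exprVn !exprS expr0; ring.
rewrite -(@derive_val _ _ _ _ _ _ _ d_formula).
apply: is_derive_near; last exact: (@ex_derive _ _ _ _ _ _ _ d_formula).
by near=> s; rewrite /flat_exp ifT //; near: s; exact: lt_nbhsr.
Unshelve. all: by end_near. Qed.

Lemma is_derive_flat_exp0 k : is_derive (0 : R) (1 : R) (flat_exp k) 0.
Proof.
apply: is_derive_cvg; apply/cvgr0Pnorm_le => e e0; near=> h.
rewrite /= addr0 [h%:A]mulr1 (flat_exp_le0 k (lexx 0)) subr0 normrZ normfV.
rewrite (ger0_norm (flat_exp_ge0 _ _)).
have h0 : h != 0 by near: h; exact: nbhs_dnbhs_neq.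
rewrite ler_pdivrMl ?normr_gt0 //.
apply: le_trans (flat_exp_le_sqr _ _) _.
rewrite -[h ^+ 2]real_normK ?num_real // expr2 mulrCA ler_wpM2l //.
rewrite mulrC -ler_pdivlMr ?exprn_gt0 ?ltr0n //.
by near: h; apply: dnbhs0_le; rewrite divr_gt0 // exprn_gt0 // ltr0n.
Unshelve. all: by end_near. Qed.

Lemma is_derive_flat_exp k (t : R) :
  is_derive t (1 : R) (flat_exp k) (flat_exp k.+2 t - k%:R * flat_exp k.+1 t).
Proof.
have [t0|t0|->] := ltgtP t 0; last 2 first.
- exact: is_derive_flat_exp_gt0.
- by rewrite !flat_exp_le0 // mulr0 subr0; exact: is_derive_flat_exp0.
rewrite !flat_exp_le0 ?(ltW t0) // mulr0 subr0.
have -> : (0 : R) = 'D_1 (fun=> 0 : R) t by rewrite derive_cst.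
apply: is_derive_near; last exact: derivable_cst.
near=> s; rewrite flat_exp_le0 // ltW //.
by near: s; exact: lt_nbhsl.
Unshelve. all: by end_near. Qed.

Definition flat_comb (l : seq (R * nat)) (t : R) : R :=
  \sum_(c <- l) c.1 * flat_exp c.2 t.

Definition flat_comb_derive (b : R) (l : seq (R * nat)) : seq (R * nat) :=
  flatten [seq [:: (b * c.1, c.2.+2); (- (b * c.1 * c.2%:R), c.2.+1)] | c <- l].

Lemma flat_comb_deriveM (b r : R) l t :
  flat_comb (flat_comb_derive (b * r) l) t = r * flat_comb (flat_comb_derive b l) t.
Proof.
rewrite /flat_comb mulr_sumr /flat_comb_derive.
elim: l => [|c l IHl] /=; first by rewrite !big_nil.
by rewrite !big_cons /= IHl; ring.
Qed.

Lemma is_derive_flat_comb (b : R) l (t : R) :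
  is_derive t (1 : R) (fun s => b * flat_comb l s) (flat_comb (flat_comb_derive b l) t).
Proof.
elim: l => [|[c k] l IHl].
  rewrite /flat_comb /flat_comb_derive; under eq_fun do rewrite big_nil mulr0.
  by rewrite big_nil; exact: is_derive_cst.
rewrite /flat_comb /=; under eq_fun do rewrite big_cons mulrDr /= mulrA.
rewrite !big_cons /=.
apply: (is_derive_eq (is_deriveD (@is_deriveZ _ _ _ _ (b * c) _ _ _ (is_derive_flat_exp k t)) IHl)).
by rewrite scaleE addrA; congr (_ + _); ring.
Qed.

Lemma is_derive1_flat_comb l (t : R) :
  is_derive t (1 : R) (flat_comb l) (flat_comb (flat_comb_derive 1 l) t).
Proof. by have := is_derive_flat_comb 1 l t; under eq_fun do rewrite mul1r. Qed.

Lemma is_derive_flat_comb_coord n l (a b : R) (i j : 'I_n) (x : 'rV[R]_n) :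
  is_derive x (delta_mx 0 i) (fun x : 'rV[R]_n => flat_comb l (a + b * x 0 j))
    (flat_comb (flat_comb_derive (b * (i == j)%:R) l) (a + b * x 0 j)).
Proof.
apply: is_derive_of_line; set r := b * _; set s := a + b * x 0 j.
have -> : (fun h : R => flat_comb l (a + b * (h *: delta_mx 0 i + x) 0 j)) =
    flat_comb l \o (fun h : R => h * r + s).
  by apply/funext => h /=; rewrite !mxE eqxx /= eq_sym /r /s; congr flat_comb; ring.
have d_affine : is_derive (0 : R) (1 : R) (fun h : R => h * r + s) r.
  apply: (is_derive_eq (is_deriveD (is_deriveM (is_derive_id (0 : R) (1 : R))
    (is_derive_cst r (0 : R) (1 : R))) (is_derive_cst s (0 : R) (1 : R)))).
  by rewrite !scaleE /cst; ring.
have d_comb : is_derive ((fun h : R => h * r + s) 0) (1 : R) (flat_comb l)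
    (flat_comb (flat_comb_derive 1 l) s).
  by rewrite mul0r add0r; exact: is_derive1_flat_comb.
apply: (is_derive_eq (@is_derive1_comp R _ (fun h : R => h * r + s) 0 _ _ d_comb d_affine)).
by rewrite -[r in RHS]mul1r flat_comb_deriveM mulrC.
Qed.

Lemma smooth_flat_comb n l (a b : R) (j : 'I_n) :
  smooth (fun x : 'rV[R]_n => flat_comb l (a + b * x 0 j)).
Proof.
apply: (@smooth_on_coind _ _ _
  (fun f => exists l, f = (fun x : 'rV[R]_n => flat_comb l (a + b * x 0 j)))) => //.
- exact: openT.
- move=> _ [{}l ->] x _; split; last by move=> i; have [] := is_derive_flat_comb_coord l a b i j x.
  apply: (@continuous_comp _ _ _ (fun x : 'rV[R]_n => a + b * x 0 j) (flat_comb l)).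
    apply: continuous_atD; first exact: continuous_at_cst.
    by apply: continuous_atM; [exact: continuous_at_cst|exact: coord_continuous].
  apply: differentiable_continuous; apply/derivable1_diffP.
  by have [] := is_derive1_flat_comb l (a + b * x 0 j).
- move=> _ i [{}l ->]; eexists; first by eexists.
  by move=> x _; rewrite /partial (@derive_val _ _ _ _ _ _ _ (is_derive_flat_comb_coord l a b i j x)).
- by exists l.
Qed.

Definition smooth_step (t : R) : R :=
  flat_exp 0 t / (flat_exp 0 t + flat_exp 0 (1 - t)).

Lemma smooth_step_denom t : 0 < flat_exp 0 t + flat_exp 0 (1 - t).
Proof.
have [t0|t0] := ltP 0 t.
  by rewrite ltr_pwDl // ?flat_exp0_gt0 // flat_exp_ge0.
by rewrite ltr_wpDl // ?flat_exp0_gt0 ?flat_exp_ge0 // subr_gt0 (le_lt_trans t0).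
Qed.

Lemma smooth_step_ge0 t : 0 <= smooth_step t.
Proof. by rewrite divr_ge0 ?flat_exp_ge0 // ltW // smooth_step_denom. Qed.

Lemma smooth_step_le1 t : smooth_step t <= 1.
Proof. by rewrite ler_pdivrMr ?smooth_step_denom // mul1r lerDl flat_exp_ge0. Qed.

Lemma smooth_step_eq0 t : t <= 0 -> smooth_step t = 0.
Proof. by move=> t0; rewrite /smooth_step flat_exp_le0 // mul0r. Qed.

Lemma smooth_step_eq1 t : 1 <= t -> smooth_step t = 1.
Proof.
move=> t1; have := smooth_step_denom t.
rewrite /smooth_step [flat_exp 0 (1 - t)]flat_exp_le0 ?subr_le0 // addr0 => t0.
by rewrite divff // lt0r_neq0.
Qed.

Lemma smooth_smooth_step n (a b : R) (j : 'I_n) :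
  smooth (fun x : 'rV[R]_n => smooth_step (a + b * x 0 j)).
Proof.
have smooth_flat_exp (c d : R) : smooth (fun x : 'rV[R]_n => flat_exp 0 (c + d * x 0 j)).
  have := @smooth_flat_comb n [:: (1, 0%N)] c d j.
  by under eq_fun do rewrite /flat_comb big_seq1 /= mul1r.
apply: smooth_onM; [exact: openT|exact: smooth_flat_exp|].
apply: smooth_onV; first exact: openT.
  apply: smooth_onD; [exact: openT|exact: smooth_flat_exp|].
  have := smooth_flat_exp (1 - a) (- b).
  by under eq_fun do rewrite mulNr -addrA -opprD.
by move=> x _; rewrite lt0r_neq0 // smooth_step_denom.
Qed.

Definition box_cutoff n (k : R) (a b : 'I_n -> R) (x : 'rV[R]_n) : R :=
  \prod_i (smooth_step (k * (x 0 i - a i)) * smooth_step (k * (b i - x 0 i))).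

Lemma smooth_box_cutoff n k (a b : 'I_n -> R) : smooth (box_cutoff k a b).
Proof.
apply: smooth_on_prod => [|i]; first exact: openT.
apply: smooth_onM; first exact: openT.
  have := @smooth_smooth_step n (- (k * a i)) k i.
  by under eq_fun do rewrite addrC -mulrBr.
have := @smooth_smooth_step n (k * b i) (- k) i.
by under eq_fun do rewrite mulNr -mulrBr.
Qed.

Lemma box_cutoff_ge0 n k (a b : 'I_n -> R) (x : 'rV[R]_n) : 0 <= box_cutoff k a b x.
Proof. by apply: prodr_ge0 => i _; rewrite mulr_ge0 // smooth_step_ge0. Qed.

Lemma box_cutoff_le1 n k (a b : 'I_n -> R) (x : 'rV[R]_n) : box_cutoff k a b x <= 1.
Proof.
suff /andP[] : 0 <= box_cutoff k a b x <= 1 by [].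
apply: (big_ind (fun y : R => 0 <= y <= 1)) => [|y z /andP[y0 y1] /andP[z0 z1]|i _].
- by rewrite ler01 lexx.
- by rewrite mulr_ge0 //= mulr_ile1.
- by rewrite mulr_ge0 ?smooth_step_ge0 //= mulr_ile1 ?smooth_step_ge0 ?smooth_step_le1.
Qed.

Lemma box_cutoff_eq0 n (k : R) (a b : 'I_n -> R) (x : 'rV[R]_n) : 0 <= k ->
  ~ (forall i, a i < x 0 i < b i) -> box_cutoff k a b x = 0.
Proof.
move=> k0 /existsNP[i]; rewrite /box_cutoff (bigD1 i) //= => x_notin.
have [ax|xa] := ltP (a i) (x 0 i); last first.
  by rewrite [smooth_step (k * (x 0 i - a i))]smooth_step_eq0 ?mul0r // mulr_ge0_le0 // subr_le0.
have [xb|bx] := ltP (x 0 i) (b i); first by case: x_notin; rewrite ax xb.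
by rewrite [smooth_step (k * (b i - x 0 i))]smooth_step_eq0 ?mulr0 ?mul0r // mulr_ge0_le0 // subr_le0.
Qed.

Lemma box_cutoff_eq1 n (k : R) (a b : 'I_n -> R) (x : 'rV[R]_n) :
  (forall i, 1 <= k * (x 0 i - a i) /\ 1 <= k * (b i - x 0 i)) -> box_cutoff k a b x = 1.
Proof.
move=> x_inner; rewrite /box_cutoff big1 // => i _.
by have [ax xb] := x_inner i; rewrite !smooth_step_eq1 // mulr1.
Qed.

Lemma smooth_cutoff n (r s : R) (x0 : 'rV[R]_n) : 0 <= r -> r < s -> exists chi : 'rV[R]_n -> R,
  [/\ smooth chi, forall x, 0 <= chi x <= 1, forall x, `|x - x0| <= r -> chi x = 1 &
      forall x, s <= `|x - x0| -> chi x = 0].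
Proof.
move=> r0 rs; have s0 : 0 < s by exact: le_lt_trans rs.
exists (box_cutoff (s - r)^-1 (fun i => x0 0 i - s) (fun i => x0 0 i + s)); split.
- exact: smooth_box_cutoff.
- by move=> x; rewrite box_cutoff_ge0 box_cutoff_le1.
- move=> x xr; apply: box_cutoff_eq1 => i.
  have := le_trans (coord_le_norm (x - x0) i) xr; rewrite !mxE ler_norml => /andP[? ?].
  by rewrite !ler_pdivlMl ?subr_gt0 // !mulr1; split; lra.
- move=> x sx; apply: box_cutoff_eq0; first by rewrite invr_ge0 subr_ge0 ltW.
  move=> x_in_box; have : `|x - x0| < s.
    apply: norm_rV_lt => // i; have /andP[? ?] := x_in_box i; rewrite !mxE ltr_norml.
    by apply/andP; split; lra.
  by rewrite ltNge sx.
Qed.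

End cutoff_functions.
(** * Differential operators built from vector fields *)

Section vector_field_calculus.
Context {R : realType}.
Implicit Types n m : nat.

Lemma partial_scale_add n (i : 'I_n) (a : R) (f g : 'rV[R]_n -> R) x :
  smooth f -> smooth g ->
  partial i (fun y => a * f y + g y) x = a * partial i f x + partial i g x.
Proof.
move=> sf sg; rewrite partialD; last exact: smooth_derivable sg.
- by rewrite partialZ //; exact: smooth_derivable sf.
- by apply: smooth_derivable; exact: (smooth_onZ _ openT sf).
Qed.

Lemma partials_scale_add n (s : seq 'I_n) (a : R) (f g : 'rV[R]_n -> R) x :
  smooth f -> smooth g ->
  partials s (fun y => a * f y + g y) x = a * partials s f x + partials s g x.
Proof.
elim: s x => //= i s IHs x sf sg.
have -> : partials s (fun y => a * f y + g y) = (fun y => a * partials s f y + partials s g y).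
  by apply/funext => y; exact: IHs.
by rewrite partial_scale_add; [|exact: smooth_on_partials sf|exact: smooth_on_partials sg].
Qed.

Lemma smooth_scale_add n (a : R) (f g : 'rV[R]_n -> R) :
  smooth f -> smooth g -> smooth (fun y => a * f y + g y).
Proof.
by move=> sf sg; exact: (smooth_onD openT (smooth_onZ _ openT sf) sg).
Qed.

Lemma partials0 n (s : seq 'I_n) (x : 'rV[R]_n) : partials s (fun=> 0 : R) x = 0.
Proof.
by elim: s x => //= i s IHs x; rewrite (_ : partials s _ = fun=> 0) ?partial_cst //; exact/funext.
Qed.

Lemma partialsZ n s (a : R) (f : 'rV[R]_n -> R) x : smooth f ->
  partials s (fun y => a * f y) x = a * partials s f x.
Proof.
move=> sf; have := partials_scale_add s a x sf (smooth_on_cst 0 openT).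
rewrite partials0 addr0 => <-.
by congr (partials s _ x); apply/funext => y; rewrite addr0.
Qed.

Lemma partials_supported n (K : set 'rV[R]_n) s (f : 'rV[R]_n -> R) : closed K ->
  supported_in K f -> supported_in K (partials s f).
Proof.
move=> cK Kf x Kx.
rewrite (@partials_eq_on _ _ (~` K) f (fun=> 0) s) ?partials0 //; exact: closed_openC.
Qed.

Lemma partial_supported n (K : set 'rV[R]_n) i (f : 'rV[R]_n -> R) : closed K ->
  supported_in K f -> supported_in K (partial i f).
Proof. exact: (@partials_supported _ _ [:: i]). Qed.

Lemma supported_in_mul n (f g : 'rV[R]_n -> R) K : supported_in K g -> supported_in K (fun x => f x * g x).
Proof. by move=> Kg x /Kg ->; rewrite mulr0. Qed.

Lemma vfapp_scale_add n (X : @vfield R n) (a : R) (f g : 'rV[R]_n -> R) x :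
  smooth f -> smooth g ->
  vfapp X (fun y => a * f y + g y) x = a * vfapp X f x + vfapp X g x.
Proof.
move=> sf sg; rewrite /vfapp mulr_sumr -big_split /=; apply: eq_bigr => i _.
by rewrite (partial_scale_add _ _ _ sf sg) mulrDr mulrCA.
Qed.

Lemma vfapp0 n (X : @vfield R n) : vfapp X (fun=> 0) = (fun=> 0).
Proof.
by apply/funext => x; rewrite /vfapp big1 // => i _; rewrite partial_cst mulr0.
Qed.

Lemma vfappZ n (X : @vfield R n) (a : R) (f : 'rV[R]_n -> R) x :
  smooth f -> vfapp X (fun y => a * f y) x = a * vfapp X f x.
Proof.
move=> sf; have := @vfapp_scale_add n X a f (fun=> 0) x sf (smooth_on_cst _ openT).
by rewrite vfapp0 addr0; under eq_fun do rewrite addr0.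
Qed.

Lemma smooth_vfapp n (X : @vfield R n) (f : 'rV[R]_n -> R) :
  smooth_map X -> smooth f -> smooth (vfapp X f).
Proof.
move=> sX sf; apply: smooth_on_sum => [|i _]; first exact: openT.
exact: (smooth_onM openT (sX i) (smooth_on_partial i sf)).
Qed.

Lemma vfapp_coord n (X : @vfield R n) j x : vfapp X (fun y => y 0 j) x = X x 0 j.
Proof.
rewrite /vfapp (bigD1 j) //= partial_coord eqxx mulr1 big1 ?addr0 // => i /negbTE ij.
by rewrite partial_coord ij mulr0.
Qed.

Lemma vfapp_eq_on n (W : set 'rV[R]_n) (X : @vfield R n) (f g : 'rV[R]_n -> R) : open W ->
  (forall x, W x -> f x = g x) -> forall x, W x -> vfapp X f x = vfapp X g x.
Proof.
move=> oW fg x Wx; apply: eq_bigr => i _; congr (_ * _).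
exact: partial_eq_on fg _ Wx.
Qed.

Lemma vfappM n (X : @vfield R n) (f g : 'rV[R]_n -> R) x : smooth f -> smooth g ->
  vfapp X (fun y => f y * g y) x = f x * vfapp X g x + g x * vfapp X f x.
Proof.
move=> sf sg; rewrite /vfapp !mulr_sumr -big_split /=; apply: eq_bigr => i _.
rewrite (partialM (smooth_derivable sf) (smooth_derivable sg)).
by rewrite mulrDr !mulrA ![X x 0 i * _]mulrC.
Qed.

Lemma vfapp_supported n (X : @vfield R n) (f : 'rV[R]_n -> R) K : closed K ->
  supported_in K f -> supported_in K (vfapp X f).
Proof.
move=> cK Kf x Kx; rewrite (@vfapp_eq_on n (~` K) X f (fun=> 0)) ?vfapp0 //.
exact: closed_openC.
Qed.

Definition divergence n (X : @vfield R n) (x : 'rV[R]_n) : R :=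
  \sum_i partial i (fun y => X y 0 i) x.

Definition divergence_free n (X : @vfield R n) : Prop := forall x, divergence X x = 0.

Lemma vfapp_divergence n (X : @vfield R n) (f : 'rV[R]_n -> R) x : smooth_map X -> smooth f ->
  vfapp X f x = \sum_i partial i (fun y => X y 0 i * f y) x - f x * divergence X x.
Proof.
move=> sX sf; rewrite mulr_sumr -sumrB; apply: eq_bigr => i _.
by rewrite (partialM (smooth_derivable (sX i)) (smooth_derivable sf)) addrK.
Qed.

Section words.
Variables (n m : nat) (X : 'I_m -> @vfield R n) (w : 'I_m -> nat).
Hypothesis sX : forall i, smooth_map (X i).

Lemma smooth_vf_word I f : smooth f -> smooth (vf_word X I f).
Proof. by move=> sf; elim: I => [|i I IHI]; [exact: sf|exact: (smooth_vfapp (sX i) IHI)]. Qed.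

Lemma vf_word_scale_add I a f g x : smooth f -> smooth g ->
  vf_word X I (fun y => a * f y + g y) x = a * vf_word X I f x + vf_word X I g x.
Proof.
move=> sf sg; elim: I x => //= i I IHI x.
have -> : vf_word X I (fun y => a * f y + g y) =
    (fun y => a * vf_word X I f y + vf_word X I g y) by exact/funext.
by rewrite vfapp_scale_add; [|exact: smooth_vf_word sf|exact: smooth_vf_word sg].
Qed.

Lemma vf_word_eq_on (W : set 'rV[R]_n) I f g : open W ->
  (forall x, W x -> f x = g x) -> forall x, W x -> vf_word X I f x = vf_word X I g x.
Proof. by move=> oW fg; elim: I => //= i I; exact: vfapp_eq_on. Qed.

Lemma vf_word_rcons I i f : vf_word X (rcons I i) f = vf_word X I (vfapp (X i) f).
Proof. by rewrite /vf_word foldr_rcons. Qed.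

Lemma smooth_hom_op nu c f : smooth f -> smooth (hom_op X w nu c f).
Proof.
move=> sf; apply: smooth_on_sum => [|k _]; first exact: openT.
apply: smooth_on_sum => [|I _]; first exact: openT.
exact: (smooth_onZ _ openT (smooth_vf_word _ sf)).
Qed.

Lemma hom_op_scale_add nu c a f g x : smooth f -> smooth g ->
  hom_op X w nu c (fun y => a * f y + g y) x =
  a * hom_op X w nu c f x + hom_op X w nu c g x.
Proof.
move=> sf sg; rewrite /hom_op mulr_sumr -big_split /=; apply: eq_bigr => k _.
rewrite mulr_sumr -big_split /=; apply: eq_bigr => I _.
by rewrite (vf_word_scale_add _ _ _ sf sg) mulrDr mulrCA.
Qed.

Lemma hom_op0 nu c x : hom_op X w nu c (fun=> 0) x = 0.
Proof.
have s0 : smooth (fun _ : 'rV[R]_n => 0 : R) by exact: (smooth_on_cst 0 openT).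
have := @hom_op_scale_add nu c (-1) _ _ x s0 s0.
by under eq_fun do rewrite mulr0 addr0; rewrite mulN1r addNr.
Qed.

Lemma hom_opZ nu c a f x : smooth f ->
  hom_op X w nu c (fun y => a * f y) x = a * hom_op X w nu c f x.
Proof.
move=> sf; have := @hom_op_scale_add nu c a _ _ x sf (smooth_on_cst 0 openT).
by under eq_fun do rewrite addr0; rewrite hom_op0 addr0.
Qed.

Lemma hom_op_eq_on (W : set 'rV[R]_n) nu c f g : open W ->
  (forall x, W x -> f x = g x) ->
  forall x, W x -> hom_op X w nu c f x = hom_op X w nu c g x.
Proof.
move=> oW fg x Wx; apply: eq_bigr => k _; apply: eq_bigr => I _; congr (_ * _).
exact: (vf_word_eq_on _ oW fg Wx).
Qed.

Lemma hom_op_supported (K : set 'rV[R]_n) nu c f : closed K ->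
  supported_in K f -> supported_in K (hom_op X w nu c f).
Proof.
move=> cK Kf x Kx.
rewrite (@hom_op_eq_on (~` K) nu c f (fun=> 0)) ?hom_op0 //.
exact: closed_openC.
Qed.

End words.

Lemma transpose_coefK m (c : seq 'I_m -> R) : transpose_coef (transpose_coef c) = c.
Proof.
apply/funext => I; rewrite /transpose_coef size_rev revK mulrA -exprMn.
by rewrite mulrNN mulr1 expr1n mul1r.
Qed.

Section dilations.
Variables (n : nat) (e : 'I_n -> nat).

Lemma dilation_coord (l : R) (x : 'rV[R]_n) i : dilation e l x 0 i = l ^+ e i * x 0 i.
Proof. by rewrite mxE. Qed.

Lemma dilation1 (x : 'rV[R]_n) : dilation e 1 x = x.
Proof. by apply/rowP => i; rewrite mxE expr1n mul1r. Qed.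

Lemma dilation_dilation (l k : R) (x : 'rV[R]_n) :
  dilation e l (dilation e k x) = dilation e (l * k) x.
Proof. by apply/rowP => i; rewrite !mxE exprMn mulrA. Qed.

Lemma dilationK (l : R) : l != 0 -> cancel (dilation e l) (dilation e l^-1).
Proof. by move=> l0 x; rewrite dilation_dilation mulVf // dilation1. Qed.

Lemma dilationVK (l : R) : l != 0 -> cancel (dilation e l^-1) (dilation e l).
Proof. by move=> l0 x; rewrite dilation_dilation divff // dilation1. Qed.

Lemma dilation0 (l : R) : dilation e l 0 = 0.
Proof. by apply/rowP => i; rewrite !mxE mulr0. Qed.

Lemma dilation_eq0 (l : R) x : l != 0 -> dilation e l x = 0 -> x = 0.
Proof. by move=> l0 /(congr1 (dilation e l^-1)); rewrite dilationK // dilation0. Qed.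

Lemma smooth_dilation (l : R) : smooth_map (dilation e l).
Proof.
move=> j; under eq_fun do rewrite mxE.
by apply: smooth_onZ; [exact: openT|apply: smooth_on_coord; exact: openT].
Qed.

Lemma partial_dilation_on (W : set 'rV[R]_n) (l : R) i (f : 'rV[R]_n -> R) x :
  open W -> smooth_on W f -> W (dilation e l x) ->
  partial i (f \o dilation e l) x = l ^+ e i * partial i f (dilation e l x).
Proof.
move=> oW sf Wx; rewrite (partial_comp i oW sf (smooth_dilation l) (Logic.I : setT x) Wx).
have partial_coef j : partial i (fun y => dilation e l y 0 j) x = l ^+ e j * (i == j)%:R.
  under eq_fun do rewrite mxE.
  by rewrite partialZ ?partial_coord //; exact: (smooth_derivable (smooth_on_coord j openT)).
rewrite (bigD1 i) //= partial_coef eqxx mulr1 big1 ?addr0 1?mulrC // => j /negbTE ji.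
by rewrite partial_coef eq_sym ji !mulr0.
Qed.

Lemma partial_dilation (l : R) i (f : 'rV[R]_n -> R) x : smooth f ->
  partial i (f \o dilation e l) x = l ^+ e i * partial i f (dilation e l x).
Proof. by move=> sf; exact: (partial_dilation_on i openT sf Logic.I). Qed.

Lemma partials_dilation (l : R) s (f : 'rV[R]_n -> R) x : smooth f ->
  partials s (f \o dilation e l) x =
  l ^+ (\sum_(i <- s) e i)%N * partials s f (dilation e l x).
Proof.
move=> sf; elim: s x => [|i s IHs] x /=; first by rewrite big_nil mul1r.
have -> : partials s (f \o dilation e l) =
    (fun y => l ^+ (\sum_(i <- s) e i)%N * (partials s f \o dilation e l) y).
  by apply/funext => y; exact: IHs.
have sp : smooth (partials s f) by exact: smooth_on_partials.
rewrite partialZ; last first.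
  by apply: smooth_derivable; exact: (smooth_comp sp (smooth_dilation _)).
by rewrite (partial_dilation _ _ _ sp) mulrA big_cons addnC exprD.
Qed.

Section homogeneous_words.
Variables (m : nat) (X : 'I_m -> @vfield R n) (w : 'I_m -> nat).
Hypotheses (sX : forall i, smooth_map (X i))
  (homX : forall i, vf_homogeneous e (X i) (w i)).

Lemma vf_word_dilation I (l : R) u x : 0 < l -> smooth u ->
  vf_word X I (u \o dilation e l) x =
  l ^+ (\sum_(i <- I) w i)%N * vf_word X I u (dilation e l x).
Proof.
move=> l0 su; elim: I x => [|i I IHI] x /=; first by rewrite big_nil mul1r.
have -> : vf_word X I (u \o dilation e l) =
    (fun y => l ^+ (\sum_(i <- I) w i)%N * (vf_word X I u \o dilation e l) y).
  by apply/funext => y; exact: IHI.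
have sw : smooth (vf_word X I u) by exact: smooth_vf_word.
rewrite vfappZ; last exact: (smooth_comp sw (smooth_dilation _)).
by rewrite (homX _ l0 sw) mulrA big_cons addnC exprD.
Qed.

Lemma hom_op_dilation nu c (l : R) u x : 0 < l -> smooth u ->
  hom_op X w nu c (u \o dilation e l) x = l ^+ nu * hom_op X w nu c u (dilation e l x).
Proof.
move=> l0 su; rewrite /hom_op mulr_sumr; apply: eq_bigr => k _.
rewrite mulr_sumr; apply: eq_bigr => I /eqP wI.
by rewrite (vf_word_dilation _ _ l0 su) wI mulrCA.
Qed.

End homogeneous_words.

End dilations.

Section left_invariant_words.
Variables (N m : nat) (mul : 'rV[R]_N -> 'rV[R]_N -> 'rV[R]_N)
  (X : 'I_m -> @vfield R N) (w : 'I_m -> nat).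
Hypotheses (linv : forall i, left_invariant mul (X i))
  (smul : forall a, smooth_map (mul a)).

Lemma hom_op_left_translation nu c a u x : smooth u ->
  hom_op X w nu c (u \o mul a) x = hom_op X w nu c u (mul a x).
Proof.
move=> su; rewrite /hom_op; apply: eq_bigr => k _; apply: eq_bigr => I _; congr (_ * _).
elim: (val I) x => [//|i J IHJ] x /=.
have -> : vf_word X J (u \o mul a) = vf_word X J u \o mul a by exact/funext.
have [sX ->] := linv i; first by [].
by apply: smooth_vf_word su => j; have [] := linv j.
Qed.

End left_invariant_words.
End vector_field_calculus.

Section test_functions.
Context {R : realType} (n : nat).
Implicit Types (phi psi : 'rV[R]_n -> R) (W : set 'rV[R]_n).

Lemma test_fun_sub V W phi : V `<=` W -> test_fun V phi -> test_fun W phi.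
Proof. by move=> VW [sphi [K [cK KV Kphi]]]; split => //; exists K; split => // x /KV /VW. Qed.

Lemma test_fun_setT W phi : test_fun W phi -> test_fun setT phi.
Proof. exact: test_fun_sub. Qed.

Lemma test_fun0 W : test_fun W (fun=> 0 : R).
Proof.
split; first exact: (@smooth_on_cst _ _ setT 0 openT).
by exists set0; split => //; exact: compact0.
Qed.

Lemma test_fun_scale_add W (a : R) phi psi :
  test_fun W phi -> test_fun W psi -> test_fun W (fun x => a * phi x + psi x).
Proof.
move=> [sphi [K [cK KW Kphi]]] [spsi [K' [cK' KW' Kpsi]]].
split; first exact: (smooth_scale_add a sphi spsi).
exists (K `|` K'); split; [exact: compactU|by move=> x [/KW|/KW']|].
by move=> x nx; rewrite Kphi ?Kpsi ?mulr0 ?addr0 // => hx; apply: nx; [right|left].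
Qed.

Lemma test_funM W (f phi : 'rV[R]_n -> R) : smooth f -> test_fun W phi ->
  test_fun W (fun x => f x * phi x).
Proof.
move=> sf [sphi [K [cK KW Kphi]]]; split; first exact: (smooth_onM openT sf sphi).
by exists K; split => //; exact: supported_in_mul.
Qed.

Lemma test_fun_partial W (i : 'I_n) phi : test_fun W phi -> test_fun W (partial i phi).
Proof.
move=> [sphi [K [cK KW Kphi]]]; split; first exact: smooth_on_partial.
by exists K; split => //; apply: partial_supported => //; exact: compact_closed_normed.
Qed.

Lemma test_fun_vfapp W (X : @vfield R n) phi : smooth_map X -> test_fun W phi ->
  test_fun W (vfapp X phi).
Proof.
move=> sX [sphi [K [cK KW Kphi]]]; split; first exact: smooth_vfapp.
by exists K; split => //; apply: vfapp_supported => //; exact: compact_closed_normed.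
Qed.

Lemma test_fun_vf_word m (X : 'I_m -> @vfield R n) I W phi : (forall i, smooth_map (X i)) ->
  test_fun W phi -> test_fun W (vf_word X I phi).
Proof. by move=> sX tphi; elim: I => //= i I; exact: test_fun_vfapp. Qed.

Lemma test_fun_comp V W (F G : 'rV[R]_n -> 'rV[R]_n) phi : smooth_map F -> continuous G ->
  cancel F G -> (forall y, W y -> V (G y)) -> test_fun W phi -> test_fun V (phi \o F).
Proof.
move=> sF cG FK WV [sphi [K [cK KW Kphi]]]; split; first exact: (smooth_comp sphi sF).
exists (G @` K); split.
- by apply: continuous_compact cK; exact: continuous_subspaceT.
- by move=> _ [y Ky <-]; apply: WV; exact: KW.
- by move=> x nx; apply: Kphi => KFx; apply: nx; exists (F x).
Qed.

Lemma test_fun_dilation W (e : 'I_n -> nat) (l : R) phi : 0 < l ->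
  (forall x, W x -> W (dilation e l^-1 x)) -> test_fun W phi -> test_fun W (phi \o dilation e l).
Proof.
move=> l0; apply: test_fun_comp; first exact: smooth_dilation.
  exact: (smooth_map_continuous (@smooth_dilation R n e l^-1)).
exact: dilationK (lt0r_neq0 l0).
Qed.

Lemma test_fun_hom_op m (X : 'I_m -> @vfield R n) w nu c W phi : (forall i, smooth_map (X i)) ->
  test_fun W phi -> test_fun W (hom_op X w nu c phi).
Proof.
move=> sX [sphi [K [cK KW Kphi]]]; split; first exact: (smooth_hom_op _ sX _ _ sphi).
by exists K; split => //; apply: hom_op_supported => //; exact: compact_closed_normed.
Qed.

Lemma ball_test_fun W (x0 : 'rV[R]_n) (r : R) : 0 < r ->
  (forall x, `|x - x0| < r -> W x) ->
  exists phi, [/\ test_fun W phi, (forall x, 0 <= phi x <= 1),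
    (forall x, `|x - x0| <= r / 4 -> phi x = 1) &
    supported_in [set x | `|x - x0| <= r / 2] phi].
Proof.
move=> r0 rW; have r4 : 0 <= r / 4 by lra.
have r42 : r / 4 < r / 2 by lra.
have [chi [schi chi01 chi1 chi0]] := smooth_cutoff x0 r4 r42.
have supp_chi : supported_in [set x | `|x - x0| <= r / 2] chi.
  by move=> x /= /negP; rewrite -ltNge => /ltW; exact: chi0.
exists chi; split; [split; first exact: schi|exact: chi01|exact: chi1|exact: supp_chi].
exists [set x | `|x - x0| <= r / 2]; split; [exact: compact_ball_at| |exact: supp_chi].
by move=> x /= xr; apply: rW; apply: le_lt_trans xr _; lra.
Qed.

End test_functions.

(** * Lebesgue measure and integration on row vectors *)

Section transport_of_measure.
Context {R : realType} {d1 d2 d3 : measure_display} {T1 : measurableType d1}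
  {T2 : measurableType d2} {T3 : measurableType d3}.
Local Open Scope ereal_scope.

Definition push_measure (m : {measure set T1 -> \bar R}) (F : T1 -> T2)
    (mF : measurable_fun setT F) : {measure set T2 -> \bar R} :=
  measure_function_pushforward__canonical__measure_function_Measure m mF.

Definition transports (m1 : set T1 -> \bar R) (m2 : set T2 -> \bar R)
    (F : T1 -> T2) : Prop :=
  measurable_fun setT F /\ forall A, measurable A -> m1 (F @^-1` A) = m2 A.

Variables (m1 : {measure set T1 -> \bar R}) (m2 : {measure set T2 -> \bar R})
  (F : T1 -> T2).
Hypothesis tF : transports m1 m2 F.

Lemma transports_ge0_integral (f : T2 -> \bar R) : measurable_fun [set: T2] f ->
  (forall y, 0 <= f y) -> \int[m1]_x f (F x) = \int[m2]_y f y.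
Proof.
have [mF FE] := tF => mf f0.
rewrite -(@eq_measure_integral _ _ _ _ m2 (push_measure m1 mF)); last by move=> A mA _; exact: FE.
by rewrite (ge0_integral_pushforward mF) // => y _.
Qed.

Lemma transports_integral (f : T2 -> \bar R) : measurable_fun [set: T2] f ->
  \int[m1]_x f (F x) = \int[m2]_y f y.
Proof.
move=> mf; rewrite integralE [RHS]integralE; congr (_ - _).
  have := @transports_ge0_integral f^\+ (measurable_funepos mf) (funepos_ge0 f).
  by move=> <-; apply: eq_integral => x _; rewrite ?funeposE ?funenegE.
have := @transports_ge0_integral f^\- (measurable_funeneg mf) (funeneg_ge0 f).
by move=> <-; apply: eq_integral => x _; rewrite ?funeposE ?funenegE.
Qed.

Lemma transports_Rintegral (f : T2 -> R) : measurable_fun setT f ->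
  (\int[m1]_x f (F x) = \int[m2]_y f y)%R.
Proof.
move=> mf; rewrite /Rintegral -(@transports_integral (EFin \o f)) //.
exact/measurable_EFinP.
Qed.

Lemma transports_integrable (f : T2 -> R) : measurable_fun setT f ->
  m2.-integrable setT (EFin \o f) <-> m1.-integrable setT (EFin \o (f \o F)).
Proof.
have [mF FE] := tF => mf.
have abs_integralE : \int[m1]_x `|(f (F x))%:E| = \int[m2]_y `|(f y)%:E|.
  rewrite (@transports_ge0_integral (fun y => `|(f y)%:E|)) //.
  by apply: measurableT_comp => //; exact/measurable_EFinP.
split=> /integrableP[_ fin_abs]; apply/integrableP; split.
- by apply/measurable_EFinP; exact: measurableT_comp mF.
- by rewrite /= abs_integralE.
- exact/measurable_EFinP.
- by rewrite /= -abs_integralE.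
Qed.

End transport_of_measure.

Lemma transports_comp {R : realType} {d1 d2 d3 : measure_display} {T1 : measurableType d1}
  {T2 : measurableType d2} {T3 : measurableType d3} (m1 : set T1 -> \bar R)
  (m2 : set T2 -> \bar R) (m3 : set T3 -> \bar R) (F : T1 -> T2) (G : T2 -> T3) :
  transports m1 m2 F -> transports m2 m3 G -> transports m1 m3 (G \o F).
Proof.
move=> [mF FE] [mG GE]; split; first exact: measurableT_comp.
move=> A mA; rewrite -GE // -FE // -[X in measurable X]setTI.
exact: mG.
Qed.

Section measurable_rV_functions.
Context {R : realType}.

Lemma measurable_ball_rV n (x : 'rV[R]_n) (r : R) : 0 < r ->
  measurable [set y : 'rV[R]_n | `|y - x| < r].
Proof.
move=> r0; rewrite (_ : [set y | _] =
  [set y : 'rV[R]_n | forall i, `]x 0 i - r, x 0 i + r[%classic (y 0 i)]).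
  by apply: (@measurable_rV_box R n (fun i => `]x 0 i - r, x 0 i + r[%classic)) => i; exact: measurable_itv.
apply/seteqP; split=> y /=.
  move=> yx i; have := le_lt_trans (coord_le_norm _ i) yx; rewrite !mxE ltr_norml.
  by rewrite in_itv /= => /andP[? ?]; apply/andP; split; lra.
move=> yx; apply: norm_rV_lt => // i; have := yx i; rewrite !mxE in_itv /= ltr_norml.
by move=> /andP[? ?]; apply/andP; split; lra.
Qed.

(* An open set is the union of the balls with rational centre and radius [1 / k] which
   it contains. *)
Lemma open_measurable_rV n (U : set 'rV[R]_n) : open U -> measurable U.
Proof.
move=> oU.
pose c (q : {ffun 'I_n -> rat}) : 'rV[R]_n := \row_i ratr (q i).
pose B (t : {ffun 'I_n -> rat} * nat) : set 'rV[R]_n :=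
  [set y | `|y - c t.1| < t.2.+1%:R^-1 /\ (forall z, `|z - c t.1| < t.2.+1%:R^-1 -> U z)].
have -> : U = \bigcup_t B t.
  apply/seteqP; split => [x Ux|x [t _ [xt]]]; last by apply.
  have [r r0 rU] := nbhs_norm_lt (open_nbhs_nbhs (conj oU Ux)).
  have [k _ /(_ k (leqnn k)) kr] := near_infty_natSinv_lt (PosNum (divr_gt0 r0 (ltr0Sn R 1))).
  have /choice[q xq] : forall i, exists q : rat, ratr q \in `]x 0 i - k.+1%:R^-1, x 0 i + k.+1%:R^-1[.
    by move=> i; apply: rat_in_itvoo; rewrite ltrD2l gtrN // invr_gt0.
  have xc : `|x - c [ffun i => q i]| < k.+1%:R^-1.
    apply: norm_rV_lt => // i; have := xq i; rewrite !mxE ffunE in_itv /= ltr_norml.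
    by move: (k.+1%:R^-1 : R) => z /andP[? ?]; apply/andP; split; lra.
  exists ([ffun i => q i], k) => //; split => //= z zc; apply: rU.
  rewrite -(subrKA (c [ffun i => q i])) (le_lt_trans (ler_normD _ _)) //.
  by rewrite [X in _ < X]splitr ltrD // ?(lt_trans zc) // distrC (lt_trans xc).
apply: countable_bigcupT_measurable; first exact: countableP.
move=> t; have [tU|ntU] := pselect (forall z, `|z - c t.1| < t.2.+1%:R^-1 -> U z).
  rewrite (_ : B t = [set y | `|y - c t.1| < t.2.+1%:R^-1]); first exact: measurable_ball_rV.
  by apply/seteqP; split => y //= -[].
rewrite (_ : B t = set0); first exact: measurable0.
by apply/seteqP; split => y //= -[].
Qed.

Lemma closed_measurable_rV n (U : set 'rV[R]_n) : closed U -> measurable U.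
Proof.
by move=> cU; rewrite -(setCK U); apply: measurableC; apply: open_measurable_rV; exact: closed_openC.
Qed.

Lemma compact_measurable_rV n (K : set 'rV[R]_n) : compact K -> measurable K.
Proof. by move=> cK; apply: closed_measurable_rV; exact: compact_closed_normed. Qed.

Lemma measurable_fun_open_rV n (W : set 'rV[R]_n) (f : 'rV[R]_n -> R) : open W ->
  (forall x, W x -> {for x, continuous f}) -> measurable_fun W f.
Proof.
move=> oW cf; apply: (measurability _ (RGenOpens.measurableE R)) => _ [_ [a [b ->]] <-].
apply: open_measurable_rV; rewrite openE => x [Wx xab].
apply: filterI; first exact: open_nbhs_nbhs.
by apply: (cf x Wx); apply: open_nbhs_nbhs; split => //; exact: interval_open.
Qed.

Lemma continuous_measurable_rV n (f : 'rV[R]_n -> R) :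
  continuous f -> measurable_fun setT f.
Proof. by move=> cf; apply: measurable_fun_open_rV => [|x _]; [exact: openT|exact: cf]. Qed.

Lemma measurable_restrict_open_rV n (W : set 'rV[R]_n) (f : 'rV[R]_n -> R) : open W ->
  (forall x, W x -> {for x, continuous f}) -> measurable_fun setT (f \_ W).
Proof.
move=> oW cf; have mW := open_measurable_rV oW.
apply/(measurable_restrictT _ mW).
exact: measurable_fun_open_rV.
Qed.

Lemma continuous_map_measurable n k (F : 'rV[R]_n -> 'rV[R]_k) :
  continuous F -> measurable_fun setT F.
Proof.
move=> cF; apply: measurable_fun_rV => i; apply: continuous_measurable_rV => x.
apply: (@continuous_comp _ _ _ F (fun y : 'rV[R]_k => y 0 i)); first exact: cF.
exact: coord_continuous.
Qed.

Lemma measurable_row_mx d (T : measurableType d) n k (f : T -> 'rV[R]_n) (g : T -> 'rV[R]_k) :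
  measurable_fun setT f -> measurable_fun setT g ->
  measurable_fun setT (fun t => row_mx (f t) (g t)).
Proof.
move=> mf mg; apply: measurable_fun_rV => i; case: (split_ordP i) => j ->.
  under eq_fun do rewrite row_mxEl.
  exact: (measurableT_comp (measurable_rV_coord j) mf).
under eq_fun do rewrite row_mxEr.
exact: (measurableT_comp (measurable_rV_coord j) mg).
Qed.

Lemma measurable_lsubmx n k : measurable_fun setT (@lsubmx R 1 n k).
Proof. by apply: continuous_map_measurable; exact: continuous_lsubmx. Qed.

Lemma measurable_rsubmx n k : measurable_fun setT (@rsubmx R 1 n k).
Proof. by apply: continuous_map_measurable; exact: continuous_rsubmx. Qed.

End measurable_rV_functions.

Section lebesgue_rV_transport.
Context {R : realType}.
Local Open Scope ereal_scope.
Local Notation leb := (@lebesgue_measure R).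
Local Notation lebV n := (@lebesgue_rV R n).

Let boxes n : set (set 'rV[R]_n) :=
  [set B | exists2 A : 'I_n -> set (measurableTypeR R), (forall i, measurable (A i)) &
     B = [set x : 'rV[R]_n | forall i, A i (x 0%R i)]].

Let measurable_boxes n : @measurable _ 'rV[R]_n = <<s @boxes n >>.
Proof.
apply/seteqP; split => [A|]; last first.
  apply: smallest_sub; first exact: sigma_algebra_measurable.
  by move=> _ [C mC ->]; exact: measurable_rV_box.
move=> mA; apply: mA; split; first exact: smallest_sigma_algebra.
move=> {}A; rewrite -bigcup_seq => -[i _ [C mC <-]].
apply: sub_sigma_algebra; exists (fun j => if j == i then C else setT); first by move=> j; case: ifP.
rewrite setTI; apply/seteqP; split => x /=; last by move=> /(_ i); rewrite eqxx.
by move=> Cx j; case: eqP => [->|].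
Qed.

Lemma lebesgue_rV_cube_lty n (M : R) :
  lebV n [set x : 'rV[R]_n | forall i, (`[(- M)%R, M]%classic : set R) (x 0%R i)] < +oo.
Proof.
have cubeE := @lebesgue_rV_box R n (fun=> `[(- M)%R, M]%classic) (fun=> measurable_itv _).
suff side_fin : \prod_(i < n) leb `[(- M)%R, M]%classic \is a fin_num.
  by apply: (eq_ind_r (fun z => z < +oo) _ cubeE); rewrite ltey_eq side_fin.
apply: (big_ind (fun y : \bar R => y \is a fin_num)) => // [x y|i _]; first exact: fin_numM.
by rewrite lebesgue_measure_itv /=; case: ifP.
Qed.

Lemma lebesgue_rV_unique n (mu : {measure set 'rV[R]_n -> \bar R}) :
  (forall A : 'I_n -> set (measurableTypeR R), (forall i, measurable (A i)) ->
    mu [set x : 'rV[R]_n | forall i, A i (x 0%R i)] = \prod_i leb (A i)) ->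
  forall B, measurable B -> mu B = lebV n B.
Proof.
move=> muE B mB; apply/esym.
pose cube (k : nat) : set 'rV[R]_n :=
  [set x | forall i, (`[(- k%:R)%R, k%:R%R]%classic : set R) (x 0%R i)].
apply: (measure_unique (@boxes n) cube) => //.
- exact: measurable_boxes.
- move=> _ _ [A mA ->] [C mC ->]; exists (fun i => A i `&` C i).
    by move=> i; exact: measurableI.
  apply/seteqP; split => x /=; first by move=> [Ax Cx] i.
  by move=> ACx; split => i; have [] := ACx i.
- by move=> k; exists (fun=> `[(- k%:R)%R, k%:R%R]%classic) => // i; exact: measurable_itv.
- apply/seteqP; split => // x _.
  exists (Num.bound `|x|) => // i /=; rewrite in_itv /= -ler_norml.
  rewrite (le_trans (coord_le_norm _ _)) // ltW //.
  by have := archi_boundP (normr_ge0 x).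
- by move=> _ [A mA ->]; rewrite muE //; exact: lebesgue_rV_box.
- by move=> k; exact: lebesgue_rV_cube_lty.
Qed.

Lemma measurable_affine (s b : R) :
  measurable_fun [set: measurableTypeR R] (fun x : measurableTypeR R => s * x + b : measurableTypeR R)%R.
Proof.
by apply: measurable_funD => //; apply: measurable_funM.
Qed.

Lemma lebesgue_measure_affine (s b : R) (A : set (measurableTypeR R)) : s != 0%R -> measurable A ->
  leb A = `|s|%:E * leb ((fun x => s * x + b)%R @^-1` A).
Proof.
move=> s0 mA.
pose mu : {measure set (measurableTypeR R) -> \bar R} :=
  mscale (NngNum (normr_ge0 s)) (push_measure leb (measurable_affine s b)).
rewrite -[RHS]/(mu A).
apply: (@lebesgue_measure_unique R mu) => // X [[a c] _ <-] /=.
rewrite /mscale /= /pushforward.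
have [s_lt0|s_gt0|s00] := ltgtP s 0%R; last by rewrite s00 eqxx in s0.
- rewrite (_ : _ @^-1` _ = `[((c - b) / s)%R, ((a - b) / s)%R[%classic); last first.
    apply/seteqP; split => x /=; rewrite !in_itv /= => /andP[xa xc]; apply/andP; split.
    + by rewrite ler_ndivrMr // mulrC; lra.
    + by rewrite ltr_ndivlMr // mulrC; lra.
    + by move: xc; rewrite ltr_ndivlMr // mulrC; lra.
    + by move: xa; rewrite ler_ndivrMr // mulrC; lra.
  rewrite !lebesgue_measure_itv /= !lte_fin ltr_nM2r ?invr_lt0 // ltrD2r.
  case: ifPn => _; last by rewrite mule0.
  rewrite -!EFinD -EFinM ltr0_norm //; congr EFin.
  by field.
- rewrite (_ : _ @^-1` _ = `]((a - b) / s)%R, ((c - b) / s)%R]%classic); last first.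
    apply/seteqP; split => x /=; rewrite !in_itv /= => /andP[xa xc]; apply/andP; split.
    + by rewrite ltr_pdivrMr // mulrC; lra.
    + by rewrite ler_pdivlMr // mulrC; lra.
    + by move: xa; rewrite ltr_pdivrMr // mulrC; lra.
    + by move: xc; rewrite ler_pdivlMr // mulrC; lra.
  rewrite !lebesgue_measure_itv /= !lte_fin ltr_pM2r ?invr_gt0 // ltrD2r.
  case: ifPn => _; last by rewrite mule0.
  rewrite -!EFinD -EFinM gtr0_norm //; congr EFin.
  by field.
Qed.

Definition affine_rV n (s b : 'I_n -> R) (x : 'rV[R]_n) : 'rV[R]_n :=
  \row_i (s i * x 0%R i + b i)%R.

Lemma measurable_affine_rV n (s b : 'I_n -> R) : measurable_fun setT (affine_rV s b).
Proof.
apply: measurable_fun_rV => i; under eq_fun do rewrite mxE.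
exact: (measurableT_comp (measurable_affine (s i) (b i)) (measurable_rV_coord i)).
Qed.

Lemma lebesgue_rV_affine n (s b : 'I_n -> R) A : (forall i, s i != 0%R) -> measurable A ->
  lebV n A = (\prod_i `|s i|)%R%:E * lebV n (affine_rV s b @^-1` A).
Proof.
move=> s0 mA; apply/esym.
have P0 : (0 <= \prod_i `|s i|)%R by apply: prodr_ge0.
pose mu := mscale (NngNum P0) (push_measure (lebV n) (measurable_affine_rV s b)).
rewrite -[LHS]/(mu A); apply: lebesgue_rV_unique => // B mB.
rewrite /mu /= /mscale /= /pushforward.
rewrite (_ : _ @^-1` _ =
  [set x : 'rV[R]_n | forall i, ((fun t => s i * t + b i)%R @^-1` B i) (x 0%R i)]); last first.
  by apply/seteqP; split => x /= Bx i; have := Bx i; rewrite mxE.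
rewrite (@lebesgue_rV_box R n (fun i => (fun t => s i * t + b i)%R @^-1` B i)); last first.
  by move=> i; have := measurable_affine (s i) (b i) measurableT (mB i); rewrite setTI.
rewrite -prodEFin -big_split /=; apply: eq_bigr => i _.
by rewrite -(lebesgue_measure_affine (b i) (s0 i) (mB i)).
Qed.

Definition rV_insert n (i : 'I_n.+1) (z : 'rV[R]_n * measurableTypeR R) : 'rV[R]_n.+1 :=
  \row_j (if unlift i j is Some k then z.1 0%R k else z.2).

Lemma measurable_rV_insert n (i : 'I_n.+1) : measurable_fun setT (rV_insert i).
Proof.
apply: measurable_fun_rV => j; under eq_fun do rewrite mxE.
case: (unlift i j) => [k|]; last exact: measurable_snd.
exact: (measurableT_comp (measurable_rV_coord k) measurable_fst).
Qed.

Lemma transports_insert n (i : 'I_n.+1) :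
  transports (lebV n \x leb) (lebV n.+1) (rV_insert i).
Proof.
split; first exact: measurable_rV_insert.
move=> A mA; rewrite -[LHS]/(push_measure (lebV n \x leb) (measurable_rV_insert i) A).
apply: lebesgue_rV_unique => // B mB; rewrite /= /pushforward.
have mC : measurable [set v : 'rV[R]_n | forall k, B (lift i k) (v 0%R k)].
  exact: (@measurable_rV_box R n (fun k => B (lift i k))).
rewrite (_ : _ @^-1` _ = [set v : 'rV[R]_n | forall k, B (lift i k) (v 0%R k)] `*` B i); last first.
  apply/seteqP; split => -[v t] /=.
    move=> Bx; split => [k|]; [have := Bx (lift i k)|have := Bx i]; rewrite mxE ?liftK ?unlift_none //.
  move=> [Bv Bt] j; rewrite mxE; case: (unliftP i j) => [k ->|-> //]; exact: Bv.
have faceE : lebV n [set v : 'rV[R]_n | forall k, B (lift i k) (v 0%R k)] =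
    \prod_(k < n) leb (B (lift i k)).
  exact: (@lebesgue_rV_box R n (fun k => B (lift i k))).
rewrite product_measure1E // [X in X * _]faceE muleC.
by rewrite (bigD1_ord i).
Qed.

Lemma transports_row_mx n k :
  transports (lebV n \x lebV k) (lebV (n + k)) (fun z => row_mx z.1 z.2).
Proof.
have mF : measurable_fun [set: 'rV[R]_n * 'rV[R]_k] (fun z => row_mx z.1 z.2).
  by apply: measurable_row_mx; [exact: measurable_fst|exact: measurable_snd].
split => // A mA; rewrite -[LHS]/(push_measure (lebV n \x lebV k) mF A).
apply: lebesgue_rV_unique => // B mB; rewrite /= /pushforward.
have mB_left : measurable [set v : 'rV[R]_n | forall j, B (lshift k j) (v 0%R j)].
  exact: (@measurable_rV_box R n (fun j => B (lshift k j))).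
have mB_right : measurable [set v : 'rV[R]_k | forall j, B (rshift n j) (v 0%R j)].
  exact: (@measurable_rV_box R k (fun j => B (rshift n j))).
rewrite (_ : _ @^-1` _ = [set v : 'rV[R]_n | forall j, B (lshift k j) (v 0%R j)] `*`
     [set v : 'rV[R]_k | forall j, B (rshift n j) (v 0%R j)]); last first.
  apply/seteqP; split => -[v t] /=.
    move=> Bz; split => j; [have := Bz (lshift k j)|have := Bz (rshift n j)].
      by rewrite row_mxEl.
    by rewrite row_mxEr.
  by move=> [Bv Bt] j; case: (split_ordP j) => l ->; rewrite ?row_mxEl ?row_mxEr.
have left_boxE := @lebesgue_rV_box R n (fun j => B (lshift k j)) (fun j => mB _).
have right_boxE := @lebesgue_rV_box R k (fun j => B (rshift n j)) (fun j => mB _).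
by rewrite product_measure1E // [X in X * _]left_boxE [X in _ * X]right_boxE big_split_ord.
Qed.

Lemma transports_reindex m n (s : 'I_n -> 'I_m) :
  bijective s -> transports (lebV m) (lebV n) (fun x => \row_j x 0%R (s j)).
Proof.
move=> [t sK tK]; have mF : measurable_fun [set: 'rV[R]_m] (fun x => \row_j x 0%R (s j)).
  by apply: measurable_fun_rV => j; under eq_fun do rewrite mxE; exact: measurable_rV_coord.
split => // A mA; rewrite -[LHS]/(push_measure (lebV m) mF A).
apply: lebesgue_rV_unique => // B mB; rewrite /= /pushforward.
rewrite (_ : _ @^-1` _ = [set x : 'rV[R]_m | forall i, B (t i) (x 0%R i)]); last first.
  apply/seteqP; split => x /= Bx i; first by have := Bx (t i); rewrite mxE tK.
  by rewrite mxE; have := Bx (s i); rewrite sK.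
have boxE := @lebesgue_rV_box R m (fun i => B (t i)) (fun i => mB _).
rewrite [LHS]boxE (reindex s) /=; last by exists t => i _.
by apply: eq_bigr => j _; rewrite sK.
Qed.

Lemma transports_swap n k : transports (lebV (n + k)) (lebV (k + n))
  (fun z => row_mx (rsubmx z) (lsubmx z)).
Proof.
pose s a b (j : 'I_(a + b)) : 'I_(b + a) :=
  match fintype.split j with inl i => rshift b i | inr i => lshift a i end.
have sl a b i : s a b (lshift b i) = rshift b i by rewrite /s (unsplitK (inl i)).
have sr a b i : s a b (rshift a i) = lshift a i by rewrite /s (unsplitK (inr i)).
have sK a b : cancel (s a b) (s b a) by move=> j; case: (split_ordP j) => i ->; rewrite ?sl ?sr ?sl.
rewrite (_ : (fun z => _) = fun z : 'rV[R]_(n + k) => \row_j z 0%R (s k n j)); last first.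
  apply/funext => z; apply/rowP => j.
  by rewrite [RHS]mxE; case: (split_ordP j) => i ->; rewrite ?row_mxEl ?row_mxEr ?sl ?sr mxE.
by apply: transports_reindex; exists (s n k).
Qed.

Lemma transports_swap_middle n p q : transports (lebV (n + p + q)) (lebV (n + q + p))
  (fun v => row_mx (row_mx (lsubmx (lsubmx v)) (rsubmx v)) (rsubmx (lsubmx v))).
Proof.
pose s a b (j : 'I_(n + a + b)) : 'I_(n + b + a) := match fintype.split j with
  | inl i => match fintype.split i with inl h => lshift a (lshift b h) | inr h => rshift (n + b) h end
  | inr i => lshift a (rshift n i) end.
have sll a b i : s a b (lshift b (lshift a i)) = lshift a (lshift b i).
  by rewrite /s (unsplitK (inl _)) (unsplitK (inl _)).
have slr a b i : s a b (lshift b (rshift n i)) = rshift (n + b) i.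
  by rewrite /s (unsplitK (inl _)) (unsplitK (inr _)).
have sr a b i : s a b (rshift (n + a) i) = lshift a (rshift n i) by rewrite /s (unsplitK (inr _)).
have sK a b : cancel (s a b) (s b a).
  move=> j; case: (split_ordP j) => i ->; last by rewrite sr slr.
  by case: (split_ordP i) => h ->; rewrite ?sll // slr sr.
rewrite (_ : (fun v => _) = fun v : 'rV[R]_(n + p + q) => \row_j v 0%R (s q p j)); last first.
  apply/funext => v; apply/rowP => j; rewrite [RHS]mxE; case: (split_ordP j) => i ->.
    by case: (split_ordP i) => h ->; rewrite !row_mxEl ?row_mxEr ?sll ?slr !mxE.
  by rewrite row_mxEr sr !mxE.
by apply: transports_reindex; exists (s p q).
Qed.

Lemma shear_preserves n (i : 'I_n) (b : bool) (g : 'rV[R]_n -> R) (F : 'rV[R]_n -> 'rV[R]_n) :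
  measurable_fun setT g ->
  (forall x y : 'rV[R]_n, (forall j, j != i -> x 0%R j = y 0%R j) -> g x = g y) ->
  (forall (x : 'rV[R]_n) j, F x 0%R j = if j == i then ((-1) ^+ b * x 0%R i + g x)%R else x 0%R j) ->
  transports (lebV n) (lebV n) F.
Proof.
case: n i g F => [[]//|n] i g F mg gi FE.
have mF : measurable_fun setT F.
  apply: measurable_fun_rV => j; under eq_fun do rewrite FE.
  case: eqP => _; last exact: measurable_rV_coord.
  apply: measurable_funD => //; apply: measurable_funM => //.
  exact: measurable_rV_coord.
split => // A mA.
have [m_insert insertE] := transports_insert i.
have mFA : measurable (F @^-1` A) by rewrite -[X in measurable X]setTI; exact: mF.
have m_preinsert B : measurable B -> measurable (rV_insert i @^-1` B).
  by move=> mB; rewrite -[X in measurable X]setTI; exact: m_insert.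
rewrite -!insertE //; rewrite /product_measure1 /=.
apply: eq_integral => v _ /=.
pose h := g (rV_insert i (v, 0%R : measurableTypeR R)).
have m_section : measurable (xsection (rV_insert i @^-1` A) v) by apply: measurable_xsection;
  exact: m_preinsert.
have s0 : ((-1) ^+ b != 0 :> R)%R by rewrite signr_eq0.
rewrite [RHS](lebesgue_measure_affine h s0 m_section) normr_sign mul1e.
have F_insert t : F (rV_insert i (v, t)) = rV_insert i (v, ((-1) ^+ b * t + h)%R).
  apply/rowP => j; rewrite FE !mxE unlift_none.
  have -> : g (rV_insert i (v, t)) = h.
    by apply: gi => k ki; rewrite !mxE; case: unliftP ki => // ->; rewrite eqxx.
  by case: unliftP => [k ->|->]; rewrite ?eqxx // eq_sym (negbTE (neq_lift _ _)).
by congr (leb _); apply/seteqP; split => t; rewrite /xsection /= !inE /= F_insert.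
Qed.

(* Composing shears, the coordinates of largest weight are changed first. *)
Lemma triangular_preserves n (e : 'I_n -> nat) (b : 'I_n -> bool)
    (g : 'I_n -> 'rV[R]_n -> R) (F : 'rV[R]_n -> 'rV[R]_n) :
  (forall i, measurable_fun setT (g i)) ->
  (forall i (x y : 'rV[R]_n), (forall j, (e j < e i)%N -> x 0%R j = y 0%R j) -> g i x = g i y) ->
  (forall (x : 'rV[R]_n) i, F x 0%R i = ((-1) ^+ b i * x 0%R i + g i x)%R) ->
  transports (lebV n) (lebV n) F.
Proof.
move=> mg gi FE.
pose FA (A : {set 'I_n}) (x : 'rV[R]_n) : 'rV[R]_n := \row_i (if i \in A then F x 0%R i else x 0%R i).
suff partial_map_transports (A : {set 'I_n}) : (forall i j, i \in A -> (e i < e j)%N -> j \in A) ->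
  transports (lebV n) (lebV n) (FA A).
  have -> : F = FA (finset xpredT) by apply/funext => x; apply/rowP => i; rewrite mxE inE.
  by apply: partial_map_transports => i j _ _; rewrite inE.
have [k] := ubnP #|A|; elim: k A => // k IHk A; rewrite ltnS => Ak upA.
have [->|[i0 i0A]] := set_0Vmem A.
  have -> : FA finset.set0 = id by apply/funext => x; apply/rowP => i; rewrite mxE inE.
  by split; [exact: measurable_id|].
case: (arg_minnP e i0A) => i iA imin.
pose A' := A :\ i.
have A'E : FA A = (fun x => FA (finset (pred1 i)) x) \o FA A'.
  apply/funext => x; apply/rowP => j; rewrite !mxE inE.
  rewrite /= in_setD1; have [->|ji //] := eqVneq j i.
  have -> : i \in A by exact: iA.
  rewrite !FE mxE in_setD1 eqxx /=; congr (_ + _)%R.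
  apply: gi => l lt_li; rewrite mxE in_setD1.
  by case: ifP => // /andP[_ lA]; have := imin l lA; rewrite leqNgt lt_li.
rewrite A'E; apply: transports_comp.
  apply: IHk; first by rewrite (leq_trans _ Ak) // [X in (_ < X)%N](cardsD1 i) (iA : i \in A).
  move=> j l; rewrite !in_setD1 => /andP[ji jA] jl; rewrite (upA j l jA jl) andbT.
  by apply: contraTneq jl => ->; rewrite -leqNgt imin.
apply: (@shear_preserves n i (b i) (g i)).
- exact: mg.
- by move=> x y xy; apply: gi => j ji; apply: xy; apply: contraTneq ji => ->; rewrite ltnn.
- by move=> x j; rewrite mxE inE /=; case: eqP => [->|//]; rewrite FE.
Qed.

End lebesgue_rV_transport.

Definition Rintegrable {R : realType} d (T : measurableType d) (m : set T -> \bar R) (f : T -> R) : Prop :=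
  integrable m setT (EFin \o f).

Section Rintegrable_theory.
Context {R : realType} {d : measure_display} {T : measurableType d}
  (mu : {measure set T -> \bar R}).

Lemma Rintegrable_measurable (f : T -> R) : Rintegrable mu f -> measurable_fun setT f.
Proof. by case/integrableP => /measurable_EFinP. Qed.

Lemma Rintegrable_le (f g : T -> R) : measurable_fun setT f -> Rintegrable mu g ->
  (forall x, `|f x| <= g x) -> Rintegrable mu f.
Proof.
move=> mf ig fg; apply: (le_integrable measurableT _ _ ig); first exact/measurable_EFinP.
by move=> x _ /=; rewrite lee_fin (le_trans (fg x)) // ler_norm.
Qed.

Lemma RintegrableD (f g : T -> R) : Rintegrable mu f -> Rintegrable mu g ->
  Rintegrable mu (fun x => f x + g x).
Proof. by move=> int_f int_g; exact: (integrableD measurableT int_f int_g). Qed.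

Lemma RintegrableN (f : T -> R) : Rintegrable mu f -> Rintegrable mu (fun x => - f x).
Proof. by move=> int_f; exact: (integrableN int_f). Qed.

Lemma RintegrableB (f g : T -> R) : Rintegrable mu f -> Rintegrable mu g ->
  Rintegrable mu (fun x => f x - g x).
Proof. by move=> int_f int_g; exact: (RintegrableD int_f (RintegrableN int_g)). Qed.

Lemma RintegrableZ (c : R) (f : T -> R) : Rintegrable mu f -> Rintegrable mu (fun x => c * f x).
Proof. by move=> int_f; exact: (integrableZl measurableT _ int_f). Qed.

Lemma Rintegrable0 : Rintegrable mu (fun=> 0).
Proof. exact: integrable0. Qed.

Lemma Rintegrable_abs (f : T -> R) : Rintegrable mu f -> Rintegrable mu (fun x => `|f x|).
Proof.
move=> int_f; apply: (le_integrable measurableT _ _ int_f).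
  by apply/measurable_EFinP; apply: measurableT_comp => //; exact: Rintegrable_measurable.
by move=> x _ /=; rewrite normr_id.
Qed.

Lemma Rintegrable_sum (I : Type) (s : seq I) (P : pred I) (f : I -> T -> R) :
  (forall i, P i -> Rintegrable mu (f i)) -> Rintegrable mu (fun x => \sum_(i <- s | P i) f i x).
Proof.
move=> f_int; elim: s => [|i s IHs]; first by under eq_fun do rewrite big_nil; exact: Rintegrable0.
have [Pi|nPi] := boolP (P i); last by under eq_fun do rewrite big_cons (negbTE nPi).
by under eq_fun do rewrite big_cons Pi; apply: RintegrableD => //; exact: f_int.
Qed.

Lemma Rintegral_sum (I : Type) (s : seq I) (P : pred I) (f : I -> T -> R) :
  (forall i, P i -> Rintegrable mu (f i)) ->
  \int[mu]_x (\sum_(i <- s | P i) f i x) = \sum_(i <- s | P i) \int[mu]_x f i x.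
Proof.
move=> f_int; elim: s => [|i s IHs].
  by under eq_Rintegral do rewrite big_nil; rewrite big_nil /Rintegral integral0.
under eq_Rintegral do rewrite big_cons; rewrite big_cons; case: ifPn => // Pi.
by rewrite RintegralD // ?IHs //; [exact: f_int|exact: Rintegrable_sum].
Qed.

Lemma norm_Rintegral_le (f g : T -> R) : measurable_fun setT f -> Rintegrable mu g ->
  (forall x, `|f x| <= g x) -> `|\int[mu]_x f x| <= \int[mu]_x g x.
Proof.
move=> mf ig fg; have int_f := Rintegrable_le mf ig fg.
apply: le_trans (le_normr_Rintegral measurableT int_f) _.
by apply: le_Rintegral => //; exact: Rintegrable_abs.
Qed.

Lemma Rintegral_nonintegrable (f : T -> R) :
  measurable_fun setT f -> ~ Rintegrable mu f -> \int[mu]_x f x = 0.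
Proof.
move=> mf nf; rewrite /Rintegral.
have mf' : measurable_fun setT (EFin \o f) by exact/measurable_EFinP.
case: (boolP ((\int[mu]_x (f x)%:E)%E \is a fin_num)); last first.
  by case: (\int[mu]_x (f x)%:E)%E.
rewrite integralE fin_numB => /andP[f1 f2]; exfalso; apply: nf; apply/integrableP; split => //.
rewrite -[X in (\int[_]_x X x)%E]/(abse \o (EFin \o f)) fune_abse ge0_integralD //; last 2 first.
- exact: measurable_funepos.
- exact: measurable_funeneg.
by rewrite lte_add_pinfty // ltey_eq ?f1 ?f2.
Qed.

Lemma norm_Rintegral_le_abs (f : T -> R) :
  measurable_fun setT f -> `|\int[mu]_x f x| <= \int[mu]_x `|f x|.
Proof.
move=> mf; have [int_f|nf] := pselect (Rintegrable mu f).
  by apply: norm_Rintegral_le => //; exact: Rintegrable_abs.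
by rewrite (Rintegral_nonintegrable mf nf) normr0; apply: Rintegral_ge0.
Qed.

Lemma RintegralZl_measurable (c : R) (f : T -> R) :
  c != 0 -> measurable_fun setT f -> \int[mu]_x (c * f x) = c * \int[mu]_x f x.
Proof.
move=> c0 mf; have [int_f|nf] := pselect (Rintegrable mu f); first by rewrite RintegralZl.
rewrite (Rintegral_nonintegrable mf nf) mulr0; apply: Rintegral_nonintegrable.
  exact: measurable_funM.
move=> int_cf; apply: nf; have := RintegrableZ c^-1 int_cf.
by congr (Rintegrable mu _); apply/funext => x; rewrite mulKf.
Qed.

End Rintegrable_theory.

Section integrals_on_rV.
Context {R : realType}.
Local Notation lebV n := (@lebesgue_rV R n).

Lemma lebesgue_rV_compact_lty n (K : set 'rV[R]_n) : compact K -> (lebV n K < +oo)%E.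
Proof.
move=> cK; have [M M0 KM] := compact_norm_bound cK.
have mB := @measurable_rV_box R n (fun=> `[- M, M]%classic) (fun=> measurable_itv _).
apply: (@le_lt_trans _ _ (lebV n [set x : 'rV[R]_n | forall i, `[- M, M]%classic (x 0 i)])).
  apply: le_measure; rewrite ?inE //; first exact: compact_measurable_rV.
  move=> x /KM xM i /=; rewrite in_itv /= -ler_norml.
  exact: le_trans (coord_le_norm _ _) xM.
exact: lebesgue_rV_cube_lty.
Qed.

Lemma L1loc_mul_integrable n (v f : 'rV[R]_n -> R) (K : set 'rV[R]_n) (M : R) :
  L1loc v -> measurable_fun setT f -> compact K -> supported_in K f ->
  (forall x, `|f x| <= M) -> Rintegrable (lebV n) (fun x => v x * f x).
Proof.
move=> [mv vK] mf cK Kf fM; apply/integrableP; split.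
  by apply/measurable_EFinP; exact: measurable_funM.
have M0 : 0 <= M by apply: le_trans (fM 0).
have mK := compact_measurable_rV cK.
apply: (@le_lt_trans _ _ (\int[lebV n]_(x in K) (M%:E * `|v x|%:E))%E).
  rewrite [leRHS]integral_mkcond; apply: ge0_le_integral => //=.
  - by apply/measurable_EFinP; apply: measurableT_comp => //; exact: measurable_funM.
  - apply/(measurable_restrictT _ mK); apply: measurable_funS (measurableT) _ _ => //.
    apply: measurable_funeM; apply/measurable_EFinP; exact: measurableT_comp.
  - move=> x _; rewrite patchE; case: ifPn => [_|/negP xK].
      by rewrite -EFinM lee_fin normrM mulrC ler_wpM2r.
    by rewrite Kf ?mulr0 ?normr0 // => Kx; apply: xK; rewrite inE.
rewrite ge0_integralZl //; last first.
  apply: measurable_funS (measurableT) _ _ => //.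
  by apply/measurable_EFinP; exact: measurableT_comp.
by apply: lte_mul_pinfty; rewrite ?lee_fin //; exact: vK.
Qed.

Lemma L1loc_bounded n (f : 'rV[R]_n -> R) : measurable_fun setT f ->
  (forall K : set 'rV[R]_n, compact K -> exists M, forall x, K x -> `|f x| <= M) -> L1loc f.
Proof.
move=> mf fK; split => // K cK; have [M KM] := fK K cK.
have mK := compact_measurable_rV cK.
apply: (@le_lt_trans _ _ (\int[lebV n]_(x in K) `|M|%:E)%E).
  apply: ge0_le_integral => //.
  - apply: measurable_funS (measurableT) _ _ => //.
    by apply/measurable_EFinP; exact: measurableT_comp.
  - by move=> x Kx; rewrite lee_fin (le_trans (KM x Kx)) // ler_norm.
rewrite integral_cst //; apply: lte_mul_pinfty; rewrite ?lee_fin //.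
exact: lebesgue_rV_compact_lty.
Qed.

Lemma L1loc_continuous n (f : 'rV[R]_n -> R) : continuous f -> L1loc f.
Proof.
move=> cf; apply: L1loc_bounded; first exact: continuous_measurable_rV.
move=> K cK; have [M M0 KM] := compact_continuous_bound cK (fun x _ => cf x).
by exists M.
Qed.

Lemma bounded_supported_integrable n (f : 'rV[R]_n -> R) (K : set 'rV[R]_n) (M : R) :
  measurable_fun setT f -> compact K -> supported_in K f ->
  (forall x, `|f x| <= M) -> Rintegrable (lebV n) f.
Proof.
move=> mf cK Kf fM; have L1 : L1loc (fun _ : 'rV[R]_n => 1 : R).
  by apply: L1loc_continuous => x; exact: continuous_at_cst.
have := L1loc_mul_integrable L1 mf cK Kf fM.
by congr (Rintegrable _ _); apply/funext => x; rewrite mul1r.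
Qed.

Lemma L1loc_indic_mul n (v : 'rV[R]_n -> R) (K : set 'rV[R]_n) : L1loc v -> compact K ->
  Rintegrable (lebV n) (fun x => \1_K x * v x).
Proof.
move=> Lv cK; under eq_fun do rewrite mulrC.
apply: (@L1loc_mul_integrable _ _ _ K 1) => //.
- by apply: measurable_indic; exact: compact_measurable_rV.
- by move=> x nK; rewrite indicE memNset.
- by move=> x; rewrite indicE normr_nat lern1 leq_b1.
Qed.

Lemma Rintegrable_indic_compact n (K : set 'rV[R]_n) : compact K ->
  Rintegrable (lebV n) (\1_K : 'rV[R]_n -> R).
Proof.
move=> cK; have L1 : L1loc (fun _ : 'rV[R]_n => 1 : R).
  by apply: L1loc_continuous => x; exact: continuous_at_cst.
have := L1loc_indic_mul L1 cK.
by congr (Rintegrable _ _); apply/funext => x; rewrite mulr1.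
Qed.

Lemma L1loc_of_balls n (f : 'rV[R]_n -> R) : measurable_fun setT f ->
  (forall r, Rintegrable (lebV n) (fun x => \1_[set x : 'rV[R]_n | `|x| <= r] x * f x)) -> L1loc f.
Proof.
move=> mf int_f; split => // A cA; have [r r0 Ar] := compact_norm_bound cA.
have mA := compact_measurable_rV cA.
have /integrableP[mfr] := int_f r; apply: le_lt_trans.
rewrite integral_mkcond; apply: ge0_le_integral => //.
- by move=> x _; rewrite patchE; case: ifP => // _; rewrite lee_fin.
- apply: (measurable_restrictT (D := A) _ mA).1.
  by apply: measurable_funTS; apply/measurable_EFinP; apply: measurableT_comp.
- exact: measurableT_comp.
- move=> x _; rewrite patchE; case: ifPn => [/set_mem Ax|_] /=; last by rewrite lee_fin.
  by rewrite indicE mem_set ?mul1r //; exact: Ar.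
Qed.

Lemma L1loc_of_large_balls n (f : 'rV[R]_n -> R) : measurable_fun setT f ->
  (forall r, exists2 s : R, r <= s &
    Rintegrable (lebV n) (fun x => \1_[set x : 'rV[R]_n | `|x| <= s] x * f x)) ->
  L1loc f.
Proof.
move=> mf f_int; apply: L1loc_of_balls => // r; have [s rs int_s] := f_int r.
apply: Rintegrable_le (Rintegrable_abs int_s) _ => [|x].
  apply: measurable_funM => //; apply: measurable_indic; apply: compact_measurable_rV.
  exact: compact_closed_ball_rV.
rewrite !normrM ler_wpM2r // !indicE !normr_nat ler_nat.
by case: (boolP (x \in _)) => //; rewrite inE /= => xr; rewrite mem_set //= (le_trans xr).
Qed.

Lemma L1loc_ball n (v : 'rV[R]_n -> R) (r : R) : L1loc v ->
  Rintegrable (lebV n) (fun x => \1_[set x : 'rV[R]_n | `|x| <= r] x * v x).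
Proof. by move=> Lv; apply: L1loc_indic_mul => //; exact: compact_closed_ball_rV. Qed.

Lemma Rintegrable_indic_ball n (r : R) :
  Rintegrable (lebV n) (\1_[set x : 'rV[R]_n | `|x| <= r] : 'rV[R]_n -> R).
Proof. by apply: Rintegrable_indic_compact; exact: compact_closed_ball_rV. Qed.

Lemma L1loc_add n (a : R) (u v : 'rV[R]_n -> R) : L1loc u -> L1loc v -> L1loc (fun x => u x + a * v x).
Proof.
move=> Lu Lv; have [mu _] := Lu; have [mv _] := Lv; apply: L1loc_of_balls.
  by apply: measurable_funD => //; exact: measurable_funM.
move=> r; have := RintegrableD (L1loc_ball r Lu) (RintegrableZ a (L1loc_ball r Lv)).
by congr (Rintegrable _ _); apply/funext => x; rewrite mulrDr mulrCA.
Qed.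

Lemma supported_bound n (f : 'rV[R]_n -> R) (K : set 'rV[R]_n) : continuous f ->
  compact K -> supported_in K f -> exists2 M : R, 0 < M & forall x, `|f x| <= M.
Proof.
move=> cf cK Kf; have [M M0 KM] := compact_continuous_bound cK (fun x _ => cf x).
exists M => // x; have [/KM //|/Kf ->] := pselect (K x).
by rewrite normr0 ltW.
Qed.

Lemma supported_integrable n (f : 'rV[R]_n -> R) (K : set 'rV[R]_n) :
  continuous f -> compact K -> supported_in K f -> Rintegrable (lebV n) f.
Proof.
move=> cf cK Kf; have [M _ fM] := supported_bound cf cK Kf.
by apply: bounded_supported_integrable cK Kf fM; exact: continuous_measurable_rV.
Qed.

Lemma L1loc_test n (v phi : 'rV[R]_n -> R) : L1loc v -> test_fun setT phi ->
  Rintegrable (lebV n) (fun x => v x * phi x).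
Proof.
move=> Lv [sp [B [cB _ Bp]]]; have cp := smooth_continuous sp.
have [M M0 f_le] := supported_bound cp cB Bp.
exact: (L1loc_mul_integrable Lv (continuous_measurable_rV cp) cB Bp f_le).
Qed.

Lemma Rintegral_pairing_add n (a : R) (u v phi : 'rV[R]_n -> R) : L1loc u -> L1loc v -> test_fun setT phi ->
  \int[lebV n]_x ((u x + a * v x) * phi x) =
  \int[lebV n]_x (u x * phi x) + a * \int[lebV n]_x (v x * phi x).
Proof.
move=> Lu Lv tp; have int_u := L1loc_test Lu tp; have int_v := L1loc_test Lv tp.
rewrite -RintegralZl // -RintegralD //; last exact: RintegrableZ.
by apply: eq_Rintegral => x _; rewrite mulrDl mulrA.
Qed.

Lemma Rintegral_patch_test n (W : set 'rV[R]_n) (f phi : 'rV[R]_n -> R) : test_fun W phi ->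
  \int[lebV n]_x ((f \_ W) x * phi x) = \int[lebV n]_x (f x * phi x).
Proof.
move=> [_ [K [_ KW Kphi]]]; apply: eq_Rintegral => x _; rewrite patchE; case: ifPn => //.
by rewrite notin_setE => nWx; rewrite Kphi ?mulr0 // => /KW.
Qed.

Lemma test_fun_integrable n (phi : 'rV[R]_n -> R) : test_fun setT phi -> Rintegrable (lebV n) phi.
Proof.
by move=> [/smooth_continuous cphi [K [cK _ Kphi]]]; exact: supported_integrable cphi cK Kphi.
Qed.

Section product_Rintegral.
Context {d1 d2 : measure_display} {T1 : measurableType d1} {T2 : measurableType d2}
  (m1 : {sigma_finite_measure set T1 -> \bar R}) (m2 : {sigma_finite_measure set T2 -> \bar R}).
Variable f : T1 * T2 -> R.

Lemma measurable_Rintegral_snd : measurable_fun setT f ->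
  measurable_fun setT (fun x => \int[m2]_y f (x, y)).
Proof.
move=> mf; have mEf : measurable_fun setT (EFin \o f) by exact/measurable_EFinP.
rewrite /Rintegral.
apply: (measurableT_comp (fine_measurable measurableT)).
under eq_fun do rewrite integralE.
apply: emeasurable_funB.
  have := @measurable_fun_fubini_tonelli_F _ _ T1 T2 R m2 ((EFin \o f)^\+)%E (measurable_funepos mEf)
    (funepos_ge0 _).
  by apply: eq_measurable_fun => x _; apply: eq_integral => y _; rewrite !funeposE.
have := @measurable_fun_fubini_tonelli_F _ _ T1 T2 R m2 ((EFin \o f)^\-)%E (measurable_funeneg mEf)
  (funeneg_ge0 _).
by apply: eq_measurable_fun => x _; apply: eq_integral => y _; rewrite !funenegE.
Qed.

Hypothesis intf : Rintegrable (m1 \x m2)%E f.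

Let mEf : measurable_fun setT (EFin \o f).
Proof. by case/integrableP: intf. Qed.

Lemma Rintegral_prod_fst : \int[(m1 \x m2)%E]_z f z = \int[m1]_x \int[m2]_y f (x, y).
Proof.
rewrite /Rintegral -(integral12_prod_meas1 intf); congr fine.
apply: ae_eq_integral => //.
- exact: (measurable_fubini_F intf).
- apply/measurable_EFinP; apply: measurable_Rintegral_snd; exact/measurable_EFinP.
- have := ae_integrable1 intf; apply: filterS => x ix _.
  by rewrite /Rintegral fineK //; exact: integrable_fin_num ix.
Qed.

Lemma Rintegrable_prod_fst : Rintegrable m1 (fun x => \int[m2]_y f (x, y)).
Proof.
have := integrable_fubini_F intf.
move=> /integrableP[mF Foo]; apply/integrableP; split.
  by apply/measurable_EFinP; apply: measurable_Rintegral_snd; exact/measurable_EFinP.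
rewrite (ae_eq_integral (fun x => `|fubini_F m2 (EFin \o f) x|)%E) //.
- apply: measurableT_comp => //; apply/measurable_EFinP; apply: measurable_Rintegral_snd;
  exact/measurable_EFinP.
- exact: measurableT_comp.
- have := ae_integrable1 intf; apply: filterS => x ix _ /=.
  rewrite -abse_EFin /Rintegral fineK //; exact: integrable_fin_num ix.
Qed.

End product_Rintegral.

Lemma Rintegral_prod_snd {d1 d2 : measure_display} {T1 : measurableType d1} {T2 : measurableType d2}
  (m1 : {sigma_finite_measure set T1 -> \bar R}) (m2 : {sigma_finite_measure set T2 -> \bar R})
  (f : T1 * T2 -> R) : Rintegrable (m1 \x m2)%E f ->
  \int[(m1 \x m2)%E]_z f z = \int[m2]_y \int[m1]_x f (x, y).
Proof.
move=> intf; have mf : measurable_fun setT f by case/integrableP: intf => /measurable_EFinP.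
rewrite /Rintegral -(integral21_prod_meas1 intf); congr fine.
apply: ae_eq_integral => //.
- exact: (measurable_fubini_G intf).
- apply/measurable_EFinP.
  apply: (@measurable_Rintegral_snd _ _ T2 T1 m1 (fun z => f (z.2, z.1))).
  by apply: (measurableT_comp mf); apply: measurable_fun_pair;
    [exact: measurable_snd|exact: measurable_fst].
- have := ae_integrable2 intf; apply: filterS => x ix _.
  by rewrite /Rintegral fineK //; exact: integrable_fin_num ix.
Qed.

Section split_rV.
Variables n k : nat.

Lemma ge0_integral_row (f : 'rV[R]_(n + k) -> \bar R) : measurable_fun setT f ->
  (forall z, 0 <= f z)%E ->
  (\int[lebV (n + k)]_z f z = \int[lebV n]_x \int[lebV k]_y f (row_mx x y))%E.
Proof.
move=> mf f0; have tr := @transports_row_mx R n k.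
rewrite -(transports_ge0_integral tr mf f0) fubini_tonelli1 //.
by apply: (measurableT_comp mf); have [] := tr.
Qed.

Lemma measurable_ge0_integral_row (f : 'rV[R]_(n + k) -> \bar R) : measurable_fun setT f ->
  (forall z, 0 <= f z)%E -> measurable_fun setT (fun x : 'rV[R]_n => \int[lebV k]_y f (row_mx x y))%E.
Proof.
move=> mf f0; apply: (@measurable_fun_fubini_tonelli_F _ _ 'rV[R]_n 'rV[R]_k R (lebV k)
  (fun z => f (row_mx z.1 z.2))) => //.
by apply: (measurableT_comp mf); have [] := @transports_row_mx R n k.
Qed.

Variable f : 'rV[R]_(n + k) -> R.

Lemma measurable_Rintegral_row : measurable_fun setT f ->
  measurable_fun setT (fun x : 'rV[R]_n => \int[lebV k]_y f (row_mx x y)).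
Proof.
move=> mf; apply: (@measurable_Rintegral_snd _ _ 'rV[R]_n 'rV[R]_k (lebV k) (fun z => f (row_mx z.1 z.2))).
by apply: (measurableT_comp mf); have [] := @transports_row_mx R n k.
Qed.

Lemma Rintegrable_rowP : measurable_fun setT f ->
  Rintegrable (lebV (n + k)) f <->
  (\int[lebV n]_x \int[lebV k]_y `|f (row_mx x y)|%:E < +oo)%E.
Proof.
move=> mf; have mf' : measurable_fun setT (fun z => `|f z|%:E).
  by apply/measurable_EFinP; exact: measurableT_comp.
rewrite -(ge0_integral_row mf') //; split => [/integrableP[]//|fin_abs].
by apply/integrableP; split => //; exact/measurable_EFinP.
Qed.

Hypothesis intf : Rintegrable (lebV (n + k)) f.

Let mf : measurable_fun setT f.
Proof. by case/integrableP: intf => /measurable_EFinP. Qed.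

Let intf' : Rintegrable (lebV n \x lebV k)%E (fun z => f (row_mx z.1 z.2)).
Proof. exact/(transports_integrable (@transports_row_mx R n k) mf). Qed.

Lemma Rintegral_row : \int[lebV (n + k)]_z f z = \int[lebV n]_x \int[lebV k]_y f (row_mx x y).
Proof.
rewrite -(transports_Rintegral (@transports_row_mx R n k) mf).
exact: (Rintegral_prod_fst intf').
Qed.

Lemma Rintegral_row_swap : \int[lebV (n + k)]_z f z = \int[lebV k]_y \int[lebV n]_x f (row_mx x y).
Proof.
rewrite -(transports_Rintegral (@transports_row_mx R n k) mf).
exact: (Rintegral_prod_snd intf').
Qed.

Lemma Rintegrable_row : Rintegrable (lebV n) (fun x => \int[lebV k]_y f (row_mx x y)).
Proof. exact: (Rintegrable_prod_fst intf'). Qed.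

End split_rV.

Lemma transports_fiberwise n k (F : 'rV[R]_n -> 'rV[R]_k -> 'rV[R]_k) :
  measurable_fun setT (fun v : 'rV[R]_(n + k) => F (lsubmx v) (rsubmx v)) ->
  (forall x, transports (lebV k) (lebV k) (F x)) ->
  transports (lebV (n + k)) (lebV (n + k)) (fun v => row_mx (lsubmx v) (F (lsubmx v) (rsubmx v))).
Proof.
move=> mF F_preserves; set T := fun v => _.
have mT : measurable_fun setT T by apply: measurable_row_mx => //; exact: measurable_lsubmx.
split=> // A mA; have mTA : measurable (T @^-1` A) by rewrite -[_ @^-1` _]setTI; exact: mT.
have m_indic (B : set 'rV[R]_(n + k)) : measurable B -> measurable_fun setT (fun z => (\1_B z : R)%:E).
  by move=> mB; apply/measurable_EFinP; exact: measurable_indic.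
have slicesE B : measurable B -> lebV (n + k) B = (\int[lebV n]_x \int[lebV k]_y (\1_B (row_mx x y))%:E)%E.
  move=> mB; rewrite -(ge0_integral_row (m_indic B mB)) => [|z]; last by rewrite lee_fin.
  by rewrite integral_indic // setIT.
rewrite (slicesE _ mTA) (slicesE _ mA); apply: eq_integral => x _.
have m_slice : measurable_fun setT (fun y => (\1_A (row_mx x y) : R)%:E).
  by apply: (measurableT_comp (m_indic A mA)); apply: measurable_row_mx.
rewrite -(transports_ge0_integral (F_preserves x) m_slice) => [|y]; last by rewrite lee_fin.
apply: eq_integral => y _; rewrite !indicE /T; congr (_%:E); congr (nat_of_bool _)%:R.
by apply/idP/idP; rewrite !inE /= row_mxKl row_mxKr.
Qed.

Lemma Rintegrable_tensor n k (a : 'rV[R]_n -> R) (b : 'rV[R]_k -> R) :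
  Rintegrable (lebV n) a -> Rintegrable (lebV k) b ->
  Rintegrable (lebV (n + k)) (fun z => a (lsubmx z) * b (rsubmx z)).
Proof.
move=> int_a int_b; have ma := Rintegrable_measurable int_a; have mb := Rintegrable_measurable int_b.
apply/(@Rintegrable_rowP n k); first apply: measurable_funM.
- exact: (measurableT_comp ma (@measurable_lsubmx R n k)).
- exact: (measurableT_comp mb (@measurable_rsubmx R n k)).
have /integrableP[_ fb] := int_b; have /integrableP[_ fa] := int_a.
under eq_integral => x _.
  under eq_integral do rewrite row_mxKl row_mxKr normrM EFinM.
  rewrite ge0_integralZl //; last by apply/measurable_EFinP; apply: measurableT_comp.
  over.
rewrite ge0_integralZr //=; last 2 first.
- by apply/measurable_EFinP; apply: measurableT_comp.
- exact: integral_ge0.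
by rewrite lte_mul_pinfty ?integral_ge0 // ge0_fin_numE ?integral_ge0.
Qed.

Lemma Rintegrable_tensor_middle n p q (k : 'rV[R]_(n + q) -> R) (b : 'rV[R]_p -> R) :
  Rintegrable (lebV (n + q)) k -> Rintegrable (lebV p) b -> Rintegrable (lebV (n + p + q))
    (fun v => k (row_mx (lsubmx (lsubmx v)) (rsubmx v)) * b (rsubmx (lsubmx v))).
Proof.
move=> int_k int_b; have int_kb := Rintegrable_tensor int_k int_b.
have := (transports_integrable (@transports_swap_middle R n p q) (Rintegrable_measurable int_kb)).1 int_kb.
by congr (Rintegrable _ _); apply/funext => v /=; rewrite row_mxKl row_mxKr.
Qed.

Lemma L1loc_lsubmx n k (v : 'rV[R]_n -> R) : L1loc v ->
  L1loc (fun z : 'rV[R]_(n + k) => v (lsubmx z)).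
Proof.
move=> Lv; apply: L1loc_of_balls => [|r].
  exact: (measurableT_comp Lv.1 (@measurable_lsubmx R n k)).
apply: (Rintegrable_le _ (Rintegrable_tensor (Rintegrable_abs (L1loc_ball `|r| Lv))
  (Rintegrable_indic_ball k `|r|))).
  apply: measurable_funM; first exact: (Rintegrable_measurable (Rintegrable_indic_ball (n + k) r)).
  exact: (measurableT_comp Lv.1 (@measurable_lsubmx R n k)).
move=> z; rewrite [\1_[set z | `|z| <= r] z]indicE.
case: (boolP (z \in _)); rewrite ?mul0r ?normr0 ?mulr_ge0 ?indicE // mul1r inE /= => zr.
have : `|row_mx (lsubmx z) (rsubmx z)| <= `|r| by rewrite hsubmxK (le_trans zr) // ler_norm.
by rewrite norm_row_mx_le // => /andP[zl zr']; rewrite !mem_set // mulr1 mul1r.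
Qed.

Lemma L1loc_row n k (f : 'rV[R]_(n + k) -> R) : measurable_fun setT f ->
  (forall r, exists C : R, forall x : 'rV[R]_n, `|x| <= r ->
    Rintegrable (lebV k) (fun y => \1_[set y : 'rV[R]_k | `|y| <= r] y * f (row_mx x y)) /\
    \int[lebV k]_y `|\1_[set y : 'rV[R]_k | `|y| <= r] y * f (row_mx x y)| <= C) ->
  L1loc f.
Proof.
move=> mf slices; apply: L1loc_of_balls => // r; have [C sliceC] := slices `|r|.
pose Bk : set 'rV[R]_k := [set y | `|y| <= `|r|]; pose Bn : set 'rV[R]_n := [set x | `|x| <= `|r|].
pose Br : set 'rV[R]_(n + k) := [set z | `|z| <= r].
have mBr : measurable_fun setT (fun z => \1_Br z * f z).
  by apply: measurable_funM => //; exact: Rintegrable_measurable (Rintegrable_indic_ball (n + k) r).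
have mabs : measurable_fun setT (fun z => `|\1_Br z * f z|%:E).
  by apply/measurable_EFinP; exact: measurableT_comp.
have int_dom : Rintegrable (lebV n) (fun x => `|C| * \1_Bn x) by exact: RintegrableZ
  (Rintegrable_indic_ball n `|r|).
apply/Rintegrable_rowP => //.
have /integrableP[_] := Rintegrable_abs int_dom; apply: le_lt_trans; apply: ge0_le_integral => //.
- by move=> x _; exact: integral_ge0.
- exact: (measurable_ge0_integral_row mabs (fun z => normr_ge0 _)).
- by apply: measurableT_comp => //; apply/measurable_EFinP;
  exact: Rintegrable_measurable (Rintegrable_abs int_dom).
move=> x _; rewrite /= normr_id ger0_norm ?mulr_ge0 //.
have Br_sub y : Br (row_mx x y) -> Bn x /\ Bk y.
  move=> /le_trans /(_ (ler_norm r)); rewrite norm_row_mx_le // => /andP[]; by [].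
have [Bx|nBx] := pselect (Bn x); last first.
  rewrite integral0_eq ?lee_fin ?mulr_ge0 // => y _.
  by rewrite indicE memNset ?mul0r ?normr0 // => /Br_sub[].
have [int_x int_xC] := sliceC x Bx; rewrite indicE mem_set // mulr1.
apply: (@le_trans _ _ (\int[lebV k]_y `|\1_Bk y * f (row_mx x y)|%:E)%E); last first.
  rewrite -(fineK (integrable_fin_num measurableT (Rintegrable_abs int_x))) lee_fin.
  exact: le_trans int_xC (ler_norm C).
apply: ge0_le_integral => //.
- by apply: (measurableT_comp mabs); apply: measurable_row_mx.
- by apply/measurable_EFinP; exact: Rintegrable_measurable (Rintegrable_abs int_x).
move=> y _; rewrite lee_fin !normrM ler_wpM2r // !indicE !normr_nat ler_nat.
by case: (boolP (row_mx x y \in _)) => //; rewrite inE => /Br_sub[_ By]; rewrite mem_set.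
Qed.

Lemma preserves_translation n (b : 'rV[R]_n) : transports (lebV n) (lebV n) (fun x => x + b).
Proof.
have transE : (fun x : 'rV[R]_n => x + b) = affine_rV (fun=> 1) (fun i => b 0 i).
  by apply/funext => x; apply/rowP => i; rewrite !mxE mul1r.
split; first by rewrite transE; exact: measurable_affine_rV.
move=> A mA; rewrite transE [RHS](@lebesgue_rV_affine R n (fun=> 1) (fun i => b 0 i)) //.
by rewrite big1 ?mul1e // => i _; rewrite normr1.
Qed.

Lemma measurable_dilation n (e : 'I_n -> nat) (l : R) : measurable_fun setT (dilation e l).
Proof. by apply: continuous_map_measurable; apply: smooth_map_continuous; exact: smooth_dilation. Qed.

Lemma lebesgue_rV_dilation n (e : 'I_n -> nat) (l : R) A : 0 < l -> measurable A ->
  (lebV n A = (l ^+ (\sum_i e i)%N)%:E * lebV n (dilation e l @^-1` A))%E.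
Proof.
move=> l0 mA; rewrite [LHS](@lebesgue_rV_affine R n (fun i => l ^+ e i) (fun=> 0)) //; last first.
  by move=> i; rewrite lt0r_neq0 // exprn_gt0.
have -> : affine_rV (fun i => l ^+ e i) (fun=> 0) = dilation e l.
  by apply/funext => x; apply/rowP => i; rewrite !mxE addr0.
congr (_%:E * _)%E; rewrite expr_sum; apply: eq_bigr => i _.
by rewrite gtr0_norm // exprn_gt0.
Qed.

Lemma ge0_integral_dilation n (e : 'I_n -> nat) (l : R) (f : 'rV[R]_n -> \bar R) : 0 < l ->
  measurable_fun setT f -> (forall x, 0 <= f x)%E ->
  (\int[lebV n]_x f x = (l ^+ (\sum_i e i)%N)%:E * \int[lebV n]_x f (dilation e l x))%E.
Proof.
move=> l0 mf f0.
have L0 : 0 <= l ^+ (\sum_i e i)%N by rewrite exprn_ge0 // ltW.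
rewrite (@eq_measure_integral _ _ _ _
  (mscale (NngNum L0) (push_measure (lebV n) (measurable_dilation e l)))); last first.
  by move=> A mA _; exact: lebesgue_rV_dilation.
rewrite ge0_integral_mscale //; congr (_ * _)%E.
by rewrite (ge0_integral_pushforward (measurable_dilation e l)).
Qed.

Lemma Rintegrable_dilation n (e : 'I_n -> nat) (l : R) (f : 'rV[R]_n -> R) : 0 < l ->
  measurable_fun setT f -> Rintegrable (lebV n) (f \o dilation e l) <-> Rintegrable (lebV n) f.
Proof.
move=> l0 mf; have mfl : measurable_fun setT (f \o dilation e l).
  by apply: (measurableT_comp mf); exact: measurable_dilation.
have mabs : measurable_fun setT (fun x => `|f x|%:E).
  by apply/measurable_EFinP; exact: measurableT_comp.
have le0 : 0 < l ^+ (\sum_i e i)%N by rewrite exprn_gt0.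
have fin_absE : (\int[lebV n]_x `|f x|%:E < +oo)%E = (\int[lebV n]_x `|f (dilation e l x)|%:E < +oo)%E.
  rewrite (ge0_integral_dilation e l0 mabs) // !ltey.
  by case: (\int[lebV n]_x _)%E => //=; rewrite ?gt0_muley ?gt0_muleNy ?lte_fin.
split=> /integrableP[_ fin_abs]; apply/integrableP; split; try exact/measurable_EFinP.
  by move: fin_abs;
    rewrite [in X in X -> _](_ : (_ < _)%E = (\int[lebV n]_x `|f (dilation e l x)|%:E < +oo)%E) // -fin_absE.
by move: fin_abs; rewrite [in X in X -> _](_ : (_ < _)%E = (\int[lebV n]_x `|f x|%:E < +oo)%E) // fin_absE.
Qed.

Lemma Rintegral_dilation n (e : 'I_n -> nat) (l : R) (f : 'rV[R]_n -> R) : 0 < l ->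
  measurable_fun setT f ->
  \int[lebV n]_x f x = l ^+ (\sum_i e i)%N * \int[lebV n]_x f (dilation e l x).
Proof.
move=> l0 mf; have mfl : measurable_fun setT (f \o dilation e l).
  by apply: (measurableT_comp mf); exact: measurable_dilation.
have [intf|nintf] := pselect (Rintegrable (lebV n) f); last first.
  rewrite !Rintegral_nonintegrable ?mulr0 // => intfl.
  by apply: nintf; exact/(Rintegrable_dilation e l0).
have intfl := (Rintegrable_dilation e l0 mf).2 intf.
pose c := l ^+ (\sum_i e i)%N; rewrite -/c /Rintegral integralE [in RHS]integralE.
have funeposE_dil : (\int[lebV n]_x (EFin \o f)^\+ x =
    c%:E * \int[lebV n]_x (EFin \o (f \o dilation e l))^\+ x)%E.
  rewrite (ge0_integral_dilation e l0 (measurable_funepos _)) //; last exact/measurable_EFinP.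
  by congr (_ * _)%E; apply: eq_integral => x _; rewrite !funeposE.
have funenegE_dil : (\int[lebV n]_x (EFin \o f)^\- x =
    c%:E * \int[lebV n]_x (EFin \o (f \o dilation e l))^\- x)%E.
  rewrite (ge0_integral_dilation e l0 (measurable_funeneg _)) //; last exact/measurable_EFinP.
  by congr (_ * _)%E; apply: eq_integral => x _; rewrite !funenegE.
have pos_fin := integrable_pos_fin_num measurableT intfl.
have neg_fin := integrable_neg_fin_num measurableT intfl.
rewrite funeposE_dil funenegE_dil -muleBr //; last exact: fin_num_adde_defr.
by rewrite fineM // fin_numB pos_fin.
Qed.

End integrals_on_rV.

Section limits_and_integrals.
Context {R : realType} {d : measure_display} {T : measurableType d}
  (mu : {measure set T -> \bar R}).

Lemma Rdominated_cvg (f_ : nat -> T -> R) (f g : T -> R) :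
  (forall k, measurable_fun setT (f_ k)) ->
  (forall x, f_ k x @[k --> \oo] --> f x) -> Rintegrable mu g ->
  (forall k x, `|f_ k x| <= g x) ->
  Rintegrable mu f /\ \int[mu]_x f_ k x @[k --> \oo] --> \int[mu]_x f x.
Proof.
move=> mf_ f_f ig f_g.
have fg x : `|f x| <= g x by exact: (cvg_norm_le (f_f x) (f_g^~ x)).
have mf : measurable_fun setT f.
  exact: (measurable_fun_cvg mf_ (fun x _ => f_f x)).
have int_f : Rintegrable mu f by exact: Rintegrable_le ig fg.
split => //; apply: fine_cvg; rewrite fineK; last exact: (integrable_fin_num measurableT int_f).
apply: (@dominated_cvg _ _ _ mu setT measurableT (fun k x => (f_ k x)%:E) (EFin \o f) (EFin \o g)) => //.
- by move=> k; exact/measurable_EFinP.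
- by move=> x _; apply: cvg_EFin; [exact: nearW|exact: f_f].
- by move=> k x _; rewrite lee_fin.
Qed.

Lemma continuous_at_seq (U : normedModType R) (f : U -> R) (t0 : U) (r : R) : 0 < r ->
  (forall u : nat -> U, u @ \oo --> t0 -> (forall k, `|u k - t0| < r) ->
    f (u k) @[k --> \oo] --> f t0) ->
  {for t0, continuous f}.
Proof.
move=> r0 f_seq; apply/continuous_normP => e e0; apply: contrapT => no_delta.
have /choice[u u_far] : forall k : nat, exists y, `|y - t0| < Num.min r k.+1%:R^-1 /\ e < `|f y - f t0|.
  move=> k; apply: contrapT => no_y; apply: no_delta; exists (Num.min r k.+1%:R^-1).
    by rewrite lt_min r0 invr_gt0 ltr0n.
  by move=> y yd; rewrite leNgt; apply/negP => ef; apply: no_y; exists y.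
have u_t0 : u @ \oo --> t0.
  apply/cvgrPdist_lt => eps eps0; near=> k.
  rewrite distrC; have [+ _] := u_far k; rewrite lt_min => /andP[_ /lt_le_trans]; apply.
  near: k; have [k0 _ inv_lt] := near_infty_natSinv_lt (PosNum eps0).
  by exists k0 => // k /= k0k; apply: ltW; exact: inv_lt.
have u_r k : `|u k - t0| < r by have [+ _] := u_far k; rewrite lt_min => /andP[].
have /cvgrPdist_lt/(_ e e0)[k _ /(_ k (leqnn k))] := f_seq u u_t0 u_r.
by rewrite distrC => /(lt_trans (u_far k).2); rewrite ltxx.
Unshelve. all: by end_near. Qed.

Lemma continuous_Rintegral (U : normedModType R) (F : U -> T -> R) (t0 : U) (g : T -> R) (r : R) :
  0 < r -> (forall t, `|t - t0| < r -> measurable_fun setT (F t)) ->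
  (forall x, {for t0, continuous (F^~ x)}) -> Rintegrable mu g ->
  (forall t x, `|t - t0| < r -> `|F t x| <= g x) ->
  {for t0, continuous (fun t => \int[mu]_x F t x)}.
Proof.
move=> r0 mF cF ig Fg; apply: (continuous_at_seq r0) => u u_t0 u_r.
apply: (@Rdominated_cvg _ _ g _ _ ig _).2 => [k|x|k x]; [exact: mF| |exact: Fg].
exact: (cvg_comp _ _ u_t0 (cF x)).
Qed.

Lemma is_derive_Rintegral1 (f : R -> T -> R) (g : T -> R) (rho : R) : 0 < rho ->
  (forall h, `|h| < rho -> Rintegrable mu (f h)) ->
  (forall h x, `|h| < rho -> derivable (f^~ x) h 1) -> Rintegrable mu g ->
  (forall h x, `|h| < rho -> `|'D_1 (f^~ x) h| <= g x) ->
  is_derive (0 : R) 1 (fun h => \int[mu]_x f h x) (\int[mu]_x 'D_1 (f^~ x) 0).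
Proof.
move=> rho0 f_int f_der ig Dfg.
have itvP (h : R) : (`]- rho, rho[%classic : set R) h -> `|h| < rho by rewrite /= in_itv /= -ltr_norml.
have itv0 : (`]- rho, rho[%classic : set R) 0 by rewrite /= in_itv /= oppr_lt0 rho0.
have g0 x : 0 <= g x by apply: le_trans (Dfg 0 x _); rewrite ?normr0.
have quotient_cvg : h^-1 *: (\int[mu]_x f (h + 0) x - \int[mu]_x f 0 x)
    @[h --> 0^'] --> \int[mu]_y (partial1of2 f 0 y).
  apply: (@cvg_differentiation_under_integral R d T mu f setT measurableT 0 (- rho) rho itv0 _ _ g g0 ig).
  - by move=> h /itvP; exact: f_int.
  - by move=> h x /itvP hr _; exact: f_der.
  - by move=> h x /itvP hr _; rewrite partial1of2E; exact: Dfg.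
have quotientE : (fun h : R => h^-1 *:
  (((fun h : R => \int[mu]_x f h x) \o shift 0) (h *: 1) - \int[mu]_x f 0 x)) =
    (fun h : R => h^-1 *: (\int[mu]_x f (h + 0) x - \int[mu]_x f 0 x)).
  by apply/funext => h /=; rewrite [h%:A]mulr1.
have -> : \int[mu]_x 'D_1 (f^~ x) 0 = \int[mu]_y (partial1of2 f 0 y).
  by apply: eq_Rintegral => x _; rewrite partial1of2E.
by apply: is_derive_cvg; rewrite quotientE.
Qed.

Lemma is_derive_Rintegral (V : normedModType R) (F : V -> T -> R) (t0 v : V) (g : T -> R) (r : R) :
  0 < r -> (forall t, `|t - t0| < r -> Rintegrable mu (F t)) ->
  (forall t x, `|t - t0| < r -> derivable (F^~ x) t v) -> Rintegrable mu g ->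
  (forall t x, `|t - t0| < r -> `|'D_v (F^~ x) t| <= g x) ->
  is_derive t0 v (fun t => \int[mu]_x F t x) (\int[mu]_x 'D_v (F^~ x) t0).
Proof.
move=> r0 F_int F_der ig DFg.
have v0 : 0 < `|v| + 1 by rewrite ltr_wpDl.
have line_near (h : R) : `|h| < r / (`|v| + 1) -> `|(t0 + h *: v) - t0| < r.
  move=> hr; rewrite addrC addKr normrZ.
  apply: le_lt_trans (_ : `|h| * (`|v| + 1) < r); first by rewrite ler_wpM2l // lerDl.
  by rewrite -ltr_pdivlMr.
have lineE (h : R) x : `|h| < r / (`|v| + 1) ->
    is_derive h 1 (fun h => F (t0 + h *: v) x) ('D_v (F^~ x) (t0 + h *: v)).
  by move=> hr; apply: (@is_derive_line _ _ (F^~ x)); apply: F_der; exact: line_near.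
have rho0 : 0 < r / (`|v| + 1) by exact: divr_gt0.
apply: is_derive_of_line.
rewrite (_ : (fun h : R => _) = fun h : R => \int[mu]_x F (t0 + h *: v) x); last first.
  by apply/funext => h; rewrite addrC.
have -> : \int[mu]_x 'D_v (F^~ x) t0 = \int[mu]_x 'D_1 (fun h : R => F (t0 + h *: v) x) 0.
  by apply: eq_Rintegral => x _; rewrite (@derive_val _ _ _ _ _ _ _ (lineE 0 x _)) ?normr0 // scale0r addr0.
apply: (is_derive_Rintegral1 rho0 _ _ ig).
- by move=> h hr; apply: F_int; exact: line_near.
- by move=> h x hr; have [] := lineE h x hr.
- move=> h x hr; rewrite (@derive_val _ _ _ _ _ _ _ (lineE h x hr)).
  by apply: DFg; exact: line_near.
Qed.

End limits_and_integrals.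

Section integration_by_parts.
Context {R : realType}.
Local Notation lebV n := (@lebesgue_rV R n).
Implicit Types n m : nat.

Lemma Rintegrable_translation n (f : 'rV[R]_n -> R) (b : 'rV[R]_n) : Rintegrable (lebV n) f ->
  Rintegrable (lebV n) (fun x => f (x + b)).
Proof.
move=> intf; exact/(transports_integrable (preserves_translation b) (Rintegrable_measurable intf)).
Qed.

Lemma Rintegral_increment n (f : 'rV[R]_n -> R) (b : 'rV[R]_n) : Rintegrable (lebV n) f ->
  \int[lebV n]_x (f (x + b) - f x) = 0.
Proof.
move=> intf; rewrite RintegralB //; last exact: Rintegrable_translation.
by rewrite (transports_Rintegral (preserves_translation b) (Rintegrable_measurable intf)) subrr.
Qed.

Lemma difference_quotient_cvg (V : normedModType R) (f : V -> R) (x v : V) (h : nat -> R) :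
  derivable f x v -> h @ \oo --> (0 : R) -> (forall k, h k != 0) ->
  (h k)^-1 * (f (x + h k *: v) - f x) @[k --> \oo] --> 'D_v f x.
Proof.
move=> /cvgr_dnbhsP df h_cvg h_neq0.
have : (fun y : R => y^-1 *: ((f \o shift x) (y *: v) - f x)) (h k) @[k --> \oo] --> 'D_v f x by exact: df.
by apply: cvg_trans; apply: near_eq_cvg; apply: nearW => k /=; rewrite [x + _]addrC.
Qed.

Lemma difference_quotient_le n (i : 'I_n) (f : 'rV[R]_n -> R) (C M h : R) x : 0 < h <= 1 ->
  smooth f -> supported_in [set x | `|x| <= M] f -> (forall x, `|partial i f x| <= C) ->
  `|h^-1 * (f (x + h *: delta_mx 0 i) - f x)| <= C * \1_[set x : 'rV[R]_n | `|x| <= M + 1] x.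
Proof.
move=> /andP[h0 h1] sf Mf fC; rewrite indicE; case: (boolP (x \in _)) => [_|].
  rewrite mulr1 normrM normfV (gtr0_norm h0) ler_pdivrMl //.
  have [s _ ->] := @MVT_line _ _ f x (delta_mx 0 i) h (fun s _ => smooth_derivable sf).
  by rewrite normrM (gtr0_norm h0); apply: ler_wpM2l; [exact: ltW|exact: fC].
rewrite notin_setE /= => xM; rewrite mulr0 !Mf ?subrr ?mulr0 ?normr0 //= => xM'; apply: xM.
  by rewrite (le_trans xM') // lerDl.
rewrite -[x](addrK (h *: delta_mx 0 i)) (le_trans (ler_normB _ _)) // lerD //.
by rewrite normrZ gtr0_norm // -[leRHS]mulr1 ler_pM // ?norm_delta_le // ltW.
Qed.

(* By translation invariance the difference quotients of [f] have integral 0. *)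
Lemma integral_partial n (i : 'I_n) (f : 'rV[R]_n -> R) : test_fun setT f ->
  \int[lebV n]_x partial i f x = 0.
Proof.
move=> tf; have [sf [K [cK _ Kf]]] := tf; have intf := test_fun_integrable tf.
have [M M0 KM] := compact_norm_bound cK.
have Mf : supported_in [set x | `|x| <= M] f by move=> x xM; apply: Kf => /KM.
have spf : smooth (partial i f) by exact: smooth_on_partial.
have Kpf : supported_in K (partial i f) by apply: partial_supported => //; exact: compact_closed_normed.
have [C C0 fC] := supported_bound (smooth_continuous spf) cK Kpf.
pose h k : R := harmonic k; have h01 k : 0 < h k <= 1 by rewrite /h harmonic_gt0 /= invf_le1 // ler1n.
have h0 k : h k != 0 by rewrite lt0r_neq0 //; have /andP[] := h01 k.
pose quotient k x := (h k)^-1 * (f (x + h k *: delta_mx 0 i) - f x).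
have int_quotient k : Rintegrable (lebV n) (quotient k).
  by apply: RintegrableZ; apply: RintegrableB => //; exact: Rintegrable_translation.
have quotient0 k : \int[lebV n]_x quotient k x = 0.
  rewrite RintegralZl // ?Rintegral_increment ?mulr0 //.
  by apply: RintegrableB => //; exact: Rintegrable_translation.
have [||_] := @Rdominated_cvg _ _ _ (lebV n) quotient (partial i f)
    (fun x => C * \1_[set x : 'rV[R]_n | `|x| <= M + 1] x)
    (fun k => Rintegrable_measurable (int_quotient k)) _
    (RintegrableZ C (Rintegrable_indic_ball n (M + 1))).
- by move=> x; apply: difference_quotient_cvg => //; [exact: smooth_derivable sf|exact: cvg_harmonic].
- by move=> k x; exact: difference_quotient_le.
under eq_fun do rewrite quotient0.
by move=> lim_quotient; rewrite -(cvg_lim _ lim_quotient) // lim_cst.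
Qed.

Lemma integral_vfapp n (X : @vfield R n) (f : 'rV[R]_n -> R) : smooth_map X -> divergence_free X ->
  test_fun setT f -> \int[lebV n]_x vfapp X f x = 0.
Proof.
move=> sX divX tf; have [sf _] := tf.
have tXf i : test_fun setT (fun y => X y 0 i * f y) by exact: (test_funM (sX i) tf).
under eq_Rintegral do rewrite vfapp_divergence // divX mulr0 subr0.
rewrite Rintegral_sum => [|i _]; first by apply: big1 => i _; exact: integral_partial.
by apply: test_fun_integrable; exact: test_fun_partial.
Qed.

Lemma integral_vfapp_parts n (X : @vfield R n) (f g : 'rV[R]_n -> R) : smooth_map X ->
  divergence_free X -> smooth f -> test_fun setT g ->
  \int[lebV n]_x (vfapp X f x * g x) = - \int[lebV n]_x (f x * vfapp X g x).
Proof.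
move=> sX divX sf tg; have [sg _] := tg; apply/eqP; rewrite -addr_eq0 -RintegralD //; last 2 first.
- exact: (test_fun_integrable (test_funM (smooth_vfapp sX sf) tg)).
- exact: (test_fun_integrable (test_funM sf (test_fun_vfapp sX tg))).
rewrite -(integral_vfapp sX divX (test_funM sf tg)); apply/eqP; apply: eq_Rintegral => x _.
by rewrite (vfappM _ _ sf sg) addrC [g x * _]mulrC.
Qed.

Lemma integral_vf_word_parts n m (X : 'I_m -> @vfield R n) I (f g : 'rV[R]_n -> R) :
  (forall i, smooth_map (X i)) -> (forall i, divergence_free (X i)) ->
  smooth f -> test_fun setT g ->
  \int[lebV n]_x (vf_word X I f x * g x) =
  (-1) ^+ size I * \int[lebV n]_x (f x * vf_word X (rev I) g x).
Proof.
move=> sX divX sf; elim: I g => [|i I IHI] g tg; first by rewrite expr0 mul1r.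
rewrite /= (integral_vfapp_parts (sX i) (divX i) (smooth_vf_word sX I sf) tg).
rewrite IHI; last exact: test_fun_vfapp.
by rewrite rev_cons vf_word_rcons exprS mulN1r mulNr.
Qed.

Lemma Rintegral_hom_op n m (X : 'I_m -> @vfield R n) w nu c (f g : 'rV[R]_n -> R) :
  (forall I, Rintegrable (lebV n) (fun x => vf_word X I f x * g x)) ->
  \int[lebV n]_x (hom_op X w nu c f x * g x) =
  \sum_(k < nu.+1) \sum_(I : k.-tuple 'I_m | (\sum_(i <- I) w i == nu)%N)
    c I * \int[lebV n]_x (vf_word X I f x * g x).
Proof.
move=> int_word; rewrite /hom_op; under eq_Rintegral do rewrite mulr_suml.
have int_term (I : seq 'I_m) : Rintegrable (lebV n) (fun x => c I * vf_word X I f x * g x).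
  by under eq_fun do rewrite -mulrA; exact: RintegrableZ.
rewrite Rintegral_sum => [|k _]; last first.
  under eq_fun do rewrite mulr_suml.
  by apply: Rintegrable_sum => I _; exact: int_term.
apply: eq_bigr => k _; under eq_Rintegral do rewrite mulr_suml.
rewrite Rintegral_sum => [|I _]; last exact: int_term.
apply: eq_bigr => I _; rewrite -(RintegralZl (c I) measurableT (int_word I)).
by apply: eq_Rintegral => x _; rewrite mulrA.
Qed.

Lemma integral_hom_op_parts n m (X : 'I_m -> @vfield R n) w nu c (f g : 'rV[R]_n -> R) :
  (forall i, smooth_map (X i)) -> (forall i, divergence_free (X i)) ->
  smooth f -> test_fun setT g ->
  \int[lebV n]_x (hom_op X w nu c f x * g x) =
  \int[lebV n]_x (f x * hom_op X w nu (transpose_coef c) g x).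
Proof.
move=> sX divX sf tg; under [RHS]eq_Rintegral do rewrite mulrC.
have int_wordl I : Rintegrable (lebV n) (fun x => vf_word X I f x * g x).
  exact: (test_fun_integrable (test_funM (smooth_vf_word sX I sf) tg)).
have int_wordr I : Rintegrable (lebV n) (fun x => vf_word X I g x * f x).
  under eq_fun do rewrite mulrC.
  exact: (test_fun_integrable (test_funM sf (test_fun_vf_word I sX tg))).
rewrite !Rintegral_hom_op //; apply: eq_bigr => k _.
rewrite [RHS](reindex_inj (h := fun I : k.-tuple 'I_m => [tuple of rev I])) /=; last first.
  by move=> I J /(congr1 val) /= /(congr1 rev); rewrite !revK => /val_inj.
have sum_rev (I : seq 'I_m) : (\sum_(i <- rev I) w i = \sum_(i <- I) w i)%N.
  by apply: perm_big; rewrite perm_rev.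
apply: eq_big => [I|I _]; first by rewrite sum_rev.
rewrite integral_vf_word_parts // /transpose_coef size_rev revK mulrCA mulrA.
by congr (_ * _); apply: eq_Rintegral => x _; rewrite mulrC.
Qed.

End integration_by_parts.

Section fundamental_lemma.
Context {R : realType}.
Local Notation lebV n := (@lebesgue_rV R n).
Implicit Types n : nat.

Lemma lebesgue_ball_gt0 n (x0 : 'rV[R]_n) (r : R) : 0 < r ->
  (0 < lebV n [set x : 'rV[R]_n | (`|x - x0| < r)%R])%E.
Proof.
move=> r0; pose A (i : 'I_n) : set (measurableTypeR R) := `]x0 0 i - r, x0 0 i + r[%classic.
have -> : [set x : 'rV[R]_n | `|x - x0| < r] = [set x : 'rV[R]_n | forall i, A i (x 0 i)].
  apply/seteqP; split => x /=.
    move=> xr i; rewrite /A /= in_itv /= -ltr_distl; apply: le_lt_trans xr.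
    by have := coord_le_norm (x - x0) i; rewrite !mxE.
  move=> h; apply: norm_rV_lt => // i; rewrite !mxE ltr_distl.
  by have := h i; rewrite /A /= in_itv.
have mA i : measurable (A i) by exact: measurable_itv.
rewrite (lebesgue_rV_box mA); apply: (big_ind (fun y => (0 < y)%E)) => //.
  by move=> a b; exact: mule_gt0.
move=> i _; have -> : lebesgue_measure (A i) = (r + r)%:E.
  apply: (etrans (lebesgue_measure_itv _)); rewrite /= lte_fin.
  case: ifPn => h; last by exfalso; move/negP: h; apply; lra.
  by rewrite -EFinB; congr EFin; lra.
by rewrite lte_fin addr_gt0.
Qed.

(* [f] is irrelevant outside [W], but the product need not be measurable there
   unless the factor vanishes. *)
Lemma continuous_on_mul_integrable n (W : set 'rV[R]_n) (f phi : 'rV[R]_n -> R) K : open W ->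
  (forall x, W x -> {for x, continuous f}) ->
  continuous phi -> compact K -> K `<=` W -> supported_in K phi ->
  Rintegrable (lebV n) (fun x => f x * phi x).
Proof.
move=> oW cf cphi cK KW Kphi.
have restrictE : (fun x => f x * phi x) = (fun x => (f \_ W) x * phi x).
  apply/funext => x; rewrite patchE; case: ifPn => // /negP xW.
  by rewrite Kphi ?mulr0 // => /KW Wx; apply: xW; rewrite inE.
have [M M0 fM] := compact_continuous_bound cK (fun x Kx => cf x (KW x Kx)).
have [M' M'0 phiM] := supported_bound cphi cK Kphi.
rewrite restrictE; apply: (@bounded_supported_integrable _ _ _ K (M * M')) => //.
- apply: measurable_funM; first exact: measurable_restrict_open_rV.
  exact: continuous_measurable_rV.
- by move=> x /Kphi ->; rewrite mulr0.
- move=> x; case: (pselect (K x)) => [Kx|/Kphi ->]; last first.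
    by rewrite mulr0 normr0 mulr_ge0 // ltW.
  by rewrite normrM ler_pM // patchE ifT ?fM // inE; exact: KW.
Qed.

Lemma bump_integral_gt0 n (phi : 'rV[R]_n -> R) x0 (r : R) : 0 < r ->
  Rintegrable (lebV n) phi -> (forall x, 0 <= phi x) ->
  (forall x, `|x - x0| <= r -> phi x = 1) -> 0 < \int[lebV n]_x phi x.
Proof.
move=> r0 int_phi phi0 phi1; pose B : set 'rV[R]_n := [set x | `|x - x0| < r].
have mB : measurable B by exact: measurable_ball_rV.
have ball_le : (lebV n B <= \int[lebV n]_x (phi x)%:E)%E.
  rewrite -[leLHS]/(lebV n B) -(setIT B) -(integral_indic (lebV n) measurableT mB).
  apply: ge0_le_integral => //.
  - by apply/measurable_EFinP; exact: measurable_indic.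
  - by apply/measurable_EFinP; exact: (Rintegrable_measurable int_phi).
  - move=> x _; rewrite lee_fin indicE; case: (boolP (x \in B)) => //.
    by rewrite inE => /ltW /phi1 ->.
have := lt_le_trans (lebesgue_ball_gt0 x0 r0) ball_le.
by rewrite -(fineK (integrable_fin_num measurableT int_phi)) lte_fin.
Qed.

Lemma fundamental_lemma_le n (W : set 'rV[R]_n) (f : 'rV[R]_n -> R) (M : R) : open W ->
  (forall x, W x -> {for x, continuous f}) ->
  (forall phi, test_fun W phi -> (forall x, 0 <= phi x) ->
    \int[lebV n]_x (f x * phi x) <= M * \int[lebV n]_x phi x) ->
  forall x, W x -> f x <= M.
Proof.
move=> oW cf f_le x0 Wx0; rewrite leNgt; apply/negP => fM.
pose eps := (f x0 - M) / 2; have eps0 : 0 < eps by rewrite divr_gt0 // subr_gt0.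
have /continuous_normP/(_ _ eps0)[d d0 fd] := cf x0 Wx0.
have [r0 r0_gt0 ball_W] := nbhs_norm_lt (open_nbhs_nbhs (conj oW Wx0)).
pose r := Num.min d r0; have r_gt0 : 0 < r by rewrite lt_min d0 r0_gt0.
have rd : r <= d by rewrite ge_min lexx.
have [phi [tphi phi01 phi1 supp_phi]] : exists phi, [/\ test_fun W phi, (forall x, 0 <= phi x <= 1),
    (forall x, `|x - x0| <= r / 4 -> phi x = 1) & supported_in [set x | `|x - x0| <= r / 2] phi].
  by apply: ball_test_fun => // x; rewrite lt_min => /andP[_]; exact: ball_W.
have phi_ge0 x : 0 <= phi x by have /andP[] := phi01 x.
have int_phi := test_fun_integrable (test_fun_setT tphi).
have int_fphi : Rintegrable (lebV n) (fun x => f x * phi x).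
  have [sphi [K [cK KW Kphi]]] := tphi.
  exact: (continuous_on_mul_integrable oW cf (smooth_continuous sphi) cK KW Kphi).
have mass_gt0 : 0 < \int[lebV n]_x phi x.
  by apply: (@bump_integral_gt0 _ _ x0 (r / 4)) => //; lra.
have := f_le phi tphi phi_ge0; apply/negP; rewrite -ltNge.
apply: lt_le_trans (_ : (M + eps) * \int[lebV n]_x phi x <= _).
  by rewrite ltr_pM2r //; lra.
rewrite -RintegralZl //; apply: le_Rintegral => //; first exact: RintegrableZ.
move=> x _; case: (pselect (`|x - x0| <= r / 2)) => [xr|/supp_phi ->]; last by rewrite !mulr0.
rewrite ler_wpM2r //; have : `|f x - f x0| <= eps by apply: fd; lra.
by rewrite ler_norml /eps => /andP[]; lra.
Qed.

Lemma fundamental_lemma_norm_le n (W : set 'rV[R]_n) (f : 'rV[R]_n -> R) (M : R) : open W ->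
  (forall x, W x -> {for x, continuous f}) ->
  (forall phi, test_fun W phi -> (forall x, 0 <= phi x) ->
    `|\int[lebV n]_x (f x * phi x)| <= M * \int[lebV n]_x phi x) ->
  forall x, W x -> `|f x| <= M.
Proof.
move=> oW cf f_pairing x Wx; rewrite ler_norml; apply/andP; split; last first.
  apply: (fundamental_lemma_le oW cf _ Wx) => phi tphi phi_ge0.
  by apply: le_trans (f_pairing phi tphi phi_ge0); exact: ler_norm.
rewrite lerNl -mulN1r.
apply: (@fundamental_lemma_le _ W (fun x => -1 * f x) M oW _ _ x Wx).
  by move=> y Wy; apply: continuous_atM; [exact: continuous_at_cst|exact: cf].
move=> phi tphi phi_ge0; apply: le_trans (f_pairing phi tphi phi_ge0).
have int_fphi : Rintegrable (lebV n) (fun x => f x * phi x).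
  by case: (tphi) => sphi [K [cK KW Kphi]];
    apply: (continuous_on_mul_integrable oW cf (smooth_continuous sphi) cK KW Kphi).
under eq_Rintegral do rewrite -mulrA.
by rewrite RintegralZl // mulN1r -normrN ler_norm.
Qed.

Lemma fundamental_lemma n (W : set 'rV[R]_n) (f : 'rV[R]_n -> R) : open W ->
  (forall x, W x -> {for x, continuous f}) ->
  (forall phi, test_fun W phi -> \int[lebV n]_x (f x * phi x) = 0) ->
  forall x, W x -> f x = 0.
Proof.
move=> oW cf f_pairing x Wx; apply/normr0_eq0/eqP; rewrite eq_le normr_ge0 andbT.
by apply: (fundamental_lemma_norm_le oW cf _ Wx) => phi tphi phi_ge0; rewrite f_pairing // normr0 mul0r.
Qed.

Lemma fundamental_lemma_eq n (W : set 'rV[R]_n) (f g : 'rV[R]_n -> R) : open W ->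
  (forall x, W x -> {for x, continuous f}) -> (forall x, W x -> {for x, continuous g}) ->
  (forall phi, test_fun W phi -> \int[lebV n]_x (f x * phi x) = \int[lebV n]_x (g x * phi x)) ->
  forall x, W x -> f x = g x.
Proof.
move=> oW cf cg fgE x Wx; apply/eqP; rewrite -subr_eq0 -mulN1r; apply/eqP.
apply: (@fundamental_lemma _ W (fun y => f y + -1 * g y)) Wx => // [y Wy|phi tphi].
  apply: continuous_atD; first exact: cf.
  by apply: continuous_atM; [exact: continuous_at_cst|exact: cg].
have [sphi [K [cK KW Kphi]]] := tphi; have cphi := smooth_continuous sphi.
have int_f := continuous_on_mul_integrable oW cf cphi cK KW Kphi.
have int_g := continuous_on_mul_integrable oW cg cphi cK KW Kphi.
under eq_Rintegral do rewrite mulrDl mulN1r mulNr.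
by rewrite RintegralB // fgE // subrr.
Qed.

Definition open_box n (a b : 'I_n -> R) : set 'rV[R]_n := [set x | forall i, a i < x 0 i < b i].

Definition open_boxes n : set (set 'rV[R]_n) := [set B | exists a b, B = open_box a b].

Lemma open_box_margin n (a b : 'I_n -> R) (x : 'rV[R]_n) : open_box a b x ->
  exists2 d : R, 0 < d & forall i, d <= x 0 i - a i /\ d <= b i - x 0 i.
Proof.
move=> abx; pose d : R := \big[Num.min/1]_i Num.min (x 0 i - a i) (b i - x 0 i); exists d.
  apply: (big_ind (fun y : R => 0 < y)) => // [u v u0 v0|i _]; first by rewrite lt_min u0.
  by have /andP[ax xb] := abx i; rewrite lt_min !subr_gt0 ax.
move=> i; have : d <= Num.min (x 0 i - a i) (b i - x 0 i) by rewrite /d (bigD1 i) //= ge_min lexx.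
by rewrite le_min => /andP[].
Qed.

Lemma open_open_box n (a b : 'I_n -> R) : open (open_box a b).
Proof.
rewrite openE => x /= abx; have [d d0 margin] := open_box_margin abx.
apply: (norm_lt_nbhs d0) => y yd i; have [da db] := margin i.
have := le_lt_trans (coord_le_norm (y - x) i) yd; rewrite !mxE ltr_norml => /andP[lo hi].
by apply/andP; split; lra.
Qed.

Lemma open_box_setI n (a b a' b' : 'I_n -> R) : open_box a b `&` open_box a' b' =
  open_box (fun i => Num.max (a i) (a' i)) (fun i => Num.min (b i) (b' i)).
Proof.
apply/seteqP; split => x.
  by move=> [abx abx'] i; rewrite gt_max lt_min; have /andP[-> ->] := abx i; have /andP[-> ->] := abx' i.
move=> abx; split => i; have := abx i; rewrite gt_max lt_min => /andP[/andP[lo lo'] /andP[hi hi']].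
  by rewrite lo hi.
by rewrite lo' hi'.
Qed.

Lemma open_box_bounded n (a b : 'I_n -> R) : exists M, forall x, open_box a b x -> `|x| <= M.
Proof.
exists (\sum_i (`|a i| + `|b i|)) => x abx; apply: norm_rV_le => [|i].
  by apply: sumr_ge0 => i _; rewrite addr_ge0.
rewrite (bigD1 i) //=; apply: le_trans (_ : `|a i| + `|b i| <= _); last first.
  by rewrite lerDl; apply: sumr_ge0 => j _; rewrite addr_ge0.
have /andP[ax xb] := abx i; rewrite ler_norml.
have := ler_norm (b i); have := lerNnormlW (lexx `|a i|).
by have := normr_ge0 (a i); have := normr_ge0 (b i); lra.
Qed.

Lemma mem_open_cube n (x : 'rV[R]_n) : open_box (fun=> - (Num.bound `|x|)%:R) (fun=> (Num.bound `|x|)%:R) x.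
Proof.
move=> i; rewrite -ltr_norml; apply: le_lt_trans (coord_le_norm _ _) _; exact: archi_boundP.
Qed.

Lemma measurable_open_boxes n : @measurable _ 'rV[R]_n = <<s @open_boxes n >>.
Proof.
apply/seteqP; split => [A|]; last first.
  apply: smallest_sub; first exact: sigma_algebra_measurable.
  by move=> _ [a [b ->]]; apply: open_measurable_rV; exact: open_open_box.
move=> mA; apply: mA; split; first exact: smallest_sigma_algebra.
move=> {}A; rewrite -bigcup_seq => -[i _ [C mC <-]]; rewrite setTI.
have [s0 sC sU] := @smallest_sigma_algebra _ [set: 'rV[R]_n] (@open_boxes n).
pose S : set (set R) := [set D | <<s @open_boxes n >> ((fun x : 'rV[R]_n => x 0 i) @^-1` D)].
suff : S C by [].
move: mC; rewrite RGenOpens.measurableE; apply.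
split.
  split => [|D|F]; rewrite /S /=.
  - by rewrite preimage_set0.
  - by move=> /sC; rewrite !setTD -preimage_setC.
  - by move=> SF; rewrite preimage_bigcup; exact: sU.
move=> _ [a [b ->]]; rewrite /S /=.
pose lo k (j : 'I_n) := if j == i then a else - k%:R.
pose hi k (j : 'I_n) := if j == i then b else k%:R.
have -> : (fun x : 'rV[R]_n => x 0 i) @^-1` `]a, b[%classic = \bigcup_(k : nat) open_box (lo k) (hi k).
  apply/seteqP; split => x /=.
    rewrite in_itv /= => xi; exists (Num.bound `|x|) => // j; rewrite /lo /hi.
    by case: eqP => [->//|_]; exact: mem_open_cube.
  by move=> [k _ /(_ i)]; rewrite /lo /hi eqxx in_itv.
by apply: sU => k; apply: sub_gen_smallest; exists (lo k), (hi k).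
Qed.

Lemma box_cutoff_cvg n (a b : 'I_n -> R) (x : 'rV[R]_n) :
  box_cutoff k%:R a b x @[k --> \oo] --> (\1_(open_box a b) x : R).
Proof.
rewrite indicE; case: (boolP (x \in _)); rewrite ?inE ?notin_setE => abx; last first.
  rewrite (_ : (fun k : nat => _) = cst 0); first exact: cvg_cst.
  by apply/funext => k; rewrite box_cutoff_eq0.
have [d d0 margin] := open_box_margin abx.
apply: cvg_near_cst; near=> k; rewrite box_cutoff_eq1 // => i.
have kd : 1 <= k%:R * d.
  by rewrite -ler_pdivrMr // mul1r; near: k; exact: nbhs_infty_ger.
by have [da db] := margin i; split; apply: le_trans kd _; rewrite ler_wpM2l.
Unshelve. all: by end_near. Qed.

Lemma integral_open_box n (f : 'rV[R]_n -> R) (a b : 'I_n -> R) : L1loc f ->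
  (forall phi, test_fun setT phi -> \int[lebV n]_x (f x * phi x) = 0) ->
  Rintegrable (lebV n) (fun x => f x * \1_(open_box a b) x) /\
  \int[lebV n]_x (f x * \1_(open_box a b) x) = 0.
Proof.
move=> Lf f_null; have [M abM] := open_box_bounded a b.
have cM := @compact_closed_ball_rV R n M.
pose cutoff (k : nat) := @box_cutoff R n k%:R a b.
have supp_cutoff k : supported_in [set x : 'rV[R]_n | `|x| <= M] (cutoff k).
  by move=> x /= xM; apply: box_cutoff_eq0 => // abx; apply: xM; exact: abM.
have scutoff k : smooth (cutoff k) by exact: smooth_box_cutoff.
have [k|x||k x|int_box lim_box] := @Rdominated_cvg _ _ _ (lebV n) (fun k x => f x * cutoff k x)
    (fun x => f x * \1_(open_box a b) x) (fun x => `|\1_[set x : 'rV[R]_n | `|x| <= M] x * f x|).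
- apply: measurable_funM; first exact: Lf.1.
  by apply: continuous_measurable_rV; exact: smooth_continuous.
- by apply: cvgMl_tmp; exact: box_cutoff_cvg.
- by apply: Rintegrable_abs; exact: L1loc_ball.
- rewrite mulrC !normrM ler_wpM2r // indicE; case: (boolP (x \in _)); last first.
    by rewrite notin_setE => /supp_cutoff ->; rewrite normr0.
  by rewrite normr1 ger0_norm ?box_cutoff_ge0 ?box_cutoff_le1.
split=> //; rewrite -(cvg_lim _ lim_box) //.
rewrite (_ : (fun k : nat => _) = cst 0) ?lim_cst //.
apply/funext => k; apply: f_null; split => //.
by exists [set x : 'rV[R]_n | `|x| <= M]; split.
Qed.

Lemma open_boxes_ae_eq0 n (f : 'rV[R]_n -> R) : Rintegrable (lebV n) f -> \int[lebV n]_x f x = 0 ->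
  (forall a b, \int[lebV n]_x (f x * \1_(open_box a b) x) = 0) ->
  {ae lebV n, forall x, f x = 0}.
Proof.
move=> int_f int0 box0; have mf : measurable_fun setT (EFin \o f) by case/integrableP: int_f.
have int0E : (\int[lebV n]_x (EFin \o f) x = 0)%E.
  by rewrite -(fineK (integrable_fin_num measurableT int_f)); congr EFin.
suff null A : measurable A -> (\int[lebV n]_(x in A) (EFin \o f) x = 0)%E.
  have : ae_eq (lebV n) setT (EFin \o f) (cst 0%E).
    by apply: integral_ae_eq => // A _ mA; rewrite null // integral0.
  by apply: filterS => x /(_ Logic.I) [].
move=> mA; have := mA; rewrite measurable_open_boxes.
apply: (@dynkin_induction _ _ _ (fun A => \int[lebV n]_(x in A) (EFin \o f) x = 0)%E
  (@measurable_open_boxes n)) => //.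
- move=> _ _ [a [b ->]] [a' [b' ->]]; rewrite open_box_setI.
  by eexists; eexists.
- move=> _ [a [b ->]] /=; have mab := open_measurable_rV (@open_open_box n a b).
  rewrite integral_mkcond (_ : _ \_ _ = fun x => (f x * \1_(open_box a b) x)%:E); last first.
    by apply/funext => x; rewrite patchE indicE; case: (x \in _); rewrite ?mulr1 ?mulr0.
  rewrite -(fineK (integrable_fin_num measurableT (_ : (lebV n).-integrable setT _))); last first.
    have := integrableS measurableT mab (@subsetT _ _) int_f.
    move/(integrable_mkcond _ mab); congr integrable; apply/funext => x.
    by rewrite patchE indicE; case: (x \in _); rewrite /= ?mulr1 ?mulr0.
  by congr EFin; exact: box0.
- move=> S mS null_S; have := integral_setU (lebV n) mS (measurableC mS) (measurable_funTS mf).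
  rewrite setUCr int0E null_S add0e => -> //.
  by apply/disj_setPS; rewrite setICr.
- move=> G mG tG null_G; rewrite integral_bigcup //; first by apply: eseries0 => i _ _; exact: null_G.
  by apply: (integrableS measurableT _ _ int_f) => //; exact: bigcup_measurable.
Qed.

Lemma fundamental_lemma_ae n (f : 'rV[R]_n -> R) : L1loc f ->
  (forall phi, test_fun setT phi -> \int[lebV n]_x (f x * phi x) = 0) ->
  {ae lebV n, forall x, f x = 0}.
Proof.
move=> Lf f_null; pose cube (k : nat) := open_box (fun _ : 'I_n => - k%:R : R) (fun=> k%:R).
suff cube_null (k : nat) : {ae lebV n, forall x, f x * \1_(cube k) x = 0}.
  apply: filterS (ae_foralln cube_null) => x /(_ (Num.bound `|x|)).
  by rewrite indicE mem_set ?mulr1 //; exact: mem_open_cube.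
have [int_cube int_cube0] := integral_open_box (fun=> - k%:R) (fun=> k%:R) Lf f_null.
apply: open_boxes_ae_eq0 => // a b.
under eq_Rintegral do rewrite -mulrA -[X in _ * X]/((\1__ \* \1__) _) -indicI open_box_setI.
exact: (integral_open_box _ _ Lf f_null).2.
Qed.

End fundamental_lemma.
(** * Homogeneity *)

Section homogeneous_functions.
Context {R : realType}.
Local Notation lebV n := (@lebesgue_rV R n).
Implicit Types n : nat.

Lemma derive_sum_partial n (g : 'rV[R]_n -> R) (x v : 'rV[R]_n) : smooth g ->
  is_derive x v g (\sum_j partial j g x * v 0 j).
Proof.
move=> sg; have C1g : C1_at g x by exact: (smooth_on_C1 openT sg).
have coordD j := is_derive_coord j x v.
have := @chain_rule R 'rV[R]_n n id x v (fun j => @ex_derive _ _ _ _ _ _ _ (coordD j)) g C1g.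
move/is_derive_eq; apply; apply: eq_bigr => j _; congr (_ * _).
exact: (@derive_val _ _ _ _ _ _ _ (coordD j)).
Qed.

Lemma zero_partials_eq n (g : 'rV[R]_n -> R) (P : pred 'I_n) (x y : 'rV[R]_n) : smooth g ->
  (forall j z, P j -> partial j g z = 0) -> (forall j, ~~ P j -> x 0 j = y 0 j) -> g x = g y.
Proof.
move=> sg g0 xy.
have dg (z : 'rV[R]_n) := derive_sum_partial z (y - x) sg.
have [s _] := @MVT_line R 'rV[R]_n g x (y - x) 1 (fun s _ => @ex_derive _ _ _ _ _ _ _ (dg _)).
rewrite scale1r [x + (y - x)]addrC subrK (@derive_val _ _ _ _ _ _ _ (dg _)) mul1r big1 => [|j _].
  by move/eqP; rewrite subr_eq0 => /eqP.
have [Pj|Pj] := boolP (P j); first by rewrite g0 // mul0r.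
by rewrite !mxE xy // subrr mulr0.
Qed.

Lemma norm_dilation_le n (e : 'I_n -> nat) (l : R) (x : 'rV[R]_n) : (forall i, 0 < e i)%N ->
  0 <= l <= 1 -> `|dilation e l x| <= l * `|x|.
Proof.
move=> e0 /andP[l0 l1]; apply: norm_rV_le; first by rewrite mulr_ge0.
move=> i; rewrite dilation_coord normrM ler_pM // ?coord_le_norm //.
rewrite ger0_norm ?exprn_ge0 //; case: (e i) (e0 i) => // k _.
by rewrite exprS -[leRHS]mulr1 ler_wpM2l // exprn_ile1.
Qed.

Section homogeneous.
Variables (n : nat) (e : 'I_n -> nat) (g : 'rV[R]_n -> R) (a b : nat).
Hypothesis e0 : forall i, (0 < e i)%N.
Hypothesis hom : forall (l : R) x, 0 < l -> l ^+ a * g x = l ^+ b * g (dilation e l x).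

Lemma homogeneous_neg_eq0 x : continuous g -> (a < b)%N -> g x = 0.
Proof.
move=> cg ab.
have [M M0 gM] := compact_continuous_bound (@compact_closed_ball_rV R n `|x|) (fun y _ => cg y).
have g_le (l : R) : 0 < l -> l <= 1 -> `|g x| <= l * M.
  move=> l0 l1.
  have -> : g x = l ^+ (b - a) * g (dilation e l x).
    apply: (@mulfI _ (l ^+ a)); first by rewrite expf_neq0 // gt_eqF.
    by rewrite mulrA -exprD subnKC ?(ltnW ab) // hom.
  rewrite normrM normrX gtr0_norm // ler_pM ?exprn_ge0 ?(ltW l0) //; last first.
    apply: gM => /=; apply: le_trans (norm_dilation_le x e0 _) _; first by rewrite (ltW l0).
    by rewrite -[leRHS]mul1r ler_wpM2r.
  have := ab; rewrite -subn_gt0; case: (b - a)%N => // k _.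
  by rewrite exprS -[leRHS]mulr1 ler_wpM2l ?(ltW l0) // exprn_ile1 // ltW.
apply/normr0_eq0/eqP; rewrite eq_le normr_ge0 andbT leNgt; apply/negP => gx.
have := g_le (Num.min 1 (`|g x| / (2 * M))).
rewrite lt_min ltr01 divr_gt0 ?mulr_gt0 //= ge_min lexx => /(_ isT isT).
apply/negP; rewrite -ltNge.
apply: le_lt_trans (_ : `|g x| / (2 * M) * M < _).
  by rewrite ler_wpM2r ?(ltW M0) // ge_min lexx orbT.
by rewrite invfM mulrA mulfVK ?gt_eqF //; lra.
Qed.

Lemma homogeneous_zero_const x : continuous g -> a = b -> g x = g 0.
Proof.
move=> cg ab; apply/eqP; rewrite -subr_eq0; apply/eqP/normr0_eq0/eqP.
rewrite eq_le normr_ge0 andbT leNgt; apply/negP => gx.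
have /continuous_normP/(_ (`|g x - g 0| / 2))[] := cg 0; first by rewrite divr_gt0.
move=> d d0 /(_ (dilation e (Num.min 1 (d / (2 * (`|x| + 1)))) x)).
set l := Num.min _ _.
have x1 : 0 < `|x| + 1 by rewrite ltr_wpDl.
have l0 : 0 < l by rewrite lt_min ltr01 divr_gt0 ?mulr_gt0.
have l1 : l <= 1 by rewrite ge_min lexx.
have <- : g x = g (dilation e l x).
  by apply: (@mulfI _ (l ^+ a)); [rewrite expf_neq0 // gt_eqF|rewrite hom // ab].
move=> near0; have : `|g x - g 0| <= `|g x - g 0| / 2.
  apply: near0; rewrite subr0; apply: le_lt_trans (norm_dilation_le x e0 _) _; first by rewrite (ltW l0).
  apply: le_lt_trans (_ : d / (2 * (`|x| + 1)) * (`|x| + 1) < d).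
    by apply: ler_pM => //; rewrite ?(ltW l0) // ?ge_min ?lexx ?orbT // lerDl.
  by rewrite invfM mulrA mulfVK ?gt_eqF //; lra.
by apply/negP; rewrite -ltNge; move: gx; rewrite normr_gt0 -normr_gt0; lra.
Qed.

Lemma homogeneous_partial k (l : R) x : smooth g -> 0 < l ->
  l ^+ a * partial k g x = l ^+ (b + e k) * partial k g (dilation e l x).
Proof.
move=> sg l0.
have sgl := smooth_comp sg (smooth_dilation e l).
rewrite -(partialZ (l ^+ a) (smooth_derivable sg)).
rewrite (_ : (fun y => l ^+ a * g y) = fun y => l ^+ b * (g \o dilation e l) y); last first.
  by apply/funext => y; rewrite hom.
rewrite (partialZ (l ^+ b) (smooth_derivable sgl)).
by rewrite (partial_dilation e l k x sg) mulrA -exprD.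
Qed.

End homogeneous.

Lemma homogeneous_partial_eq0 n (e : 'I_n -> nat) (g : 'rV[R]_n -> R) a b k x :
  (forall i, 0 < e i)%N ->
  (forall (l : R) x, 0 < l -> l ^+ a * g x = l ^+ b * g (dilation e l x)) ->
  smooth g -> (a < b + e k)%N -> partial k g x = 0.
Proof.
move=> e0 hom sg ab; apply: (@homogeneous_neg_eq0 n e _ a (b + e k) e0) => //.
  by move=> l y l0; exact: homogeneous_partial.
exact: (smooth_continuous (smooth_on_partial k sg)).
Qed.

Lemma vf_coef_homogeneous n (e : 'I_n -> nat) (X : @vfield R n) d i (l : R) x :
  vf_homogeneous e X d -> 0 < l ->
  l ^+ e i * X x 0 i = l ^+ d * X (dilation e l x) 0 i.
Proof.
move=> hX l0; have sc : smooth (fun y : 'rV[R]_n => y 0 i) by exact: (smooth_on_coord i openT).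
have := hX l _ l0 sc x; rewrite !vfapp_coord => <-.
rewrite (_ : _ \o _ = (fun y : 'rV[R]_n => l ^+ e i * y 0 i)); last first.
  by apply/funext => y /=; rewrite dilation_coord.
by rewrite (vfappZ _ _ _ sc) vfapp_coord.
Qed.

Lemma homogeneous_divergence_free n (e : 'I_n -> nat) (X : @vfield R n) d :
  (forall i, 0 < e i)%N -> (0 < d)%N -> smooth_map X -> vf_homogeneous e X d -> divergence_free X.
Proof.
move=> e0 d0 sX hX x; apply: big1 => i _.
apply: (homogeneous_partial_eq0 x e0 _ (sX i)) => [l y l0|]; first exact: (vf_coef_homogeneous _ _ hX l0).
by rewrite -[ltnLHS]add0n ltn_add2r.
Qed.

Lemma cat_exp_lshift k n (e1 : 'I_k -> nat) (e2 : 'I_n -> nat) i : cat_exp e1 e2 (lshift n i) = e1 i.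
Proof. by rewrite /cat_exp (unsplitK (inl i)). Qed.

Lemma cat_exp_rshift k n (e1 : 'I_k -> nat) (e2 : 'I_n -> nat) i : cat_exp e1 e2 (rshift k i) = e2 i.
Proof. by rewrite /cat_exp (unsplitK (inr i)). Qed.

Lemma cat_exp_gt0 k n (e1 : 'I_k -> nat) (e2 : 'I_n -> nat) :
  (forall i, 0 < e1 i)%N -> (forall i, 0 < e2 i)%N -> forall i, (0 < cat_exp e1 e2 i)%N.
Proof. by move=> e10 e20 i; rewrite /cat_exp; case: fintype.split. Qed.

Lemma sum_cat_exp k n (e1 : 'I_k -> nat) (e2 : 'I_n -> nat) :
  (\sum_i cat_exp e1 e2 i = \sum_i e1 i + \sum_i e2 i)%N.
Proof.
rewrite big_split_ord /=; congr (_ + _)%N; apply: eq_bigr => i _.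
  by rewrite cat_exp_lshift.
by rewrite cat_exp_rshift.
Qed.

Lemma dilation_row_mx k n (e1 : 'I_k -> nat) (e2 : 'I_n -> nat) (l : R) x y :
  dilation (cat_exp e1 e2) l (row_mx x y) = row_mx (dilation e1 l x) (dilation e2 l y).
Proof.
apply/rowP => i; rewrite dilation_coord; case: (split_ordP i) => j ->.
  by rewrite cat_exp_lshift !row_mxEl dilation_coord.
by rewrite cat_exp_rshift !row_mxEr dilation_coord.
Qed.

Lemma lsubmx_dilation k n (e1 : 'I_k -> nat) (e2 : 'I_n -> nat) (l : R) z :
  lsubmx (dilation (cat_exp e1 e2) l z) = dilation e1 l (lsubmx z).
Proof. by rewrite -{1}[z]hsubmxK dilation_row_mx row_mxKl. Qed.

Lemma rsubmx_dilation k n (e1 : 'I_k -> nat) (e2 : 'I_n -> nat) (l : R) z :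
  rsubmx (dilation (cat_exp e1 e2) l z) = dilation e2 l (rsubmx z).
Proof. by rewrite -{1}[z]hsubmxK dilation_row_mx row_mxKr. Qed.

Section homogeneous_maps.
Variables (k n : nat) (e1 : 'I_k -> nat) (e2 : 'I_n -> nat) (F : 'rV[R]_(k + n) -> 'rV[R]_n).
Hypothesis e1_gt0 : forall i, (0 < e1 i)%N.
Hypothesis e2_gt0 : forall i, (0 < e2 i)%N.
Hypothesis sF : smooth_map F.
Hypothesis homF : forall (l : R) z, 0 < l -> F (dilation (cat_exp e1 e2) l z) = dilation e2 l (F z).

Let hom_coord i (l : R) z : 0 < l -> l ^+ e2 i * F z 0 i = l ^+ 0 * F (dilation (cat_exp e1 e2) l z) 0 i.
Proof. by move=> l0; rewrite homF // dilation_coord expr0 mul1r. Qed.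

Lemma homogeneous_map_partial i j z : (e2 i <= e2 j)%N ->
  partial (rshift k j) (fun z => F z 0 i) z = partial (rshift k j) (fun z => F z 0 i) 0.
Proof.
have e_gt0 := cat_exp_gt0 e1_gt0 e2_gt0; rewrite leq_eqVlt => /orP[/eqP ij|ij]; last first.
  by rewrite !(homogeneous_partial_eq0 _ e_gt0 (@hom_coord i) (sF i)) // add0n cat_exp_rshift.
apply: (homogeneous_zero_const e_gt0) ij; last exact: (smooth_continuous (smooth_on_partial _ (sF i))).
move=> l y l0; have := homogeneous_partial (@hom_coord i) (rshift k j) y (sF i) l0.
by rewrite add0n cat_exp_rshift.
Qed.

(* Homogeneity makes the map triangular with respect to the weights. *)
Lemma homogeneous_map_preserves (b : 'I_n -> bool) :
  (forall i j, partial (rshift k j) (fun z => F z 0 i) 0 = (i == j)%:R * (-1) ^+ b i) ->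
  forall t, transports (lebV n) (lebV n) (fun z => F (row_mx t z)).
Proof.
move=> dF t.
pose h i (z : 'rV[R]_(k + n)) := - (-1) ^+ b i * z 0 (rshift k i) + F z 0 i.
have scoord i : smooth (fun z : 'rV[R]_(k + n) => z 0 (rshift k i)) by exact: (smooth_on_coord _ openT).
have sh i : smooth (h i) by exact: (smooth_scale_add _ (scoord i) (sF i)).
have partial_h i j z : ~~ (e2 j < e2 i)%N -> partial (rshift k j) (h i) z = 0.
  rewrite -leqNgt => ij; rewrite (partial_scale_add _ _ _ (scoord i) (sF i)) partial_coord.
  rewrite homogeneous_map_partial // dF (inj_eq (@rshift_inj _ _)) eq_sym mulrC.
  by rewrite mulrN addrC subrr.
apply: (@triangular_preserves R n e2 b (fun i z => h i (row_mx t z))).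
- move=> i; apply: (measurableT_comp (f := h i)).
    exact: (continuous_measurable_rV (smooth_continuous (sh i))).
  by apply: measurable_row_mx => //.
- move=> i x y xy.
  apply: (@zero_partials_eq _ _
    (fun l => if fintype.split l is inr j then ~~ (e2 j < e2 i)%N else false)) => //.
    move=> l z; case: (split_ordP l) => // j ->; exact: partial_h.
  move=> l; case: (split_ordP l) => j ->; first by rewrite !row_mxEl.
  by rewrite negbK !row_mxEr; exact: xy.
- by move=> x i; rewrite /h row_mxEr mulNr addNKr.
Qed.

End homogeneous_maps.

Record homogeneous_system n m (e : 'I_n -> nat) (w : 'I_m -> nat) (X : 'I_m -> @vfield R n) : Prop :=
  HomogeneousSystem {
    hsys_exp_gt0 : forall i, (0 < e i)%N ;
    hsys_weight_gt0 : forall j, (0 < w j)%N ;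
    hsys_smooth : forall j, smooth_map (X j) ;
    hsys_homogeneous : forall j, vf_homogeneous e (X j) (w j) }.

Lemma hsys_divergence_free n m (e : 'I_n -> nat) (w : 'I_m -> nat) (X : 'I_m -> @vfield R n) :
  homogeneous_system e w X -> forall j, divergence_free (X j).
Proof.
move=> [e_gt0 w_gt0 sX hX] j; exact: homogeneous_divergence_free e_gt0 (w_gt0 j) (sX j) (hX j).
Qed.

End homogeneous_functions.
(** * A priori estimates for hypoelliptic operators *)

Section parametrised_integrals.
Context {R : realType} {d : measure_display} {T : measurableType d}
  (mu : {measure set T -> \bar R}) (n : nat) (W : set 'rV[R]_n) (F : 'rV[R]_n -> T -> R).
Hypothesis oW : open W.
Hypothesis sF : forall t, smooth_on W (F^~ t).
Hypothesis mF : forall s x, W x -> measurable_fun setT (fun t => partials s (F^~ t) x).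
Hypothesis dF : forall s x, W x -> exists (r : R) (g : T -> R),
  [/\ 0 < r, Rintegrable mu g & forall y t, `|y - x| < r -> `|partials s (F^~ t) y| <= g t].

Let dominated_near s x : W x -> exists (r : R) (g : T -> R), [/\ 0 < r, Rintegrable mu g,
  (forall y, `|y - x| < r -> W y) & forall y t, `|y - x| < r -> `|partials s (F^~ t) y| <= g t].
Proof.
move=> Wx; have [r [g [r0 ig Fg]]] := dF s Wx.
have [r' r'0 rW] := nbhs_norm_lt (open_nbhs_nbhs (conj oW Wx)).
exists (Num.min r r'), g; split => //; first by rewrite lt_min r0.
  by move=> y; rewrite lt_min => /andP[_]; exact: rW.
by move=> y t; rewrite lt_min => /andP[yr _]; exact: Fg.
Qed.

Let is_derive_partials s x i : W x -> is_derive x (delta_mx 0 i)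
  (fun y => \int[mu]_t partials s (F^~ t) y) (\int[mu]_t partials (i :: s) (F^~ t) x).
Proof.
move=> Wx; have [r [g [r0 ig rW Fg]]] := dominated_near s Wx.
have [r' [g' [r'0 ig' rW' Fg']]] := dominated_near (i :: s) Wx.
have rr'0 : 0 < Num.min r r' by rewrite lt_min r0.
apply: (@is_derive_Rintegral R _ _ mu _ (fun y t => partials s (F^~ t) y) x (delta_mx 0 i) g' _ rr'0) => //.
- move=> y; rewrite lt_min => /andP[yr _].
  by apply: (Rintegrable_le _ ig); [apply: mF; exact: rW|move=> t; exact: Fg].
- move=> y t; rewrite lt_min => /andP[yr _].
  exact: (smooth_on_derivable (smooth_on_partials s (@sF t)) (rW _ yr)).
- by move=> y t; rewrite lt_min => /andP[_ yr']; exact: Fg'.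
Qed.

Lemma smooth_on_Rintegral : smooth_on W (fun x => \int[mu]_t F x t).
Proof.
apply: (smooth_on_coind (P := fun f => exists s, f = (fun x => \int[mu]_t partials s (F^~ t) x)) oW).
- move=> _ [s ->] x Wx; split; last first.
    by move=> i; exact: (@ex_derive _ _ _ _ _ _ _ (is_derive_partials s i Wx)).
  have [r [g [r0 ig rW Fg]]] := dominated_near s Wx.
  apply: (continuous_Rintegral r0 _ _ ig Fg).
    by move=> y yr; apply: mF; exact: rW.
  by move=> t; exact: (smooth_on_continuous (smooth_on_partials s (@sF t)) Wx).
- move=> _ i [s ->]; exists (fun x => \int[mu]_t partials (i :: s) (F^~ t) x); first by exists (i :: s).
  by move=> x Wx; exact: (@derive_val _ _ _ _ _ _ _ (is_derive_partials s i Wx)).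
- by exists [::].
Qed.

End parametrised_integrals.

Section series.
Context {R : realType}.
Local Notation count := (@counting nat R).

Lemma nneseries_le (f : nat -> R) (M : R) : (forall k, 0 <= f k) ->
  (forall k, \sum_(0 <= i < k) f i <= M) -> (\sum_(0 <= k <oo) (f k)%:E <= M%:E)%E.
Proof.
move=> f0 fM; apply: lime_le; first by apply: is_cvg_nneseries => k _ _; rewrite lee_fin.
by apply: nearW => k; rewrite sumEFin lee_fin.
Qed.

Lemma geometric_half_sum k : \sum_(0 <= i < k) (2^-1 : R) ^+ i <= 2.
Proof.
have half1 : `|2^-1 : R| < 1 by rewrite gtr0_norm ?invr_gt0 // invf_lt1 // ltr1n.
have := @geometric_le_lim R k 1 2^-1 ler01 _ half1; rewrite invr_gt0 ltr0n => /(_ isT).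
rewrite (_ : 1 - 2^-1 = 2^-1) ?invrK ?mul1r; last by lra.
by apply: le_trans; rewrite /series /=; under [leRHS]eq_bigr do rewrite mul1r.
Qed.

Lemma nneseries_geometric (A : R) : 0 <= A ->
  (\sum_(0 <= k <oo) (A * 2^-1 ^+ k)%:E <= (A * 2)%:E)%E.
Proof.
move=> A0; apply: nneseries_le; first by move=> k; rewrite mulr_ge0 // exprn_ge0 // invr_ge0.
by move=> k; rewrite -mulr_sumr ler_wpM2l // geometric_half_sum.
Qed.

Lemma dyadic_dominant d (T : measurableType d) (mu : {measure set T -> \bar R})
    (E : nat -> set T) (c : nat -> R) (A : R) :
  (forall k, measurable (E k)) -> (forall k, 0 <= c k) -> 0 <= A ->
  (forall k, (c k)%:E * mu (E k) <= (A * 2^-1 ^+ k)%:E)%E ->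
  (forall x, exists M : R, forall k, \sum_(0 <= i < k) c i * \1_(E i) x <= M) ->
  exists2 g : T -> R, Rintegrable mu g & forall k x, E k x -> c k <= g x.
Proof.
move=> mE c0 A0 cE sum_bounded.
pose f k x : R := c k * \1_(E k) x; pose S x := (\sum_(0 <= k <oo) (f k x)%:E)%E.
have f0 k x : 0 <= f k x by rewrite mulr_ge0.
have mf k : measurable_fun setT (fun x => (f k x)%:E).
  by apply/measurable_EFinP; apply: measurable_funM => //; exact: measurable_indic.
have S0 x : (0 <= S x)%E by apply: nneseries_ge0 => k _ _; rewrite lee_fin.
have S_fin x : S x \is a fin_num.
  by have [M SM] := sum_bounded x; rewrite ge0_fin_numE //;
    apply: le_lt_trans (nneseries_le (f0^~ x) SM) (ltry _).
exists (fine \o S); last first.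
  move=> k x Ekx; rewrite -lee_fin /= fineK //.
  rewrite /S (nneseries_split _ k.+1) => [|j _]; last by rewrite lee_fin.
  rewrite big_nat_recr //= -addeA addeCA.
  apply: (@le_trans _ _ (f k x)%:E); first by rewrite /f indicE mem_set // mulr1.
  rewrite leeDl // adde_ge0 //; first by apply: sume_ge0 => i _; rewrite lee_fin.
  by apply: nneseries_ge0 => i _ _; rewrite lee_fin.
have SE : EFin \o (fine \o S) = S by apply/funext => x /=; rewrite fineK.
rewrite /Rintegrable SE; apply/integrableP; split.
  by apply: ge0_emeasurable_sum => // k x _; rewrite lee_fin.
under eq_integral do rewrite gee0_abs //.
rewrite /S integral_nneseries //; last by move=> k x _; rewrite lee_fin.
apply: le_lt_trans (ltry (A * 2)).
apply: le_trans (nneseries_geometric A0); apply: lee_nneseries => [k _ _|k _].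
  by apply: integral_ge0 => x _; rewrite lee_fin.
under eq_integral do rewrite /f EFinM.
rewrite ge0_integralZl ?lee_fin //; last by apply/measurable_EFinP; exact: measurable_indic.
by rewrite integral_indic // setIT.
Qed.

Lemma Rintegrable_geometric (A : R) : Rintegrable count (fun k => A * 2^-1 ^+ k).
Proof.
apply: RintegrableZ; apply/integrableP; split => //.
rewrite (@ge0_integral_count _ (fun k => `|(2^-1 ^+ k : R)|%:E)) //.
apply: le_lt_trans (ltry (1 * 2)); apply: le_trans (nneseries_geometric ler01).
apply: lee_nneseries => // k _.
by rewrite mul1r lee_fin ger0_norm // exprn_ge0 // invr_ge0.
Qed.

Lemma Rintegral_counting_cvg (f : nat -> R) : Rintegrable count f ->
  (\sum_(i < k) f i) @[k --> \oo] --> \int[count]_i f i.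
Proof.
move=> /integrableP[_]; rewrite ge0_integral_count // nneseries_esumT // => sum_f.
have summable_abs : summable [set: nat] (fun i => `|f i|%:E).
  by apply: le_lt_trans sum_f; apply: le_esum => i _ /=; rewrite normr_id.
have cvg_f : cvgn (series f).
  apply: normed_cvg; apply: (@summable_cvg R xpredT (fun i => `|f i|%:E)) => //.
  by move: summable_abs; congr (is_true (summable _ _)); apply/seteqP; split.
have -> : \int[count]_i f i = limn (series f).
  rewrite /Rintegral integral_count //.
  rewrite -[RHS]/(fine (limn (series f))%:E) -EFin_lim //; congr (fine (limn _)).
  by apply/funext => k; rewrite /= -sumEFin.
by under eq_fun do rewrite -(big_mkord xpredT).
Qed.

End series.

Section weighted_series.
Context {R : realType} (a : nat -> R).
Local Notation count := (@counting nat R).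
Hypothesis a_geometric : forall j, 0 <= a j <= 2^-1 ^+ j.

Definition weighted_series (f : nat -> R) : R := \int[count]_j (a j * f j).

Let weighted_term_le j (b A : R) : `|b| <= A -> `|a j * b| <= A * 2^-1 ^+ j.
Proof. by move=> bA; have /andP[a0 aj] := a_geometric j; rewrite normrM ger0_norm // mulrC ler_pM. Qed.

Lemma Rintegrable_weighted (f : nat -> R) (A : R) : (forall j, `|f j| <= A) ->
  Rintegrable count (fun j => a j * f j).
Proof.
move=> fA; apply: (Rintegrable_le _ (Rintegrable_geometric A)) => // j; exact: weighted_term_le.
Qed.

Lemma weighted_series_cvg (f : nat -> R) (A : R) : (forall j, `|f j| <= A) ->
  (\sum_(i < k) a i * f i) @[k --> \oo] --> weighted_series f.
Proof. by move=> fA; apply: Rintegral_counting_cvg; exact: Rintegrable_weighted fA. Qed.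

Lemma weighted_sum_le (f : nat -> R) (A : R) k : (forall j, `|f j| <= A) ->
  `|\sum_(i < k) a i * f i| <= A * 2.
Proof.
move=> fA; have A0 : 0 <= A by exact: le_trans (fA 0%N).
apply: le_trans (ler_norm_sum _ _ _) _.
apply: le_trans (_ : \sum_(i < k) A * 2^-1 ^+ i <= _).
  by apply: ler_sum => j _; exact: weighted_term_le.
by rewrite -mulr_sumr ler_wpM2l // -(big_mkord xpredT (fun i => 2^-1 ^+ i)) geometric_half_sum.
Qed.

Lemma weighted_series_le (f : nat -> R) (A : R) : (forall j, `|f j| <= A) ->
  `|weighted_series f| <= A * 2.
Proof.
move=> fA; apply: (cvg_norm_le (weighted_series_cvg fA)) => k; exact: weighted_sum_le.
Qed.

Lemma continuous_weighted_series (V : normedModType R) (W : set V) (f : nat -> V -> R) (A : R) :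
  open W -> (forall j x, W x -> {for x, continuous (f j)}) ->
  (forall j x, W x -> `|f j x| <= A) ->
  forall x, W x -> {for x, continuous (fun y => weighted_series (f^~ y))}.
Proof.
move=> oW cf fA x Wx; have [r r0 rW] := nbhs_norm_lt (open_nbhs_nbhs (conj oW Wx)).
apply: (continuous_Rintegral (F := fun y j => a j * f j y) r0 _ _ (Rintegrable_geometric A)) => //.
  by move=> j; apply: continuous_atM; [exact: continuous_at_cst|exact: cf].
by move=> y j yr; apply: weighted_term_le; apply: fA; exact: rW.
Qed.

Lemma smooth_on_weighted_series n (W : set 'rV[R]_n) (f : nat -> 'rV[R]_n -> R) : open W ->
  (forall j, smooth (f j)) ->
  (forall s, exists A, forall j x, W x -> `|partials s (f j) x| <= A) ->
  smooth_on W (fun x => weighted_series (f^~ x)).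
Proof.
move=> oW sf f_bounded; apply: (smooth_on_Rintegral (F := fun x j => a j * f j x) oW) => //.
  by move=> j; apply: smooth_smooth_on; exact: (smooth_onZ _ openT (sf j)).
move=> s x Wx; have [A fA] := f_bounded s.
have [r r0 rW] := nbhs_norm_lt (open_nbhs_nbhs (conj oW Wx)).
exists r, (fun j => A * 2^-1 ^+ j); split => //; first exact: Rintegrable_geometric.
move=> y j yr; rewrite (partialsZ s (a j) y (sf j)); apply: weighted_term_le; apply: fA; exact: rW.
Qed.

Lemma weighted_series_pairing n (W : set 'rV[R]_n) (f : nat -> 'rV[R]_n -> R) (A : R)
    (phi : 'rV[R]_n -> R) :
  (forall j, smooth (f j)) -> (forall j x, W x -> `|f j x| <= A) -> test_fun W phi ->
  (\sum_(i < k) a i * \int[@lebesgue_rV R n]_x (f i x * phi x)) @[k --> \oo] -->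
    \int[@lebesgue_rV R n]_x (weighted_series (f^~ x) * phi x).
Proof.
move=> sf fA tphi; have [sphi [K [cK KW Kphi]]] := tphi.
have int_term j : Rintegrable (@lebesgue_rV R n) (fun x => a j * (f j x * phi x)).
  exact: RintegrableZ (test_fun_integrable (test_funM (sf j) (test_fun_setT tphi))).
have partial_sumE k x : \sum_(i < k) a i * (f i x * phi x) = (\sum_(i < k) a i * f i x) * phi x.
  by rewrite mulr_suml; apply: eq_bigr => i _; rewrite mulrA.
have [|x||k x|_] := @Rdominated_cvg _ _ _ (@lebesgue_rV R n)
    (fun k x => \sum_(i < k) a i * (f i x * phi x))
    (fun x => weighted_series (f^~ x) * phi x) (fun x => A * 2 * `|phi x|).
- by move=> k; apply: Rintegrable_measurable; apply: Rintegrable_sum => i _.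
- rewrite (_ : (fun k : nat => _) = fun k => (\sum_(i < k) a i * f i x) * phi x); last first.
    by apply/funext => k; exact: partial_sumE.
  have [/KW Wx|/Kphi phi_x] := pselect (K x); last first.
    by under eq_fun do rewrite phi_x mulr0; rewrite phi_x mulr0; exact: cvg_cst.
  by apply: cvgM; [exact: (weighted_series_cvg (fun j => fA j x Wx))|exact: cvg_cst].
- by apply: RintegrableZ; apply: Rintegrable_abs; exact: (test_fun_integrable (test_fun_setT tphi)).
- rewrite partial_sumE normrM; have [/KW Wx|/Kphi ->] := pselect (K x); last by rewrite normr0 !mulr0.
  by apply: ler_wpM2r => //; apply: (@weighted_sum_le (f^~ x)) => j; exact: fA.
apply: cvg_trans; apply: near_eq_cvg; apply: nearW => k.
rewrite Rintegral_sum => [|i _ //]; apply: eq_bigr => i _.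
by rewrite RintegralZl //; exact: (test_fun_integrable (test_funM (sf i) (test_fun_setT tphi))).
Qed.

End weighted_series.

Section gliding_hump.
Context {R : realType} (U T : Type) (P : nat -> U -> Prop) (h : T -> R) (q : U -> T -> R).
Hypothesis h_gt0 : forall t, 0 < h t.
Hypothesis q_le : forall k u t, P k u -> `|q u t| <= (h t)^-1.
Hypothesis q_bounded : forall k u, P k u -> exists D : R, forall t, `|q u t| <= D.
Hypothesis q_unbounded : forall k (B : R), exists u t, P k u /\ B < `|q u t|.

(* The term [a k * q (u k)] dominates at [t k]: the earlier terms are bounded and
   the coefficients of the later ones are chosen small with respect to [h (t k)]. *)
Lemma gliding_hump_sequences : exists (u : nat -> U) (t : nat -> T) (a D : nat -> R),
  [/\ forall k, P k (u k), forall k s, `|q (u k) s| <= D k, forall k, 0 < a k <= 2^-1 ^+ k,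
      forall k i, (k < i)%N -> a i <= 2^-1 ^+ i * h (t k) &
      forall k, k%:R + 2 + \sum_(0 <= i < k) a i * D i < a k * `|q (u k) (t k)|].
Proof.
have next (z : nat * (R * R)) : exists x : U * T * R, 0 < z.2.2 -> [/\ P z.1 x.1.1,
    (forall t, `|q x.1.1 t| <= x.2) &
    z.1%:R + 2 + z.2.1 < 2^-1 ^+ z.1 * z.2.2 * `|q x.1.1 x.1.2|].
  case: z => k [A b] /=; have [u [t [Pu qu]]] := q_unbounded k ((k%:R + 2 + A) / (2^-1 ^+ k * b)).
  have [D uD] := q_bounded Pu; exists (u, t, D) => /= b0; split => //.
  by move: qu; rewrite ltr_pdivrMr ?mulr_gt0 ?exprn_gt0 ?invr_gt0 // mulrC.
have [F nextF] := choice next.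
(* [st k] holds the sum of the earlier bounds and the least of the earlier [h (t i)]. *)
pose st := fix st k : R * R := if k is k'.+1 then
  (let x := F (k', st k') in ((st k').1 + 2^-1 ^+ k' * (st k').2 * x.2, Num.min (st k').2 (h x.1.2)))
  else (0, 1).
pose t k := (F (k, st k)).1.2; pose D k := (F (k, st k)).2; pose a k : R := 2^-1 ^+ k * (st k).2.
have st0 k : 0 < (st k).2 by elim: k => //= k IHk; rewrite lt_min IHk h_gt0.
have st1 k : (st k).2 <= 1 by elim: k => //= k IHk; rewrite ge_min IHk.
have st_sum k : (st k).1 = \sum_(0 <= i < k) a i * D i.
  by elim: k => [|k IHk]; [rewrite big_nil|rewrite big_nat_recr //= -IHk].
have half0 k : 0 < (2^-1 : R) ^+ k by rewrite exprn_gt0 // invr_gt0.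
exists (fun k => (F (k, st k)).1.1), t, a, D; split.
- by move=> k; have [] := nextF (k, st k) (st0 k).
- by move=> k; have [] := nextF (k, st k) (st0 k).
- by move=> k; rewrite mulr_gt0 //= -[leRHS]mulr1 ler_wpM2l // ltW.
- move=> k i ki; rewrite ler_wpM2l ?(ltW (half0 i)) //; elim: i ki => // i IHi.
  by rewrite ltnS leq_eqVlt /= ge_min => /orP[/eqP ->|/IHi ->]; rewrite ?lexx ?orbT.
- by move=> k; rewrite -st_sum; have [] := nextF (k, st k) (st0 k).
Qed.

Lemma gliding_hump : exists (u : nat -> U) (t : nat -> T) (a : nat -> R),
  [/\ forall k, P k (u k), forall k, 0 < a k <= 2^-1 ^+ k &
      forall k j, (k < j)%N -> k%:R <= `|\sum_(i < j) a i * q (u i) (t k)|].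
Proof.
have [u [t [a [D [Pu uD a01 a_small hump]]]]] := gliding_hump_sequences.
exists u, t, a; split=> // k j kj; pose b i := a i * q (u i) (t k).
have a_gt0 i : 0 < a i by have /andP[] := a01 i.
have normb i : `|b i| = a i * `|q (u i) (t k)| by rewrite normrM gtr0_norm.
have before i : (i < k)%N -> `|b i| <= a i * D i by rewrite normb ler_wpM2l // ltW.
have after i : (k < i)%N -> `|b i| <= 2^-1 ^+ i.
  move=> ki; rewrite normb; apply: le_trans (_ : 2^-1 ^+ i * h (t k) * (h (t k))^-1 <= _).
    by apply: ler_pM => //; [exact: ltW|exact: a_small|exact: q_le (Pu i)].
  by rewrite mulfK // gt_eqF.
have others : \sum_(0 <= i < j | i != k) `|b i| <= \sum_(0 <= i < k) a i * D i + 2.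
  apply: le_trans (_ : _ <= \sum_(0 <= i < j | i != k) (if (i < k)%N then a i * D i else 2^-1 ^+ i)) _.
    apply: ler_sum => i; rewrite neq_ltn => /orP[ik|ki]; first by rewrite ik before.
    by rewrite ltnNge (ltnW ki) after.
  rewrite (big_nat_widen _ _ _ _ _ (ltnW kj)) big_mkcond [X in _ <= X + _]big_mkcond /=.
  apply: le_trans (lerD (lexx _) (geometric_half_sum j)); rewrite -big_split /=.
  apply: ler_sum => i _; have half0 : 0 <= (2^-1 : R) ^+ i by rewrite exprn_ge0 // invr_ge0.
  have aD0 : 0 <= a i * D i by rewrite mulr_ge0 ?(ltW (a_gt0 i)) // (le_trans _ (uD i (t k))).
  by case: (i != k); case: ltnP => _; lra.
rewrite -(big_mkord xpredT b) (bigD1_seq k) /= ?mem_index_iota ?iota_uniq //.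
have : `|b k| <= `|b k + \sum_(0 <= i < j | i != k) b i| + `|\sum_(0 <= i < j | i != k) b i|.
  by rewrite -[X in `|X| <= _](addrK (\sum_(0 <= i < j | i != k) b i)) ler_normB.
have : `|\sum_(0 <= i < j | i != k) b i| <= \sum_(0 <= i < j | i != k) `|b i| by exact: ler_norm_sum.
by have := hump k; rewrite -normb; lra.
Qed.

End gliding_hump.

Section derivative_bounds.
Context {R : realType}.

Definition Ck_bound n k (f : 'rV[R]_n -> R) (M : R) : Prop :=
  forall (s : seq 'I_n) x, (size s <= k)%N -> `|partials s f x| <= M.

Lemma Ck_boundS n k (f : 'rV[R]_n -> R) (M : R) : (forall x, `|f x| <= M) ->
  (forall i, Ck_bound k (partial i f) M) -> Ck_bound k.+1 f M.
Proof.
move=> fM dfM s x; case/lastP: s => [_|s i]; first exact: fM.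
by rewrite size_rcons ltnS partials_rcons => sk; exact: dfM.
Qed.

Lemma Ck_bound_partial n k (f : 'rV[R]_n -> R) (M : R) i : Ck_bound k.+1 f M -> Ck_bound k (partial i f) M.
Proof. by move=> fM s x sk; rewrite -partials_rcons; apply: fM; rewrite size_rcons. Qed.

Lemma Ck_bound_le n k (f : 'rV[R]_n -> R) (M M' : R) : M <= M' -> Ck_bound k f M -> Ck_bound k f M'.
Proof. by move=> MM' fM s x sk; exact: le_trans (fM s x sk) MM'. Qed.

Lemma le_sum_term (I : finType) (M : I -> R) i : (forall j, 0 <= M j) -> M i <= \sum_j M j.
Proof. by move=> M0; rewrite (bigD1 i) //= lerDl sumr_ge0. Qed.

Lemma Ck_bound_test n k (f : 'rV[R]_n -> R) : test_fun setT f ->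
  exists2 M : R, 0 < M & Ck_bound k f M.
Proof.
elim: k f => [|k IHk] f tf; have [sf [K [cK _ Kf]]] := tf;
    have [M0 M00 fM0] := supported_bound (smooth_continuous sf) cK Kf.
  by exists M0 => // -[].
have /choice[M dfM] : forall i : 'I_n, exists M : R, 0 < M /\ Ck_bound k (partial i f) M.
  by move=> i; have [M M_gt0 dfM] := IHk _ (test_fun_partial i tf); exists M.
have M_ge0 i : 0 <= M i by apply: ltW; have [] := dfM i.
have sum_ge0 : 0 <= \sum_i M i by exact: sumr_ge0.
exists (M0 + \sum_i M i); first by rewrite ltr_wpDr.
apply: Ck_boundS => [x|i]; first by rewrite (le_trans (fM0 x)) // lerDl.
apply: Ck_bound_le (dfM i).2; apply: le_trans (le_sum_term i M_ge0) _.
by rewrite lerDr ltW.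
Qed.

Lemma Ck_bound_scale_add n k (a : R) (f g : 'rV[R]_n -> R) (M M' : R) : smooth f -> smooth g ->
  Ck_bound k f M -> Ck_bound k g M' -> Ck_bound k (fun x => a * f x + g x) (`|a| * M + M').
Proof.
move=> sf sg fM gM s x sk; rewrite (partials_scale_add s a x sf sg).
by apply: le_trans (ler_normD _ _) _; rewrite normrM lerD ?ler_wpM2l ?fM ?gM.
Qed.

Lemma Ck_bound_mul n k (chi : 'rV[R]_n -> R) : test_fun setT chi ->
  exists2 C : R, 0 < C & forall g M, smooth g -> Ck_bound k g M ->
    Ck_bound k (fun x => chi x * g x) (C * M).
Proof.
elim: k chi => [|k IHk] chi tchi; have [schi [K [cK _ Kchi]]] := tchi;
    have [M0 M00 chiM0] := supported_bound (smooth_continuous schi) cK Kchi.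
  by exists M0 => // g M sg gM [] // x _; rewrite normrM ler_pM //; exact: (gM [::]).
have [C C0 chiC] := IHk chi tchi.
have /choice[D dchiD] : forall i : 'I_n, exists D : R, 0 < D /\ forall g M, smooth g -> Ck_bound k g M ->
    Ck_bound k (fun x => partial i chi x * g x) (D * M).
  by move=> i; have [D D_gt0 dchiD] := IHk _ (test_fun_partial i tchi); exists D.
have D_ge0 i : 0 <= D i by apply: ltW; have [] := dchiD i.
have sum_ge0 : 0 <= \sum_i D i by exact: sumr_ge0.
exists (M0 + C + \sum_i D i); first by rewrite ltr_wpDr // addr_gt0.
move=> g M sg gM; have M_ge0 : 0 <= M by apply: le_trans (gM [::] 0 _).
apply: Ck_boundS => [x|i].
  apply: le_trans (_ : M0 * M <= _); first by rewrite normrM ler_pM //; exact: (gM [::]).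
  by rewrite ler_wpM2r //; lra.
have -> : partial i (fun y => chi y * g y) = (fun y => 1 * (chi y * partial i g y) + partial i chi y * g y).
  apply/funext => y; rewrite (partialM (smooth_derivable schi) (smooth_derivable sg)).
  by rewrite mul1r [g y * _]mulrC.
have sdg := smooth_on_partial i sg; have sdchi := smooth_on_partial i schi.
have chi_dg := chiC _ _ sdg (Ck_bound_partial i gM).
have dchi_g : Ck_bound k (fun y => partial i chi y * g y) (D i * M).
  by apply: (dchiD i).2 => // t y tk; apply: gM; exact: leq_trans tk _.
apply: Ck_bound_le (Ck_bound_scale_add 1 (smooth_onM openT schi sdg) (smooth_onM openT sdchi sg)
  chi_dg dchi_g).
by rewrite normr1 mul1r -mulrDl ler_wpM2r //; have := le_sum_term i D_ge0; lra.
Qed.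

Lemma sum_exp_le n (e : 'I_n -> nat) s : (\sum_(i <- s) e i <= size s * \sum_i e i)%N.
Proof.
elim: s => [|i s IHs]; first by rewrite big_nil.
by rewrite big_cons /= mulSn leq_add // (bigD1 i) //= leq_addr.
Qed.

Lemma Ck_bound_dilation n k (e : 'I_n -> nat) (l : R) (f : 'rV[R]_n -> R) (M : R) : smooth f ->
  0 <= l -> Ck_bound k f M ->
  Ck_bound k (f \o dilation e l) ((Num.max 1 l) ^+ (k * \sum_i e i) * M).
Proof.
move=> sf l0 fM s x sk; rewrite (partials_dilation e l s x sf) normrM.
apply: ler_pM => //; last exact: fM.
have m1 : 1 <= Num.max 1 l by rewrite le_max lexx.
rewrite normrX ger0_norm //; apply: le_trans (_ : Num.max 1 l ^+ (\sum_(i <- s) e i) <= _).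
  by apply: lerXn2r; rewrite ?nnegrE ?le_max ?lexx ?l0 ?orbT.
rewrite ler_weXn2l //; apply: (leq_trans (sum_exp_le e s)).
by rewrite leq_mul2r sk orbT.
Qed.

End derivative_bounds.

Section a_priori_estimate.
Context {R : realType}.
Local Notation lebV n := (@lebesgue_rV R n).
Local Notation count := (@counting nat R).
Implicit Types n : nat.

Lemma L1loc_distribution n (v : 'rV[R]_n -> R) (W : set 'rV[R]_n) : L1loc v ->
  distribution_on W (fun phi => \int[lebV n]_x (v x * phi x)).
Proof.
move=> Lv; split=> [a f g /test_fun_setT tf /test_fun_setT tg|K cK _].
  have int_f := L1loc_test Lv tf; have int_g := L1loc_test Lv tg.
  rewrite -RintegralZl // -RintegralD //; last exact: RintegrableZ.
  by apply: eq_Rintegral => x _; rewrite mulrDr mulrCA.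
have int_K := Rintegrable_abs (L1loc_indic_mul Lv cK).
exists (\int[lebV n]_x `|\1_K x * v x|), 0%N => f sf Kf M fM.
have f_le x : `|f x| <= M by exact: (fM [::]).
rewrite mulrC -RintegralZl //; apply: norm_Rintegral_le; last 1 first.
- move=> x; have [Kx|/Kf ->] := pselect (K x).
    by rewrite indicE mem_set // mul1r normrM mulrC ler_wpM2r.
  by rewrite mulr0 normr0 mulr_ge0 // (le_trans _ (f_le 0)).
- apply: measurable_funM; first exact: Lv.1.
  exact: (continuous_measurable_rV (smooth_continuous sf)).
- exact: RintegrableZ.
Qed.

Lemma eventually_bounded_uniform (T : Type) (f : nat -> T -> R) (k : nat) (B : R) :
  (forall j, exists M : R, forall t, `|f j t| <= M) ->
  (forall j t, (k <= j)%N -> `|f j t| <= B) -> exists A : R, forall j t, `|f j t| <= A.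
Proof.
move=> fM; elim: k B => [|k IHk] B fB; first by exists B => j t; exact: fB.
have [M kM] := fM k; apply: (IHk (Num.max B M)) => j t.
rewrite leq_eqVlt le_max => /orP[/eqP<-|/fB->//]; by rewrite kM orbT.
Qed.

Section increment_quotients.
Context {n : nat}.

Definition unit_increment := {t : 'rV[R]_n * R * 'I_n | `|t.1.1| < 1 /\ 0 < t.1.2 <= 2^-1}.

Definition increment_quotient (f : 'rV[R]_n -> R) (t : unit_increment) : R :=
  let: (x, h, i) := sval t in (f (x + h *: delta_mx 0 i) - f x) / h.

Lemma norm_increment_lt2 (x : 'rV[R]_n) (h : R) i : `|x| < 1 -> 0 < h <= 2^-1 ->
  `|x + h *: delta_mx 0 i| < 2.
Proof.
move=> x1 /andP[h0 h1]; apply: le_lt_trans (ler_normD _ _) _.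
by have := norm_scale_delta_le h i; rewrite gtr0_norm //; lra.
Qed.

Lemma increment_quotient_bounded (f : 'rV[R]_n -> R) : smooth_on [set x | `|x| < 2] f ->
  exists D : R, forall t, `|increment_quotient f t| <= D.
Proof.
move=> sf; have ball2 (x : 'rV[R]_n) : `|x| <= 1 + 2^-1 -> `|x| < 2 by lra.
have /choice[M fM] : forall i, exists M : R, 0 < M /\ forall x, `|x| <= 1 + 2^-1 -> `|partial i f x| <= M.
  move=> i; have [M M0 fM] := compact_continuous_bound (@compact_closed_ball_rV R n (1 + 2^-1))
    (fun x x_le => smooth_on_continuous (smooth_on_partial i sf) (ball2 x x_le)).
  by exists M.
exists (\sum_i M i) => -[[[x h] i] /= [x1 h01]]; have /andP[h0 h1] := h01.
rewrite /increment_quotient /=.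
have on_ball (t : R) : `|t| <= `|h| -> `|x + t *: delta_mx 0 i| <= 1 + 2^-1.
  move=> th; apply: le_trans (ler_normD _ _) _; apply: lerD; first exact: ltW.
  by apply: le_trans (norm_scale_delta_le _ _) _; apply: le_trans th _; rewrite gtr0_norm.
have [t th ->] := @MVT_line R _ f x (delta_mx 0 i) h
  (fun t th => smooth_on_derivable sf (ball2 _ (on_ball t th)) (i := i)).
rewrite mulrC mulKf ?gt_eqF //; have [_ /(_ _ (on_ball t th)) /le_trans] := fM i; apply.
by rewrite (bigD1 i) //= lerDl sumr_ge0 // => j _; apply: ltW; have [] := fM j.
Qed.

Lemma increment_quotient_le (f : 'rV[R]_n -> R) t : (forall x, `|x| < 2 -> `|f x| <= 1) ->
  `|increment_quotient f t| <= ((sval t).1.2 / 2)^-1.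
Proof.
case: t => -[[x h] i] /= [x1 h01] f1; have /andP[h0 h1] := h01.
rewrite /increment_quotient /= invf_div normrM normfV (gtr0_norm h0) ler_wpM2r ?invr_ge0 ?(ltW h0) //.
apply: le_trans (ler_normB _ _) _; have := f1 _ (norm_increment_lt2 i x1 h01).
have x2 : `|x| < 2 by lra.
by have := f1 x x2; lra.
Qed.

Lemma increment_quotient_near_partial (f : 'rV[R]_n -> R) i x : smooth f -> `|x| < 1 ->
  exists t, `|partial i f x| <= `|increment_quotient f t| + 1.
Proof.
move=> sf x1; have := smooth_continuous (smooth_on_partial i sf) (x := x).
move=> /continuous_normP/(_ 1 ltr01)[d d0 near_x].
pose h : R := Num.min 2^-1 (d / 2).
have h0 : 0 < h by rewrite lt_min; apply/andP; split; lra.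
have h12 : h <= 2^-1 by rewrite ge_min lexx.
have hd : h <= d / 2 by rewrite ge_min lexx orbT.
have h01 : 0 < h <= 2^-1 by rewrite h0.
exists (exist _ (x, h, i) (conj x1 h01)); rewrite /increment_quotient /=.
have [t th ->] := @MVT_line R _ f x (delta_mx 0 i) h (fun t _ => smooth_derivable sf).
rewrite mulrC mulKf ?gt_eqF // -lerBlDl; apply: le_trans (lerB_dist _ _) _.
rewrite distrC; apply: near_x; rewrite addrC addKr.
apply: le_lt_trans (norm_scale_delta_le _ _) _; by move: th; rewrite (gtr0_norm h0); lra.
Qed.

End increment_quotients.

Section estimate.
Variables (n m : nat) (X : 'I_m -> @vfield R n) (w : 'I_m -> nat) (nu : nat) (c : seq 'I_m -> R).
Hypothesis sX : forall i, smooth_map (X i).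
Hypothesis divX : forall j, divergence_free (X j).
Local Notation L := (hom_op X w nu c).
Local Notation Ls := (hom_op X w nu (transpose_coef c)).

Lemma partials_hom_op_bounded (u : nat -> 'rV[R]_n -> R) s : (forall j, smooth (u j)) ->
  (forall j x, (size s <= j)%N -> `|x| < 2 -> `|partials s (L (u j)) x| <= 1) ->
  exists A : R, forall j x, `|x| < 2 -> `|partials s (L (u j)) x| <= A.
Proof.
move=> su Lu1.
have [j|j [x x2] sj|A uA] := @eventually_bounded_uniform {x : 'rV[R]_n | `|x| < 2}
    (fun j x => partials s (L (u j)) (sval x)) (size s) 1; last 1 first.
- by exists A => j x x2; exact: (uA j (exist _ x x2)).
- have sLu := smooth_on_partials s (smooth_hom_op w sX nu c (su j)).
  have [M M0 uM] := compact_continuous_bound (@compact_closed_ball_rV R n 2)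
    (fun x _ => smooth_continuous sLu (x := x)).
  by exists M => -[x x2] /=; apply: uM; exact: ltW.
- exact: Lu1.
Qed.

(* The series solves [L v = f] weakly, with [f] the smooth sum of the series of the
   [L (u j)]; hypoellipticity makes its sum smooth. *)
Lemma hypoelliptic_series (u : nat -> 'rV[R]_n -> R) (a : nat -> R) : hypoelliptic X w nu c ->
  (forall j, smooth (u j)) -> (forall j, 0 <= a j <= 2^-1 ^+ j) ->
  (forall j x, `|x| < 2 -> `|u j x| <= 1) ->
  (forall j s x, (size s <= j)%N -> `|x| < 2 -> `|partials s (L (u j)) x| <= 1) ->
  smooth_on [set x | `|x| < 2] (fun x => weighted_series a (u^~ x)).
Proof.
move=> hypo su a01 u1 Lu1; set W := [set x | `|x| < 2].
have oW : open W by exact: open_norm_lt0.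
have sLu j := smooth_hom_op w sX nu c (su j).
have Lu_bounded s := partials_hom_op_bounded su (fun j x sj => Lu1 j s x sj).
pose v x := weighted_series a (u^~ x); pose f x := weighted_series a (fun j => L (u j) x).
have cv x : W x -> {for x, continuous v}.
  exact: (continuous_weighted_series a01 oW (fun j x _ => smooth_continuous (su j) (x := x)) u1).
have sf : smooth_on W f by exact: (smooth_on_weighted_series a01 oW sLu Lu_bounded).
have Lv : L1loc (v \_ W).
  apply: L1loc_bounded; first exact: measurable_restrict_open_rV.
  move=> K _; exists 2 => x _; rewrite patchE; case: ifPn => [/set_mem Wx|_]; last by rewrite normr0.
  by rewrite -[leRHS]mul1r; apply: (weighted_series_le a01) => j; exact: u1.
have weak phi : test_fun W phi -> \int[lebV n]_x ((v \_ W) x * Ls phi x) = \int[lebV n]_x (f x * phi x).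
  move=> tphi; have tLphi := test_fun_hom_op w nu (transpose_coef c) sX tphi.
  have [A LuA] := Lu_bounded [::].
  rewrite (Rintegral_patch_test _ tLphi).
  apply: (cvg_seq_unique _ (weighted_series_pairing a01 su u1 tLphi)
    (weighted_series_pairing a01 sLu LuA tphi)).
  move=> k; apply: eq_bigr => i _; congr (_ * _).
  by rewrite integral_hom_op_parts //; exact: test_fun_setT tphi.
have [g sg vg] : dist_smooth_on W (fun phi => \int[lebV n]_x ((v \_ W) x * phi x)).
  by apply: (hypo W W _ oW oW) => //; [exact: L1loc_distribution|exists f].
apply: (smooth_on_ext oW _ sg) => x Wx; apply: (fundamental_lemma_eq oW _ cv _ Wx).
  by move=> y Wy; exact: (smooth_on_continuous sg Wy).
by move=> phi tphi; rewrite -vg // Rintegral_patch_test.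
Qed.

Definition gradient_estimate (C : R) (k : nat) : Prop :=
  forall (u : 'rV[R]_n -> R) (M : R), smooth u -> (forall x, `|x| < 2 -> `|u x| <= M) ->
    (forall s x, (size s <= k)%N -> `|x| < 2 -> `|partials s (L u) x| <= M) ->
    forall i x, `|x| < 1 -> `|partial i u x| <= C * M.

Definition unit_controlled (k : nat) (u : 'rV[R]_n -> R) : Prop :=
  [/\ smooth u, forall x, `|x| < 2 -> `|u x| <= 1 &
      forall s x, (size s <= k)%N -> `|x| < 2 -> `|partials s (L u) x| <= 1].

Lemma unit_controlled_scale k (u : 'rV[R]_n -> R) (M l : R) : 0 <= l -> l * M <= 1 -> smooth u ->
  (forall x, `|x| < 2 -> `|u x| <= M) ->
  (forall s x, (size s <= k)%N -> `|x| < 2 -> `|partials s (L u) x| <= M) ->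
  unit_controlled k (fun y => l * u y).
Proof.
move=> l0 lM su uM LuM; have scale_le (b : R) : `|b| <= M -> `|l * b| <= 1.
  by move=> bM; rewrite normrM (ger0_norm l0); apply: le_trans lM; rewrite ler_wpM2l.
split=> [|x x2|s x sk x2]; [exact: (smooth_onZ l openT su)|exact/scale_le/uM|].
rewrite (_ : L _ = fun z => l * L u z); last by apply/funext => z; exact: (hom_opZ w sX nu c l z su).
by rewrite (partialsZ s l x (smooth_hom_op w sX nu c su)); exact/scale_le/LuM.
Qed.

Lemma unbounded_increment_quotients k : (forall C : R, 0 < C -> ~ gradient_estimate C k) ->
  forall B : R, exists u t, unit_controlled k u /\ B < `|increment_quotient u t|.
Proof.
move=> no_estimate B; pose C : R := `|B| + 2.
have C0 : 0 < C by rewrite ltr_wpDl.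
have := no_estimate C C0.
move=> /existsNP[u] /existsNP[M] /not_implyP[su] /not_implyP[uM] /not_implyP[LuM] /existsNP[i].
move=> /existsNP[x] /not_implyP[x1] /negP; rewrite -ltNge => CM.
have M0 : 0 <= M by apply: le_trans (uM 0 _); rewrite // normr0.
have du0 : 0 < `|partial i u x| by apply: le_lt_trans CM; rewrite mulr_ge0 // ltW.
pose l : R := C / `|partial i u x|.
have l0 : 0 < l by rewrite divr_gt0.
have lM : l * M <= 1 by rewrite /l mulrAC ler_pdivrMr // mul1r ltW.
have control := unit_controlled_scale (ltW l0) lM su uM LuM.
have [t] := increment_quotient_near_partial i (smooth_onZ l openT su) x1.
rewrite (partialZ l (smooth_derivable su)) normrM (gtr0_norm l0) mulfVK ?gt_eqF // => Ct.
exists (fun y => l * u y), t; split=> //; move: Ct; have := ler_norm B; rewrite /C; lra.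
Qed.

Lemma hypoelliptic_estimate : hypoelliptic X w nu c ->
  exists (C : R) (k : nat), 0 < C /\ gradient_estimate C k.
Proof.
move=> hypo; apply: contrapT => no_estimate.
have unbounded k : forall B : R, exists u t, unit_controlled k u /\ B < `|increment_quotient u t|.
  by apply: unbounded_increment_quotients => C C0 est; apply: no_estimate; exists C, k.
have scale_gt0 (t : @unit_increment n) : 0 < (sval t).1.2 / 2.
  by case: t => -[[x h] i] /= [_ /andP[h0 _]]; rewrite divr_gt0.
have [|k u [su _ _]|u [t [a [control a01 hump]]]] := gliding_hump scale_gt0 _ _ unbounded.
- by move=> k u t [_ u1 _]; exact: increment_quotient_le.
- by apply: increment_quotient_bounded; exact: smooth_smooth_on.
have a01' j : 0 <= a j <= 2^-1 ^+ j by have /andP[/ltW -> ->] := a01 j.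
have su j : smooth (u j) by have [] := control j.
have u1 j x : `|x| < 2 -> `|u j x| <= 1 by have [_ + _] := control j; exact.
have Lu1 j s x : (size s <= j)%N -> `|x| < 2 -> `|partials s (L (u j)) x| <= 1.
  by have [_ _] := control j; exact.
have sv := hypoelliptic_series hypo su a01' u1 Lu1; pose v x := weighted_series a (u^~ x).
have v_cvg x : `|x| < 2 -> (\sum_(i < k) a i * u i x) @[k --> \oo] --> v x.
  by move=> x2; apply: (weighted_series_cvg a01' (f := u^~ x)) => j; exact: u1.
have quotient_cvg s : (\sum_(i < k) a i * increment_quotient (u i) s) @[k --> \oo] -->
  increment_quotient v s.
  case: s => -[[x h] i] /= [x1 h01]; rewrite /increment_quotient /=.
  have x2 : `|x| < 2 by lra.
  rewrite (_ : (fun k : nat => _) = fun k : nat =>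
      ((\sum_(j < k) a j * u j (x + h *: 'e_i)) - \sum_(j < k) a j * u j x) / h); last first.
    apply/funext => k; rewrite -sumrB mulr_suml; apply: eq_bigr => j _.
    by rewrite mulrA mulrBr.
  apply: cvgM; last exact: cvg_cst.
  by apply: cvgB; [apply: v_cvg; exact: norm_increment_lt2|exact: v_cvg].
have v_large k : k%:R <= `|increment_quotient v (t k)|.
  have lim_abs : `|\sum_(i < j) a i * increment_quotient (u i) (t k)| @[j --> \oo] -->
    `|increment_quotient v (t k)|.
    exact: cvg_norm (quotient_cvg (t k)).
  rewrite -(cvg_lim _ lim_abs) //; apply: limr_ge; first by apply/cvg_ex; eexists; exact: lim_abs.
  by exists k.+1 => // j /=; exact: hump.
have [D vD] := increment_quotient_bounded sv.
have D0 : 0 <= D by apply: le_trans (vD (t 0%N)).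
have := archi_boundP D0; rewrite ltNge => /negP; apply.
exact: le_trans (v_large _) (vD _).
Qed.

End estimate.

End a_priori_estimate.
Section scaling_consequences.
Context {R : realType} (n m : nat) (e : 'I_n -> nat) (w : 'I_m -> nat) (X : 'I_m -> @vfield R n)
  (nu : nat) (c : seq 'I_m -> R).
Hypothesis sysX : homogeneous_system e w X.
Hypothesis hypo : hypoelliptic X w nu c.
Local Notation L := (hom_op X w nu c).

Let e_gt0 := hsys_exp_gt0 sysX.
Let sX := hsys_smooth sysX.

Lemma expr_ge_self (l : R) k : (0 < k)%N -> 1 <= l -> l <= l ^+ k.
Proof.
case: k => // k _ l1; rewrite exprS -[leLHS]mulr1 ler_wpM2l ?exprn_ege1 //.
exact: le_trans l1.
Qed.

Lemma scaled_gradient_estimate (C : R) k (u : 'rV[R]_n -> R) (S M l : R) i z :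
  gradient_estimate X w nu c C k -> smooth u -> (forall x, `|u x| <= S) ->
  Ck_bound k (L u) M -> 1 <= l -> `|z| < l ->
  l * `|partial i u z| <= C * (S + l ^+ (nu + k * \sum_i e i) * M).
Proof.
move=> est su uS LuM l1 zl; have l0 : 0 < l by exact: lt_le_trans l1.
have M0 : 0 <= M by exact: le_trans (LuM [::] 0 _).
have S0 : 0 <= S by exact: le_trans (uS 0).
have lM0 : 0 <= l ^+ (nu + k * \sum_i e i) * M by rewrite mulr_ge0 // exprn_ge0 // ltW.
have sLu := smooth_hom_op w sX nu c su.
have u_le x : `|x| < 2 -> `|(u \o dilation e l) x| <= S + l ^+ (nu + k * \sum_i e i) * M.
  by move=> _; apply: le_trans (uS _) _; rewrite lerDl.
have Lu_le : Ck_bound k (L (u \o dilation e l)) (l ^+ (nu + k * \sum_i e i) * M).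
  have -> : L (u \o dilation e l) = fun y => l ^+ nu * (L u \o dilation e l) y.
    by apply/funext => y; rewrite (hom_op_dilation sX (hsys_homogeneous sysX) nu c y l0 su).
  move=> s x sk; rewrite (partialsZ s _ _ (smooth_comp sLu (smooth_dilation e l))) normrM.
  rewrite exprD -mulrA normrX gtr0_norm // ler_wpM2l ?exprn_ge0 ?(ltW l0) //.
  by have := Ck_bound_dilation e sLu (ltW l0) LuM x sk; rewrite max_r.
have Lu_le' s x : (size s <= k)%N -> `|x| < 2 ->
    `|partials s (L (u \o dilation e l)) x| <= S + l ^+ (nu + k * \sum_i e i) * M.
  by move=> sk _; apply: le_trans (Lu_le s x sk) _; rewrite lerDr.
have zl1 : `|dilation e l^-1 z| < 1.
  apply: le_lt_trans (norm_dilation_le z e_gt0 _) _; first by rewrite invr_ge0 (ltW l0) invf_le1.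
  by rewrite mulrC ltr_pdivrMr // mul1r.
have := est _ _ (smooth_comp su (smooth_dilation e l)) u_le Lu_le' i _ zl1.
rewrite (partial_dilation e l i _ su) dilationVK ?gt_eqF // normrM normrX gtr0_norm //.
by apply: le_trans; rewrite ler_wpM2r // expr_ge_self.
Qed.

Lemma liouville (u : 'rV[R]_n -> R) (M : R) : smooth u -> (forall x, `|u x| <= M) ->
  (forall x, L u x = 0) -> forall x y, u x = u y.
Proof.
move=> su uM Lu0 x y.
have [C [k [C0 est]]] := hypoelliptic_estimate sX (hsys_divergence_free sysX) hypo.
apply: (@zero_partials_eq _ _ _ predT x y su) => // i z _.
apply/normr0_eq0/eqP; rewrite eq_le normr_ge0 andbT leNgt; apply/negP => dz.
have M0 : 0 <= M by exact: le_trans (uM 0).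
pose l : R := `|z| + 1 + (C * M + 1) / `|partial i u z|.
have lz : `|z| + 1 <= l by rewrite lerDl divr_ge0 // addr_ge0 // mulr_ge0 // ltW.
have l1 : 1 <= l by apply: le_trans lz; rewrite lerDr.
have Lu_le : Ck_bound k (L u) 0.
  by move=> s t _; rewrite (_ : L u = fun=> 0) ?partials0 ?normr0 //; apply/funext.
have zl : `|z| < l by apply: lt_le_trans lz; rewrite ltrDl.
have := scaled_gradient_estimate i est su uM Lu_le l1 zl; rewrite mulr0 addr0; apply/negP; rewrite -ltNge.
rewrite /l mulrDl mulfVK ?gt_eqF //.
have : 0 <= (`|z| + 1) * `|partial i u z| by rewrite mulr_ge0 // addr_ge0.
by lra.
Qed.

Lemma unit_supported_le (phi : 'rV[R]_n -> R) (D : R) (i : 'I_n) x : smooth phi ->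
  supported_in [set x | `|x| <= 1] phi -> (forall y, `|partial i phi y| <= D) -> `|phi x| <= 3 * D.
Proof.
move=> sphi Kphi phiD; have D0 : 0 <= D by exact: le_trans (phiD 0).
have [x1|/Kphi ->] := pselect (`|x| <= 1); last by rewrite normr0 mulr_ge0.
have far : phi (x + 3 *: delta_mx 0 i) = 0.
  apply: Kphi => /= y1; have := le_trans (coord_le_norm _ i) y1.
  rewrite !mxE !eqxx mulr1 ler_norml => /andP[_ y_le].
  by have := le_trans (coord_le_norm x i) x1; rewrite ler_norml => /andP[x_ge _]; lra.
have [t _] := @MVT_line R _ phi x (delta_mx 0 i) 3 (fun t _ => smooth_derivable sphi).
rewrite far sub0r => phi_xE; rewrite -normrN phi_xE normrM gtr0_norm // ler_wpM2l //; exact: phiD.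
Qed.

Lemma test_fun_estimate : (0 < n)%N -> exists (C : R) (k : nat), 0 < C /\
  forall (phi : 'rV[R]_n -> R) (M : R), smooth phi -> supported_in [set x | `|x| <= 1] phi ->
  Ck_bound k (L phi) M -> forall x, `|phi x| <= C * M.
Proof.
move=> n_gt0; pose i0 := Ordinal n_gt0.
have [C [k [C0 est]]] := hypoelliptic_estimate sX (hsys_divergence_free sysX) hypo.
pose l : R := 2 + 6 * C; pose B := l ^+ (nu + k * \sum_i e i).
have l2 : 2 <= l by rewrite lerDl mulr_ge0 // ltW.
have l1 : 1 <= l by lra.
exists B, k; split; first by rewrite exprn_gt0; lra.
move=> phi M sphi Kphi LM.
have halve (S : R) : (forall x, `|phi x| <= S) -> forall x, `|phi x| <= (S + B * M) / 2.
  move=> phiS x; have S0 : 0 <= S + B * M.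
    by apply: addr_ge0; [exact: le_trans (phiS 0)|rewrite mulr_ge0 ?exprn_ge0
      ?(le_trans _ (LM [::] 0 _))//; lra].
  have -> : (S + B * M) / 2 = 3 * ((S + B * M) / 6) by lra.
  apply: (unit_supported_le (i := i0) _ sphi Kphi) => y.
  have [y1|y1] := pselect (`|y| <= 1); last first.
    rewrite (partial_supported i0 (@closed_norm_le0 _ _ 1) Kphi y1) normr0.
    by rewrite divr_ge0.
  have yl : `|y| < l by lra.
  have grad_le := scaled_gradient_estimate i0 est sphi phiS LM l1 yl.
  have : 6 * C * `|partial i0 phi y| <= C * (S + B * M).
    by apply: le_trans grad_le; rewrite ler_wpM2r // /l lerDr.
  by rewrite -mulrA mulrCA ler_pM2l // ler_pdivlMr //; lra.
have cphi := smooth_continuous sphi.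
have [S0 S00 phiS0] := supported_bound cphi (@compact_closed_ball_rV R n 1) Kphi.
pose A := [set `|phi x| | x in [set: 'rV[R]_n]].
have supA : has_sup A by split; [exists `|phi 0|, 0|exists S0 => _ [x _ <-]].
have phi_sup x : `|phi x| <= sup A by apply: (sup_upper_bound supA); exists x.
have : sup A <= (sup A + B * M) / 2.
  by apply: sup_le_ub; [case: supA|move=> _ [x _ <-]; exact: halve].
by move=> sup_le x; apply: le_trans (phi_sup x) _; lra.
Qed.

End scaling_consequences.
(** * The homogeneous fundamental solution on the lifted space *)

Section hahn_banach.
Context {R : realType} (T : Type) (p : (T -> R) -> R -> Prop).
(* [p f M] reads: [M] is at least the seminorm of [f], which may be infinite. *)
Hypothesis p0 : p (fun=> 0) 0.
Hypothesis pZ : forall a f M, p f M -> p (fun x => a * f x) (`|a| * M).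
Hypothesis pD : forall f g M M', p f M -> p g M' -> p (fun x => f x + g x) (M + M').
Implicit Types (A B : set ((T -> R) * R)).

Definition linear_graph A := forall (a : R) u v, A u -> A v ->
  A (fun x => a * u.1 x + v.1 x, a * u.2 + v.2).

Definition dominated_graph A :=
  [/\ linear_graph A, (forall f y M, A (f, y) -> p f M -> y <= M) & A (fun=> 0, 0)].

Lemma dominated_extension_value B f0 M0 : dominated_graph B -> p f0 M0 ->
  exists c : R, forall h y M, B (h, y) ->
    (p (fun x => h x + f0 x) M -> y + c <= M) /\ (p (fun x => h x - f0 x) M -> y - c <= M).
Proof.
move=> [lB bB B0] pf0.
pose S := [set z | exists g y M, [/\ B (g, y), p (fun x => g x - f0 x) M & z = y - M]].
have S_le z h y' M' : S z -> B (h, y') -> p (fun x => h x + f0 x) M' -> z <= M' - y'.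
  move=> [g [y [M [Bg pg ->]]]] Bh ph.
  have := lB 1 _ _ Bg Bh; rewrite /= mul1r => Bgh.
  have pgh : p (fun x => 1 * g x + h x) (M + M').
    have := pD pg ph; congr (p _ _); apply/funext => x; ring.
  by have := bB _ _ _ Bgh pgh; lra.
have supS : has_sup S.
  split.
    exists (0 - `|-1| * M0), (fun=> 0), 0, (`|-1| * M0); split => //.
    by have := pZ (-1) pf0; congr (p _ _); apply/funext => x; ring.
  exists (M0 - 0) => z Sz; apply: (S_le _ _ _ _ Sz B0).
  by congr (p _ _): pf0; apply/funext => x; ring.
exists (sup S) => h y M Bh; split=> ph.
  have : sup S <= M - y by apply: ge_sup; [case: supS|move=> z Sz; exact: S_le Bh ph].
  by lra.
have : y - M <= sup S by apply: (sup_upper_bound supS); exists h, y, M.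
by lra.
Qed.

Definition graph_extension B (f0 : T -> R) (c : R) : set ((T -> R) * R) :=
  [set v | exists g y a, B (g, y) /\ v = (fun x => g x + a * f0 x, y + a * c)].

Lemma graph_extension_sub B f0 c : B `<=` graph_extension B f0 c.
Proof.
move=> [g y] Bg; exists g, y, 0; split => //; congr pair; [apply/funext => x|]; ring.
Qed.

Lemma graph_extension_new B f0 c : B (fun=> 0, 0) -> graph_extension B f0 c (f0, c).
Proof.
by move=> B0; exists (fun=> 0), 0, 1; split => //; congr pair; [apply/funext => x|]; ring.
Qed.

Lemma linear_graph_scale B a g y : linear_graph B -> B (fun=> 0, 0) -> B (g, y) ->
  B (fun x => a * g x, a * y).
Proof.
move=> lB B0 Bg; have := lB a _ _ Bg B0; rewrite /= addr0; congr (B (_, _)).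
by apply/funext => x; rewrite addr0.
Qed.

Lemma dominated_graph_extension B f0 M0 : dominated_graph B -> p f0 M0 ->
  exists A, [/\ dominated_graph A, B `<=` A & exists c, A (f0, c)].
Proof.
move=> domB pf0; have [lB bB B0] := domB; have [c cE] := dominated_extension_value domB pf0.
exists (graph_extension B f0 c); split; last by exists c; exact: graph_extension_new.
  split; last exact: graph_extension_sub.
    move=> a _ _ [g [y [b [Bg ->]]]] [h [z [b' [Bh ->]]]] /=.
    exists (fun x => a * g x + h x), (a * y + z), (a * b + b'); split; first exact: (lB a _ _ Bg Bh).
    by congr pair; [apply/funext => x|]; ring.
  move=> f z M [g [y [a [Bg [-> ->]]]]] pf; have [a0|a0|a0] := ltgtP a 0.
  - have na0 : 0 < - a by rewrite oppr_gt0.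
    have := pZ (- a)^-1 pf; rewrite ger0_norm ?invr_ge0 ?(ltW na0) // => pf'.
    have := (cE _ _ ((- a)^-1 * M) (linear_graph_scale (- a)^-1 lB B0 Bg)).2.
    have -> : (fun x => (- a)^-1 * g x - f0 x) = (fun x => (- a)^-1 * (g x + a * f0 x)).
      by apply/funext => x; field; rewrite lt_eqF.
    by move=> /(_ pf'); rewrite lerBlDr -(ler_pM2l na0) mulrDr !mulVKf ?gt_eqF //; lra.
  - have := pZ a^-1 pf; rewrite ger0_norm ?invr_ge0 ?(ltW a0) // => pf'.
    have := (cE _ _ (a^-1 * M) (linear_graph_scale a^-1 lB B0 Bg)).1.
    have -> : (fun x => a^-1 * g x + f0 x) = (fun x => a^-1 * (g x + a * f0 x)).
      by apply/funext => x; field; rewrite gt_eqF.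
    by move=> /(_ pf'); rewrite -(ler_pM2l a0) mulrDr !mulVKf ?gt_eqF.
  - rewrite a0 mul0r addr0; apply: bB Bg _.
    by congr (p _ _): pf; apply/funext => x; rewrite a0 mul0r addr0.
exact: graph_extension_sub.
Qed.

Lemma maximal_dominated_graph G : dominated_graph G ->
  exists B, [/\ dominated_graph B, G `<=` B & forall f M, p f M -> exists y, B (f, y)].
Proof.
move=> domG; have [lG bG G0] := domG.
have [A [domA maxA]] : exists A, dominated_graph (A `|` G) /\
    (forall B, A `<` B -> ~ dominated_graph (B `|` G)).
  apply: (@Zorn_bigcup _ (fun A => dominated_graph (A `|` G))) => F domF totF.
  have member X : F X -> X `|` G `<=` \bigcup_(Y in F) Y `|` G.
    by move=> FX u [Xu|Gu]; [left; exists X|right].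
  have common u v : (\bigcup_(Y in F) Y `|` G) u -> (\bigcup_(Y in F) Y `|` G) v ->
      (G u /\ G v) \/ exists2 X, F X & (X `|` G) u /\ (X `|` G) v.
    move=> [[X FX Xu]|Gu] [[Y FY Yv]|Gv].
    - by have [XY|YX] := totF X Y FX FY; right; [exists Y => //; split; left => //; exact: XY
        |exists X => //; split; left => //; exact: YX].
    - by right; exists X => //; split; [left|right].
    - by right; exists Y => //; split; [right|left].
    - by left.
  split; last by right.
    move=> a u v Fu Fv; have [[Gu Gv]|[X FX [Xu Xv]]] := common u v Fu Fv; first by right; exact: lG.
    by apply: (member X FX); have [lX _ _] := domF _ FX; exact: lX.
  move=> f y M [[X FX Xf]|Gf]; last exact: bG.
  by have [_ bX _] := domF _ FX; apply: bX; left.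
exists (A `|` G); split; [exact: domA|by move=> u Gu; right|move=> f M pf].
apply: contrapT => no_value; have [A' [domA' AA' [c A'c]]] := dominated_graph_extension domA pf.
apply: (maxA A').
  split; first by move=> u Au; apply: AA'; left.
  by move=> /(_ _ A'c) Ac; apply: no_value; exists c; left.
by rewrite (_ : A' `|` G = A') //; apply/seteqP; split => [u []// Gu|u]; [apply: AA'; right|left].
Qed.

Lemma dominated_graph_functional B f y y' : dominated_graph B -> B (f, y) -> B (f, y') -> y = y'.
Proof.
move=> [lB bB B0] By By'; have le z z' : B (f, z) -> B (f, z') -> z' <= z.
  move=> Bz Bz'; have := lB (-1) _ _ Bz Bz'; rewrite /= => Bdiff.
  have := bB _ _ 0 Bdiff; rewrite (_ : (fun x => _) = fun=> 0); last by apply/funext => x; ring.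
  by move=> /(_ p0); lra.
by apply/eqP; rewrite eq_le !le.
Qed.

Lemma hahn_banach G : dominated_graph G ->
  exists F : (T -> R) -> R, [/\ forall f y, G (f, y) -> F f = y,
    forall f M, p f M -> `|F f| <= M &
    forall a f g M M', p f M -> p g M' -> F (fun x => a * f x + g x) = a * F f + F g].
Proof.
move=> domG; have [B [domB GB total]] := maximal_dominated_graph domG; have [lB bB B0] := domB.
pose F f : R := xget 0 [set y | B (f, y)].
have BF f M : p f M -> B (f, F f).
  by move=> /total[y By]; rewrite /F; case: xgetP => [z -> //|/(_ y)].
have FE f y : B (f, y) -> F f = y.
  by move=> By; rewrite /F; case: xgetP => [z -> Bz|/(_ y)//]; exact: dominated_graph_functional Bz By.
exists F; split.
- by move=> f y Gf; apply: FE; exact: GB.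
- move=> f M pf; have Bf := BF _ _ pf; rewrite ler_norml (bB _ _ _ Bf pf) andbT lerNl.
  have Bopp := linear_graph_scale (-1) lB B0 Bf; rewrite -mulN1r; apply: bB Bopp _.
  by have := pZ (-1) pf; rewrite normrN1 mul1r.
- by move=> a f g M M' pf pg; apply: FE; exact: (lB a _ _ (BF _ _ pf) (BF _ _ pg)).
Qed.

End hahn_banach.

Section dyadic_dilations.
Context {R : realType} (n : nat) (e : 'I_n -> nat).
Hypothesis e_gt0 : forall i, (0 < e i)%N.

Lemma norm_dilation_ge (l : R) (x : 'rV[R]_n) : 1 <= l -> l * `|x| <= `|dilation e l x|.
Proof.
move=> l1; have l0 : 0 < l by exact: lt_le_trans l1.
rewrite -{1}[x](dilationK e (lt0r_neq0 l0)) mulrC -ler_pdivlMr // mulrC.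
by apply: norm_dilation_le => //; rewrite invr_ge0 (ltW l0) invf_le1.
Qed.

Lemma norm_dilation_le_expr (l : R) (x : 'rV[R]_n) : 1 <= l ->
  `|dilation e l x| <= l ^+ (\sum_i e i) * `|x|.
Proof.
move=> l1; have l0 : 0 <= l by exact: le_trans l1.
apply: norm_rV_le => [|i]; first by rewrite mulr_ge0 // exprn_ge0.
rewrite dilation_coord normrM normrX ger0_norm // ler_pM ?exprn_ge0 ?coord_le_norm //.
by rewrite ler_weXn2l // (bigD1 i) //= leq_addr.
Qed.

Lemma dyadic_inner_shell (x : 'rV[R]_n) : x != 0 -> `|x| < 1 ->
  exists k, `|dilation e (2 ^+ k) x| < 1 /\ 1 <= `|dilation e (2 ^+ k.+1) x|.
Proof.
move=> x0 x1; have nx : 0 < `|x| by rewrite normr_gt0.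
have exits : exists k, 1 <= `|dilation e (2 ^+ k) x|.
  exists (Num.bound `|x|^-1); apply: le_trans (norm_dilation_ge _ _); last by rewrite exprn_ege1 // ler1n.
  rewrite -ler_pdivrMr // mul1r; apply: le_trans (expr2_ge_nat _).
  by apply: ltW; apply: archi_boundP; rewrite invr_ge0.
case: (ex_minnP exits) => -[|k] k1 kmin; first by move: k1; rewrite expr0 dilation1 leNgt x1.
by exists k; split => //; rewrite ltNge; apply/negP => /kmin; rewrite ltnn.
Qed.

Lemma dyadic_outer_shell (x : 'rV[R]_n) : 1 <= `|x| ->
  exists k, 1 <= `|dilation e (2^-1 ^+ k) x| /\ `|dilation e (2^-1 ^+ k.+1) x| < 1.
Proof.
move=> x1; have nx : 0 < `|x| by exact: lt_le_trans x1.
have enters : exists k, `|dilation e (2^-1 ^+ k) x| < 1.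
  have kb : `|x| < 2 ^+ Num.bound `|x|.
    by apply: lt_le_trans (expr2_ge_nat _); exact: archi_boundP.
  exists (Num.bound `|x|); apply: le_lt_trans (norm_dilation_le _ e_gt0 _) _.
    by rewrite exprn_ge0 ?exprn_ile1 ?invr_ge0 ?invf_le1 ?ler1n.
  by rewrite exprVn mulrC ltr_pdivrMr ?exprn_gt0 // mul1r.
case: (ex_minnP enters) => -[|k] k1 kmin; first by move: k1; rewrite expr0 dilation1 ltNge x1.
by exists k; split => //; rewrite leNgt; apply/negP => /kmin; rewrite ltnn.
Qed.

Lemma dilation2S k (x : 'rV[R]_n) : dilation e 2 (dilation e (2 ^+ k) x) = dilation e (2 ^+ k.+1) x.
Proof. by rewrite dilation_dilation exprS. Qed.

Local Notation leb := (@lebesgue_rV R n).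
Local Notation Q := (\sum_i e i)%N.
Local Notation unit_ball := [set x : 'rV[R]_n | `|x| <= 1].

Lemma lebesgue_dilated_ball (l : R) : 0 < l ->
  leb [set x | `|dilation e l x| <= 1] = (fine (leb unit_ball) * l ^- Q)%:E.
Proof.
move=> l0; have cB := @compact_closed_ball_rV R n 1.
rewrite EFinM fineK ?ge0_fin_numE //; last exact: lebesgue_rV_compact_lty.
rewrite [leb unit_ball](lebesgue_rV_dilation e l0 (compact_measurable_rV cB)) muleAC -EFinM.
by rewrite mulfV ?mul1e // expf_neq0 // gt_eqF.
Qed.

Lemma measurable_dilated_ball (l : R) : measurable [set x | `|dilation e l x| <= 1].
Proof.
have mball : measurable (dilation e l @^-1` unit_ball).
  have := @measurable_dilation R n e l measurableT _
    (compact_measurable_rV (@compact_closed_ball_rV R n 1)).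
  by rewrite setTI.
exact: mball.
Qed.

Section dyadic_homogeneity.
Variables (K : 'rV[R]_n -> R) (d : nat).
Hypothesis homK : forall x : 'rV[R]_n, x != 0 -> K (dilation e 2 x) * 2 ^+ d = K x.

Lemma dyadic_homogeneous k x : x != 0 -> K (dilation e (2 ^+ k) x) * 2 ^+ (d * k) = K x.
Proof.
move=> x0; elim: k => [|k IHk]; first by rewrite expr0 dilation1 muln0 expr0 mulr1.
rewrite -dilation2S mulnS exprD mulrA homK //.
by apply/eqP => /dilation_eq0 dil0; move/eqP: x0; apply; apply: dil0; rewrite expf_neq0.
Qed.

Hypothesis cK : forall x : 'rV[R]_n, x != 0 -> {for x, continuous K}.

Lemma homogeneous_shell_bound (r s : R) : 0 < r -> exists2 C : R, 0 < C &
  forall x, r <= `|x| -> `|x| <= s -> `|K x| <= C.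
Proof.
move=> r0; pose S : set 'rV[R]_n := [set x | r <= `|x| /\ `|x| <= s].
have cS : compact S.
  apply: (subclosed_compact _ (@compact_closed_ball_rV R n s)); last by move=> x [].
  rewrite (_ : S = ~` [set x | `|x| < r] `&` [set x | `|x| <= s]); last first.
    by apply/seteqP; split => x /= [rx xs]; split => //; [rewrite ltNge rx|rewrite leNgt; apply/negP].
  by apply: closedI; [apply: open_closedC; exact: open_norm_lt0|exact: closed_norm_le0].
have S_neq0 x : S x -> x != 0 by case=> rx _; rewrite -normr_gt0; exact: lt_le_trans rx.
have [C C0 KC] := compact_continuous_bound cS (fun x Sx => cK (S_neq0 x Sx)).
by exists C => // x rx xs; apply: KC.
Qed.

Lemma homogeneous_inner_bound : exists2 C : R, 0 < C &
  forall k x, `|dilation e (2 ^+ k) x| < 1 -> 1 <= `|dilation e (2 ^+ k.+1) x| ->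
    `|K x| <= C * 2 ^+ (d * k.+1).
Proof.
have [C C0 KC] := homogeneous_shell_bound (2 ^+ (\sum_i e i)) ltr01.
exists C => // k x inside outside.
have x0 : x != 0.
  by apply/eqP => x0; move: outside; rewrite x0 dilation0 normr0 leNgt ltr01.
rewrite -(dyadic_homogeneous k.+1 x0) normrM [`|2 ^+ _|]ger0_norm ?exprn_ge0 // ler_wpM2r ?exprn_ge0 //.
apply: KC => //; rewrite -dilation2S; apply: le_trans (norm_dilation_le_expr _ _) _; first by rewrite ler1n.
by rewrite -[leRHS]mulr1 ler_wpM2l ?exprn_ge0 // ltW.
Qed.

Hypothesis d_lt : (d < \sum_i e i)%N.
Hypothesis mK : measurable_fun setT K.
Hypothesis K0 : K 0 = 0.

Lemma homogeneous_inner_dominant :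
  exists2 g : 'rV[R]_n -> R, Rintegrable leb g & forall x, x != 0 -> `|x| < 1 -> `|K x| <= g x.
Proof.
have [C C0 KC] := homogeneous_inner_bound; set v := fine (leb unit_ball).
have v0 : 0 <= v by rewrite fine_ge0.
pose E k : set 'rV[R]_n := [set x | x != 0 /\ `|dilation e (2 ^+ k) x| <= 1].
pose c k : R := C * 2 ^+ (d * k.+1).
have c0 k : 0 <= c k by rewrite mulr_ge0 ?exprn_ge0 // ltW.
have mE k : measurable (E k).
  by apply: measurableI (measurable_dilated_ball _); apply: open_measurable_rV; exact: open_neq_normed.
have E_eventually x : exists k0, forall k, (k0 <= k)%N -> ~ E k x.
  have [->|x0] := eqVneq x 0; first by exists 0%N => k _ [/eqP].
  have nx : 0 < `|x| by rewrite normr_gt0.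
  have [k0 k0x] := exists_expr2_ge (`|x|^-1 + 1).
  exists k0 => k k0k [_]; apply/negP; rewrite -ltNge.
  apply: lt_le_trans (norm_dilation_ge _ _); last by rewrite exprn_ege1 // ler1n.
  rewrite -ltr_pdivrMr // mul1r; apply: lt_le_trans (_ : `|x|^-1 + 1 <= _); first by rewrite ltrDl.
  by apply: le_trans k0x _; rewrite ler_weXn2l // ler1n.
have [|k|x|g int_g cg] := @dyadic_dominant _ _ _ leb E c (C * 2 ^+ d * v) mE c0.
- by rewrite !mulr_ge0 ?exprn_ge0 // ltW.
- apply: (@le_trans _ _ ((c k)%:E * (v * 2^-1 ^+ (Q * k))%:E)%E).
    rewrite lee_wpmul2l ?lee_fin // [(Q * k)%N]mulnC exprM !exprVn -lebesgue_dilated_ball ?exprn_gt0 //.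
    apply: le_measure; rewrite ?inE //; first exact: measurable_dilated_ball.
    by move=> x [_].
  rewrite -EFinM lee_fin /c mulnS exprD.
  have -> : C * (2 ^+ d * 2 ^+ (d * k)) * (v * 2^-1 ^+ (Q * k)) =
      C * 2 ^+ d * v * (2 ^+ (d * k) * 2^-1 ^+ (Q * k)) by ring.
  rewrite ler_wpM2l ?mulr_ge0 ?exprn_ge0 ?(ltW C0) //.
  rewrite (_ : (Q * k = d * k + (Q - d) * k)%N); last by rewrite -mulnDl subnKC // ltnW.
  rewrite exprD mulrA -exprMn mulfV // expr1n mul1r ler_wiXn2l ?invr_ge0 ?invf_le1 ?ler1n //.
  by rewrite -{1}[k]mul1n leq_mul2r subn_gt0 d_lt orbT.
- have [k0 far] := E_eventually x.
  exists (\sum_(0 <= i < k0) c i * \1_(E i) x) => k.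
  have [kk0|k0k] := leqP k k0.
    by rewrite [leRHS](big_cat_nat _ kk0) //= lerDl sumr_ge0 // => i _; rewrite mulr_ge0.
  rewrite (big_cat_nat _ (ltnW k0k)) //= [X in _ + X]big1_seq ?addr0 // => i /=.
  by rewrite mem_index_iota => /andP[k0i _]; rewrite indicE memNset ?mulr0 //; exact: far.
exists g => // x x0 x1; have [k [inside outside]] := dyadic_inner_shell x0 x1.
by apply: le_trans (KC k x inside outside) _; apply: cg; split => //; exact: ltW.
Qed.

Lemma L1loc_homogeneous : L1loc K.
Proof.
have [g int_g Kg] := homogeneous_inner_dominant.
apply: L1loc_of_balls => // r; have [D D0 KD] := homogeneous_shell_bound r ltr01.
have int_dom : Rintegrable leb (fun x => `|g x| + D * \1_[set x : 'rV[R]_n | `|x| <= r] x).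
  by apply: RintegrableD; [exact: Rintegrable_abs|apply: RintegrableZ; exact: Rintegrable_indic_ball].
apply: Rintegrable_le int_dom _ => [|x].
  exact: measurable_funM (Rintegrable_measurable (Rintegrable_indic_ball n r)) mK.
rewrite indicE; case: (boolP (x \in _)); last by rewrite mul0r normr0 mulr0 addr0.
rewrite inE /= mul1r mulr1 => xr; have [->|x0] := eqVneq x 0.
  by rewrite K0 normr0 addr_ge0 // ltW.
have [x1|x1] := ltP `|x| 1; last by apply: le_trans (KD x x1 xr) _; rewrite lerDr.
apply: le_trans (Kg x x0 x1) _; apply: le_trans (ler_norm _) _.
by rewrite lerDl ltW.
Qed.

End dyadic_homogeneity.

End dyadic_dilations.

Record homogeneous_kernel {R : realType} n (e : 'I_n -> nat) (d : nat) (K : 'rV[R]_n -> R) : Prop :=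
  HomogeneousKernel {
    hker_smooth : smooth_on [set x | x != 0] K ;
    hker0 : K 0 = 0 ;
    hker_dilation2 : forall x : 'rV[R]_n, x != 0 -> K (dilation e 2 x) * 2 ^+ d = K x ;
    hker_L1loc : L1loc K }.

Section test_functionals.
Context {R : realType} (n : nat).
Local Notation lebV := (@lebesgue_rV R n).
Implicit Types (T : ('rV[R]_n -> R) -> R) (phi : 'rV[R]_n -> R).

Definition test_linear W T : Prop := forall (a : R) f g, test_fun W f -> test_fun W g ->
  T (fun x => a * f x + g x) = a * T f + T g.

Lemma test_linear0 W T : test_linear W T -> T (fun=> 0) = 0.
Proof.
move=> lT; have := lT (-1) _ _ (test_fun0 W) (test_fun0 W).
rewrite (_ : (fun x : 'rV[R]_n => -1 * 0 + 0) = fun=> 0); first by lra.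
by apply/funext => x; rewrite mulr0 addr0.
Qed.

Lemma test_linearZ W T (a : R) phi : test_linear W T -> test_fun W phi ->
  T (fun x => a * phi x) = a * T phi.
Proof.
move=> lT tphi; have := lT a _ _ tphi (test_fun0 W); rewrite (test_linear0 lT) addr0 => <-.
by congr T; apply/funext => x; rewrite addr0.
Qed.

Lemma distribution_sub W T T' : distribution_on W T -> distribution_on W T' ->
  distribution_on W (fun phi => T phi - T' phi).
Proof.
move=> [lT bT] [lT' bT']; split=> [a f g tf tg|K cK KW]; first by rewrite lT // lT' //; ring.
have [C [k TC]] := bT K cK KW; have [C' [k' TC']] := bT' K cK KW.
exists (C + C'), (maxn k k') => f sf Kf M fM; rewrite mulrDl; apply: le_trans (ler_normB _ _) _.
apply: lerD; first by apply: TC => // s x sk; apply: fM; exact: leq_trans sk (leq_maxl _ _).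
by apply: TC' => // s x sk; apply: fM; exact: leq_trans sk (leq_maxr _ _).
Qed.

Lemma supported_test_fun (K : set 'rV[R]_n) phi : compact K -> smooth phi -> supported_in K phi ->
  test_fun K phi.
Proof. by move=> cK sphi Kphi; split => //; exists K; split. Qed.

Lemma test_fun_supported_ball phi : test_fun setT phi ->
  exists2 r : R, 0 < r & supported_in [set x | `|x| <= r] phi.
Proof.
move=> [_ [K [cK _ Kphi]]]; have [r r0 Kr] := compact_norm_bound cK.
by exists r => // x nx; apply: Kphi => /Kr.
Qed.

Lemma distribution_localize_at0 (D : ('rV[R]_n -> R) -> R) (chi : 'rV[R]_n -> R) (r : R) : 0 < r ->
  distribution_on setT D -> (forall phi, test_fun [set x | x != 0] phi -> D phi = 0) ->
  smooth chi -> (forall x, `|x| <= r -> chi x = 1) ->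
  forall phi, test_fun setT phi -> D phi = D (fun x => chi x * phi x).
Proof.
move=> r0 [D_lin _] D0 schi chi1 phi tphi; have [sphi [K [cK _ Kphi]]] := tphi.
have t_out : test_fun [set x | x != 0] (fun x => (1 - chi x) * phi x).
  split; first exact: (smooth_onM openT (smooth_onB openT (smooth_on_cst 1 openT) schi) sphi).
  exists (K `&` ~` [set x | `|x| < r]); split.
  - apply: (subclosed_compact _ cK); last by move=> x [].
    by apply: closedI; [exact: compact_closed_normed|apply: open_closedC; exact: open_norm_lt0].
  - by move=> x [_ /=] x_ge; apply/eqP => x0; apply: x_ge; rewrite x0 normr0.
  - move=> x x_out; have [Kx|/Kphi ->] := pselect (K x); last by rewrite mulr0.
    rewrite chi1 ?subrr ?mul0r // leNgt; apply/negP => x_gt.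
    by apply: x_out; split=> //=; apply/negP; rewrite -leNgt ltW.
rewrite {1}(_ : phi = fun x => 1 * (chi x * phi x) + (1 - chi x) * phi x); last by apply/funext => x; ring.
by rewrite (D_lin 1 _ _ (test_funM schi tphi) (test_fun_setT t_out)) (D0 _ t_out) mul1r addr0.
Qed.

Section dilated_test_functions.
Variable e : 'I_n -> nat.
Hypothesis e_gt0 : forall i, (0 < e i)%N.

Lemma supported_in_dilation (l r : R) phi : 1 <= l -> supported_in [set x | `|x| <= r] phi ->
  supported_in [set x | `|x| <= r / l] (phi \o dilation e l).
Proof.
move=> l1 rphi x /= nx; have l0 : 0 < l by exact: lt_le_trans l1.
apply: rphi => /= dx; apply: nx; rewrite ler_pdivlMr // mulrC.
exact: le_trans (norm_dilation_ge e_gt0 x l1) dx.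
Qed.

Lemma Rintegral_norm_dilation2 phi j : test_fun setT phi ->
  \int[lebV]_x `|phi (dilation e (2 ^+ j) x)| = \int[lebV]_x `|phi x| * 2^-1 ^+ (j * \sum_i e i).
Proof.
move=> tphi; have pow0 : 0 < 2 ^+ j :> R by rewrite exprn_gt0.
have mphi := Rintegrable_measurable (Rintegrable_abs (test_fun_integrable tphi)).
have := Rintegral_dilation e pow0 mphi; rewrite -exprM => ->.
by rewrite mulrAC -exprMn mulfV // expr1n mul1r.
Qed.

(* [D] is invariant under the dilations up to the factor [2^nu], hence determined by
   its values on functions supported near the origin, which stay bounded. *)
Lemma homogeneous_supported_at0_eq0 (D : ('rV[R]_n -> R) -> R) nu : (0 < nu)%N ->
  distribution_on setT D -> (forall phi, test_fun [set x | x != 0] phi -> D phi = 0) ->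
  (forall phi, test_fun setT phi -> D phi * 2 ^+ nu = D (phi \o dilation e 2^-1)) ->
  forall phi, test_fun setT phi -> D phi = 0.
Proof.
move=> nu_gt0 D_dist D0 homD phi tphi; have half0 : 0 < 2^-1 :> R by rewrite invr_gt0.
have iterate j : D phi * 2 ^+ (nu * j) = D (phi \o dilation e (2^-1 ^+ j)) /\
    test_fun setT (phi \o dilation e (2^-1 ^+ j)).
  elim: j => [|j [Dj tj]].
    rewrite muln0 expr0 mulr1 expr0; have -> : phi \o dilation e 1 = phi by apply/funext => x;
      rewrite /= dilation1.
    by [].
  have -> : phi \o dilation e (2^-1 ^+ j.+1) = (phi \o dilation e (2^-1 ^+ j)) \o dilation e 2^-1.
    by apply/funext => x; rewrite /= dilation_dilation exprSr.
  by split; [rewrite -homD // -Dj mulnSr exprD mulrA|exact: test_fun_dilation].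
have [chi [schi _ chi1 chi0]] : exists chi : 'rV[R]_n -> R, [/\ smooth chi, forall x, 0 <= chi x <= 1,
    forall x, `|x - 0| <= 2^-1 -> chi x = 1 & forall x, 1 <= `|x - 0| -> chi x = 0].
  by apply: smooth_cutoff; [exact: ltW|rewrite invf_lt1 // ltr1n].
pose B : set 'rV[R]_n := [set x | `|x| <= 1]; have cB : compact B by exact: compact_closed_ball_rV.
have Bchi : supported_in B chi.
  by move=> x /= nx; apply: chi0; rewrite subr0 ltW // ltNge; apply/negP.
have tchi : test_fun setT chi by exact: test_fun_setT (supported_test_fun cB schi Bchi).
have chi_near x : `|x| <= 2^-1 -> chi x = 1 by rewrite -{1}[x]subr0; exact: chi1.
have localize := distribution_localize_at0 half0 D_dist D0 schi chi_near.
have [C [k DC]] := D_dist.2 B cB (@subsetT _ B).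
have [C' C'0 chiC'] := Ck_bound_mul k tchi; have [M M0 phiM] := Ck_bound_test k tphi.
have bounded j : `|D phi| * 2 ^+ (nu * j) <= C * (C' * M).
  rewrite -[2 ^+ (nu * j)]ger0_norm ?exprn_ge0 // -normrM; have [-> tj] := iterate j.
  have [sj _] := tj; rewrite (localize _ tj); apply: DC; first exact: (smooth_onM openT schi sj).
    by move=> x /Bchi ->; rewrite mul0r.
  apply: chiC' => //; have := Ck_bound_dilation e tphi.1 (exprn_ge0 j (ltW half0)) phiM.
  by rewrite max_l ?expr1n ?mul1r // exprn_ile1 ?invf_le1 ?ler1n // ltW.
apply/normr0_eq0/eqP; rewrite eq_le normr_ge0 andbT leNgt; apply/negP => Dphi0.
have [j large] := exists_expr2_ge (C * (C' * M) / `|D phi| + 1).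
have := bounded j; rewrite mulrC -ler_pdivlMr //; apply/negP; rewrite -ltNge.
apply: lt_le_trans (_ : C * (C' * M) / `|D phi| + 1 <= _); first by rewrite ltrDl.
by apply: le_trans large _; rewrite ler_weXn2l ?ler1n // leq_pmull.
Qed.

End dilated_test_functions.

End test_functionals.

Section geometric_cauchy.
Context {R : realType}.

Lemma geometric_cauchy (a : nat -> R) (j0 : nat) (A : R) :
  (forall j, (j0 <= j)%N -> `|a j.+1 - a j| <= A * 2^-1 ^+ j) ->
  exists2 l : R, a @ \oo --> l & `|l - a j0| <= A * 2.
Proof.
move=> aA; pose weight j : R := 2^-1 ^+ j; pose f i := 2 ^+ i * (a (i + j0).+1 - a (i + j0)%N).
have weight_geometric j : 0 <= weight j <= 2^-1 ^+ j by rewrite lexx andbT exprn_ge0 // invr_ge0.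
have A0 : 0 <= A.
  by have := le_trans (normr_ge0 _) (aA j0 (leqnn j0)); rewrite pmulr_lge0 // exprn_gt0 // invr_gt0.
have fA i : `|f i| <= A.
  rewrite normrM ger0_norm ?exprn_ge0 // mulrC -ler_pdivlMr ?exprn_gt0 // -exprVn.
  apply: le_trans (aA _ (leq_addl _ _)) _; rewrite ler_wpM2l //.
  by rewrite ler_wiXn2l ?invr_ge0 ?invf_le1 ?ler1n // leq_addr.
have telescope k : \sum_(i < k) weight i * f i = a (k + j0)%N - a j0.
  elim: k => [|k IHk]; first by rewrite big_ord0 add0n subrr.
  by rewrite big_ord_recr /= IHk /f mulrA -exprMn mulVf // expr1n mul1r addSn; ring.
exists (a j0 + weighted_series weight f); last by rewrite addrC addKr; exact: weighted_series_le.
rewrite -(cvg_shiftn j0).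
have : (fun k => a j0 + \sum_(i < k) weight i * f i) @ \oo --> a j0 + weighted_series weight f.
  by apply: cvgD; [exact: cvg_cst|exact: (weighted_series_cvg weight_geometric fA)].
by under eq_fun do rewrite telescope addrC subrK.
Qed.

End geometric_cauchy.

Section homogeneous_fundamental_solution.
Context {R : realType} (n m : nat) (e : 'I_n -> nat) (w : 'I_m -> nat) (X : 'I_m -> @vfield R n)
  (nu : nat) (c : seq 'I_m -> R).
Hypothesis sysX : homogeneous_system e w X.
Hypothesis hypo : hypoelliptic X w nu c.
Hypothesis hypo_tr : hypoelliptic X w nu (transpose_coef c).
Hypothesis nu_gt0 : (0 < nu)%N.
Hypothesis nu_lt : (nu < \sum_i e i)%N.
Local Notation Ls := (hom_op X w nu (transpose_coef c)).
Local Notation leb := (@lebesgue_rV R n).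
Local Notation Q := (\sum_i e i)%N.
Local Notation dil := (dilation e).

Let e_gt0 := hsys_exp_gt0 sysX.
Let sX := hsys_smooth sysX.

Let n_gt0 : (0 < n)%N.
Proof.
by rewrite lt0n; apply/eqP => n0; move: nu_lt; rewrite big1 // => i _; have := ltn_ord i; rewrite {2}n0.
Qed.

Lemma local_solution : exists (T : ('rV[R]_n -> R) -> R) (C : R) (k : nat), [/\ test_linear setT T,
  forall f M, smooth f -> Ck_bound k f M -> `|T f| <= C * M &
  forall phi, test_fun [set x | `|x| <= 1] phi -> T (Ls phi) = - phi 0].
Proof.
have [C [k [C0 estimate]]] := test_fun_estimate sysX hypo_tr n_gt0.
pose p (f : 'rV[R]_n -> R) (M : R) := smooth f /\ Ck_bound k f (M / C).
have p_scale f M : smooth f -> Ck_bound k f M -> p f (C * M).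
  by move=> sf fM; split; [exact: sf|rewrite mulrAC mulfV ?mul1r // gt_eqF].
have p0 : p (fun=> 0) 0.
  by split; [exact: (test_fun0 setT).1|move=> s x _; rewrite partials0 normr0 mul0r].
have pZ a f M : p f M -> p (fun x => a * f x) (`|a| * M).
  move=> [sf fM]; split; first exact: (smooth_onZ a openT sf).
  by move=> s x sk; rewrite (partialsZ s a x sf) normrM -mulrA ler_wpM2l // fM.
have pD f g M M' : p f M -> p g M' -> p (fun x => f x + g x) (M + M').
  move=> [sf fM] [sg gM]; split; first exact: (smooth_onD openT sf sg).
  have := Ck_bound_scale_add 1 sf sg fM gM; rewrite normr1 mul1r -mulrDl.
  by congr (Ck_bound k _ _); apply/funext => x; rewrite mul1r.
pose G := [set v : ('rV[R]_n -> R) * R | exists2 phi, test_fun [set x | `|x| <= 1] phi &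
  v = (Ls phi, - phi 0)].
have domG : dominated_graph p G.
  split=> [a _ _ [phi tphi ->] [psi tpsi ->]|f y M [phi [sphi [K [_ K1 Kphi]]] [-> ->]] [_ phiM]|].
  - exists (fun x => a * phi x + psi x); first exact: test_fun_scale_add.
    congr pair; last by rewrite /=; ring.
    by apply/funext => x; rewrite /= (hom_op_scale_add w sX nu _ a x tphi.1 tpsi.1).
  - have phi1 : supported_in [set x | `|x| <= 1] phi by move=> x nx; apply: Kphi => /K1.
    have := estimate phi (M / C) sphi phi1 phiM 0; rewrite mulrCA mulfV ?gt_eqF // mulr1.
    by apply: le_trans; rewrite -normrN ler_norm.
  - exists (fun=> 0); first exact: test_fun0.
    by congr pair; [apply/funext => x; rewrite hom_op0|rewrite oppr0].
have [T [TG T_le T_lin]] := hahn_banach p0 pZ pD domG.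
exists T, C, k; split=> [a f g tf tg|f M sf fM|phi tphi].
- have [M _ fM] := Ck_bound_test k tf; have [M' _ gM] := Ck_bound_test k tg.
  exact: (T_lin a f g _ _ (p_scale _ _ tf.1 fM) (p_scale _ _ tg.1 gM)).
- by apply: T_le; exact: p_scale.
- by apply: TG; exists phi.
Qed.

Section rescaled_limit.
Variables (T : ('rV[R]_n -> R) -> R) (C : R) (k : nat).
Hypothesis T_lin : test_linear setT T.
Hypothesis T_le : forall f M, smooth f -> Ck_bound k f M -> `|T f| <= C * M.
Hypothesis T_sol : forall phi, test_fun [set x | `|x| <= 1] phi -> T (Ls phi) = - phi 0.

Let W : set 'rV[R]_n := [set x | `|x| < 1].
Let oW : open W. Proof. exact: open_norm_lt0. Qed.

Let test_fun_dil (l : R) phi : 0 < l -> test_fun setT phi -> test_fun setT (phi \o dil l).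
Proof. by move=> l0; exact: test_fun_dilation. Qed.

Let pow_ge1 j : 1 <= 2 ^+ j :> R. Proof. by rewrite exprn_ege1 // ler1n. Qed.
Let pow_gt0 j : 0 < 2 ^+ j :> R. Proof. by rewrite exprn_gt0. Qed.

Let T_dilation_le j f M : smooth f -> Ck_bound k f M ->
  `|T (f \o dil (2 ^+ j))| <= C * ((2 ^+ j) ^+ (k * Q) * M).
Proof.
move=> sf fM; apply: T_le; first exact: (smooth_comp sf (smooth_dilation e _)).
by have := Ck_bound_dilation e sf (ltW (pow_gt0 j)) fM; rewrite max_r.
Qed.

Let T_sol_dilation (l r : R) phi : 1 <= l -> r <= l -> test_fun setT phi ->
  supported_in [set x | `|x| <= r] phi -> l ^+ nu * T (Ls phi \o dil l) = - phi 0.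
Proof.
move=> l1 rl tphi rphi; have l0 : 0 < l by exact: lt_le_trans l1.
rewrite -(test_linearZ _ T_lin); last exact: test_fun_dil l0 (test_fun_hom_op w nu _ sX tphi).
rewrite (_ : (fun x => _) = Ls (phi \o dil l)); last first.
  by apply/funext => x; rewrite (hom_op_dilation sX (hsys_homogeneous sysX)) //; exact: tphi.1.
rewrite T_sol /= ?dilation0 //.
apply: supported_test_fun;
  [exact: compact_closed_ball_rV|exact: (smooth_comp tphi.1 (smooth_dilation e l))|].
move=> x /= nx; apply: (supported_in_dilation e_gt0 l1 rphi) => /= xr; apply: nx.
by apply: le_trans xr _; rewrite ler_pdivrMr // mul1r.
Qed.

Definition scaling_defect (phi : 'rV[R]_n -> R) : R := 2 ^+ nu * T (phi \o dil 2) - T phi.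

Lemma scaling_defect_smooth : dist_smooth_on W scaling_defect.
Proof.
apply: (hypo oW oW (@subset_refl _ W)).
  split=> [a f g /test_fun_setT tf /test_fun_setT tg|K cK KW].
    rewrite /scaling_defect T_lin // [T (_ \o dil 2)](T_lin a (test_fun_dil _ tf) (test_fun_dil _ tg)) //.
    by ring.
  exists (2 ^+ nu * (C * 2 ^+ (k * Q)) + C), k => f sf Kf M fM.
  apply: le_trans (ler_normB _ _) _; rewrite mulrDl lerD //; last exact: T_le.
  rewrite normrM ger0_norm ?exprn_ge0 // -!mulrA ler_wpM2l ?exprn_ge0 //.
  by have := T_dilation_le 1 sf fM; rewrite expr1.
exists (fun=> 0) => [|phi tphi]; first exact: smooth_on_cst.
under eq_Rintegral do rewrite mul0r; rewrite /Rintegral integral0.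
have tphi1 : test_fun [set x | `|x| <= 1] phi by apply: test_fun_sub tphi => x /ltW.
have phi1 : supported_in [set x | `|x| <= 1] phi.
  by have [_ [K [_ K1 Kphi]]] := tphi1; move=> x nx; apply: Kphi => /K1.
rewrite /dist_hom_op /scaling_defect (T_sol tphi1) (T_sol_dilation _ _ _ phi1) ?ler1n //.
  by rewrite subrr.
exact: test_fun_setT tphi.
Qed.

Lemma scaling_defect_le : exists2 D : R, 0 < D & forall phi, test_fun setT phi ->
  supported_in [set x | `|x| <= 2^-1] phi -> `|scaling_defect phi| <= D * \int[leb]_x `|phi x|.
Proof.
have [h sh defectE] := scaling_defect_smooth.
have half_W : [set x : 'rV[R]_n | `|x| <= 2^-1] `<=` W.
  by move=> x /= x_le; apply: le_lt_trans x_le _; rewrite invf_lt1 // ltr1n.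
have cB := @compact_closed_ball_rV R n 2^-1.
have [D D0 h_le] := compact_continuous_bound cB (fun x xB => smooth_on_continuous sh (half_W x xB)).
exists D => // phi tphi Bphi; have int_phi := Rintegrable_abs (test_fun_integrable tphi).
have int_h : Rintegrable leb (fun x => h x * phi x).
  apply: (continuous_on_mul_integrable oW _ (smooth_continuous tphi.1) cB half_W Bphi) => x.
  exact: smooth_on_continuous.
rewrite defectE; last exact: test_fun_sub half_W (supported_test_fun cB tphi.1 Bphi).
rewrite -RintegralZl //; apply: norm_Rintegral_le;
  [exact: Rintegrable_measurable int_h|exact: RintegrableZ|].
move=> x; have [xB|/Bphi ->] := pselect (`|x| <= 2^-1); last by rewrite mulr0 normr0 mulr0.
by rewrite normrM ler_wpM2r // h_le.
Qed.

Definition rescaled (phi : 'rV[R]_n -> R) (j : nat) : R := 2 ^+ (nu * j) * T (phi \o dil (2 ^+ j)).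

Lemma rescaledS phi j : rescaled phi j.+1 - rescaled phi j =
  2 ^+ (nu * j) * scaling_defect (phi \o dil (2 ^+ j)).
Proof.
rewrite /rescaled /scaling_defect mulnS exprD.
have -> : (phi \o dil (2 ^+ j)) \o dil 2 = phi \o dil (2 ^+ j.+1).
  by apply/funext => x; rewrite /= dilation_dilation exprSr.
by ring.
Qed.

Lemma rescaled_cvg : exists2 D : R, 0 < D & forall phi (r : R) j0, test_fun setT phi ->
  supported_in [set x | `|x| <= r] phi -> 2 * r <= 2 ^+ j0 ->
  exists2 l : R, rescaled phi @ \oo --> l & `|l - rescaled phi j0| <= D * \int[leb]_x `|phi x| * 2.
Proof.
have [D D0 defect_le] := scaling_defect_le; exists D => // phi r j0 tphi rphi rj0.
have mass0 : 0 <= \int[leb]_x `|phi x| by apply: Rintegral_ge0.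
apply: geometric_cauchy => j j0j; have tj := test_fun_dil (pow_gt0 j) tphi.
have rj : 2 * r <= 2 ^+ j by apply: le_trans rj0 _; rewrite ler_weXn2l // ler1n.
have halfj : supported_in [set x | `|x| <= 2^-1] (phi \o dil (2 ^+ j)).
  move=> x nx; apply: (supported_in_dilation e_gt0 (pow_ge1 j) rphi) => /= xr; apply: nx => /=.
  by apply: le_trans xr _; rewrite ler_pdivrMr //; lra.
rewrite rescaledS normrM ger0_norm ?exprn_ge0 //.
apply: le_trans (ler_wpM2l (exprn_ge0 _ (ler0n R 2)) (defect_le _ tj halfj)) _.
rewrite /comp Rintegral_norm_dilation2 // mulrCA -!mulrA ler_wpM2l ?(ltW D0) // mulrCA ler_wpM2l //.
rewrite mulnC (_ : (j * Q = j * nu + j * (Q - nu))%N); last by rewrite -mulnDr subnKC // ltnW.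
rewrite exprD mulrA -exprMn mulfV // expr1n mul1r ler_wiXn2l ?invr_ge0 ?invf_le1 ?ler1n //.
by rewrite -{1}[j]muln1 leq_mul2l subn_gt0 nu_lt orbT.
Qed.

Definition rescaled_lim (phi : 'rV[R]_n -> R) : R := lim (rescaled phi @ \oo).

Lemma cvg_rescaled_lim phi : test_fun setT phi -> rescaled phi @ \oo --> rescaled_lim phi.
Proof.
move=> tphi; have [D _ rescaled_near] := rescaled_cvg; have [r r0 rphi] := test_fun_supported_ball tphi.
have [j0 rj0] := exists_expr2_ge (2 * r); have [l phi_l _] := rescaled_near _ r j0 tphi rphi rj0.
by rewrite /rescaled_lim (cvg_lim _ phi_l).
Qed.

Lemma rescaled_lim_distribution : distribution_on setT rescaled_lim.
Proof.
split=> [b f g tf tg|K cK _].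
  apply: (@cvg_seq_unique _ (rescaled (fun x => b * f x + g x)) (fun j => b * rescaled f j + rescaled g j)).
  - move=> j; rewrite /rescaled [T _](T_lin b (test_fun_dil (pow_gt0 j) tf) (test_fun_dil (pow_gt0 j) tg)).
    by ring.
  - by apply: cvg_rescaled_lim; exact: test_fun_scale_add.
  - by apply: cvgD; [apply: cvgM; [exact: cvg_cst|exact: cvg_rescaled_lim]|exact: cvg_rescaled_lim].
have [D D0 rescaled_near] := rescaled_cvg; have [r r0 Kr] := compact_norm_bound cK.
have [j0 rj0] := exists_expr2_ge (2 * r).
have int_K := Rintegrable_indic_compact cK.
exists (D * (\int[leb]_x \1_K x) * 2 + 2 ^+ (nu * j0) * (C * (2 ^+ j0) ^+ (k * Q))), k => f sf Kf M fM.
have tf : test_fun setT f := test_fun_setT (supported_test_fun cK sf Kf).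
have rf : supported_in [set x | `|x| <= r] f by move=> x nx; apply: Kf => /Kr.
have [l f_l l_le] := rescaled_near _ r j0 tf rf rj0.
have -> : rescaled_lim f = l by rewrite /rescaled_lim (cvg_lim _ f_l).
have mass_le : \int[leb]_x `|f x| <= M * \int[leb]_x \1_K x.
  rewrite -RintegralZl //; apply: le_Rintegral => //; [|exact: RintegrableZ|].
    exact: (Rintegrable_abs (test_fun_integrable tf)).
  move=> x _; rewrite indicE; have [Kx|nKx] := pselect (K x).
    by rewrite mem_set // mulr1; exact: (fM [::]).
  by rewrite memNset // Kf // normr0 mulr0.
have term_le : `|rescaled f j0| <= 2 ^+ (nu * j0) * (C * (2 ^+ j0) ^+ (k * Q)) * M.
  rewrite normrM ger0_norm ?exprn_ge0 // -mulrA ler_wpM2l ?exprn_ge0 // -mulrA.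
  exact: T_dilation_le.
rewrite -[l](subrK (rescaled f j0)) mulrDl; apply: le_trans (ler_normD _ _) _; apply: lerD => //.
by apply: le_trans l_le _; have := ler_wpM2l (ltW D0) mass_le; lra.
Qed.

Lemma rescaled_lim_solution phi : test_fun setT phi -> rescaled_lim (Ls phi) = - phi 0.
Proof.
move=> tphi; have [r r0 rphi] := test_fun_supported_ball tphi.
have [j0 rj0] := exists_expr2_ge r.
have := cvg_rescaled_lim (test_fun_hom_op w nu (transpose_coef c) sX tphi).
move=> /(cvg_lim (@Rhausdorff R)) <-; apply: lim_near_cst => //; exists j0 => // j /= j0j.
rewrite /rescaled mulnC exprM (T_sol_dilation (pow_ge1 j) _ tphi rphi) //.
by apply: le_trans rj0 _; rewrite ler_weXn2l // ler1n.
Qed.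

Lemma rescaled_lim_dilation2 phi : test_fun setT phi ->
  rescaled_lim (phi \o dil 2) * 2 ^+ nu = rescaled_lim phi.
Proof.
move=> tphi.
apply: (@cvg_seq_unique _ (fun j => rescaled (phi \o dil 2) j * 2 ^+ nu) (fun j => rescaled phi j.+1)).
- move=> j; rewrite /rescaled mulnS exprD.
  have -> : (phi \o dil 2) \o dil (2 ^+ j) = phi \o dil (2 ^+ j.+1).
    by apply/funext => x; rewrite /= dilation_dilation exprS.
  by ring.
- by apply: cvgM; [apply: cvg_rescaled_lim; exact: test_fun_dil|exact: cvg_cst].
- by have := cvg_rescaled_lim tphi; rewrite -(cvg_shiftS (rescaled phi)).
Qed.

End rescaled_limit.

Lemma homogeneous_distribution : exists S : ('rV[R]_n -> R) -> R, [/\ distribution_on setT S,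
  forall phi, test_fun setT phi -> S (Ls phi) = - phi 0 &
  forall phi, test_fun setT phi -> S (phi \o dil 2) * 2 ^+ nu = S phi].
Proof.
have [T [C [k [T_lin T_le T_sol]]]] := local_solution.
exists (rescaled_lim T); split.
- exact: (rescaled_lim_distribution T_lin T_le T_sol).
- exact: (rescaled_lim_solution T_lin T_le T_sol).
- exact: (rescaled_lim_dilation2 T_lin T_le T_sol).
Qed.

Section distribution_kernel.
Variable S : ('rV[R]_n -> R) -> R.
Hypothesis S_dist : distribution_on setT S.
Hypothesis S_sol : forall phi, test_fun setT phi -> S (Ls phi) = - phi 0.
Hypothesis S_dil : forall phi, test_fun setT phi -> S (phi \o dil 2) * 2 ^+ nu = S phi.

Let W : set 'rV[R]_n := [set x | x != 0].
Let oW : open W. Proof. exact: open_neq_normed. Qed.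
Let two0 : 0 < 2 :> R. Proof. by []. Qed.
Let half0 : 0 < 2^-1 :> R. Proof. by rewrite invr_gt0. Qed.

Let W_dil (l : R) x : 0 < l -> W x -> W (dil l x).
Proof. by move=> l0 /eqP x0; apply/eqP => /dilation_eq0 dil0; apply: x0; apply: dil0; rewrite gt_eqF. Qed.

Let pow_split : 2 ^+ Q = 2 ^+ nu * 2 ^+ (Q - nu) :> R.
Proof. by rewrite -exprD subnKC // ltnW. Qed.

Let half_dilK (phi : 'rV[R]_n -> R) : (phi \o dil 2^-1) \o dil 2 = phi.
Proof. by apply/funext => x; rewrite /= dilationK. Qed.

Lemma distribution_kernel_off0 : exists K : 'rV[R]_n -> R, [/\ smooth_on W K, K 0 = 0,
  measurable_fun setT K & forall phi, test_fun W phi -> S phi = \int[leb]_x (K x * phi x)].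
Proof.
have [K sK SK] : dist_smooth_on W S.
  apply: (hypo openT oW (@subsetT _ W)) => //; exists (fun=> 0); first exact: smooth_on_cst.
  move=> phi tphi; under eq_Rintegral do rewrite mul0r.
  rewrite /Rintegral integral0 /dist_hom_op S_sol; last exact: test_fun_setT tphi.
  by have [_ [A [_ AW Aphi]]] := tphi; rewrite Aphi ?oppr0 // => /AW; rewrite /W /= eqxx.
exists (K \_ W); split.
- by apply: (smooth_on_ext oW _ sK) => x Wx; rewrite patchE mem_set.
- by rewrite patchE memNset // /W /= eqxx.
- by apply: measurable_restrict_open_rV => // x Wx; exact: (smooth_on_continuous sK Wx).
- by move=> phi tphi; rewrite SK // Rintegral_patch_test.
Qed.

Lemma distribution_kernel_dilation2 (K : 'rV[R]_n -> R) : smooth_on W K -> measurable_fun setT K ->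
  (forall phi, test_fun W phi -> S phi = \int[leb]_x (K x * phi x)) ->
  forall x, W x -> K (dil 2 x) * 2 ^+ (Q - nu) = K x.
Proof.
move=> sK mK SK; have cK y : W y -> {for y, continuous K} by exact: smooth_on_continuous.
have cKdil y : W y -> {for y, continuous (fun y => K (dil 2 y))}.
  move=> Wy; apply: (@continuous_comp _ _ _ (dil 2) K); last exact: (cK _ (W_dil two0 Wy)).
  exact: (smooth_map_continuous (smooth_dilation e 2)).
apply: (fundamental_lemma_eq oW _ cK) => [y Wy|phi tphi].
  by apply: continuous_atM; [exact: cKdil|exact: continuous_at_cst].
have thalf : test_fun W (phi \o dil 2^-1).
  by apply: test_fun_dilation => // y Wy; rewrite invrK; exact: W_dil.
have scaled : \int[leb]_x (K x * phi x) * 2 ^+ nu = 2 ^+ Q * \int[leb]_x (K (dil 2 x) * phi x).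
  rewrite -SK // -{1}(half_dilK phi) S_dil; last exact: test_fun_setT thalf.
  rewrite SK // (Rintegral_dilation e two0); last first.
    by apply: measurable_funM => //; exact: (continuous_measurable_rV (smooth_continuous thalf.1)).
  by congr (_ * _); apply: eq_Rintegral => y _; rewrite /= dilationK.
have [sphi [A [cA AW Aphi]]] := tphi.
have int_dil := continuous_on_mul_integrable oW cKdil (smooth_continuous sphi) cA AW Aphi.
apply: (@mulIf _ (2 ^+ nu)); first by rewrite expf_neq0.
rewrite scaled pow_split -[RHS]mulrA -RintegralZl // mulrC; congr (_ * _).
by apply: eq_Rintegral => y _; rewrite mulrAC mulrC.
Qed.

Lemma homogeneous_kernel_pairing_half (K phi : 'rV[R]_n -> R) d : homogeneous_kernel e d K ->
  test_fun setT phi ->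
  2 ^+ d * \int[leb]_x (K x * (phi \o dil 2^-1) x) = 2 ^+ Q * \int[leb]_x (K x * phi x).
Proof.
move=> [_ K0 homK LK] tphi; have int_phi := L1loc_test LK tphi.
have sphi := smooth_comp tphi.1 (smooth_dilation e 2^-1).
rewrite (Rintegral_dilation e two0); last first.
  by apply: measurable_funM LK.1 _; exact: (continuous_measurable_rV (smooth_continuous sphi)).
rewrite (_ : \int[leb]_x _ = (2 ^+ d)^-1 * \int[leb]_x (K x * phi x)).
  by rewrite mulrCA mulVKf // expf_neq0.
rewrite -RintegralZl //; apply: eq_Rintegral => x _; rewrite /= dilationK //.
have [->|x0] := eqVneq x 0; first by rewrite dilation0 K0 !mul0r mulr0.
by rewrite -(homK x x0) mulrA [_ * 2 ^+ d]mulrC mulKf // expf_neq0.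
Qed.

Lemma distribution_kernel : exists2 K : 'rV[R]_n -> R, homogeneous_kernel e (Q - nu) K &
  forall phi, test_fun setT phi -> S phi = \int[leb]_x (K x * phi x).
Proof.
have [K [sK K0 mK SK]] := distribution_kernel_off0.
have homK := distribution_kernel_dilation2 sK mK SK.
have d_lt : (Q - nu < Q)%N by rewrite ltn_subrL nu_gt0 (leq_ltn_trans _ nu_lt).
have LK : L1loc K.
  apply: (L1loc_homogeneous e_gt0 homK _ d_lt mK K0) => x x0.
  exact: (smooth_on_continuous sK x0).
have kerK : homogeneous_kernel e (Q - nu) K by split.
exists K => // phi tphi; apply/eqP; rewrite -subr_eq0; apply/eqP.
move: phi tphi; apply: (homogeneous_supported_at0_eq0 nu_gt0) => [|psi tpsi|psi tpsi].
- exact: (distribution_sub S_dist (L1loc_distribution setT LK)).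
- by rewrite SK // subrr.
- have thalf : test_fun setT (psi \o dil 2^-1) by exact: test_fun_dilation.
  rewrite mulrBl -{1}(half_dilK psi) S_dil //; congr (_ - _).
  apply: (@mulfI _ (2 ^+ (Q - nu))); first by rewrite expf_neq0.
  by rewrite (homogeneous_kernel_pairing_half kerK tpsi) pow_split; ring.
Qed.

End distribution_kernel.

Lemma homogeneous_fundamental_kernel : exists2 K : 'rV[R]_n -> R, homogeneous_kernel e (Q - nu) K &
  forall phi, test_fun setT phi -> \int[leb]_x (K x * Ls phi x) = - phi 0.
Proof.
have [S [S_dist S_sol S_dil]] := homogeneous_distribution.
have [K kerK SK] := distribution_kernel S_dist S_sol S_dil.
by exists K => // phi tphi; rewrite -SK ?S_sol //; exact: test_fun_hom_op.
Qed.

End homogeneous_fundamental_solution.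

(** * Geometry of the lifting *)

Section projectable_fields.
Context {R : realType} (n k : nat).

Definition vf_projects (Xt : @vfield R (n + k)) (X : @vfield R n) : Prop :=
  forall z, lsubmx (Xt z) = X (lsubmx z).

Lemma vfapp_lsubmx (Xt : @vfield R (n + k)) (X : @vfield R n) (g : 'rV[R]_n -> R) z :
  vf_projects Xt X -> vfapp Xt (fun z => g (lsubmx z)) z = vfapp X g (lsubmx z).
Proof.
move=> proj; rewrite /vfapp big_split_ord /= [X in _ + X]big1 ?addr0; last first.
  by move=> i _; rewrite partial_lsubmx_r mulr0.
by apply: eq_bigr => i _; rewrite partial_lsubmx_l -proj mxE.
Qed.

Section lifted_words.
Variables (m : nat) (Xt : 'I_m -> @vfield R (n + k)) (X : 'I_m -> @vfield R n).
Hypothesis proj : forall j, vf_projects (Xt j) (X j).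

Lemma vf_word_lsubmx I (g : 'rV[R]_n -> R) :
  vf_word Xt I (fun z => g (lsubmx z)) = (fun z => vf_word X I g (lsubmx z)).
Proof.
elim: I => //= i I ->; apply/funext => z.
exact: (@vfapp_lsubmx (Xt i) (X i) (vf_word X I g) z (proj i)).
Qed.

Lemma hom_op_lsubmx w nu c (g : 'rV[R]_n -> R) :
  hom_op Xt w nu c (fun z => g (lsubmx z)) = (fun z => hom_op X w nu c g (lsubmx z)).
Proof.
apply/funext => z; apply: eq_bigr => l _; apply: eq_bigr => I _.
by rewrite vf_word_lsubmx.
Qed.

Lemma lie_bracket_projects (Yt Zt : @vfield R (n + k)) (Y Z : @vfield R n) :
  vf_projects Yt Y -> vf_projects Zt Z -> vf_projects (lie_bracket Yt Zt) (lie_bracket Y Z).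
Proof.
move=> YtY ZtZ z; apply/rowP => j; rewrite !mxE.
have YE : (fun y => Yt y 0 (lshift k j)) = (fun y => Y (lsubmx y) 0 j).
  by apply/funext => y; rewrite -YtY mxE.
have ZE : (fun y => Zt y 0 (lshift k j)) = (fun y => Z (lsubmx y) 0 j).
  by apply/funext => y; rewrite -ZtZ mxE.
by rewrite YE ZE (vfapp_lsubmx (fun y => Z y 0 j) _ YtY) (vfapp_lsubmx (fun y => Y y 0 j) _ ZtZ).
Qed.

Lemma lie_generated_projects Z : lie_generated Xt Z -> exists Y, vf_projects Z Y.
Proof.
elim=> [j||Yt Zt _ [Y YtY] _ [Z' ZtZ]|a Yt _ [Y YtY]|Yt Zt _ [Y YtY] _ [Z' ZtZ]].
- by exists (X j).
- by exists (fun=> 0) => z; apply/rowP => i; rewrite !mxE.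
- by exists (fun x => Y x + Z' x) => z; rewrite lsubmx_add YtY ZtZ.
- by exists (fun x => a *: Y x) => z; rewrite -YtY; apply/rowP => i; rewrite !mxE.
- by exists (lie_bracket Y Z'); exact: lie_bracket_projects.
Qed.

End lifted_words.

End projectable_fields.

Section homogeneous_groups.
Context {R : realType} (N : nat) (e : 'I_N -> nat) (mul : 'rV[R]_N -> 'rV[R]_N -> 'rV[R]_N)
  (inv : 'rV[R]_N -> 'rV[R]_N).
Hypothesis hg : homogeneous_group e mul inv.
Local Notation leb := (@lebesgue_rV R N).
Let e_gt0 := hg_exp_gt0 hg.

Lemma smooth_mul k (F G : 'rV[R]_k -> 'rV[R]_N) : smooth_map F -> smooth_map G ->
  smooth_map (fun x => mul (F x) (G x)).
Proof.
move=> sF sG j; have := smooth_map_comp (hg_mul_smooth hg) (smooth_map_row_mx sF sG).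
by move=> /(_ j); under eq_fun do rewrite row_mxKl row_mxKr.
Qed.

Lemma smooth_inv k (F : 'rV[R]_k -> 'rV[R]_N) : smooth_map F -> smooth_map (fun x => inv (F x)).
Proof. by move=> sF; exact: (smooth_map_comp (hg_inv_smooth hg) sF). Qed.

Lemma group_mulKV a x : mul a (mul (inv a) x) = x.
Proof. by rewrite (hg_mulA hg) (hg_mulxV hg) (hg_mul0x hg). Qed.

Lemma group_mulVK a x : mul (inv a) (mul a x) = x.
Proof. by rewrite (hg_mulA hg) (hg_mulVx hg) (hg_mul0x hg). Qed.

Lemma group_inv_unique a b : mul a b = 0 -> b = inv a.
Proof. by move=> ab; rewrite -(group_mulVK a b) ab (hg_mulx0 hg). Qed.

Lemma group_inv0 : inv 0 = 0.
Proof. by apply/esym/group_inv_unique; rewrite (hg_mul0x hg). Qed.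

Lemma group_invK a : inv (inv a) = a.
Proof. by apply/esym/group_inv_unique; rewrite (hg_mulVx hg). Qed.

Lemma group_invM a b : inv (mul a b) = mul (inv b) (inv a).
Proof.
apply/esym/group_inv_unique.
by rewrite -(hg_mulA hg) [mul b _](hg_mulA hg) (hg_mulxV hg) (hg_mul0x hg) (hg_mulxV hg).
Qed.

Lemma group_inv_dilation (l : R) x : 0 < l -> inv (dilation e l x) = dilation e l (inv x).
Proof.
move=> l0; apply/esym/group_inv_unique.
by rewrite -(hg_dilation hg) // (hg_mulxV hg) dilation0.
Qed.

Lemma partial_mul_l0 i j :
  partial (lshift N j) (fun z : 'rV[R]_(N + N) => mul (lsubmx z) (rsubmx z) 0 i) 0 = (i == j)%:R.
Proof.
rewrite -[RHS](_ : partial j (fun y : 'rV[R]_N => y 0 i) 0 = _); last by rewrite partial_coord eq_sym.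
apply: partial_line_eq => t; rewrite -(row_mx0 R 1 N N) -row_mx_line_l row_mxKl row_mxKr.
by rewrite (hg_mulx0 hg).
Qed.

Lemma partial_mul_r0 i j :
  partial (rshift N j) (fun z : 'rV[R]_(N + N) => mul (lsubmx z) (rsubmx z) 0 i) 0 = (i == j)%:R.
Proof.
rewrite -[RHS](_ : partial j (fun y : 'rV[R]_N => y 0 i) 0 = _); last by rewrite partial_coord eq_sym.
apply: partial_line_eq => t; rewrite -(row_mx0 R 1 N N) -row_mx_line_r row_mxKl row_mxKr.
by rewrite (hg_mul0x hg).
Qed.

Lemma partial_inv0 i j : partial j (fun z => inv z 0 i) 0 = - (i == j)%:R.
Proof.
have sid := @smooth_map_id R N; have sinv := hg_inv_smooth hg.
have := partial_smooth_comp j 0 (hg_mul_smooth hg i) (smooth_map_row_mx sid sinv).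
rewrite group_inv0 row_mx0.
have -> : (fun y => mul (lsubmx (row_mx y (inv y))) (rsubmx (row_mx y (inv y))) 0 i) = (fun=> 0 : R).
  by apply/funext => y; rewrite row_mxKl row_mxKr (hg_mulxV hg) mxE.
rewrite partial_cst big_split_ord /=.
rewrite (bigD1 i) //= big1 => [|l li]; last by rewrite partial_mul_l0 eq_sym (negbTE li) mul0r.
rewrite [X in _ + X](bigD1 i) //= [X in _ + (_ + X)]big1 => [|l li]; last first.
  by rewrite partial_mul_r0 eq_sym (negbTE li) mul0r.
rewrite partial_mul_l0 partial_mul_r0 eqxx !mul1r !addr0.
under eq_fun do rewrite row_mxEl; under [X in _ + partial _ X _]eq_fun do rewrite row_mxEr.
rewrite partial_coord eq_sym => /eqP; rewrite eq_sym addrC addr_eq0 => /eqP ->.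
by rewrite eq_sym.
Qed.

Lemma left_translation_preserves a : transports leb leb (mul a).
Proof.
have trans_mul : transports leb leb (fun z => (fun z => mul (lsubmx z) (rsubmx z)) (row_mx a z)).
  apply: (homogeneous_map_preserves e_gt0 e_gt0 (hg_mul_smooth hg) _ (b := fun=> false)).
    by move=> l z l0; rewrite lsubmx_dilation rsubmx_dilation -(hg_dilation hg).
  by move=> i j; rewrite partial_mul_r0 expr0 mulr1.
by move: trans_mul; rewrite (_ : (fun z => _) = mul a) //; apply/funext => z; rewrite row_mxKl row_mxKr.
Qed.

(* The left invariant field equal to the [k]-th coordinate field at the origin. *)
Definition left_field (k : 'I_N) : @vfield R N := fun x =>
  \row_i partial (rshift N k) (fun z : 'rV[R]_(N + N) => mul (lsubmx z) (rsubmx z) 0 i) (row_mx x 0).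

Lemma smooth_left_field k : smooth_map (left_field k).
Proof.
move=> i; under eq_fun do rewrite mxE.
apply: (smooth_comp (smooth_on_partial (rshift N k) (hg_mul_smooth hg i))).
exact: (smooth_map_row_mx (@smooth_map_id R N) (@smooth_map_cst R N N 0)).
Qed.

Lemma vfapp_left_field k u x : smooth u ->
  vfapp (left_field k) u x = partial k (fun y => u (mul x y)) 0.
Proof.
move=> su; have smx := smooth_mul (@smooth_map_cst R N N x) (@smooth_map_id R N).
rewrite (partial_smooth_comp k 0 su smx) (hg_mulx0 hg); apply: eq_bigr => i _.
rewrite mulrC !mxE; congr (_ * _); apply: partial_line_eq => t.
by rewrite -row_mx_line_r row_mxKl row_mxKr.
Qed.

Lemma left_field_invariant k : left_invariant mul (left_field k).
Proof.
split; first exact: smooth_left_field.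
move=> a u su x; have sma := smooth_mul (@smooth_map_cst R N N a) (@smooth_map_id R N).
rewrite (vfapp_left_field k x (smooth_comp su sma)) (vfapp_left_field k _ su).
by under eq_fun do rewrite /= (hg_mulA hg).
Qed.

Lemma left_field_homogeneous k i (l : R) x : 0 < l ->
  l ^+ e i * left_field k x 0 i = l ^+ e k * left_field k (dilation e l x) 0 i.
Proof.
move=> l0; rewrite !mxE.
have hom_mul (r : R) z : 0 < r -> r ^+ e i * mul (lsubmx z) (rsubmx z) 0 i =
    r ^+ 0 * (fun z => mul (lsubmx z) (rsubmx z) 0 i) (dilation (cat_exp e e) r z).
  by move=> r0; rewrite lsubmx_dilation rsubmx_dilation -(hg_dilation hg) // dilation_coord expr0 mul1r.
have := homogeneous_partial hom_mul (rshift N k) (row_mx x 0) (hg_mul_smooth hg i) l0.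
by rewrite add0n cat_exp_rshift dilation_row_mx dilation0.
Qed.

Lemma left_fields_const u : smooth u -> (forall k z, vfapp (left_field k) u z = 0) -> forall z, u z = u 0.
Proof.
move=> su u0 z; apply: (zero_partials_eq (P := predT) su) => // m y _.
have sy := smooth_mul (@smooth_map_cst R N N y) (@smooth_map_id R N).
have siy := smooth_mul (@smooth_map_cst R N N (inv y)) (@smooth_map_id R N).
rewrite (_ : u = fun x => (fun v => u (mul y v)) (mul (inv y) x)); last first.
  by apply/funext => x; rewrite group_mulKV.
rewrite (partial_smooth_comp m y (smooth_comp su sy) siy) big1 // => j _.
by rewrite (hg_mulVx hg) -(vfapp_left_field j y su) u0 mul0r.
Qed.

End homogeneous_groups.
Section lifted_group.
Context {R : realType} (n m p : nat) (sigma : 'I_n -> nat) (tau : 'I_p -> nat)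
  (X : 'I_m -> @vfield R n) (Xt : 'I_m -> @vfield R (n + p))
  (mul : 'rV[R]_(n + p) -> 'rV[R]_(n + p) -> 'rV[R]_(n + p)) (inv : 'rV[R]_(n + p) -> 'rV[R]_(n + p)).
Hypothesis hg : homogeneous_group (cat_exp sigma tau) mul inv.
Hypothesis gen : forall Z, left_invariant mul Z -> lie_generated Xt Z.
Hypothesis proj : forall j, vf_projects (Xt j) (X j).
Local Notation e := (cat_exp sigma tau).
Local Notation leb k := (@lebesgue_rV R k).

Lemma base_exp_gt0 i : (0 < sigma i)%N.
Proof. by have := hg_exp_gt0 hg (lshift p i); rewrite cat_exp_lshift. Qed.

Lemma fiber_exp_gt0 i : (0 < tau i)%N.
Proof. by have := hg_exp_gt0 hg (rshift n i); rewrite cat_exp_rshift. Qed.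

(* Left invariant fields project to the base, and by homogeneity the coefficient
   of weight [sigma i] of the projection only involves coordinates of smaller
   weight; this drives the induction. *)
Lemma fiber_invariant eta z : lsubmx (mul (row_mx 0 eta) z) = lsubmx z.
Proof.
set h := row_mx 0 eta.
suff coord_fixed (k : nat) (i : 'I_n) : (sigma i <= k)%N ->
  forall z, mul h z 0 (lshift p i) = z 0 (lshift p i).
  by apply/rowP => i; rewrite !mxE; exact: (coord_fixed (sigma i)).
elim: k i => [|k IHk] i ik {}z.
  by have := base_exp_gt0 i; rewrite ltnNge ik.
have sh := smooth_mul hg (@smooth_map_cst R (n + p) (n + p) h) (@smooth_map_id R (n + p)).
have sc : smooth (fun y : 'rV[R]_(n + p) => y 0 (lshift p i)) by exact: (smooth_on_coord _ openT).
pose g (y : 'rV[R]_(n + p)) : R := (-1) * y 0 (lshift p i) + mul h y 0 (lshift p i).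
have sg : smooth g by exact: (smooth_scale_add (-1) sc (sh (lshift p i))).
suff : g z = g 0.
  rewrite /g (hg_mulx0 hg) /h row_mxEl !mxE => /eqP.
  by rewrite mulr0 add0r mulN1r addrC subr_eq0 => /eqP.
apply: (left_fields_const hg sg) => l y.
rewrite (vfapp_scale_add _ (-1) _ sc (sh (lshift p i))) vfapp_coord.
have [_ inv_l] := left_field_invariant hg l.
have -> : vfapp (left_field mul l) (fun x => mul h x 0 (lshift p i)) y =
    left_field mul l (mul h y) 0 (lshift p i).
  by rewrite -vfapp_coord -(inv_l h _ sc y).
have [Y projY] := lie_generated_projects proj (gen (left_field_invariant hg l)).
have base_only v : left_field mul l v 0 (lshift p i) =
    left_field mul l (row_mx (lsubmx v) 0) 0 (lshift p i).
  by have := projY (row_mx (lsubmx v) 0); rewrite row_mxKl -projY => /rowP/(_ i); rewrite !mxE.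
pose f (x : 'rV[R]_n) := left_field mul l (row_mx x 0) 0 (lshift p i).
have sf : smooth f.
  apply: (smooth_comp (smooth_left_field hg l (lshift p i))).
  exact: (smooth_map_row_mx (@smooth_map_id R n) (@smooth_map_cst R n p 0)).
have hf (r : R) x : 0 < r -> r ^+ sigma i * f x = r ^+ e l * f (dilation sigma r x).
  move=> r0; have := left_field_homogeneous hg l (lshift p i) (row_mx x 0) r0.
  by rewrite cat_exp_lshift dilation_row_mx dilation0.
rewrite base_only [X in _ + X]base_only -!/(f _).
have -> : f (lsubmx (mul h y)) = f (lsubmx y); last by rewrite mulN1r addNr.
apply: (zero_partials_eq (P := fun j => (sigma i <= sigma j)%N) sf).
  move=> j x ij; apply: (homogeneous_partial_eq0 _ base_exp_gt0 hf sf).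
  by rewrite -[ltnLHS]add0n -addSn leq_add // (hg_exp_gt0 hg).
move=> j; rewrite -ltnNge => ji; rewrite !mxE; apply: IHk.
by rewrite -ltnS (leq_trans ji).
Qed.

Lemma fiber_translation_preserves z :
  transports (leb p) (leb p) (fun eta => rsubmx (mul (row_mx 0 eta) z)).
Proof.
pose F (v : 'rV[R]_((n + p) + p)) := rsubmx (mul (row_mx 0 (rsubmx v)) (lsubmx v)).
have sF : smooth_map F.
  apply: (smooth_map_comp (@smooth_map_rsubmx R n p)); apply: (smooth_mul hg).
    exact: (smooth_map_row_mx (smooth_map_cst _) (@smooth_map_rsubmx R _ _)).
  exact: smooth_map_lsubmx.
have transF : transports (leb p) (leb p) (fun eta => F (row_mx z eta)).
  apply: (homogeneous_map_preserves (hg_exp_gt0 hg) fiber_exp_gt0 sF _ (b := fun=> false)).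
    move=> l v l0; rewrite /F lsubmx_dilation rsubmx_dilation -[RHS](rsubmx_dilation sigma tau);
      congr rsubmx.
    by rewrite (hg_dilation hg) // dilation_row_mx dilation0.
  move=> i j; rewrite expr0 mulr1.
  rewrite -[RHS](_ : partial j (fun y : 'rV[R]_p => y 0 i) 0 = _); last by rewrite partial_coord eq_sym.
  apply: partial_line_eq => t; rewrite -(row_mx0 R 1 (n + p) p) -row_mx_line_r /F row_mxKl row_mxKr.
  by rewrite (hg_mulx0 hg) row_mxKr.
by move: transF; rewrite (_ : (fun eta => _) = (fun eta => rsubmx (mul (row_mx 0 eta) z))) //;
  apply/funext => eta; rewrite /F row_mxKl row_mxKr.
Qed.

Lemma fiber_inverse_preserves y :
  transports (leb p) (leb p) (fun eta => rsubmx (mul (inv (row_mx 0 eta)) (row_mx y 0))).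
Proof.
pose F (v : 'rV[R]_(n + p)) := rsubmx (mul (inv (row_mx 0 (rsubmx v))) (row_mx (lsubmx v) 0)).
have sF : smooth_map F.
  apply: (smooth_map_comp (@smooth_map_rsubmx R n p)); apply: (smooth_mul hg).
    apply: (smooth_inv hg); exact: (smooth_map_row_mx (smooth_map_cst _) (@smooth_map_rsubmx R _ _)).
  exact: (smooth_map_row_mx (@smooth_map_lsubmx R _ _) (smooth_map_cst _)).
have transF : transports (leb p) (leb p) (fun eta => F (row_mx y eta)).
  apply: (homogeneous_map_preserves base_exp_gt0 fiber_exp_gt0 sF _ (b := fun=> true)).
    move=> l v l0; rewrite /F lsubmx_dilation rsubmx_dilation -[RHS](rsubmx_dilation sigma tau);
      congr rsubmx.
    by rewrite (hg_dilation hg) // -(group_inv_dilation hg) // !dilation_row_mx !dilation0.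
  move=> i j; rewrite expr1 mulrN1.
  rewrite -[RHS](_ : partial (rshift n j) (fun z => inv z 0 (rshift n i)) 0 = _); last first.
    by rewrite (partial_inv0 hg) (inj_eq (@rshift_inj _ _)).
  apply: partial_line_eq => t; rewrite -(row_mx0 R 1 n p) -row_mx_line_r /F row_mxKl row_mxKr.
  by rewrite row_mx0 (hg_mulx0 hg) mxE.
by move: transF; rewrite
  (_ : (fun eta => _) = (fun eta => rsubmx (mul (inv (row_mx 0 eta)) (row_mx y 0)))) //;
  apply/funext => eta; rewrite /F row_mxKl row_mxKr.
Qed.

Lemma section_inverse_preserves x : transports (leb (n + p)) (leb (n + p))
  (fun v => mul (inv (row_mx (lsubmx v) 0)) (row_mx x (rsubmx v))).
Proof.
pose F (v : 'rV[R]_(n + (n + p))) :=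
  mul (inv (row_mx (lsubmx (rsubmx v)) 0)) (row_mx (lsubmx v) (rsubmx (rsubmx v))).
have sr := @smooth_map_rsubmx R n (n + p).
have slr := smooth_map_comp (@smooth_map_lsubmx R n p) sr.
have srr := smooth_map_comp (@smooth_map_rsubmx R n p) sr.
have sF : smooth_map F.
  apply: (smooth_mul hg); last exact: (smooth_map_row_mx (@smooth_map_lsubmx R _ _) srr).
  by apply: (smooth_inv hg); exact: (smooth_map_row_mx slr (smooth_map_cst _)).
have transF : transports (leb (n + p)) (leb (n + p)) (fun v => F (row_mx x v)).
  apply: (homogeneous_map_preserves base_exp_gt0 (hg_exp_gt0 hg) sF _
    (b := fun i => if fintype.split i is inl _ then true else false)).
    move=> l v l0; rewrite /F !(lsubmx_dilation, rsubmx_dilation).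
    by rewrite (hg_dilation hg) // -(group_inv_dilation hg) // !dilation_row_mx !dilation0.
  move=> i j; case: (split_ordP j) => l ->.
    rewrite (_ : partial _ _ _ = partial (lshift p l) (fun z => inv z 0 i) 0).
      rewrite (partial_inv0 hg); case: (split_ordP i) => k ->; first by rewrite expr1 mulrN1.
      by rewrite eq_rlshift mul0r oppr0.
    apply: partial_line_eq => t; rewrite -(row_mx0 R 1 n (n + p)) -row_mx_line_r /F row_mxKl row_mxKr.
    by rewrite -(row_mx0 R 1 n p) -row_mx_line_l row_mxKl row_mxKr row_mx0 (hg_mulx0 hg).
  rewrite (_ : partial _ _ _ = partial (rshift n l) (fun z : 'rV[R]_(n + p) => z 0 i) 0).
    rewrite partial_coord eq_sym; case: (split_ordP i) => k ->; first by rewrite eq_lrshift mul0r.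
    by rewrite expr0 mulr1.
  apply: partial_line_eq => t; rewrite -(row_mx0 R 1 n (n + p)) -row_mx_line_r /F row_mxKl row_mxKr.
  by rewrite -(row_mx0 R 1 n p) -row_mx_line_r row_mxKl row_mxKr row_mx0 (group_inv0 hg) (hg_mul0x hg).
by move: transF; rewrite
  (_ : (fun v => _) = (fun v => mul (inv (row_mx (lsubmx v) 0)) (row_mx x (rsubmx v)))) //;
  apply/funext => v; rewrite /F row_mxKl row_mxKr.
Qed.

End lifted_group.

(** * Integration along the fibers *)

Section fiber_integrals.
Context {R : realType}.
Local Notation leb k := (@lebesgue_rV R k).

Lemma partials_dyadic n (e : 'I_n -> nat) (W : set 'rV[R]_n) (f : 'rV[R]_n -> R) d s :
  open W -> (forall x, W x -> W (dilation e 2 x)) -> smooth_on W f ->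
  (forall x, W x -> f (dilation e 2 x) * 2 ^+ d = f x) ->
  forall x, W x -> partials s f (dilation e 2 x) * 2 ^+ (d + \sum_(i <- s) e i) = partials s f x.
Proof.
move=> oW W2 sf f_dil; elim: s => [|i s IHs] x Wx; first by rewrite big_nil addn0 f_dil.
rewrite /= big_cons addnA [(d + e i)%N]addnC -addnA exprD.
have sp := smooth_on_partials s sf.
have -> : partial i (partials s f) x =
    partial i (fun y => 2 ^+ (d + \sum_(j <- s) e j) * (partials s f \o dilation e 2) y) x.
  by apply: (partial_eq_on i oW _ Wx) => y Wy; rewrite mulrC IHs.
have dil_der := is_derive_comp i oW sp (@smooth_dilation R n e 2) (Logic.I : setT x) (W2 x Wx).
rewrite (partialZ _ (@ex_derive _ _ _ _ _ _ _ dil_der)) (partial_dilation_on i oW sp (W2 x Wx)).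
by rewrite mulrC [2 ^+ e i * _]mulrC -mulrA.
Qed.

Section decay.
Variables (k p : nat) (e1 : 'I_k -> nat) (e2 : 'I_p -> nat) (F : 'rV[R]_k -> 'rV[R]_p -> R) (d : nat).
Hypothesis e1_gt0 : forall i, (0 < e1 i)%N.
Hypothesis e2_gt0 : forall i, (0 < e2 i)%N.
Hypothesis F_dil : forall x (xi : 'rV[R]_p), xi != 0 ->
  F (dilation e1 2 x) (dilation e2 2 xi) * 2 ^+ d = F x xi.
Hypothesis F_cont : forall x xi, `|x| <= 2^-1 -> 1 <= `|xi| ->
  {for row_mx x xi, continuous (fun v => F (lsubmx v) (rsubmx v))}.
Local Notation E := (\sum_i e2 i)%N.

Let half0 : 0 <= 2^-1 :> R. Proof. by rewrite invr_ge0. Qed.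

Lemma dyadic_shrink j x xi : xi != 0 ->
  F x xi = F (dilation e1 (2^-1 ^+ j) x) (dilation e2 (2^-1 ^+ j) xi) * 2^-1 ^+ (d * j).
Proof.
move=> xi0; elim: j => [|j IHj]; first by rewrite expr0 !dilation1 muln0 expr0 mulr1.
have shrink0 : dilation e2 (2^-1 ^+ j.+1) xi != 0.
  apply/eqP => /dilation_eq0 dil0; move/eqP: xi0; apply; apply: dil0.
  by rewrite expf_neq0 // invr_neq0.
rewrite IHj mulnSr exprD mulrA -(F_dil _ shrink0) !dilation_dilation exprS mulrA mulfV // mul1r.
by rewrite mulrAC -[_ * 2 ^+ d * _]mulrA -exprMn mulfV // expr1n mulr1 mulrC.
Qed.

Lemma unit_shell_bound : exists2 C : R, 0 < C & forall x xi, `|x| <= 2^-1 ->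
  1 <= `|xi| -> `|xi| <= 2 ^+ E -> `|F x xi| <= C.
Proof.
pose S : set 'rV[R]_(k + p) := [set v | `|lsubmx v| <= 2^-1 /\ `|rsubmx v| <= 2 ^+ E] `&`
  ~` ((@rsubmx R 1 k p) @^-1` [set y | `|y| < 1]).
have cbox : compact [set v : 'rV[R]_(k + p) | `|lsubmx v| <= 2^-1 /\ `|rsubmx v| <= 2 ^+ E].
  exact: (compact_row_mx (@compact_closed_ball_rV R k _) (@compact_closed_ball_rV R p _)).
have cS : compact S.
  apply: (subclosed_compact _ cbox); last by move=> v [].
  apply: closedI; first exact: compact_closed_normed.
  apply: open_closedC; apply: open_comp; first by move=> v _; exact: continuous_rsubmx.
  exact: open_norm_lt0.
have [v [[v1 _] /= v2]|C C0 FC] := @compact_continuous_bound _ _ S (fun v => F (lsubmx v) (rsubmx v)) cS.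
  by rewrite -[v]hsubmxK; apply: F_cont; rewrite // leNgt; apply/negP.
exists C => // x xi x1 xi1 xi2; have := FC (row_mx x xi); rewrite row_mxKl row_mxKr; apply.
by split; rewrite /= ?row_mxKl ?row_mxKr //; apply/negP; rewrite -leNgt.
Qed.

Lemma shell_decay : exists2 C : R, 0 < C & forall (r : R) j x xi, `|x| <= r -> 2 * r <= 2 ^+ j ->
  1 <= `|dilation e2 (2^-1 ^+ j) xi| -> `|dilation e2 (2^-1 ^+ j.+1) xi| < 1 ->
  `|F x xi| <= C * 2^-1 ^+ (d * j).
Proof.
have [C C0 FC] := unit_shell_bound; exists C => // r j x xi xr rj outside inside.
have xi0 : xi != 0.
  by apply/eqP => xi0; move: outside; rewrite xi0 dilation0 normr0 leNgt ltr01.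
rewrite (dyadic_shrink j x xi0) normrM [`|2^-1 ^+ _|]ger0_norm ?exprn_ge0 //.
rewrite ler_wpM2r ?exprn_ge0 //; apply: FC => //.
  apply: le_trans (norm_dilation_le _ e1_gt0 _) _.
    by rewrite exprn_ge0 ?exprn_ile1 ?invf_le1 ?ler1n.
  rewrite exprVn mulrC ler_pdivrMr ?exprn_gt0 //; apply: le_trans xr _; lra.
have -> : dilation e2 (2^-1 ^+ j) xi = dilation e2 2 (dilation e2 (2^-1 ^+ j.+1) xi).
  by rewrite dilation_dilation exprS mulrA mulfV // mul1r.
apply: le_trans (norm_dilation_le_expr _ _ _) _; first by rewrite ler1n.
by rewrite -[leRHS]mulr1 ler_wpM2l ?exprn_ge0 // ltW.
Qed.

Lemma outer_shell_index (j0 : nat) (xi : 'rV[R]_p) : 2 ^+ (j0 * E) <= `|xi| ->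
  exists2 j, (j0 <= j)%N &
  1 <= `|dilation e2 (2^-1 ^+ j) xi| /\ `|dilation e2 (2^-1 ^+ j.+1) xi| < 1.
Proof.
move=> xi_ge; have [|j [outside inside]] := dyadic_outer_shell e2_gt0 (x := xi).
  by apply: le_trans xi_ge; rewrite exprn_ege1 // ler1n.
exists j => //; rewrite leqNgt; apply/negP => jj0.
move: xi_ge; apply/negP; rewrite -ltNge.
have -> : xi = dilation e2 (2 ^+ j.+1) (dilation e2 (2^-1 ^+ j.+1) xi).
  by rewrite dilation_dilation -exprMn mulfV // expr1n dilation1.
apply: le_lt_trans (norm_dilation_le_expr _ _ _) _; first by rewrite exprn_ege1 // ler1n.
rewrite -exprM; apply: lt_le_trans (_ : 2 ^+ (j.+1 * E) <= _).
  by rewrite -[ltRHS]mulr1 ltr_pM2l // exprn_gt0.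
by rewrite ler_weXn2l ?ler1n // leq_mul2r jj0 orbT.
Qed.

Lemma outer_decay : exists2 C : R, 0 < C & forall r s : R, exists2 rho : R, 0 < rho &
  forall x xi, `|x| <= r -> rho <= `|xi| -> exists j, [/\ s <= 2 ^+ j,
    `|dilation e2 (2^-1 ^+ j.+1) xi| <= 1 & `|F x xi| <= C * 2^-1 ^+ (d * j)].
Proof.
have [C C0 FC] := shell_decay; exists C => // r s.
have [j0] := exists_expr2_ge (Num.max s (2 * `|r|)); rewrite ge_max => /andP[sj0 rj0].
exists (2 ^+ (j0 * E)) => [|x xi xr /outer_shell_index[j j0j [outside inside]]]; first by rewrite exprn_gt0.
have pow_le : 2 ^+ j0 <= 2 ^+ j :> R by rewrite ler_weXn2l // ler1n.
exists j; split; [exact: le_trans pow_le|exact: ltW|].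
by apply: (FC `|r|) => //; [exact: le_trans xr (ler_norm r)|exact: le_trans pow_le].
Qed.

Lemma decay_at_infinity (r eps : R) : (0 < d)%N -> 0 < eps ->
  exists M : R, forall x xi, `|x| <= r -> M < `|xi| -> `|F x xi| < eps.
Proof.
move=> d0 eps0; have [C C0 /(_ r (C / eps + 1))[rho _ FC]] := outer_decay.
exists rho => x xi xr /ltW xi_ge; have [j [j_large _ F_le]] := FC x xi xr xi_ge.
apply: le_lt_trans F_le _; apply: le_lt_trans (_ : C * 2^-1 ^+ j < _).
  rewrite ler_wpM2l ?(ltW C0) // ler_wiXn2l ?invf_le1 ?ler1n //.
  by rewrite leq_pmull.
rewrite exprVn ltr_pdivrMr ?exprn_gt0 // mulrC -ltr_pdivrMr //.
by apply: lt_le_trans j_large; rewrite ltrDl.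
Qed.

Lemma fiber_dominant (r : R) : (E < d)%N -> exists (rho : R) (g : 'rV[R]_p -> R),
  [/\ 0 < rho, Rintegrable (leb p) g & forall x xi, `|x| <= r -> rho <= `|xi| -> `|F x xi| <= g xi].
Proof.
move=> Ed; have [C C0 /(_ r 1)[rho rho0 FC]] := outer_decay.
pose A j : set 'rV[R]_p := [set xi | `|dilation e2 (2^-1 ^+ j.+1) xi| <= 1].
pose v := fine (leb p [set x : 'rV[R]_p | `|x| <= 1]); have v0 : 0 <= v by rewrite fine_ge0.
have [j|j||j|x|g int_g gA] := @dyadic_dominant R _ _ (leb p) A (fun j => C * 2^-1 ^+ (d * j))
  (C * 2 ^+ E * v).
- exact: measurable_dilated_ball.
- by rewrite mulr_ge0 ?exprn_ge0 // ltW.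
- by rewrite !mulr_ge0 ?exprn_ge0 // ltW.
- have shrink0 : 0 < 2^-1 ^+ j.+1 :> R by rewrite exprn_gt0 // invr_gt0.
  apply: (@le_trans _ _ ((C * 2^-1 ^+ (d * j))%:E * (v * (2^-1 ^+ j.+1) ^- E)%:E)%E).
    rewrite -(lebesgue_dilated_ball e2 shrink0) lee_wpmul2l // lee_fin mulr_ge0 ?exprn_ge0 //.
    exact: ltW.
  rewrite -EFinM lee_fin.
  have -> : (2^-1 ^+ j.+1) ^- E = 2 ^+ E * 2 ^+ (E * j) :> R.
    by rewrite -exprVn -exprVn invrK -exprM mulSn exprD [(j * E)%N]mulnC.
  have -> : C * 2^-1 ^+ (d * j) * (v * (2 ^+ E * 2 ^+ (E * j))) =
      C * 2 ^+ E * v * (2 ^+ (E * j) * 2^-1 ^+ (d * j)) by ring.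
  rewrite ler_wpM2l ?mulr_ge0 ?exprn_ge0 ?(ltW C0) //.
  rewrite (_ : (d * j = E * j + (d - E) * j)%N); last by rewrite -mulnDl subnKC // ltnW.
  rewrite exprD mulrA -exprMn mulfV // expr1n mul1r ler_wiXn2l ?invf_le1 ?ler1n //.
  by rewrite -{1}[j]mul1n leq_mul2r subn_gt0 Ed orbT.
- exists (C * 2) => l; apply: le_trans (_ : \sum_(0 <= i < l) C * 2^-1 ^+ i <= _); last first.
    by rewrite -mulr_sumr ler_wpM2l ?(ltW C0) // geometric_half_sum.
  apply: ler_sum => i _; rewrite -[leRHS]mulr1; apply: ler_pM => //.
  + by rewrite mulr_ge0 ?exprn_ge0 // ltW.
  + rewrite ler_wpM2l ?(ltW C0) // ler_wiXn2l ?invf_le1 ?ler1n //.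
    by rewrite leq_pmull // (leq_ltn_trans _ Ed).
exists rho, g; split=> // x xi xr xi_ge; have [j [_ xiA F_le]] := FC x xi xr xi_ge.
exact: le_trans F_le (gA j xi xiA).
Qed.

End decay.

Section smooth_fiber_integral.
Variables (k p : nat) (e1 : 'I_k -> nat) (e2 : 'I_p -> nat) (F : 'rV[R]_(k + p) -> R) (d : nat)
  (V : set 'rV[R]_(k + p)) (W : set 'rV[R]_k).
Hypothesis e1_gt0 : forall i, (0 < e1 i)%N.
Hypothesis e2_gt0 : forall i, (0 < e2 i)%N.
Hypothesis oV : open V.
Hypothesis V_dil : forall v, V v -> V (dilation (cat_exp e1 e2) 2 v).
Hypothesis V_fiber : forall v, rsubmx v != 0 -> V v.
Hypothesis sF : smooth_on V F.
Hypothesis F_dil : forall v, V v -> F (dilation (cat_exp e1 e2) 2 v) * 2 ^+ d = F v.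
Hypothesis d_gt : (\sum_i e2 i < d)%N.
Hypothesis oW : open W.
Hypothesis WV : forall x xi, W x -> V (row_mx x xi).

Let partials_fiber_dominant s (r : R) : exists (rho : R) (g : 'rV[R]_p -> R),
  [/\ 0 < rho, Rintegrable (leb p) g & forall x xi, `|x| <= r -> rho <= `|xi| ->
    `|partials [seq lshift p i | i <- s] F (row_mx x xi)| <= g xi].
Proof.
set s' := [seq lshift p i | i <- s]; have sFs := smooth_on_partials s' sF.
apply: (@fiber_dominant k p e1 e2 (fun x xi => partials s' F (row_mx x xi))
  (d + \sum_(i <- s') cat_exp e1 e2 i)) => // [x xi xi0|x xi _ xi1|].
- have Vv : V (row_mx x xi) by apply: V_fiber; rewrite row_mxKr.
  by rewrite -(partials_dyadic s' oV V_dil sF F_dil Vv) dilation_row_mx.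
- apply: continuous_at_ext (_ : {for _, continuous (partials s' F)}).
    by move=> v; rewrite hsubmxK.
  apply: (smooth_on_continuous sFs); apply: V_fiber; rewrite row_mxKr -normr_gt0.
  exact: lt_le_trans xi1.
- exact: leq_trans d_gt (leq_addr _ _).
Qed.

Lemma fiber_partials_dominated s x0 : W x0 -> exists (r : R) (g : 'rV[R]_p -> R),
  [/\ 0 < r, Rintegrable (leb p) g &
    forall x xi, `|x - x0| < r -> `|partials s (fun x => F (row_mx x xi)) x| <= g xi].
Proof.
move=> Wx0; have [r0 r00 ball_W] := nbhs_norm_lt (open_nbhs_nbhs (conj oW Wx0)).
have [rho [g [rho0 int_g F_le]]] := partials_fiber_dominant s (`|x0| + r0).
set s' := [seq lshift p i | i <- s] in F_le; have sFs := smooth_on_partials s' sF.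
pose S : set 'rV[R]_(k + p) := [set v | `|lsubmx v - x0| <= r0 / 2 /\ `|rsubmx v| <= rho].
have cS : compact S by exact:
  (compact_row_mx (@compact_ball_at R k x0 (r0 / 2)) (@compact_closed_ball_rV R p rho)).
have SV v : S v -> V v.
  by move=> [v_le _]; rewrite -[v]hsubmxK; apply: WV; apply: ball_W; apply: le_lt_trans v_le _; lra.
have [M M0 FM] := compact_continuous_bound cS (fun v Sv => smooth_on_continuous sFs (SV v Sv)).
exists (r0 / 2), (fun xi => `|g xi| + M * \1_[set xi : 'rV[R]_p | `|xi| <= rho] xi); split.
- by rewrite divr_gt0.
- by apply: RintegrableD; [exact: Rintegrable_abs|apply: RintegrableZ; exact: Rintegrable_indic_ball].
move=> x xi xr; rewrite partials_row_mx -/s' indicE.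
have x_le : `|x| <= `|x0| + r0.
  by rewrite -[x](subrK x0) addrC; apply: le_trans (ler_normD _ _) _; rewrite lerD2l; lra.
have [xi_le|xi_gt] := leP `|xi| rho.
  rewrite mem_set // mulr1; apply: le_trans (FM (row_mx x xi) _) _; last by rewrite lerDr.
  by split; rewrite ?row_mxKl ?row_mxKr //; exact: ltW.
apply: le_trans (F_le x xi x_le (ltW xi_gt)) _; apply: le_trans (ler_norm _) _.
by rewrite lerDl mulr_ge0 // ltW.
Qed.

Lemma smooth_on_fiber_integral : smooth_on W (fun x => \int[leb p]_xi F (row_mx x xi)).
Proof.
apply: (smooth_on_Rintegral (F := fun x xi => F (row_mx x xi)) oW).
- move=> xi; apply: (smooth_on_comp oW oV sF) => [x Wx|j]; first exact: WV.
  exact: (smooth_smooth_on (smooth_map_row_mx (@smooth_map_id R k) (@smooth_map_cst R k p xi) j)).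
- move=> s x Wx; under eq_fun do rewrite partials_row_mx.
  apply: continuous_measurable_rV => xi.
  apply: (@continuous_comp _ _ _ (fun xi => row_mx x xi) (partials [seq lshift p i | i <- s] F)).
    by apply: continuous_row_mx; [exact: cst_continuous|].
  exact: (smooth_on_continuous (smooth_on_partials _ sF) (WV xi Wx)).
- exact: fiber_partials_dominated.
Qed.

End smooth_fiber_integral.

End fiber_integrals.

(** * The projected kernel *)

Section strips.
Context {R : realType} (n p : nat).
Local Notation leb k := (@lebesgue_rV R k).

Definition strip_bounded (f : 'rV[R]_n -> 'rV[R]_(n + p) -> R) (r : R) : Prop :=
  exists C : R, forall t, `|t| <= r ->
    Rintegrable (leb (n + p)) (fun z => \1_[set x : 'rV[R]_n | `|x| <= r] (lsubmx z) * f t z) /\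
    \int[leb (n + p)]_z `|\1_[set x : 'rV[R]_n | `|x| <= r] (lsubmx z) * f t z| <= C.

Definition fiber_dominated (f : 'rV[R]_n -> 'rV[R]_(n + p) -> R) : Prop :=
  forall r : R, exists (rho : R) (g : 'rV[R]_p -> R), [/\ 0 < rho, Rintegrable (leb p) g &
    forall t z, `|t| <= r -> `|lsubmx z| <= r -> rho <= `|rsubmx z| -> `|f t z| <= g (rsubmx z)].

Lemma measurable_strip (r : R) (f : 'rV[R]_(n + p) -> R) : measurable_fun setT f ->
  measurable_fun setT (fun z => \1_[set x : 'rV[R]_n | `|x| <= r] (lsubmx z) * f z).
Proof.
move=> mf; apply: measurable_funM => //; apply: measurableT_comp (@measurable_lsubmx R n p).
exact: Rintegrable_measurable (Rintegrable_indic_ball n r).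
Qed.

Lemma strip_bounded_fiber (f : 'rV[R]_n -> 'rV[R]_(n + p) -> R) (F : 'rV[R]_n -> 'rV[R]_n -> R) (r : R) :
  (forall t, measurable_fun setT (f t)) -> (forall t x, F t x = \int[leb p]_xi f t (row_mx x xi)) ->
  strip_bounded f r -> exists C : R, forall t, `|t| <= r ->
    Rintegrable (leb n) (fun x => \1_[set x : 'rV[R]_n | `|x| <= r] x * F t x) /\
    \int[leb n]_x `|\1_[set x : 'rV[R]_n | `|x| <= r] x * F t x| <= C.
Proof.
move=> mf FE [C fC]; exists C => t /fC[int_t le_C]; set B := [set x | _] in int_t le_C *.
have fiberE x : \1_B x * F t x = \int[leb p]_xi (\1_B (lsubmx (row_mx x xi)) * f t (row_mx x xi)).
  rewrite FE; under [RHS]eq_Rintegral do rewrite row_mxKl; rewrite indicE; case: (_ \in _).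
    by under [RHS]eq_Rintegral do rewrite mul1r; rewrite mul1r.
  by under [RHS]eq_Rintegral do rewrite mul0r; rewrite mul0r /Rintegral integral0.
have int_F : Rintegrable (leb n) (fun x => \1_B x * F t x).
  by under eq_fun do rewrite fiberE; exact: Rintegrable_row int_t.
split=> //; apply: le_trans le_C; have int_abs := Rintegrable_abs int_t.
rewrite (Rintegral_row int_abs); apply: le_Rintegral => [//|||x _].
- exact: Rintegrable_abs.
- exact: Rintegrable_row int_abs.
- rewrite fiberE; apply: norm_Rintegral_le_abs.
  by apply: (measurableT_comp (Rintegrable_measurable int_t)); apply: measurable_row_mx.
Qed.

Section transported_strip.
Variables (K : 'rV[R]_(n + p) -> R) (Phi : 'rV[R]_n -> 'rV[R]_(n + p) -> 'rV[R]_(n + p)).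
Hypothesis LK : L1loc K.
Hypothesis Phi_preserves : forall t, transports (leb (n + p)) (leb (n + p)) (Phi t).
Hypothesis Phi_continuous : continuous (fun v : 'rV[R]_(n + (n + p)) => Phi (lsubmx v) (rsubmx v)).
Hypothesis Phi_dominated : fiber_dominated (fun t z => K (Phi t z)).

Let Phi_box_bound (r rho : R) : exists M : R, forall t z, `|t| <= r -> `|lsubmx z| <= r ->
  `|rsubmx z| <= rho -> `|Phi t z| <= M.
Proof.
have norm_cont : continuous (fun v : 'rV[R]_(n + (n + p)) => `|Phi (lsubmx v) (rsubmx v)|).
  by move=> v; apply: continuous_comp; [exact: Phi_continuous|exact: norm_continuous].
have [M _ PhiM] := compact_continuous_bound (@compact_closed_ball_rV R (n + (n + p)) (`|r| + `|rho|))
  (fun v _ => norm_cont v).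
have r_le : r <= `|r| + `|rho| by apply: le_trans (ler_norm _) _; rewrite lerDl.
have rho_le : rho <= `|r| + `|rho| by apply: le_trans (ler_norm _) _; rewrite lerDr.
exists M => t z tr zr zrho; have := PhiM (row_mx t z); rewrite row_mxKl row_mxKr normr_id; apply => /=.
rewrite norm_row_mx_le ?addr_ge0 // (le_trans tr) //=.
by rewrite -[z]hsubmxK norm_row_mx_le ?addr_ge0 // (le_trans zr) // (le_trans zrho).
Qed.

Lemma transported_strip_bounded (r : R) : strip_bounded (fun t z => K (Phi t z)) r.
Proof.
have [rho [g [_ int_g K_le]]] := Phi_dominated r; have [M PhiM] := Phi_box_bound r rho.
pose B : set 'rV[R]_n := [set x | `|x| <= r].
have int_far := Rintegrable_tensor (Rintegrable_indic_ball n r) (Rintegrable_abs int_g).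
rewrite -/B in int_far.
pose near (z : 'rV[R]_(n + p)) : R := `|\1_[set z | `|z| <= M] z * K z|.
have int_near : Rintegrable (leb (n + p)) near by apply: Rintegrable_abs; exact: L1loc_ball.
have m_near := Rintegrable_measurable int_near.
exists (\int[leb (n + p)]_z near z + \int[leb (n + p)]_z (\1_B (lsubmx z) * `|g (rsubmx z)|)) => t tr.
have int_near_t : Rintegrable (leb (n + p)) (fun z => near (Phi t z)).
  exact/(transports_integrable (Phi_preserves t) m_near).
have int_sum := RintegrableD int_near_t int_far.
have bound z : `|\1_B (lsubmx z) * K (Phi t z)| <= near (Phi t z) + \1_B (lsubmx z) * `|g (rsubmx z)|.
  have near_ge0 : 0 <= near (Phi t z) by exact: normr_ge0.
  have [Bz|nBz] := pselect (B (lsubmx z)); last by rewrite !indicE (memNset nBz) !mul0r normr0 addr0.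
  rewrite indicE (mem_set Bz) !mul1r; have [z_le|z_gt] := leP `|rsubmx z| rho.
    apply: le_trans (_ : near (Phi t z) <= _); last by rewrite lerDl.
    by rewrite /near indicE mem_set ?mul1r //=; exact: PhiM.
  by apply: le_trans (K_le t z tr Bz (ltW z_gt)) _; apply: le_trans (ler_norm _) _; rewrite lerDr.
have int_strip : Rintegrable (leb (n + p)) (fun z => \1_B (lsubmx z) * K (Phi t z)).
  apply: Rintegrable_le int_sum bound; apply: measurable_strip.
  by apply: (measurableT_comp LK.1); have [] := Phi_preserves t.
split=> //; rewrite -(transports_Rintegral (Phi_preserves t) m_near) -RintegralD //.
by apply: le_Rintegral => //; exact: Rintegrable_abs.
Qed.

End transported_strip.

End strips.

Section projected_kernel.
Context {R : realType} (n p : nat) (sigma : 'I_n -> nat) (tau : 'I_p -> nat)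
  (mul : 'rV[R]_(n + p) -> 'rV[R]_(n + p) -> 'rV[R]_(n + p)) (inv : 'rV[R]_(n + p) -> 'rV[R]_(n + p)).
Hypothesis hg : homogeneous_group (cat_exp sigma tau) mul inv.
Local Notation e := (cat_exp sigma tau).
Local Notation leb k := (@lebesgue_rV R k).
Variables (K : 'rV[R]_(n + p) -> R) (d : nat).
Hypothesis kerK : homogeneous_kernel e d K.
Hypothesis d_gt : (\sum_i tau i < d)%N.

Definition projected_kernel (x y : 'rV[R]_n) : R :=
  \int[leb p]_xi K (mul (inv (row_mx y 0)) (row_mx x xi)).
Local Notation G := projected_kernel.

Let sigma_gt0 := base_exp_gt0 hg.
Let tau_gt0 := fiber_exp_gt0 hg.
Let sigma2_gt0 := cat_exp_gt0 sigma_gt0 sigma_gt0.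

Let displacement (v : 'rV[R]_(n + n + p)) :=
  mul (inv (row_mx (rsubmx (lsubmx v)) 0)) (row_mx (lsubmx (lsubmx v)) (rsubmx v)).

Let smooth_displacement : smooth_map displacement.
Proof.
have smooth_l := @smooth_map_lsubmx R (n + n) p.
apply: (smooth_mul hg).
  apply: (smooth_inv hg); apply: smooth_map_row_mx (smooth_map_cst _).
  exact: (smooth_map_comp (@smooth_map_rsubmx R n n) smooth_l).
apply: smooth_map_row_mx (@smooth_map_rsubmx R _ _).
exact: (smooth_map_comp (@smooth_map_lsubmx R n n) smooth_l).
Qed.

Let displacement_dilation (l : R) v : 0 < l ->
  displacement (dilation (cat_exp (cat_exp sigma sigma) tau) l v) = dilation e l (displacement v).
Proof.
move=> l0; rewrite /displacement !(lsubmx_dilation, rsubmx_dilation) (hg_dilation hg) //.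
by rewrite -(group_inv_dilation hg) // !dilation_row_mx dilation0.
Qed.

Let displacement_eq0 v : displacement v = 0 -> lsubmx (lsubmx v) = rsubmx (lsubmx v) /\ rsubmx v = 0.
Proof.
move=> v0; have := group_mulKV hg (row_mx (rsubmx (lsubmx v)) 0) (row_mx (lsubmx (lsubmx v)) (rsubmx v)).
by rewrite -/(displacement v) v0 (hg_mulx0 hg) => /eq_row_mx[-> ->].
Qed.

Let regular : set 'rV[R]_(n + n + p) := [set v | displacement v != 0].

Let open_regular : open regular.
Proof.
apply: (@open_comp _ _ displacement [set z | z != 0]); last exact: open_neq_normed.
by move=> v _; exact: (smooth_map_continuous smooth_displacement).
Qed.

Let regular_fiber v : rsubmx v != 0 -> regular v.
Proof. by move=> v0; apply/eqP => /displacement_eq0[_ v0']; rewrite v0' eqxx in v0. Qed.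

Let regular_dilation v : regular v -> regular (dilation (cat_exp (cat_exp sigma sigma) tau) 2 v).
Proof.
rewrite /regular /= displacement_dilation // => v0; apply/eqP => /dilation_eq0 dil0.
by move/eqP: v0; apply; exact: dil0.
Qed.

Let smooth_on_regular : smooth_on regular (K \o displacement).
Proof.
apply: (smooth_on_comp open_regular (@open_neq_normed _ _ 0) (hker_smooth kerK)) => // j.
exact: (smooth_smooth_on (smooth_displacement j)).
Qed.

Let K_displacement_dilation v :
  K (displacement (dilation (cat_exp (cat_exp sigma sigma) tau) 2 v)) * 2 ^+ d = K (displacement v).
Proof.
rewrite displacement_dilation //; have [->|v0] := eqVneq (displacement v) 0; last exact: hker_dilation2.
by rewrite dilation0 (hker0 kerK) mul0r.
Qed.

Let joint_kernelE z : joint G z = \int[leb p]_xi K (displacement (row_mx z xi)).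
Proof. by apply: eq_Rintegral => xi _; rewrite /displacement row_mxKl row_mxKr. Qed.

Lemma open_off_diagonal : open [set z : 'rV[R]_(n + n) | lsubmx z != rsubmx z].
Proof.
have -> : [set z : 'rV[R]_(n + n) | lsubmx z != rsubmx z] =
    (fun z => lsubmx z - rsubmx z) @^-1` [set x | x != 0].
  by apply/seteqP; split => z /=; rewrite subr_eq0.
apply: open_comp; last exact: open_neq_normed.
move=> z _; apply: smooth_map_continuous => j; under eq_fun do rewrite !mxE.
by apply: (smooth_onB openT); exact: (smooth_on_coord _ openT).
Qed.

Lemma projected_kernel_smooth : smooth_off_diagonal G.
Proof.
rewrite /smooth_off_diagonal (funext joint_kernelE).
apply: (smooth_on_fiber_integral sigma2_gt0 tau_gt0 open_regular regular_dilation regular_fiber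
  smooth_on_regular (fun v _ => K_displacement_dilation v) d_gt open_off_diagonal) => z xi /= z_off.
by apply/eqP => /displacement_eq0; rewrite row_mxKl => -[diag _]; rewrite diag eqxx in z_off.
Qed.

Let measurable_K_displacement : measurable_fun setT (K \o displacement).
Proof.
apply: (measurableT_comp (hker_L1loc kerK).1).
exact: (continuous_map_measurable (smooth_map_continuous smooth_displacement)).
Qed.

Let measurable_joint : measurable_fun setT (joint G).
Proof.
rewrite (funext joint_kernelE).
exact: (@measurable_Rintegral_row R (n + n) p _ measurable_K_displacement).
Qed.

Let measurable_fiber x y : measurable_fun setT (fun xi => K (mul (inv (row_mx y 0)) (row_mx x xi))).
Proof.
have : measurable_fun setT (fun xi => (K \o displacement) (row_mx (row_mx x y) xi)).
  by apply: (measurableT_comp measurable_K_displacement); apply: measurable_row_mx.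
by under eq_fun do rewrite /= /displacement !row_mxKl !row_mxKr.
Qed.

Lemma projected_kernel_dyadic x y :
  G (dilation sigma 2 x) (dilation sigma 2 y) * 2 ^+ (d - \sum_i tau i) = G x y.
Proof.
rewrite /G (Rintegral_dilation tau (ltr0n R 2) (measurable_fiber _ _)) mulrC mulrA -exprD subnK
  ?(ltnW d_gt) //.
have -> : (fun xi => K (mul (inv (row_mx y 0)) (row_mx x xi))) = (fun xi => 2 ^+ d *
    K (mul (inv (row_mx (dilation sigma 2 y) 0)) (row_mx (dilation sigma 2 x) (dilation tau 2 xi)))).
  apply/funext => xi; have := K_displacement_dilation (row_mx (row_mx x y) xi).
  by rewrite dilation_row_mx dilation_row_mx /displacement !row_mxKl !row_mxKr mulrC => <-.
apply/esym; apply: RintegralZl_measurable; first by rewrite expf_neq0.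
exact: (measurableT_comp (measurable_fiber (dilation sigma 2 x) (dilation sigma 2 y))
  (@measurable_dilation R p tau 2)).
Qed.

Lemma projected_kernel_continuous x y : x != y -> {for row_mx x y, continuous (joint G)}.
Proof. by move=> xy; apply: (smooth_on_continuous projected_kernel_smooth);
  rewrite /= row_mxKl row_mxKr. Qed.

Lemma projected_kernel_decay (r eps : R) : 0 < eps -> exists M : R, forall x y, `|y| <= r -> M < `|x| ->
  `|G x y| < eps /\ `|G y x| < eps.
Proof.
move=> eps0; have deg0 : (0 < d - \sum_i tau i)%N by rewrite subn_gt0.
have off_diag (x y : 'rV[R]_n) : `|x| <= 2^-1 -> 1 <= `|y| -> x != y.
  by move=> x_le y_ge; apply/eqP => xy; rewrite -xy in y_ge; move: (le_trans y_ge x_le); lra.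
have G_cont (x y : 'rV[R]_n) : `|x| <= 2^-1 -> 1 <= `|y| ->
    {for row_mx x y, continuous (fun v => G (lsubmx v) (rsubmx v))}.
  by move=> x_le y_ge; apply: projected_kernel_continuous; exact: off_diag.
have G_cont_swap (x y : 'rV[R]_n) : `|x| <= 2^-1 -> 1 <= `|y| ->
    {for row_mx x y, continuous (fun v => G (rsubmx v) (lsubmx v))}.
  move=> x_le y_ge.
  apply: continuous_at_ext (_ : {for _, continuous (joint G \o (fun v => row_mx (rsubmx v) (lsubmx v)))}).
    by move=> v; rewrite /joint /= row_mxKl row_mxKr.
  apply: continuous_comp.
    by apply: continuous_row_mx; [exact: continuous_rsubmx|exact: continuous_lsubmx].
  by rewrite row_mxKl row_mxKr; apply: projected_kernel_continuous; rewrite eq_sym; exact: off_diag.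
have [M1 G_far] := decay_at_infinity sigma_gt0 sigma_gt0 (F := fun y x => G x y)
  (fun y x _ => projected_kernel_dyadic x y) G_cont_swap r deg0 eps0.
have [M2 G_far_swap] := decay_at_infinity sigma_gt0 sigma_gt0
  (fun y x _ => projected_kernel_dyadic y x) G_cont r deg0 eps0.
exists (Num.max M1 M2) => x y yr; rewrite gt_max => /andP[x1 x2].
by split; [exact: G_far|exact: G_far_swap].
Qed.

Let displacement_dominated (r : R) : exists (rho : R) (g : 'rV[R]_p -> R),
  [/\ 0 < rho, Rintegrable (leb p) g &
  forall x y xi, `|x| <= r -> `|y| <= r -> rho <= `|xi| ->
    `|K (mul (inv (row_mx y 0)) (row_mx x xi))| <= g xi].
Proof.
have [v xi _|v xi _ xi_ge|rho [g [rho0 int_g K_le]]] := @fiber_dominant R _ _ _ _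
  (fun v xi => K (displacement (row_mx v xi))) d sigma2_gt0 tau_gt0 _ _ `|r| d_gt.
- by rewrite -dilation_row_mx K_displacement_dilation.
- apply: continuous_at_ext (_ : {for _, continuous (K \o displacement)}).
    by move=> w; rewrite /= hsubmxK.
  apply: (smooth_on_continuous smooth_on_regular); apply: regular_fiber; rewrite row_mxKr -normr_gt0.
  exact: lt_le_trans xi_ge.
exists rho, g; split => // x y xi xr yr xi_ge.
have := K_le (row_mx x y) xi; rewrite /displacement !row_mxKl !row_mxKr; apply => //.
by rewrite norm_row_mx_le // !(le_trans _ (ler_norm r)).
Qed.

Let smooth_l := @smooth_map_lsubmx R n (n + p).
Let smooth_r := @smooth_map_rsubmx R n (n + p).

Lemma kernel_strip_bounded_base (r : R) :
  strip_bounded (fun y z => K (mul (inv (row_mx y 0)) z)) r.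
Proof.
apply: (transported_strip_bounded (hker_L1loc kerK) (fun y => left_translation_preserves hg _)) => [|{}r].
  apply: smooth_map_continuous; apply: (smooth_mul hg) => //.
  by apply: (smooth_inv hg); exact: (smooth_map_row_mx smooth_l (smooth_map_cst _)).
have [rho [g [rho0 int_g K_le]]] := displacement_dominated r; exists rho, g; split => // y z yr zr z_ge.
by rewrite -[z in K (mul _ z)]hsubmxK; exact: K_le.
Qed.

Lemma kernel_strip_bounded_pole (r : R) :
  strip_bounded (fun x z => K (mul (inv (row_mx (lsubmx z) 0)) (row_mx x (rsubmx z)))) r.
Proof.
apply: (transported_strip_bounded (hker_L1loc kerK) (section_inverse_preserves hg)) => [|{}r].
  apply: smooth_map_continuous; apply: (smooth_mul hg).
    apply: (smooth_inv hg); apply: smooth_map_row_mx (smooth_map_cst _).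
    exact: (smooth_map_comp (@smooth_map_lsubmx R n p) smooth_r).
  apply: smooth_map_row_mx; first exact: smooth_l.
  exact: (smooth_map_comp (@smooth_map_rsubmx R n p) smooth_r).
have [rho [g [rho0 int_g K_le]]] := displacement_dominated r; exists rho, g; split => // x z xr zr z_ge.
exact: K_le.
Qed.

Let measurable_kernel_map (F : 'rV[R]_(n + p) -> 'rV[R]_(n + p)) :
  transports (leb (n + p)) (leb (n + p)) F -> measurable_fun setT (K \o F).
Proof. by move=> [mF _]; exact: (measurableT_comp (hker_L1loc kerK).1). Qed.

Let column_ball_bounded (r : R) : exists C : R, forall y, `|y| <= r ->
  Rintegrable (leb n) (fun x => \1_[set x : 'rV[R]_n | `|x| <= r] x * G x y) /\
  \int[leb n]_x `|\1_[set x : 'rV[R]_n | `|x| <= r] x * G x y| <= C.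
Proof.
apply: strip_bounded_fiber (kernel_strip_bounded_base r) => // y.
exact: (measurable_kernel_map (left_translation_preserves hg _)).
Qed.

Let row_ball_bounded (r : R) : exists C : R, forall x, `|x| <= r ->
  Rintegrable (leb n) (fun y => \1_[set y : 'rV[R]_n | `|y| <= r] y * G x y) /\
  \int[leb n]_y `|\1_[set y : 'rV[R]_n | `|y| <= r] y * G x y| <= C.
Proof.
apply: (strip_bounded_fiber (F := G)) (kernel_strip_bounded_pole r) => x.
  exact: (measurable_kernel_map (section_inverse_preserves hg x)).
by move=> y; apply: eq_Rintegral => xi _; rewrite row_mxKl row_mxKr.
Qed.

Lemma projected_kernel_integrable : fs_integrable G.
Proof.
have sliceE x y : G x y = joint G (row_mx x y) by rewrite /joint row_mxKl row_mxKr.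
split=> [y|x|].
- apply: L1loc_of_large_balls => [|r]; first under eq_fun do rewrite sliceE.
    by apply: (measurableT_comp measurable_joint); apply: measurable_row_mx.
  have [C /(_ y)] := column_ball_bounded (Num.max r `|y|); rewrite le_max lexx orbT => /(_ isT)[int_y _].
  by exists (Num.max r `|y|); rewrite // le_max lexx.
- apply: L1loc_of_large_balls => [|r]; first under eq_fun do rewrite sliceE.
    by apply: (measurableT_comp measurable_joint); apply: measurable_row_mx.
  have [C /(_ x)] := row_ball_bounded (Num.max r `|x|); rewrite le_max lexx orbT => /(_ isT)[int_x _].
  by exists (Num.max r `|x|); rewrite // le_max lexx.
- apply: L1loc_row measurable_joint _ => r; have [C slices] := row_ball_bounded r.
  exists C => z /slices[int_z le_C]; split; first by under eq_fun do rewrite -sliceE.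
  by under eq_Rintegral do rewrite -sliceE.
Qed.

End projected_kernel.

Section fiber_projection.
Context {R : realType} (n p : nat).
Local Notation leb k := (@lebesgue_rV R k).

Definition fiber_integral (psi : 'rV[R]_(n + p) -> R) (x : 'rV[R]_n) : R :=
  \int[leb p]_xi psi (row_mx x xi).

Lemma supported_in_box (K : set 'rV[R]_(n + p)) (psi : 'rV[R]_(n + p) -> R) : compact K ->
  supported_in K psi ->
  exists2 r : R, 0 < r & forall z, psi z != 0 -> `|lsubmx z| <= r /\ `|rsubmx z| <= r.
Proof.
move=> cK Kpsi; have [r r0 Kr] := compact_norm_bound cK; exists r => // z psi_z.
have : `|z| <= r by apply: Kr; apply: contrapT => /Kpsi psi0; rewrite psi0 eqxx in psi_z.
by rewrite -{1}[z]hsubmxK norm_row_mx_le ?(ltW r0) // => /andP[].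
Qed.

Lemma test_fun_fiber_integral psi : test_fun setT psi -> test_fun setT (fiber_integral psi).
Proof.
move=> [spsi [K [cK _ Kpsi]]]; have [r r0 psi_r] := supported_in_box cK Kpsi.
split; last first.
  exists [set x | `|x| <= r]; split => //; first exact: compact_closed_ball_rV.
  move=> x x_out; rewrite /fiber_integral (_ : (fun xi => _) = (fun=> 0)) /Rintegral ?integral0 //.
  by apply/funext => xi; apply: contrapT => /eqP/psi_r[+ _]; rewrite row_mxKl.
apply: (smooth_on_Rintegral (F := fun x xi => psi (row_mx x xi)) openT).
- by move=> xi; exact:
  (smooth_comp spsi (smooth_map_row_mx (@smooth_map_id R n) (@smooth_map_cst R n p xi))).
- move=> s x _; under eq_fun do rewrite partials_row_mx.
  apply: continuous_measurable_rV => xi.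
  apply: (@continuous_comp _ _ _ (fun xi => row_mx x xi) (partials [seq lshift p i | i <- s] psi)).
    by apply: continuous_row_mx; [exact: cst_continuous|].
  exact: (smooth_continuous (smooth_on_partials _ spsi)).
move=> s x _; set s' := [seq lshift p i | i <- s]; have sps := smooth_on_partials s' spsi.
have Kps : supported_in K (partials s' psi) by apply: partials_supported => //;
  exact: compact_closed_normed.
have [M M0 ps_le] := supported_bound (smooth_continuous sps) cK Kps.
have [r' r'0 ps_r'] := supported_in_box cK Kps.
exists 1, (fun xi => M * \1_[set xi : 'rV[R]_p | `|xi| <= r'] xi); split => //.
  by apply: RintegrableZ; exact: Rintegrable_indic_ball.
move=> y xi _; rewrite partials_row_mx -/s'.
have [->|/ps_r'[_]] := eqVneq (partials s' psi (row_mx y xi)) 0; first by rewrite normr0 mulr_ge0 // ltW.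
by rewrite row_mxKr => xi_le; rewrite indicE mem_set // mulr1.
Qed.

Lemma unit_test_fun k : exists2 theta : 'rV[R]_k -> R, test_fun setT theta & \int[leb k]_x theta x = 1.
Proof.
have [theta [ttheta theta01 theta1 _]] := @ball_test_fun R k setT 0 1 ltr01 (fun _ _ => Logic.I).
have mass_gt0 : 0 < \int[leb k]_x theta x.
  apply: (@bump_integral_gt0 _ _ theta 0 (1 / 4)) => // [|x]; last by have /andP[] := theta01 x.
  exact: test_fun_integrable.
set mass := (\int[leb k]_x theta x) in mass_gt0; exists (fun x => mass^-1 * theta x).
  by apply: test_funM ttheta; exact: (smooth_on_cst _ openT).
by rewrite RintegralZl ?mulVf ?gt_eqF //; exact: test_fun_integrable.
Qed.

Lemma test_fun_tensor (phi : 'rV[R]_n -> R) (theta : 'rV[R]_p -> R) : test_fun setT phi ->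
  test_fun setT theta ->
  test_fun setT (fun z : 'rV[R]_(n + p) => phi (lsubmx z) * theta (rsubmx z)).
Proof.
move=> [sphi [B [cB _ Bphi]]] [stheta [D [cD _ Dtheta]]]; split.
  exact: (smooth_onM openT (smooth_comp sphi (@smooth_map_lsubmx R n p))
    (smooth_comp stheta (@smooth_map_rsubmx R n p))).
exists [set z | B (lsubmx z) /\ D (rsubmx z)]; split => //; first exact: compact_row_mx cB cD.
move=> z z_out; have [Bz|/Bphi->] := pselect (B (lsubmx z)); last by rewrite mul0r.
by rewrite (Dtheta (rsubmx z)) ?mulr0 // => Dz; exact: z_out.
Qed.

Lemma fiber_integral_tensor (phi : 'rV[R]_n -> R) (theta : 'rV[R]_p -> R) : test_fun setT theta ->
  \int[leb p]_x theta x = 1 -> fiber_integral (fun z => phi (lsubmx z) * theta (rsubmx z)) = phi.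
Proof.
move=> ttheta theta1; apply/funext => x; rewrite /fiber_integral.
under eq_Rintegral do rewrite row_mxKl row_mxKr.
by rewrite RintegralZl ?theta1 ?mulr1 //; exact: test_fun_integrable.
Qed.

Lemma base_pairing (v : 'rV[R]_n -> R) psi : L1loc v -> test_fun setT psi ->
  \int[leb (n + p)]_z (v (lsubmx z) * psi z) = \int[leb n]_x (v x * fiber_integral psi x).
Proof.
move=> Lv tpsi; rewrite (Rintegral_row (L1loc_test (L1loc_lsubmx p Lv) tpsi)).
apply: eq_Rintegral => x _; under eq_Rintegral do rewrite row_mxKl.
have [->|vx0] := eqVneq (v x) 0.
  by under eq_Rintegral do rewrite mul0r; rewrite /Rintegral integral0 mul0r.
apply: RintegralZl_measurable => //; apply: continuous_measurable_rV => xi.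
apply: (@continuous_comp _ _ _ (fun xi => row_mx x xi) psi); last exact: (smooth_continuous tpsi.1).
by apply: continuous_row_mx; [exact: cst_continuous|].
Qed.

(* Both sides have the same pairing with every test function on the base, since
   the lifted operator applied to a function of the base variables is [L]. *)
Lemma fiber_integral_hom_op m (X : 'I_m -> @vfield R n) (Xt : 'I_m -> @vfield R (n + p)) w nu c psi :
  (forall j, smooth_map (X j)) -> (forall j, divergence_free (X j)) ->
  (forall j, smooth_map (Xt j)) -> (forall j, divergence_free (Xt j)) ->
  (forall j, vf_projects (Xt j) (X j)) -> test_fun setT psi ->
  fiber_integral (hom_op Xt w nu (transpose_coef c) psi) =
  hom_op X w nu (transpose_coef c) (fiber_integral psi).
Proof.
move=> sX divX sXt divXt proj tpsi; have tP := test_fun_fiber_integral tpsi.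
have tL := test_fun_hom_op w nu (transpose_coef c) sXt tpsi.
have tPL := test_fun_fiber_integral tL; have tLP := test_fun_hom_op w nu (transpose_coef c) sX tP.
apply/funext => x; apply: (fundamental_lemma_eq openT _ _ _ (Logic.I : setT x)) => [y _|y _|f tf].
- exact: (smooth_continuous tPL.1).
- exact: (smooth_continuous tLP.1).
have [sf _] := tf; have sf_l := smooth_comp sf (@smooth_map_lsubmx R n p).
under eq_Rintegral do rewrite mulrC; under [RHS]eq_Rintegral do rewrite mulrC.
rewrite -(base_pairing (L1loc_continuous (smooth_continuous sf)) tL).
rewrite -(integral_hom_op_parts w nu c sXt divXt sf_l tpsi) (hom_op_lsubmx proj).
rewrite (base_pairing (L1loc_continuous (smooth_continuous (smooth_hom_op w sX nu c sf))) tpsi).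
exact: integral_hom_op_parts.
Qed.

End fiber_projection.

Section reproducing_property.
Context {R : realType} (n m p : nat) (sigma : 'I_n -> nat) (tau : 'I_p -> nat)
  (mul : 'rV[R]_(n + p) -> 'rV[R]_(n + p) -> 'rV[R]_(n + p)) (inv : 'rV[R]_(n + p) -> 'rV[R]_(n + p))
  (X : 'I_m -> @vfield R n) (Xt : 'I_m -> @vfield R (n + p)) (w : 'I_m -> nat)
  (nu : nat) (c : seq 'I_m -> R).
Local Notation e := (cat_exp sigma tau).
Local Notation leb k := (@lebesgue_rV R k).
Hypothesis hg : homogeneous_group e mul inv.
Hypothesis gen : forall Z, left_invariant mul Z -> lie_generated Xt Z.
Hypothesis proj : forall j, vf_projects (Xt j) (X j).
Hypothesis sysX : homogeneous_system sigma w X.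
Hypothesis sysXt : homogeneous_system e w Xt.
Hypothesis linv : forall j, left_invariant mul (Xt j).
Variables (K : 'rV[R]_(n + p) -> R) (d : nat).
Hypothesis kerK : homogeneous_kernel e d K.
Hypothesis d_gt : (\sum_i tau i < d)%N.
Hypothesis solK : forall psi, test_fun setT psi ->
  \int[leb (n + p)]_z (K z * hom_op Xt w nu (transpose_coef c) psi z) = - psi 0.
Local Notation G := (projected_kernel mul inv K).
Local Notation Ls := (hom_op X w nu (transpose_coef c)).
Local Notation Lts := (hom_op Xt w nu (transpose_coef c)).

Let mK : measurable_fun setT K := (hker_L1loc kerK).1.

Let measurable_left a : measurable_fun setT (fun z => K (mul a z)).
Proof. by apply: (measurableT_comp mK); have [] := left_translation_preserves hg a. Qed.

Let fiber_shift eta z : row_mx (lsubmx z) (rsubmx (mul (row_mx 0 eta) z)) = mul (row_mx 0 eta) z.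
Proof. by rewrite -{1}(fiber_invariant hg gen proj eta z) hsubmxK. Qed.

Let smooth_fiber_action : smooth_map (fun v : 'rV[R]_(n + p + p) => mul (row_mx 0 (rsubmx v)) (lsubmx v)).
Proof.
apply: (smooth_mul hg) (@smooth_map_lsubmx R _ _).
exact: (smooth_map_row_mx (smooth_map_cst _) (@smooth_map_rsubmx R _ _)).
Qed.

Let twisted_kernel y (v : 'rV[R]_(n + p + p)) :=
  K (mul (inv (row_mx y 0)) (mul (row_mx 0 (rsubmx v)) (lsubmx v))).

Let measurable_twisted y : measurable_fun setT (twisted_kernel y).
Proof.
apply: (measurableT_comp (measurable_left _)); apply: continuous_map_measurable.
exact: (smooth_map_continuous smooth_fiber_action).
Qed.

Let kernel_fiberE y z : G (lsubmx z) y = \int[leb p]_eta twisted_kernel y (row_mx z eta).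
Proof.
have m_fiber : measurable_fun setT (fun xi => K (mul (inv (row_mx y 0)) (row_mx (lsubmx z) xi))).
  by apply: (measurableT_comp (measurable_left _)); apply: measurable_row_mx.
rewrite /projected_kernel -(transports_Rintegral (fiber_translation_preserves hg z) m_fiber).
by apply: eq_Rintegral => eta _; rewrite fiber_shift /twisted_kernel row_mxKl row_mxKr.
Qed.

(* The fiberwise measure preserving map [(x, xi, eta) |-> (x, xi, eta')], where
   [(0, eta) * (x, xi) = (x, eta')], turns the twisted kernel into [K (b * (x, eta'))], which no longer involves [xi]. *)
Let twisted_integrable y A : test_fun setT A ->
  Rintegrable (leb (n + p + p)) (fun v => twisted_kernel y v * A (lsubmx v)).
Proof.
move=> [sA [B [cB _ BA]]]; have [M M0 A_le] := supported_bound (smooth_continuous sA) cB BA.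
have [r0 r00 A_r0] := supported_in_box cB BA; pose r := Num.max r0 `|y|.
have [C /(_ y)] := kernel_strip_bounded_base hg kerK d_gt r.
rewrite /r le_max lexx orbT -/r => /(_ isT)[int_strip _].
have int_box := Rintegrable_tensor_middle int_strip (Rintegrable_indic_ball p r).
have m_action : measurable_fun setT
  (fun v : 'rV[R]_(n + p + p) => rsubmx (mul (row_mx 0 (rsubmx v)) (lsubmx v))).
  apply: (measurableT_comp (@measurable_rsubmx R n p)); apply: continuous_map_measurable.
  exact: (smooth_map_continuous smooth_fiber_action).
have transT := transports_fiberwise (F := fun z eta => rsubmx (mul (row_mx 0 eta) z)) m_action
  (fiber_translation_preserves hg).
have int_twisted := (transports_integrable transT (Rintegrable_measurable int_box)).1 int_box.
apply: Rintegrable_le (RintegrableZ M (Rintegrable_abs int_twisted)) _ => [|v].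
  apply: measurable_funM (measurable_twisted y) _.
  exact: (measurableT_comp (continuous_measurable_rV (smooth_continuous sA)) (@measurable_lsubmx R _ _)).
rewrite /= !row_mxKl !row_mxKr fiber_shift -/(twisted_kernel y v) normrM mulrC.
have [->|/A_r0[x_le xi_le]] := eqVneq (A (lsubmx v)) 0; first by rewrite normr0 mul0r mulr_ge0 // ltW.
rewrite !indicE !mem_set ?mul1r ?mulr1 /=; [|by rewrite le_max xi_le|by rewrite le_max x_le].
by rewrite ler_wpM2r.
Qed.

Let left_pairing b psi : test_fun setT psi ->
  \int[leb (n + p)]_z (K (mul b z) * Lts psi z) = - psi (inv b).
Proof.
move=> tpsi; have smooth_left a : smooth_map (mul a).
  exact: (smooth_mul hg (@smooth_map_cst R _ _ a) (@smooth_map_id R _)).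
have tq : test_fun setT (psi \o mul (inv b)).
  apply: (test_fun_comp (smooth_left _) (smooth_map_continuous (smooth_left b))) tpsi => // z.
  exact: (group_mulKV hg).
have := solK tq; rewrite /= (hg_mulx0 hg) => <-.
have m_pairing : measurable_fun setT (fun z => K z * Lts (psi \o mul (inv b)) z).
  apply: measurable_funM mK _; apply: continuous_measurable_rV.
  exact: (smooth_continuous (test_fun_hom_op w nu (transpose_coef c) (hsys_smooth sysXt) tq).1).
rewrite -(transports_Rintegral (left_translation_preserves hg b) m_pairing); apply: eq_Rintegral => z _.
by rewrite (hom_op_left_translation w linv nu _ (inv b) _ tpsi.1) (group_mulVK hg).
Qed.

Let twisted_pairing y psi : test_fun setT psi ->
  \int[leb n]_x (G x y * fiber_integral (Lts psi) x) =
  - \int[leb p]_eta psi (mul (inv (row_mx 0 eta)) (row_mx y 0)).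
Proof.
move=> tpsi; have tL := test_fun_hom_op w nu (transpose_coef c) (hsys_smooth sysXt) tpsi.
have [L1_x _ _] := projected_kernel_integrable hg kerK d_gt; have int_twisted := twisted_integrable y tL.
rewrite -(base_pairing (L1_x y) tL).
transitivity (\int[leb (n + p + p)]_v (twisted_kernel y v * Lts psi (lsubmx v))).
  rewrite (Rintegral_row int_twisted); apply: eq_Rintegral => z _; rewrite kernel_fiberE.
  under [RHS]eq_Rintegral do rewrite row_mxKl mulrC.
  have [->|L0] := eqVneq (Lts psi z) 0.
    by under [RHS]eq_Rintegral do rewrite mul0r; rewrite /Rintegral integral0 mulr0.
  rewrite RintegralZl_measurable 1?mulrC //.
  by apply: (measurableT_comp (measurable_twisted y)); apply: measurable_row_mx.
rewrite (Rintegral_row_swap int_twisted) -mulN1r -RintegralZl_measurable ?oppr_eq0 //; last first.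
  apply: continuous_measurable_rV => eta; apply: continuous_comp; last exact: (smooth_continuous tpsi.1).
  apply: smooth_map_continuous; apply: (smooth_mul hg) (smooth_map_cst _); apply: (smooth_inv hg).
  exact: (smooth_map_row_mx (smooth_map_cst _) (@smooth_map_id R p)).
apply: eq_Rintegral => eta _; rewrite mulN1r /twisted_kernel.
under eq_Rintegral do rewrite row_mxKl row_mxKr (hg_mulA hg).
by rewrite left_pairing // (group_invM hg) (group_invK hg).
Qed.

(* A test function [phi] on the base is tested upstairs as [phi (x) * theta (xi)] with
   [theta] of integral one. *)
Lemma projected_kernel_reproducing : fs_reproducing Ls G.
Proof.
move=> phi tphi y; have [theta ttheta theta1] := @unit_test_fun R p.
have tpsi := test_fun_tensor tphi ttheta; have int_theta := test_fun_integrable ttheta.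
transitivity (\int[leb n]_x (G x y * fiber_integral (Lts (fun z => phi (lsubmx z) * theta (rsubmx z))) x)).
  rewrite (fiber_integral_hom_op w nu c (hsys_smooth sysX) (hsys_divergence_free sysX)
    (hsys_smooth sysXt) (hsys_divergence_free sysXt) proj tpsi).
  by rewrite fiber_integral_tensor.
rewrite twisted_pairing //; congr (- _).
transitivity (\int[leb p]_eta (phi y * theta (rsubmx (mul (inv (row_mx 0 eta)) (row_mx y 0))))).
  apply: eq_Rintegral => eta _; congr (phi _ * _).
  by rewrite -(fiber_invariant hg gen proj eta) (group_mulKV hg) row_mxKl.
have m_theta : measurable_fun setT (fun x => phi y * theta x).
  exact: (Rintegrable_measurable (RintegrableZ _ int_theta)).
by rewrite (transports_Rintegral (fiber_inverse_preserves hg y) m_theta) RintegralZl // theta1 mulr1.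
Qed.

End reproducing_property.

(** * Regularity, uniqueness and transposition on the base *)

Section weak_equality.
Context {R : realType} (n : nat).
Local Notation leb k := (@lebesgue_rV R k).
Implicit Types u v f : 'rV[R]_n -> R.

Definition weakly_equal u v : Prop :=
  forall phi, test_fun setT phi -> \int[leb n]_x (u x * phi x) = \int[leb n]_x (v x * phi x).

Definition vanishes_at_infinity v : Prop :=
  forall eps : R, 0 < eps -> exists M : R, forall x, M < `|x| -> `|v x| < eps.

Lemma L1loc_of_tests f : measurable_fun setT f ->
  (forall phi, test_fun setT phi -> Rintegrable (leb n) (fun x => f x * phi x)) -> L1loc f.
Proof.
move=> mf int_f; apply: L1loc_of_balls => // r.
have radius_gt0 : 0 < 4 * (`|r| + 1) by rewrite mulr_gt0 // ltr_wpDl.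
have [phi [tphi _ phi1 _]] := @ball_test_fun R n setT 0 _ radius_gt0 (fun _ _ => Logic.I).
apply: Rintegrable_le (Rintegrable_abs (int_f phi tphi)) _ => [|x].
  by apply: measurable_funM => //; exact: (Rintegrable_measurable (Rintegrable_indic_ball n r)).
rewrite indicE; have [|_] := boolP (x \in _); last by rewrite mul0r normr0.
rewrite inE /= => xr; rewrite phi1 ?mulr1 ?mul1r // subr0.
by apply: le_trans xr _; have := ler_norm r; set a := `|r|; lra.
Qed.

Lemma L1locZ (a : R) f : L1loc f -> L1loc (fun x => a * f x).
Proof.
move=> Lf; apply: L1loc_of_tests => [|phi tphi]; first exact: measurable_funM (measurable_cst _) Lf.1.
by under eq_fun do rewrite -mulrA; apply: RintegrableZ; exact: L1loc_test.
Qed.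

Lemma L1loc_dilation (e : 'I_n -> nat) (l : R) f : 0 < l -> L1loc f -> L1loc (f \o dilation e l).
Proof.
move=> l0 Lf; apply: L1loc_of_tests => [|phi tphi].
  by apply: (measurableT_comp Lf.1); exact: measurable_dilation.
have l'0 : 0 < l^-1 by rewrite invr_gt0.
have int_phi := L1loc_test Lf (test_fun_dilation (e := e) l'0 (fun x _ => Logic.I) tphi).
have := (Rintegrable_dilation e l0 (Rintegrable_measurable int_phi)).2 int_phi.
by congr (Rintegrable _ _); apply/funext => x; rewrite /= (dilationK e (lt0r_neq0 l0)).
Qed.

Lemma weakly_equal_ae u v : L1loc u -> L1loc v -> weakly_equal u v -> {ae leb n, forall x, u x = v x}.
Proof.
move=> Lu Lv uv; have uv0 phi : test_fun setT phi -> \int[leb n]_x ((u x + -1 * v x) * phi x) = 0.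
  by move=> tphi; rewrite Rintegral_pairing_add // uv // mulN1r subrr.
have := fundamental_lemma_ae (L1loc_add (-1) Lu Lv) uv0.
by apply: filterS => x /eqP; rewrite mulN1r subr_eq0 => /eqP.
Qed.

Lemma weakly_equal_translation (b : 'rV[R]_n) u v : L1loc u -> L1loc v -> weakly_equal u v ->
  weakly_equal (fun x => u (x + b)) (fun x => v (x + b)).
Proof.
move=> Lu Lv uv phi tphi; pose phib x := phi (x - b).
have tphib : test_fun setT phib.
  apply: (test_fun_comp (smooth_map_translation _) (smooth_map_continuous (smooth_map_translation b)))
    tphi => //.
  exact: subrK.
have shift f : L1loc f -> \int[leb n]_x (f (x + b) * phi x) = \int[leb n]_x (f x * phib x).
  move=> Lf; rewrite -(transports_Rintegral (preserves_translation b)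
    (Rintegrable_measurable (L1loc_test Lf tphib))).
  by apply: eq_Rintegral => x _; rewrite /phib addrK.
by rewrite !shift // uv.
Qed.

Lemma weakly_equal_vanishes u v : continuous u -> L1loc v -> weakly_equal u v ->
  vanishes_at_infinity v -> vanishes_at_infinity u.
Proof.
move=> cu Lv uv v0 eps eps0; have eps2 : 0 < eps / 2 by rewrite divr_gt0.
have [M v_le] := v0 _ eps2; exists M => x xM; apply: le_lt_trans (_ : eps / 2 < _); last by lra.
have open_far : open [set x : 'rV[R]_n | M < `|x|].
  rewrite (_ : [set x | _] = ~` [set x : 'rV[R]_n | `|x| <= M]);
    first exact: closed_openC (@closed_norm_le0 _ _ M).
  by apply/seteqP; split => y /=; rewrite ltNge => /negP.
apply: (fundamental_lemma_norm_le open_far (fun x _ => cu x)) xM => phi tphi phi_ge0.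
have tphiT := test_fun_setT tphi; have int_phi := test_fun_integrable tphiT.
rewrite uv // -RintegralZl //; apply: norm_Rintegral_le => [||y].
- exact: (Rintegrable_measurable (L1loc_test Lv tphiT)).
- exact: RintegrableZ.
rewrite normrM (ger0_norm (phi_ge0 y)); have [_ [B [_ B_far Bphi]]] := tphi.
have [/B_far/v_le/ltW vy|/Bphi ->] := pselect (B y); last by rewrite !mulr0.
by rewrite ler_wpM2r.
Qed.

Lemma vanishesD u v : vanishes_at_infinity u -> vanishes_at_infinity v ->
  vanishes_at_infinity (fun x => u x + v x).
Proof.
move=> u0 v0 eps eps0; have eps2 : 0 < eps / 2 by rewrite divr_gt0.
have [M u_le] := u0 _ eps2; have [M' v_le] := v0 _ eps2.
exists (Num.max M M') => x; rewrite gt_max => /andP[xM xM'].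
by apply: le_lt_trans (ler_normD _ _) _; have := ltrD (u_le x xM) (v_le x xM'); rewrite -splitr.
Qed.

Lemma vanishesZ (a : R) v : vanishes_at_infinity v -> vanishes_at_infinity (fun x => a * v x).
Proof.
move=> v0 eps eps0; have a1 : 0 < `|a| + 1 by rewrite ltr_wpDl.
have [M v_le] := v0 _ (divr_gt0 eps0 a1); exists M => x /v_le.
rewrite ltr_pdivlMr // mulrC normrM; apply: le_lt_trans.
by rewrite ler_wpM2r // lerDl.
Qed.

Lemma vanishes_test_fun phi : test_fun setT phi -> vanishes_at_infinity phi.
Proof.
move=> [_ [K [cK _ Kphi]]] eps eps0; have [r _ Kr] := compact_norm_bound cK.
by exists r => x xr; rewrite Kphi ?normr0 // => /Kr; rewrite leNgt xr.
Qed.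

Lemma vanishes_dilation (e : 'I_n -> nat) (l : R) v : 0 < l -> vanishes_at_infinity v ->
  vanishes_at_infinity (v \o dilation e l).
Proof.
move=> l0 v0 eps eps0; have [M v_le] := v0 eps eps0.
have norm_dil_cont : continuous (fun x : 'rV[R]_n => `|dilation e l^-1 x|).
  move=> x; apply: continuous_comp; last exact: norm_continuous.
  exact: (smooth_map_continuous (@smooth_dilation R n e l^-1)).
have [M' _ dil_le] := compact_continuous_bound (@compact_closed_ball_rV R n M) (fun x _ => norm_dil_cont x).
exists M' => x xM'; apply: v_le; rewrite ltNge; apply/negP => /dil_le.
by rewrite (dilationK e (lt0r_neq0 l0)) normr_id leNgt xM'.
Qed.

Lemma vanishes_bounded v : continuous v -> vanishes_at_infinity v -> exists M : R, forall x, `|v x| <= M.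
Proof.
move=> cv v0; have [r v_far] := v0 1 ltr01.
have [M _ v_near] := compact_continuous_bound (@compact_closed_ball_rV R n r) (fun x _ => cv x).
exists (Num.max 1 M) => x; rewrite le_max; have [xr|xr] := leP `|x| r; first by rewrite v_near ?orbT.
by rewrite ltW // v_far.
Qed.

Lemma vanishes_constant_eq0 v : (0 < n)%N -> (forall x y, v x = v y) -> vanishes_at_infinity v ->
  forall x, v x = 0.
Proof.
move=> n_gt0 v_const v0 x; apply/normr0_eq0/eqP; rewrite eq_le normr_ge0 andbT.
apply/ler_addgt0Pl => eps eps0; rewrite addr0; have [M v_le] := v0 _ eps0.
rewrite (v_const x (const_mx (`|M| + 1))) ltW // v_le //.
have := coord_le_norm (const_mx (`|M| + 1) : 'rV[R]_n) (Ordinal n_gt0); rewrite mxE.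
apply: lt_le_trans; rewrite ger0_norm ?addr_ge0 //.
by rewrite (le_lt_trans (ler_norm M)) // ltrDl.
Qed.

End weak_equality.

(* The lift of [v] is invariant under the translations along the fibers, hence so is its
   continuous representative. *)
Lemma weakly_equal_lift {R : realType} n p (v : 'rV[R]_n -> R) (F : 'rV[R]_(n + p) -> R) : L1loc v ->
  continuous F ->
  weakly_equal (fun z : 'rV[R]_(n + p) => v (lsubmx z)) F -> forall z, F z = F (row_mx (lsubmx z) 0).
Proof.
move=> Lv cF vF z; pose h : 'rV[R]_(n + p) := row_mx 0 (rsubmx z).
have LV := L1loc_lsubmx p Lv; have cFh : continuous (fun y : 'rV[R]_(n + p) => F (y + h)).
  move=> y; apply: continuous_comp; last exact: cF.
  exact: (smooth_map_continuous (@smooth_map_translation R _ h)).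
rewrite -[in LHS](_ : row_mx (lsubmx z) 0 + h = z); last by rewrite add_row_mx addr0 add0r hsubmxK.
apply: (fundamental_lemma_eq openT (fun y _ => cFh y) (fun y _ => cF y) _ Logic.I) => psi tpsi.
rewrite -vF // -(weakly_equal_translation h LV (L1loc_continuous cF) vF tpsi).
by apply: eq_Rintegral => y _; rewrite raddfD /= row_mxKl addr0.
Qed.

Section base_operator.
Context {R : realType} (n m p : nat) (sigma : 'I_n -> nat) (tau : 'I_p -> nat)
  (X : 'I_m -> @vfield R n) (Xt : 'I_m -> @vfield R (n + p)) (w : 'I_m -> nat)
  (nu : nat) (c : seq 'I_m -> R).
Local Notation leb k := (@lebesgue_rV R k).
Local Notation L := (hom_op X w nu c).
Local Notation Ls := (hom_op X w nu (transpose_coef c)).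
Hypothesis sysX : homogeneous_system sigma w X.
Hypothesis sysXt : homogeneous_system (cat_exp sigma tau) w Xt.
Hypothesis proj : forall j, vf_projects (Xt j) (X j).
Hypothesis hypo : hypoelliptic Xt w nu c.

Let sX := hsys_smooth sysX.
Let divX := hsys_divergence_free sysX.

Let lifted_regularity (v g : 'rV[R]_n -> R) : L1loc v -> smooth g ->
  (forall psi, test_fun setT psi -> \int[leb n]_x (v x * Ls psi x) = \int[leb n]_x (g x * psi x)) ->
  exists2 F : 'rV[R]_(n + p) -> R, smooth F & weakly_equal (fun z : 'rV[R]_(n + p) => v (lsubmx z)) F.
Proof.
move=> Lv sg vg; have Lg := L1loc_continuous (smooth_continuous sg).
have [F sF vF] : dist_smooth_on setT (fun psi => \int[leb (n + p)]_z (v (lsubmx z) * psi z));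
  last by exists F.
apply: (hypo openT openT (@subsetT _ _) (L1loc_distribution setT (L1loc_lsubmx p Lv))).
exists (fun z => g (lsubmx z)) => [|psi tpsi]; first exact: (smooth_comp sg (@smooth_map_lsubmx R n p)).
rewrite /dist_hom_op (base_pairing Lg tpsi) -vg; last exact: test_fun_fiber_integral.
rewrite (base_pairing Lv (test_fun_hom_op w nu (transpose_coef c) (hsys_smooth sysXt) tpsi)).
by rewrite (fiber_integral_hom_op w nu c sX divX (hsys_smooth sysXt)
  (hsys_divergence_free sysXt) proj tpsi).
Qed.

Lemma weak_regularity (v g : 'rV[R]_n -> R) : L1loc v -> smooth g ->
  (forall psi, test_fun setT psi -> \int[leb n]_x (v x * Ls psi x) = \int[leb n]_x (g x * psi x)) ->
  exists vs, [/\ smooth vs, weakly_equal v vs & forall x, L vs x = g x].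
Proof.
move=> Lv sg vg; have [F sF vF] := lifted_regularity Lv sg vg.
pose vs x := F (row_mx x 0); have FE := weakly_equal_lift Lv (smooth_continuous sF) vF.
have svs : smooth vs by exact: (smooth_comp sF (smooth_map_row_mx (@smooth_map_id R n) (smooth_map_cst _))).
have Lvs := L1loc_continuous (smooth_continuous svs).
have v_vs : weakly_equal v vs.
  move=> psi tpsi; have [theta ttheta theta1] := @unit_test_fun R p; have tt := test_fun_tensor tpsi ttheta.
  have := vF _ tt; rewrite (base_pairing Lv tt) (fiber_integral_tensor psi ttheta theta1) => ->.
  under eq_Rintegral do rewrite FE -/(vs _).
  by rewrite (base_pairing Lvs tt) (fiber_integral_tensor psi ttheta theta1).
exists vs; split => // x; have sL := smooth_hom_op w sX nu c svs.
apply: (fundamental_lemma_eq openT _ _ _ (Logic.I : setT x)) => [y _|y _|psi tpsi].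
- exact: (smooth_continuous sL).
- exact: (smooth_continuous sg).
have tL := test_fun_hom_op w nu (transpose_coef c) sX tpsi.
by rewrite (integral_hom_op_parts w nu c sX divX svs tpsi) -(v_vs _ tL) (vg _ tpsi).
Qed.

(* A difference of two solutions is smooth and lifts to a bounded solution, which is
   constant by Liouville's theorem. *)
Lemma weak_solution_unique (u v : 'rV[R]_n -> R) : (0 < n)%N -> L1loc u -> L1loc v ->
  vanishes_at_infinity u -> vanishes_at_infinity v ->
  (forall psi, test_fun setT psi -> \int[leb n]_x (u x * Ls psi x) = \int[leb n]_x (v x * Ls psi x)) ->
  weakly_equal u v.
Proof.
move=> n_gt0 Lu Lv u0 v0 uv; pose d x := u x + -1 * v x; have Ld : L1loc d by exact: L1loc_add.
have [|psi tpsi|ds [sds d_ds Lds]] := @weak_regularity d (fun=> 0) Ld.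
- exact: (smooth_on_cst 0 openT).
- rewrite Rintegral_pairing_add // ?uv ?mulN1r ?subrr //; last exact: test_fun_hom_op.
  by under [RHS]eq_Rintegral do rewrite mul0r; rewrite /Rintegral integral0.
have ds0 : vanishes_at_infinity ds.
  by apply: (weakly_equal_vanishes (smooth_continuous sds) Ld) => //;
    [move=> psi /d_ds|exact: vanishesD (vanishesZ _ _)].
have [M ds_le] := vanishes_bounded (smooth_continuous sds) ds0.
have ds_const x y : ds x = ds y.
  have L_lift z : hom_op Xt w nu c (fun z : 'rV[R]_(n + p) => ds (lsubmx z)) z = 0.
    by rewrite (hom_op_lsubmx proj) Lds.
  have := liouville sysXt hypo (smooth_comp sds (@smooth_map_lsubmx R n p)) (fun z => ds_le _) L_lift.
  by move=> /(_ (row_mx x 0) (row_mx y 0)) /=; rewrite !row_mxKl.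
move=> phi tphi; apply/eqP; rewrite -subr_eq0 -mulN1r -Rintegral_pairing_add // d_ds //; apply/eqP.
under eq_Rintegral do rewrite (vanishes_constant_eq0 n_gt0 ds_const ds0) mul0r.
by rewrite /Rintegral integral0.
Qed.

End base_operator.

Section kernels.
Context {R : realType} (n : nat).
Local Notation leb k := (@lebesgue_rV R k).
Implicit Types (G : 'rV[R]_n -> 'rV[R]_n -> R) (phi psi : 'rV[R]_n -> R).

Definition potential G psi (x : 'rV[R]_n) : R := \int[leb n]_y (G x y * psi y).

Definition transpose_kernel G : 'rV[R]_n -> 'rV[R]_n -> R := fun x y => G y x.

Definition continuous_off_diagonal G : Prop :=
  forall x y : 'rV[R]_n, x != y -> {for row_mx x y, continuous (joint G)}.

(* Uniform in [y] on bounded sets, and symmetric under exchange of the variables,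
   unlike [vanishing_at_infinity]. *)
Definition kernel_decays G : Prop := forall r eps : R, 0 < eps ->
  exists M : R, forall x y, `|y| <= r -> M < `|x| -> `|G x y| < eps /\ `|G y x| < eps.

Lemma joint_row_mx G x y : joint G (row_mx x y) = G x y.
Proof. by rewrite /joint row_mxKl row_mxKr. Qed.

Lemma joint_transpose G z : joint (transpose_kernel G) z = joint G (row_mx (rsubmx z) (lsubmx z)).
Proof. by rewrite joint_row_mx. Qed.

Lemma fs_integrable_transpose G : fs_integrable G -> fs_integrable (transpose_kernel G).
Proof.
move=> [L1_x L1_y L1_joint]; split=> //; have swap := @transports_swap R n n.
rewrite (funext (joint_transpose G)).
apply: L1loc_of_tests => [|phi tphi]; first by apply: (measurableT_comp L1_joint.1); have [] := swap.
have swapK : cancel (fun z : 'rV[R]_(n + n) => row_mx (rsubmx z) (lsubmx z))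
  (fun z => row_mx (rsubmx z) (lsubmx z)).
  by move=> z; rewrite row_mxKl row_mxKr hsubmxK.
have smooth_swap : smooth_map (fun z : 'rV[R]_(n + n) => row_mx (rsubmx z) (lsubmx z)).
  exact: (smooth_map_row_mx (@smooth_map_rsubmx R n n) (@smooth_map_lsubmx R n n)).
have tphi_swap : test_fun setT (phi \o (fun z : 'rV[R]_(n + n) => row_mx (rsubmx z) (lsubmx z))).
  exact: (test_fun_comp smooth_swap (smooth_map_continuous smooth_swap) swapK) tphi.
have int_phi := L1loc_test L1_joint tphi_swap.
have := (transports_integrable swap (Rintegrable_measurable int_phi)).1 int_phi.
by congr (Rintegrable _ _); apply/funext => z; rewrite /= swapK.
Qed.

Lemma kernel_decays_transpose G : kernel_decays G -> kernel_decays (transpose_kernel G).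
Proof. by move=> dG r eps eps0; have [M G_le] := dG r eps eps0; exists M => x y yr /(G_le x y yr)[]. Qed.

Lemma kernel_decays_vanishing G : kernel_decays G -> vanishing_at_infinity G.
Proof.
move=> dG y eps eps0; have [M G_le] := dG `|y| eps eps0; exists M => x xM.
by have [] := G_le x y (lexx _) xM.
Qed.

Lemma smooth_off_diagonal_continuous G : smooth_off_diagonal G -> continuous_off_diagonal G.
Proof. by move=> sG x y xy; apply: (smooth_on_continuous sG); rewrite /= row_mxKl row_mxKr. Qed.

Lemma continuous_off_diagonal_transpose G :
  continuous_off_diagonal G -> continuous_off_diagonal (transpose_kernel G).
Proof.
move=> cG x y xy; rewrite (funext (joint_transpose G)).
apply: (@continuous_comp _ _ _ (fun z => row_mx (rsubmx z) (lsubmx z)) (joint G)).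
  by apply: continuous_row_mx; [exact: continuous_rsubmx|exact: continuous_lsubmx].
by rewrite row_mxKl row_mxKr; apply: cG; rewrite eq_sym.
Qed.

Lemma continuous_column G x y : continuous_off_diagonal G -> x != y -> {for x, continuous (fun x => G x y)}.
Proof.
move=> cG xy; apply: (continuous_at_ext (g := fun x => joint G (row_mx x y))).
  by move=> z; rewrite joint_row_mx.
apply: (@continuous_comp _ _ _ (fun x => row_mx x y) (joint G)); last exact: cG.
by apply: continuous_row_mx; [|exact: cst_continuous].
Qed.

Lemma continuous_row G x y : continuous_off_diagonal G -> y != x -> {for y, continuous (G x)}.
Proof. by move=> /continuous_off_diagonal_transpose cG;
  exact: (@continuous_column (transpose_kernel G)). Qed.

Lemma kernel_tensor_integrable G phi psi : L1loc (joint G) -> test_fun setT phi -> test_fun setT psi ->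
  Rintegrable (leb (n + n)) (fun z => joint G z * (phi (lsubmx z) * psi (rsubmx z))).
Proof. by move=> LG tphi tpsi; exact: (L1loc_test LG (test_fun_tensor tphi tpsi)). Qed.

Lemma potential_tensor G phi psi x : L1loc (G x) -> test_fun setT psi ->
  \int[leb n]_y (joint G (row_mx x y) * (phi (lsubmx (row_mx x y)) * psi (rsubmx (row_mx x y)))) =
  potential G psi x * phi x.
Proof.
move=> LG tpsi; rewrite mulrC -RintegralZl //; last exact: L1loc_test.
by apply: eq_Rintegral => y _; rewrite joint_row_mx row_mxKl row_mxKr mulrCA.
Qed.

Lemma potential_L1loc G psi : fs_integrable G -> test_fun setT psi -> L1loc (potential G psi).
Proof.
move=> [_ L1_y L1_joint] tpsi; apply: L1loc_of_tests => [|phi tphi].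
  have -> : potential G psi = fun x => \int[leb n]_y (joint G (row_mx x y) * psi (rsubmx (row_mx x y))).
    by apply/funext => x; apply: eq_Rintegral => y _; rewrite joint_row_mx row_mxKr.
  apply: (@measurable_Rintegral_row R n n (fun z => joint G z * psi (rsubmx z))).
  apply: measurable_funM L1_joint.1 _.
  exact: (measurableT_comp (continuous_measurable_rV (smooth_continuous tpsi.1))
    (@measurable_rsubmx R n n)).
have := Rintegrable_row (kernel_tensor_integrable L1_joint tphi tpsi).
by congr (Rintegrable _ _); apply/funext => x; rewrite potential_tensor.
Qed.

Lemma potential_transpose G phi psi : fs_integrable G -> test_fun setT phi -> test_fun setT psi ->
  \int[leb n]_x (potential G psi x * phi x) = \int[leb n]_y (potential (transpose_kernel G) phi y * psi y).
Proof.
move=> [L1_x L1_y L1_joint] tphi tpsi; have int_tensor := kernel_tensor_integrable L1_joint tphi tpsi.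
transitivity (\int[leb (n + n)]_z (joint G z * (phi (lsubmx z) * psi (rsubmx z)))).
  by rewrite (Rintegral_row int_tensor); apply: eq_Rintegral => x _; rewrite potential_tensor.
rewrite (Rintegral_row_swap int_tensor); apply: eq_Rintegral => y _.
rewrite mulrC -RintegralZl //; last exact: (L1loc_test (L1_x y)).
by apply: eq_Rintegral => x _; rewrite joint_row_mx row_mxKl row_mxKr mulrA [RHS]mulrC.
Qed.

Lemma potential_vanishes G psi : kernel_decays G -> (forall x, measurable_fun setT (G x)) ->
  test_fun setT psi -> vanishes_at_infinity (potential G psi).
Proof.
move=> dG mG tpsi eps eps0; have [spsi [B [cB _ Bpsi]]] := tpsi; have [r _ Br] := compact_norm_bound cB.
have int_abs := Rintegrable_abs (test_fun_integrable tpsi); set mass := \int[leb n]_y `|psi y|.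
have mass_ge0 : 0 <= mass by apply: Rintegral_ge0 => y _; exact: normr_ge0.
have mass1 : 0 < mass + 1 by rewrite ltr_wpDl.
have [M G_le] := dG r (eps / (mass + 1)) (divr_gt0 eps0 mass1); exists M => x xM.
apply: (@le_lt_trans _ _ (eps / (mass + 1) * mass)); last first.
  by rewrite -mulrA gtr_pMr // mulrC ltr_pdivrMr // mul1r ltrDl.
rewrite /mass -RintegralZl //; apply: norm_Rintegral_le => [||y].
- by apply: measurable_funM => //; exact: continuous_measurable_rV (smooth_continuous spsi).
- exact: RintegrableZ.
rewrite normrM; have [/Br yr|/Bpsi ->] := pselect (B y); last by rewrite normr0 !mulr0.
by rewrite ler_wpM2r // ltW //; have [] := G_le x y yr xM.
Qed.

Lemma potential_continuous_off_support G psi (B : set 'rV[R]_n) x : continuous_off_diagonal G ->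
  (forall x, measurable_fun setT (G x)) -> smooth psi -> compact B -> supported_in B psi -> ~ B x ->
  {for x, continuous (potential G psi)}.
Proof.
move=> cG mG spsi cB Bpsi nBx; have cpsi := smooth_continuous spsi.
have [r r0 r_out] := nbhs_norm_lt (open_nbhs_nbhs (conj (closed_openC (compact_closed_normed cB)) nBx)).
have far t y : `|t - x| < r -> B y -> t != y.
  by move=> /r_out nBt By; apply/eqP => ty; apply: nBt; rewrite ty.
have cbox := compact_row_mx (@compact_ball_at R n x (r / 2)) cB.
have [z [/= zx Bz]|M _ G_le] := compact_continuous_bound (f := joint G) cbox.
  by rewrite -[z]hsubmxK; apply: cG; apply: far => //; apply: le_lt_trans zx _; lra.
apply: (@continuous_Rintegral _ _ _ _ _ (fun x y => G x y * psi y) x (fun y => M * `|psi y|) (r / 2)).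
- by rewrite divr_gt0.
- by move=> t _; apply: measurable_funM => //; exact: continuous_measurable_rV.
- move=> y; have [By|/Bpsi psi0] := pselect (B y); last first.
    by apply: (continuous_at_ext (g := fun=> 0)); [move=> t; rewrite psi0 mulr0|exact: continuous_at_cst].
  apply: continuous_atM; last exact: continuous_at_cst.
  by apply: continuous_column => //; apply: far => //; rewrite subrr normr0.
- by apply: RintegrableZ; apply: Rintegrable_abs; apply: test_fun_integrable; split=> //; exists B.
move=> t y tx; rewrite normrM; have [By|/Bpsi ->] := pselect (B y); last by rewrite normr0 !mulr0.
by rewrite ler_wpM2r // -joint_row_mx; apply: G_le; rewrite /= row_mxKl row_mxKr (ltW tx).
Qed.

Lemma kernel_eq_off_diagonal G G' : continuous_off_diagonal G -> continuous_off_diagonal G' ->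
  (forall x, measurable_fun setT (G x)) -> (forall x, measurable_fun setT (G' x)) ->
  (forall psi, test_fun setT psi -> weakly_equal (potential G psi) (potential G' psi)) ->
  forall x y, x != y -> G x y = G' x y.
Proof.
move=> cG cG' mG mG' GG' x y xy; rewrite eq_sym in xy.
apply: (@fundamental_lemma_eq R n [set y | y != x] (G x) (G' x)) xy => [|z zx|z zx|psi tpsi].
- exact: open_neq_normed.
- exact: continuous_row.
- exact: continuous_row.
have [spsi [B [cB B_out Bpsi]]] := tpsi; have oB := closed_openC (compact_closed_normed cB).
have nBx : ~ B x by move=> /B_out /=; rewrite eqxx.
apply: (@fundamental_lemma_eq R n (~` B) (potential G psi) (potential G' psi) oB _ _ _ x nBx) =>
  [z|z|phi tphi].
- exact: potential_continuous_off_support.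
- exact: potential_continuous_off_support.
- exact: (GG' psi (test_fun_setT tpsi) phi (test_fun_setT tphi)).
Qed.

End kernels.

Section fundamental_solutions.
Context {R : realType} (n m p : nat) (sigma : 'I_n -> nat) (tau : 'I_p -> nat)
  (X : 'I_m -> @vfield R n) (Xt : 'I_m -> @vfield R (n + p)) (w : 'I_m -> nat)
  (nu : nat) (c : seq 'I_m -> R).
Local Notation leb k := (@lebesgue_rV R k).
Local Notation L := (hom_op X w nu c).
Local Notation Ls := (hom_op X w nu (transpose_coef c)).
Hypothesis n_gt0 : (0 < n)%N.
Hypothesis sysX : homogeneous_system sigma w X.
Hypothesis sysXt : homogeneous_system (cat_exp sigma tau) w Xt.
Hypothesis proj : forall j, vf_projects (Xt j) (X j).
Hypothesis hypo : hypoelliptic Xt w nu c.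
Implicit Types (G : 'rV[R]_n -> 'rV[R]_n -> R).

Let sX := hsys_smooth sysX.
Let divX := hsys_divergence_free sysX.

Lemma fs_weakly_unique G G' y : (forall y, L1loc (fun x => G x y)) -> (forall y, L1loc (fun x => G' x y)) ->
  fs_reproducing Ls G -> fs_reproducing Ls G' -> vanishing_at_infinity G -> vanishing_at_infinity G' ->
  weakly_equal (fun x => G x y) (fun x => G' x y).
Proof.
move=> LG LG' rG rG' vG vG'; apply: (weak_solution_unique sysX sysXt proj hypo n_gt0) => // [||psi tpsi].
- exact: vG.
- exact: vG'.
by rewrite rG // rG'.
Qed.

Lemma fs_unique_off_diagonal G G' : (forall y, L1loc (fun x => G x y)) ->
  (forall y, L1loc (fun x => G' x y)) ->
  fs_reproducing Ls G -> fs_reproducing Ls G' -> vanishing_at_infinity G -> vanishing_at_infinity G' ->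
  continuous_off_diagonal G -> continuous_off_diagonal G' -> forall x y, x != y -> G x y = G' x y.
Proof.
move=> LG LG' rG rG' vG vG' cG cG' x y.
apply: (fundamental_lemma_eq (f := fun x => G x y) (g := fun x => G' x y) (@open_neq_normed _ _ y)).
- by move=> z zy; exact: continuous_column.
- by move=> z zy; exact: continuous_column.
by move=> phi /test_fun_setT; exact: fs_weakly_unique.
Qed.

Lemma potential_hom_op G phi y : fs_reproducing Ls G -> test_fun setT phi ->
  potential (transpose_kernel G) (Ls phi) y = - phi y.
Proof. by move=> rG tphi; exact: rG. Qed.

Lemma reproducing_solving G : fs_integrable G -> fs_reproducing Ls G -> fs_solving L Ls G.
Proof.
move=> iG rG phi tphi u; have Lu : L1loc u by exact: potential_L1loc.
have u_solves psi : test_fun setT psi -> \int[leb n]_x (u x * Ls psi x) = \int[leb n]_x (- phi x * psi x).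
  move=> tpsi; rewrite (potential_transpose iG (test_fun_hom_op w nu _ sX tpsi) tphi).
  by apply: eq_Rintegral => y _; rewrite potential_hom_op // !mulNr mulrC.
have [us [sus u_us Lus]] := weak_regularity sysX sysXt proj hypo Lu (smooth_onN openT tphi.1) u_solves.
split => //; exists us; split => //.
exact: (weakly_equal_ae Lu (L1loc_continuous (smooth_continuous sus)) u_us).
Qed.

Section transposition.
Variables G Gs : 'rV[R]_n -> 'rV[R]_n -> R.
Hypothesis hypo_tr : hypoelliptic Xt w nu (transpose_coef c).
Hypotheses (iG : fs_integrable G) (iGs : fs_integrable Gs).
Hypotheses (rG : fs_reproducing Ls G) (rGs : fs_reproducing L Gs).
Hypotheses (dG : kernel_decays G) (dGs : kernel_decays Gs).
Hypotheses (cG : continuous_off_diagonal G) (cGs : continuous_off_diagonal Gs).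

(* The potential of [L phi] and [- phi] are two solutions of the same equation which
   vanish at infinity. *)
Let potential_left_inverse phi : test_fun setT phi -> weakly_equal (potential G (L phi)) (fun x => - phi x).
Proof.
move=> tphi; have tL := test_fun_hom_op w nu c sX tphi;
  have tN := test_funM (smooth_on_cst (-1) openT) tphi.
under eq_fun do rewrite -mulN1r.
apply: (weak_solution_unique sysX sysXt proj hypo n_gt0) => [||||psi tpsi].
- exact: potential_L1loc.
- exact: (L1loc_continuous (smooth_continuous tN.1)).
- by apply: potential_vanishes => // x; have [_ LGy _] := iG; exact: (LGy x).1.
- exact: vanishes_test_fun.
rewrite (potential_transpose iG (test_fun_hom_op w nu _ sX tpsi) tL).
transitivity (- \int[leb n]_x (L phi x * psi x)).
  rewrite -mulN1r -RintegralZl //; last first.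
    exact: (L1loc_test (L1loc_continuous (smooth_continuous tL.1))).
  by apply: eq_Rintegral => y _; rewrite potential_hom_op // mulN1r mulNr mulrC.
rewrite (integral_hom_op_parts w nu c sX divX tphi.1 tpsi) -[LHS]mulN1r -RintegralZl //; last first.
  exact: (L1loc_test (L1loc_continuous (smooth_continuous tphi.1)) (test_fun_hom_op w nu _ sX tpsi)).
by apply: eq_Rintegral => x _; rewrite mulrA.
Qed.

Lemma fs_transpose x y : x != y -> Gs x y = G y x.
Proof.
have iGT := fs_integrable_transpose iG; have [LGx LGy _] := iG; have [_ LGsy _] := iGs.
apply: (kernel_eq_off_diagonal (G' := transpose_kernel G)) => // [|z|z|psi tpsi].
- exact: continuous_off_diagonal_transpose.
- exact: (LGsy z).1.
- exact: (LGx z).1.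
have vGs := potential_vanishes dGs (fun x => (LGsy x).1) tpsi.
have vGT := potential_vanishes (kernel_decays_transpose dG) (fun x => (LGx x).1) tpsi.
apply: (weak_solution_unique sysX sysXt proj hypo_tr n_gt0 (potential_L1loc iGs tpsi)
  (potential_L1loc iGT tpsi) vGs vGT) => phi tphi.
rewrite transpose_coefK; have tL := test_fun_hom_op w nu c sX tphi.
rewrite (potential_transpose iGs tL tpsi) (potential_transpose iGT tL tpsi).
rewrite [RHS](potential_left_inverse tphi tpsi).
by apply: eq_Rintegral => z _; congr (_ * _); exact: rGs.
Qed.

End transposition.

Section homogeneity.
Local Notation q := (\sum_i sigma i)%N.
Variables (G : 'rV[R]_n -> 'rV[R]_n -> R) (l : R).
Hypotheses (l0 : 0 < l) (nu_le : (nu <= q)%N).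
Hypotheses (LG : forall y, L1loc (fun x => G x y)) (rG : fs_reproducing Ls G).

Let dilated_kernel (x y : 'rV[R]_n) := l ^+ (q - nu) * G (dilation sigma l x) (dilation sigma l y).

Let ln0 : l != 0 := lt0r_neq0 l0.

Let dilated_reproducing : fs_reproducing Ls dilated_kernel.
Proof.
move=> phi tphi y; have l'0 : 0 < l^-1 by rewrite invr_gt0.
have tdil : test_fun setT (phi \o dilation sigma l^-1) := test_fun_dilation l'0 (fun x _ => Logic.I) tphi.
have LsE z : Ls (phi \o dilation sigma l^-1) (dilation sigma l z) = l ^- nu * Ls phi z.
  by rewrite (hom_op_dilation sX (hsys_homogeneous sysX) nu _ _ l'0 tphi.1) (dilationK sigma ln0) exprVn.
have := rG tdil (dilation sigma l y); rewrite /= (dilationK sigma ln0) => <-.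
have int_pairing := L1loc_test (LG (dilation sigma l y)) (test_fun_hom_op w nu (transpose_coef c) sX tdil).
have m_pairing := Rintegrable_measurable int_pairing.
rewrite (Rintegral_dilation sigma l0 m_pairing) -RintegralZl //.
  apply: eq_Rintegral => z _; rewrite LsE /dilated_kernel -[in RHS](subnK nu_le) exprD.
  by field; rewrite expf_eq0 (negbTE ln0) andbF.
exact: ((Rintegrable_dilation sigma l0 m_pairing).2 int_pairing).
Qed.

Lemma fs_homogeneous x y : vanishing_at_infinity G -> continuous_off_diagonal G -> x != y ->
  l ^+ (q - nu) * G (dilation sigma l x) (dilation sigma l y) = G x y.
Proof.
move=> vG cG; apply: (fs_unique_off_diagonal _ LG dilated_reproducing rG _ vG _ cG) => // [z|z|{}x {}y xy].
- by apply: L1locZ; exact: (L1loc_dilation sigma l0 (LG (dilation sigma l z))).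
- have vGz : vanishes_at_infinity (fun x => G x (dilation sigma l z)) := vG _.
  exact: (vanishesZ _ (vanishes_dilation sigma l0 vGz)).
have -> : joint dilated_kernel = fun z => l ^+ (q - nu) * joint G (dilation (cat_exp sigma sigma) l z).
  by apply/funext => z; rewrite /joint lsubmx_dilation rsubmx_dilation.
apply: continuous_atM; first exact: continuous_at_cst.
apply: (@continuous_comp _ _ _ (dilation (cat_exp sigma sigma) l) (joint G)).
  exact: (smooth_map_continuous (@smooth_dilation R _ _ l)).
rewrite dilation_row_mx; apply: cG; apply: contra xy => /eqP/(congr1 (dilation sigma l^-1)).
by rewrite !(dilationK sigma ln0) => ->.
Qed.

End homogeneity.

End fundamental_solutions.

Section lifted_fundamental_solution.
Context {R : realType} (n m p : nat) (sigma : 'I_n -> nat) (w : 'I_m -> nat) (X : 'I_m -> @vfield R n)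
  (tau : 'I_p -> nat) (mul : 'rV[R]_(n + p) -> 'rV[R]_(n + p) -> 'rV[R]_(n + p))
  (inv : 'rV[R]_(n + p) -> 'rV[R]_(n + p)) (Xt : 'I_m -> @vfield R (n + p)) (nu : nat) (c : seq 'I_m -> R).
Hypotheses (vX : vf_assumption sigma w X) (lX : is_lifting sigma w X tau mul inv Xt).
Hypotheses (nu_gt0 : (0 < nu)%N) (nu_lt : (nu < \sum_(i < n) sigma i)%N).

Lemma lifting_projects j : vf_projects (Xt j) (X j).
Proof. by move=> z; have [Rj [_ _ ->]] := lift_proj lX j; rewrite row_mxKl. Qed.

Lemma base_system : homogeneous_system sigma w X.
Proof.
split; [exact: base_exp_gt0 (lift_group lX)|exact: vfa_w_gt0 vX|exact: vfa_smooth vX|exact: vfa_hom vX].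
Qed.

Lemma lifted_system : homogeneous_system (cat_exp sigma tau) w Xt.
Proof.
split; [exact: hg_exp_gt0 (lift_group lX)|exact: vfa_w_gt0 vX| |exact: lift_hom lX].
by move=> j; have [] := lift_inv lX j.
Qed.

Hypotheses (hypo : hypoelliptic Xt w nu c) (hypo_tr : hypoelliptic Xt w nu (transpose_coef c)).

Lemma fundamental_kernel_exists : exists G : 'rV[R]_n -> 'rV[R]_n -> R, [/\ fs_integrable G,
    fs_reproducing (hom_op X w nu (transpose_coef c)) G, kernel_decays G & smooth_off_diagonal G].
Proof.
have hg := lift_group lX.
have QE : (\sum_i cat_exp sigma tau i = \sum_i sigma i + \sum_i tau i)%N := sum_cat_exp sigma tau.
have nuQ : (nu < \sum_i cat_exp sigma tau i)%N by rewrite QE ltn_addr.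
have [K kerK solK] := homogeneous_fundamental_kernel lifted_system hypo hypo_tr nu_gt0 nuQ.
have d_gt : (\sum_i tau i < \sum_i cat_exp sigma tau i - nu)%N by rewrite QE ltn_subRL ltn_add2r.
exists (projected_kernel mul inv K); split.
- exact: (projected_kernel_integrable hg kerK d_gt).
- exact: (projected_kernel_reproducing hg (lift_gen lX) lifting_projects base_system lifted_system
    (lift_inv lX) kerK d_gt solK).
- exact: (projected_kernel_decay hg kerK d_gt).
- exact: (projected_kernel_smooth hg kerK d_gt).
Qed.

End lifted_fundamental_solution.

Lemma fs_transpose_unique {R : realType} n m p (sigma : 'I_n -> nat) (w : 'I_m -> nat)
  (X : 'I_m -> @vfield R n)
  (tau : 'I_p -> nat) mul inv (Xt : 'I_m -> @vfield R (n + p)) nu c (G G' : 'rV[R]_n -> 'rV[R]_n -> R) :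
  vf_assumption sigma w X -> is_lifting sigma w X tau mul inv Xt -> (0 < nu)%N -> (nu < \sum_i sigma i)%N ->
  hypoelliptic Xt w nu c -> hypoelliptic Xt w nu (transpose_coef c) ->
  fs_integrable G -> fs_reproducing (hom_op X w nu (transpose_coef c)) G -> kernel_decays G ->
    smooth_off_diagonal G ->
  (forall y, L1loc (fun x => G' x y)) -> fs_reproducing (hom_op X w nu c) G' -> vanishing_at_infinity G' ->
  smooth_off_diagonal G' -> forall x y, x != y -> G' x y = G y x.
Proof.
move=> vX lX nu_gt0 nu_lt hypo hypo_tr iG rG dG sG LG' rG' vG' sG' x y xy.
have hypo_tr2 : hypoelliptic Xt w nu (transpose_coef (transpose_coef c)) by rewrite transpose_coefK.
have [Gs [iGs rGs dGs sGs]] := fundamental_kernel_exists vX lX nu_gt0 nu_lt hypo_tr hypo_tr2.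
have [LGs _ _] := iGs; have n_gt0 := vfa_dim vX; have vGs := kernel_decays_vanishing dGs.
have sysX := base_system vX lX; have sysXt := lifted_system vX lX; have proj := lifting_projects lX.
have cG := smooth_off_diagonal_continuous sG; have cGs := smooth_off_diagonal_continuous sGs.
have cG' := smooth_off_diagonal_continuous sG'.
transitivity (Gs x y).
  by apply: (fs_unique_off_diagonal n_gt0 sysX sysXt proj hypo_tr) => //; rewrite transpose_coefK.
rewrite transpose_coefK in rGs.
exact: (fs_transpose n_gt0 sysX sysXt proj hypo hypo_tr iG iGs rG rGs dG dGs cG cGs).
Qed.

Theorem theorem1p14 (R : realType) (n m p : nat) (sigma : 'I_n -> nat)
    (w : 'I_m -> nat) (X : 'I_m -> @vfield R n) (tau : 'I_p -> nat)
    (mul : 'rV[R]_(n + p) -> 'rV[R]_(n + p) -> 'rV[R]_(n + p))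
    (inv : 'rV[R]_(n + p) -> 'rV[R]_(n + p))
    (Xt : 'I_m -> @vfield R (n + p)) (nu : nat) (c : seq 'I_m -> R)
    (nu_gt0 : (0 < nu)%N) (nu_lt_q : (nu < \sum_(i < n) sigma i)%N)
    (rockland_L : generalized_rockland sigma w X tau mul inv Xt nu c)
    (rockland_Ls :
      generalized_rockland sigma w X tau mul inv Xt nu (transpose_coef c)) :
  let L := hom_op X w nu c in
  let Ls := hom_op X w nu (transpose_coef c) in
  exists G : 'rV[R]_n -> 'rV[R]_n -> R,
    global_fundamental_solution L Ls G /\
    smooth_off_diagonal G /\
    jointly_homogeneous sigma (nu%:Z - (\sum_(i < n) sigma i)%N%:Z) G /\
    vanishing_at_infinity G /\
    (forall g : 'rV[R]_n -> 'rV[R]_n -> R,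
       (forall y, L1loc (fun x => g x y)) -> fs_reproducing Ls g ->
       vanishing_at_infinity g ->
       forall y, {ae lebesgue_rV n, forall x, g x y = G x y}) /\
    (forall Gs : 'rV[R]_n -> 'rV[R]_n -> R,
       global_fundamental_solution Ls L Gs -> smooth_off_diagonal Gs ->
       vanishing_at_infinity Gs ->
       forall x y, x != y -> Gs x y = G y x) /\
    ((forall u, smooth u -> forall x, Ls u x = L u x) ->
       forall x y, x != y -> G x y = G y x).
Proof.
move=> L Ls; have [vX _ lX hypo] := rockland_L; have [_ _ _ hypo_tr] := rockland_Ls.
have sysX := base_system vX lX; have sysXt := lifted_system vX lX; have proj := lifting_projects lX.
have n_gt0 := vfa_dim vX; have nu_le := ltnW nu_lt_q.
have [G [iG rG dG sG]] := fundamental_kernel_exists vX lX nu_gt0 nu_lt_q hypo hypo_tr.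
have [LGx _ _] := iG; have vG := kernel_decays_vanishing dG; have cG := smooth_off_diagonal_continuous sG.
have transpose_unique := fs_transpose_unique vX lX nu_gt0 nu_lt_q hypo hypo_tr iG rG dG sG.
exists G; split; first by split=> //; exact: (reproducing_solving sysX sysXt proj hypo iG rG).
split; [exact: sG|split; [|split; [exact: vG|split; [|split]]]].
- move=> x y l xy l0; rewrite -opprB subzn // -exprnN.
  rewrite -(fs_homogeneous n_gt0 sysX sysXt proj hypo l0 nu_le LGx rG vG cG xy) mulKf //.
  by rewrite expf_neq0 // gt_eqF.
- move=> g Lg rg vg y; apply: (weakly_equal_ae (Lg y) (LGx y)).
  exact: (fs_weakly_unique n_gt0 sysX sysXt proj hypo).
- by move=> Gs [[LGs _ _] rGs _] sGs vGs; exact: transpose_unique.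
- move=> selfadj; apply: transpose_unique => // phi tphi y; rewrite -rG //.
  by apply: eq_Rintegral => x _; congr (_ * _); exact/esym/selfadj/tphi.1.
Qed.
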